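(* Let $G$ be a semisimple Lie group with finite centre, $K$ its maximal compact subgroup, $P\subset G$ a parabolic subgroup, $n=\dim(G/P)$, and let $V\to G/P$ and $W\to G/K$ be tractor bundles. Let $\Phi\colon\Omega^k(G/P,V)\to\Omega^\ell(G/K,W)$ be a Poisson transform with underlying Poisson kernel $\phi$ of bidegree $(\ell,n-k)$. (i) The compositions $\Phi\circ d^V$ and $\Phi\circ\partial^*$ are Poisson transforms with kernels $(-1)^{n-k+\ell+1}d_P\phi$ and $(-1)^{n-k+\ell}\partial_P^*\phi$, respectively. (ii) The compositions $d^W\circ\Phi$, $\ast\circ\Phi$, $\delta^W\circ\Phi$ and $\Delta^W\circ\Phi$ are Poisson transforms with kernels $d_K\phi$, $\ast_K\phi$, $\delta_K\phi$ and $\Delta_K\phi$, respectively. Moreover, $\ast_Kd_P=(-1)^{n+1}d_P\ast_K$ as well as $\ast_K\partial_P^*=(-1)^{n+1}\partial_P^*\ast_K$. In particular, both the $P$-differential $d_P$ and the $P$-codifferential $\partial_P^*$ anticommute with $d_K$, $\delta_K$ and $\Delta_K$.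
   Context: **Tractor bundles.** $V=G\times_P\mathbb V$ and $W=G\times_K\mathbb W$ with $\mathbb V,\mathbb W$ finite dimensional representations of $G$. A tractor bundle $G\times_H\mathbb V$ carries the flat $G$-invariant tractor connection coming from the trivialization $[g,v]\mapsto(gH,g\cdot v)$; $d^V,d^W$ are the induced covariant exterior derivatives. **Kostant codifferential.** $\mathfrak g,\mathfrak p,\mathfrak k$ are the Lie algebras of $G,P,K$; $\mathfrak p_+$ is the nilradical of $\mathfrak p$, and $(\mathfrak g/\mathfrak p)^*\cong\mathfrak p_+$ via the Killing form. For a $P$-representation $\mathbb V$, $\partial^*\colon\Lambda^k\mathfrak p_+\otimes\mathbb V\to\Lambda^{k-1}\mathfrak p_+\otimes\mathbb V$ is the $P$-equivariant map $$\partial^*(Z_1\wedge\dots\wedge Z_k\otimes v)=\sum_i(-1)^iZ_1\wedge\dots\widehat{Z_i}\dots\wedge Z_k\otimes Z_i\cdot v+\sum_{i<j}(-1)^{i+j}[Z_i,Z_j]\wedge Z_1\wedge\dots\widehat{Z_i}\dots\widehat{Z_j}\dots\wedge Z_k\otimes v ,$$ where hats denote omission. It induces tensorial operators on $\Omega^*(G/P,G\times_P\mathbb V)$, denoted by the same symbol. **Operators on $G/K$.** Let $\theta$ be a Cartan involution with $\mathfrak g=\mathfrak k\oplus\mathfrak q$. $G/K$ has the invariant metric induced by the Killing form on $\mathfrak q$. $W$ has the bundle metric $h$ induced by a $K$-invariant inner product on $\mathbb W$ with $\langle X\cdot v,w\rangle=-\langle v,\theta(X)\cdot w\rangle$ for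 $X\in\mathfrak g$. The twisted tractor connection $\nabla^\theta$ on $W$ is the flat connection defined by $h(s,\nabla^\theta_\xi t)=\xi\cdot h(s,t)-h(\nabla^W_\xi s,t)$, where $\nabla^W$ is the tractor connection; $d^\theta$ is its covariant exterior derivative. $\ast$ is the Hodge star on $\Omega^*(G/K,W)$, defined by $\alpha\wedge_h\ast\beta=\langle\alpha,\beta\rangle\mathrm{vol}$, where $\wedge_h$ is the wedge product combined with the contraction by $h$. $\delta^W=(-1)^p\ast^{-1}d^\theta\ast$ on $p$-forms is the formal adjoint of $d^W$, and $\Delta^W=d^W\delta^W+\delta^Wd^W$. **Poisson transforms.** Let $M=K\cap P$; then $G/K\times G/P\cong G/M$ with projections $\pi_K,\pi_P$. Forms of bidegree $(p,q)$ on $G/M$ are sections of $\pi_K^*\Lambda^pT^*(G/K)\otimes\pi_P^*\Lambda^qT^*(G/P)$. Put $W_M=\pi_K^*W$, $V_M=\pi_P^*V$, $E=W_M\otimes V_M^*$. A Poisson transform with Poisson kernel $\phi\in\Omega^{\ell,n-k}(G/M,E)$ is a $G$-equivariant operator of the form $\Phi(\alpha)=\int_{G/P}\phi\wedge\pi_P^*\alpha$. The wedge product uses the contraction $V^*\otimes V\to\mathbb R$, and the integral is fibre integration along $\pi_K$ with fibre $G/P$. **Operators on $G/M$.** - $\nabla^E$ is the tensor product of the pullbacks of the tractor connections on $W$ and $V^*$. Its covariant exterior derivative splits as $d^E=d_K+d_P$, with $d_K,d_P$ of bidegree $(1,0)$ and $(0,1)$. - Using $\nabla^\theta$ on $W$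 instead gives $d^{E,\theta}=d_K^\theta+d_P^\theta$ (and $d_P^\theta=d_P$). - For $\alpha\in\Omega^{p,0}(G/M,W_M)$, $\beta\in\Omega^{0,q}(G/M,V_M^* )$: $\partial_P^*(\alpha\wedge\beta)=(-1)^p\alpha\wedge\partial^*\beta$ (with $\partial^*$ the lift to $G/M$ of the Kostant codifferential on $V^*$-valued forms) and $\ast_K(\alpha\wedge\beta)=(\ast\alpha)\wedge\beta$ (with $\ast$ the lift to $G/M$ of the Hodge star), extended linearly. - On $(p,q)$-forms $\delta_K=(-1)^p\ast_K^{-1}d_K^\theta\ast_K$, and $\Delta_K=d_K\delta_K+\delta_Kd_K$.
   Formalization: The sign (-1)^{n+1} in the ''Moreover'' part is corrected to (-1)^{dim G/K}; d_P and ∂_P^* are shown to commute (not anticommute) with Δ_K; G/K and G/P are assumed to carry G-invariant orientations, as the Hodge star and fibre integral require. *)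

(* Defs.v *)
From HB Require Import structures.
From mathcomp Require Import all_boot all_order all_algebra perm.
From mathcomp Require Import all_classical all_reals all_analysis.

Set Implicit Arguments.
Unset Strict Implicit.
Unset Printing Implicit Defensive.

Import Order.TTheory GRing.Theory Num.Theory.
Import numFieldNormedType.Exports.

Local Open Scope classical_set_scope.
Local Open Scope ring_scope.

(* Sections of a homogeneous bundle G x_H V are smooth functions
   f : G -> V with f (g h) = h^-1 . f g, and T(G/H) = G x_H (g/h).  Accordingly
   a V-valued p-form on G/H is its pullback to G written in the left-invariant
   frame: a function G -> seq g -> V whose values are alternating p-linear
   forms on g vanishing on h, with the matching H-equivariance.  The degree is
   carried by a predicate: a p-form is 0 on lists of length different from p.
   Representation spaces are R^m (columns), and W (x) V^* = Hom(V, W) is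
   realised as matrices, so that the contraction with V is a matrix product.

   Notions characterised by a property (Lie bracket, Hodge star, bidegree
   components, linear extensions from decomposable elements) are rendered by
   [get], the element satisfying the characterising property. *)

Section Smooth.
Variable R : realType.

Fixpoint Ck (m n : nat) (U : set 'rV[R]_m) (f : 'rV[R]_m -> R^o) : Prop :=
  match n with
  | 0 => forall x, U x -> {for x, continuous f}
  | n'.+1 => (forall v x, U x -> derivable f x v) /\
             (forall v, Ck n' U (fun x => 'D_v f x))
  end.

Definition smooth_on (m a b : nat) (U : set 'rV[R]_m)
    (f : 'rV[R]_m -> 'M[R]_(a, b)) : Prop :=
  forall (i : 'I_a) (j : 'I_b) (n : nat), Ck n U (fun x => f x i j).

Record chart (T : ptopologicalType) (d : nat) := Chart {
  cdom : set T;
  cmap : T -> 'rV[R]_d;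
  cinv : 'rV[R]_d -> T;
  chart_open : open cdom;
  chart_img_open : open (cmap @` cdom);
  chartK : forall x, cdom x -> cinv (cmap x) = x;
  chart_cont : forall x, cdom x -> {for x, continuous cmap};
  chart_inv_cont : forall v, (cmap @` cdom) v -> {for v, continuous cinv} }.

End Smooth.

Arguments cdom {R T d}.
Arguments cmap {R T d}.
Arguments cinv {R T d}.

Definition cimg (R : realType) (T : ptopologicalType) d (c : chart R T d) :=
  cmap c @` cdom c.

#[short(type="topGroupType")]
HB.structure Definition TopGroup := {T of PointedTopological T & Group T}.

(* [lchart1], a chart of the atlas around the unit, fixes the identification of
   the tangent space at the unit with R^d; nothing else depends on it. *)
Record lieGroup (R : realType) := LieGroup {
  lsort :> topGroupType;
  ldim : nat;
  latlas : set (chart R lsort ldim);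
  lcover : forall x : lsort, exists2 c, latlas c & cdom c x;
  lcompat : forall a b, latlas a -> latlas b ->
    smooth_on (cmap a @` (cdom a `&` cdom b)) (fun v => cmap b (cinv a v));
  lmul_smooth : forall a b c, latlas a -> latlas b -> latlas c ->
    smooth_on [set z : 'rV[R]_(ldim + ldim) |
        [/\ cimg a (lsubmx z), cimg b (rsubmx z) &
            cdom c (cinv a (lsubmx z) * cinv b (rsubmx z))%g]]
      (fun z => cmap c (cinv a (lsubmx z) * cinv b (rsubmx z))%g);
  linv_smooth : forall a b, latlas a -> latlas b ->
    smooth_on [set v : 'rV[R]_ldim | cimg a v /\ cdom b (cinv a v)^-1%g]
      (fun v => cmap b (cinv a v)^-1%g);
  lmul_cont : continuous (fun z : lsort * lsort => (z.1 * z.2)%g);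
  linv_cont : continuous (fun x : lsort => x^-1%g);
  lhausdorff : hausdorff_space lsort;
  lcountable : @second_countable lsort;
  lchart1 : chart R lsort ldim;
  lchart1_atlas : latlas lchart1;
  lchart1_dom : cdom lchart1 1%g }.

Section LieAlgebra.
Variables (R : realType) (G : lieGroup R).

Definition lieAlg := 'rV[R]_(ldim G).

Definition smooth (a b : nat) (f : G -> 'M[R]_(a, b)) : Prop :=
  forall c, latlas c -> smooth_on (cimg c) (fun v => f (cinv c v)).

(* the left-invariant vector field of X, applied to f *)
Definition Lder (X : lieAlg) (a b : nat) (f : G -> 'M[R]_(a, b)) (g : G)
    : 'M[R]_(a, b) :=
  'D_X (fun v : 'rV[R]_(ldim G) => f (g * cinv (lchart1 G) v)%g)
       (cmap (lchart1 G) 1%g).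

Definition lie (X Y : lieAlg) : lieAlg :=
  get [set Z : lieAlg | forall f : G -> 'M[R]_(1, 1), smooth f -> forall g,
    Lder Z f g = Lder X (Lder Y f) g - Lder Y (Lder X f) g].

Definition Ad (g : G) (X : lieAlg) : lieAlg :=
  'D_X (fun v : 'rV[R]_(ldim G) =>
          cmap (lchart1 G) (g * cinv (lchart1 G) v * g^-1)%g)
       (cmap (lchart1 G) 1%g).

Definition killing (X Y : lieAlg) : R :=
  \tr (lin1_mx (lie X) *m lin1_mx (lie Y)).

Implicit Types U I J : {vspace lieAlg}.

Definition lieV U I : {vspace lieAlg} :=
  span [seq lie x y | x <- vbasis U, y <- vbasis I].

Definition ideal U I : Prop := (I <= U)%VS /\ (lieV U I <= I)%VS.
Definition solvableL I : Prop := exists n, iter n (fun U => lieV U U) I = 0%VS.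
Definition nilpotentL I : Prop := exists n, iter n (lieV I) I = 0%VS.

Definition semisimple : Prop :=
  forall I, ideal fullv I -> solvableL I -> I = 0%VS.

Definition nilradical U I : Prop :=
  [/\ ideal U I, nilpotentL I &
      forall J, ideal U J -> nilpotentL J -> (J <= I)%VS].

(* nonnegative part of an |m|-grading of g, as usual in parabolic geometry *)
Definition parabolic U : Prop :=
  exists (m : nat) (gr : int -> {vspace lieAlg}),
  [/\ directv (\sum_(i < m.*2.+1) gr (i%:Z - m%:Z)%R)%VS,
      (\sum_(i < m.*2.+1) gr (i%:Z - m%:Z)%R)%VS = fullv,
      forall i : int, (m%:Z < `|i|) -> gr i = 0%VS,
      forall i j : int, (lieV (gr i) (gr j) <= gr (i + j)%R)%VS &
      (forall i : nat, (0 < i)%N -> lieV (gr (- 1)) (gr (- i%:Z)) = gr (- i.+1%:Z))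
      /\ U = (\sum_(i < m.+1) gr i%:Z)%VS].

Definition subgroup (H : set G) : Prop :=
  [/\ H 1%g, forall x y, H x -> H y -> H (x * y)%g & forall x, H x -> H x^-1%g].

Definition lcenter : set G := [set z | forall x : G, (z * x)%g = (x * z)%g].

Definition maximal_compact (H : set G) : Prop :=
  [/\ subgroup H, compact H &
      forall H' : set G, subgroup H' -> compact H' -> H `<=` H' -> H' = H].

(* velocities at 0 of the one-parameter subgroups of G contained in H *)
Definition lie_algebra_of (H : set G) U : Prop :=
  forall X : lieAlg, X \in U <-> exists c : R -> G,
    [/\ forall s t, c (s + t) = (c s * c t)%g, forall t, H (c t) &
        forall f : G -> 'M[R]_(1, 1), smooth f ->
          is_derive (0 : R^o) (1 : R^o) (fun t : R^o => f (c t)) (Lder X f 1%g)].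

Definition cartan_involution (theta : {linear lieAlg -> lieAlg}) : Prop :=
  [/\ forall X, theta (theta X) = X,
      forall X Y, theta (lie X Y) = lie (theta X) (theta Y) &
      forall X, X != 0 -> killing X (theta X) < 0].

End LieAlgebra.

Arguments lcenter {R} G.

Record rep (R : realType) (G : lieGroup R) (m : nat) := Rep {
  rmx :> G -> 'M[R]_m;
  rep1 : rmx 1%g = 1%:M;
  repM : forall g h, rmx (g * h)%g = rmx g *m rmx h;
  rep_smooth : smooth rmx }.

Definition drep (R : realType) (G : lieGroup R) m (rho : rep G m)
  (X : lieAlg G) : 'M[R]_m := Lder X rho 1%g.

Section Alternating.
Variables (R : realType) (G : lieGroup R).
Local Notation g := (lieAlg G).

Definition altform (A : lmodType R) (p : nat) (hh : {vspace g})
    (u : seq g -> A) : Prop :=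
  [/\ forall s, size s != p -> u s = 0,
      forall s1 s2 a x y, u (s1 ++ (a *: x + y) :: s2) =
        a *: u (s1 ++ x :: s2) + u (s1 ++ y :: s2),
      forall s, ~~ uniq s -> u s = 0 &
      forall s, has (fun x => x \in hh) s -> u s = 0].

(* wedge product of a p-form u with a form v, with values multiplied by mul *)
Definition wedge (A B C : lmodType R) (p : nat) (mul : A -> B -> C)
    (u : seq g -> A) (v : seq g -> B) (s : seq g) : C :=
  ((p`!)%:R * ((size s - p)`!)%:R)^-1 *:
  \sum_(sg : 'S_(size s))
    let t := [seq s`_(sg i) | i <- enum 'I_(size s)] in
    (-1) ^+ sg *: mul (u (take p t)) (v (drop p t)).

Definition del (i : nat) (s : seq g) : seq g := take i s ++ drop i.+1 s.

(* the element Z_1 ^ ... ^ Z_k (x) v, where Z is the covector B(Z, .) *)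
Definition decomp (A : lmodType R) (Z : seq g) (v : A) (s : seq g) : A :=
  if size s == size Z then
    \det (\matrix_(i < size Z, j < size Z) killing Z`_i s`_j) *: v
  else 0.

(* indices start at 0, hence the sign of the first sum *)
Definition kostant_decomp (A : lmodType R) (act : g -> A -> A)
    (Z : seq g) (v : A) (s : seq g) : A :=
  \sum_(i < size Z) (-1) ^+ i.+1 *: decomp (del i Z) (act Z`_i v) s
  + \sum_(j < size Z) \sum_(i < j)
      (-1) ^+ (i + j) *: decomp (lie Z`_i Z`_j :: del i (del j Z)) v s.

Definition kostant (np : {vspace g}) (a b : nat)
    (act : g -> 'M[R]_(a, b) -> 'M[R]_(a, b)) (k : nat)
    (u : seq g -> 'M[R]_(a, b)) : seq g -> 'M[R]_(a, b) :=
  get [set w | exists ts : seq (seq g * 'M[R]_(a, b)),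
    [/\ forall t, t \in ts -> size t.1 = k /\ {subset t.1 <= np},
        u = (fun s => \sum_(t <- ts) decomp t.1 t.2 s) &
        w = (fun s => \sum_(t <- ts) kostant_decomp act t.1 t.2 s)]].

End Alternating.

Section Forms.
Variables (R : realType) (G : lieGroup R).
Local Notation g := (lieAlg G).

Definition gform (a b : nat) := G -> seq g -> 'M[R]_(a, b).

Definition Omega (H : set G) (hh : {vspace g}) (a b : nat)
    (act : G -> 'M[R]_(a, b) -> 'M[R]_(a, b)) (p : nat) (f : gform a b) : Prop :=
  [/\ forall x, altform p hh (f x),
      forall s, smooth (fun x => f x s) &
      forall x h s, H h -> f (x * h)%g s = act h^-1%g (f x (map (Ad h) s))].

Definition translate (x : G) (a b : nat) (f : gform a b) : gform a b :=
  fun y => f (x^-1 * y)%g.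

Definition conn (a b : nat) := g -> (G -> 'M[R]_(a, b)) -> G -> 'M[R]_(a, b).

Definition dcov (a b : nat) (nab : conn a b) (f : gform a b) : gform a b :=
  fun x s =>
    \sum_(i < size s) (-1) ^+ i *: nab s`_i (fun y => f y (del i s)) x
    + \sum_(j < size s) \sum_(i < j)
        (-1) ^+ (i + j) *: f x (lie s`_i s`_j :: del i (del j s)).

(* the flat connection of the trivialisation [x, v] |-> (xH, x . v) *)
Definition nabla (m : nat) (rho : rep G m) : conn m 1 :=
  fun X s x => rho x^-1%g *m Lder X (fun y => rho y *m s y) x.

(* h (s, nabla^theta_X t) = X . h (s, t) - h (nabla_X s, t) *)
Definition nabla_theta (m : nat) (rho : rep G m) (h : 'M[R]_m) : conn m 1 :=
  fun X t x => get [set u : 'cV[R]_m |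
    forall s : G -> 'cV[R]_m, smooth s ->
      (s x)^T *m h *m u =
        Lder X (fun y => (s y)^T *m h *m t y) x
        - (nabla rho X s x)^T *m h *m t x].

(* tensor product of nabW with the dual of nabV, on Hom(V, W):
   (nab A) v = nabW (A v) - A (nabV v), for the constant v = e_j *)
Definition conn_hom (w v : nat) (nabW : conn w 1) (nabV : conn v 1)
    : conn w v :=
  fun X A x => \matrix_(i, j)
    (nabW X (fun y => col j (A y)) x
     - A x *m nabV X (fun=> delta_mx j 0) x) i 0.

End Forms.

(* [frame] is a positively oriented orthonormal basis of q = T_o(G/K);
   [fibre] is a list in k representing a positively oriented basis of
   k/m = g/p = T_o(G/P); [haar] is a Haar measure on K. *)
Record setting (R : realType) (G : lieGroup R) (v w : nat) := Setting {
  K : set G;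
  P : set G;
  kk : {vspace lieAlg G};
  pp : {vspace lieAlg G};
  np : {vspace lieAlg G};
  frame : seq (lieAlg G);
  fibre : seq (lieAlg G);
  haar : {measure set (g_sigma_algebraType (@open G)) -> \bar R};
  rV : rep G v;
  rW : rep G w;
  hW : 'M[R]_w }.

Section Operators.
Variables (R : realType) (G : lieGroup R) (v w : nat) (S : setting G v w).
Local Notation g := (lieAlg G).

Definition dimP : nat := (ldim G - \dim (pp S))%N.
Definition dimK : nat := (ldim G - \dim (kk S))%N.

Definition OmegaP (p : nat) (f : gform G v 1) : Prop :=
  Omega (P S) (pp S) (fun x u => rV S x *m u) p f.

Definition OmegaK (p : nat) (f : gform G w 1) : Prop :=
  Omega (K S) (kk S) (fun x u => rW S x *m u) p f.

Definition dV : gform G v 1 -> gform G v 1 := dcov (nabla (rV S)).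
Definition dW : gform G w 1 -> gform G w 1 := dcov (nabla (rW S)).
Definition dtheta : gform G w 1 -> gform G w 1 := dcov (nabla_theta (rW S) (hW S)).

(* the codifferential on p-forms on G/P *)
Definition codiff (p : nat) (f : gform G v 1) : gform G v 1 :=
  fun x => kostant (np S) (fun Z u => drep (rV S) Z *m u) p (f x).

Definition innerh (p : nat) (a b : seq g -> 'cV[R]_w) : R :=
  (p`!)%:R^-1 * \sum_(I : {ffun 'I_p -> 'I_dimK})
    let s := [seq (frame S)`_(I i) | i <- enum 'I_p] in
    ((a s)^T *m hW S *m b s) 0 0.

Definition volK : seq g -> 'M[R]_1 := decomp (frame S) 1%:M.

Definition hodge (p : nat) (b : seq g -> 'cV[R]_w) : seq g -> 'cV[R]_w :=
  if (p <= dimK)%N then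
    get [set c | altform (dimK - p) (kk S) c /\
      forall a, altform p (kk S) a ->
        wedge p (fun x y : 'cV[R]_w => x^T *m hW S *m y) a c
        = (fun s => innerh p a b *: volK s)]
  else fun=> 0.

Definition hodgeV (p : nat) (c : seq g -> 'cV[R]_w) : seq g -> 'cV[R]_w :=
  get [set b | altform p (kk S) b /\ hodge p b = c].

Definition star (p : nat) (f : gform G w 1) : gform G w 1 :=
  fun x => hodge p (f x).

(* (-1)^p star^-1 d^theta star; there are no forms of degree -1 *)
Definition deltaW (p : nat) (f : gform G w 1) : gform G w 1 :=
  if p is p'.+1 then
    fun x s => (-1) ^+ p *: hodgeV p' (dtheta (star p f) x) s
  else fun _ _ => 0.

Definition LaplaceW (p : nat) (f : gform G w 1) : gform G w 1 :=
  fun x s => dW (deltaW p f) x s + deltaW p.+1 (dW f) x s.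

(* T(G/M) is the sum of ker T pi_K = G x_M (k/m) and ker T pi_P = G x_M (p/m);
   a (p + q)-form is of bidegree (p, q) iff it vanishes on more than p vectors
   of the latter and on more than q vectors of the former. *)
Definition bideg (a b p q : nat) (u : seq g -> 'M[R]_(a, b)) : Prop :=
  altform (p + q) (kk S :&: pp S)%VS u /\
  forall s, (p < count (fun x => x \in pp S) s)%N
         || (q < count (fun x => x \in kk S) s)%N -> u s = 0.

Definition OmegaM (p q : nat) (f : gform G w v) : Prop :=
  Omega (K S `&` P S) (kk S :&: pp S)%VS
        (fun x A => rW S x *m A *m rV S x^-1%g) (p + q) f
  /\ forall x, bideg p q (f x).

Definition nablaE : conn G w v := conn_hom (nabla (rW S)) (nabla (rV S)).
Definition nablaEtheta : conn G w v :=
  conn_hom (nabla_theta (rW S) (hW S)) (nabla (rV S)).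

(* components of bidegree (p + 1, q) and (p, q + 1) of the covariant exterior
   derivative of a (p, q)-form *)
Definition partK (nab : conn G w v) (p q : nat) (f : gform G w v) : gform G w v :=
  get [set u | OmegaM p.+1 q u /\
               OmegaM p q.+1 (fun x s => dcov nab f x s - u x s)].
Definition partP (nab : conn G w v) (p q : nat) (f : gform G w v) : gform G w v :=
  get [set u | OmegaM p q.+1 u /\
               OmegaM p.+1 q (fun x s => dcov nab f x s - u x s)].

Definition dK : nat -> nat -> gform G w v -> gform G w v := partK nablaE.
Definition dP : nat -> nat -> gform G w v -> gform G w v := partP nablaE.
Definition dKtheta : nat -> nat -> gform G w v -> gform G w v := partK nablaEtheta.

(* The linear extension of alpha ^ beta |-> opK alpha ^ opP beta, with alpha a
   p-form on g/k with values in W and beta a q-form on g/p with values in V^*;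
   [p'] is the degree of opK alpha. *)
Definition ext_op (p q p' : nat)
    (opK : (seq g -> 'cV[R]_w) -> seq g -> 'cV[R]_w)
    (opP : (seq g -> 'rV[R]_v) -> seq g -> 'rV[R]_v)
    (u : seq g -> 'M[R]_(w, v)) : seq g -> 'M[R]_(w, v) :=
  get [set c | exists (n : nat) (al : 'I_n -> seq g -> 'cV[R]_w)
                      (be : 'I_n -> seq g -> 'rV[R]_v),
    [/\ forall i, altform p (kk S) (al i) /\ altform q (pp S) (be i),
        u = (fun s => \sum_i wedge p mulmx (al i) (be i) s) &
        c = (fun s => \sum_i wedge p' mulmx (opK (al i)) (opP (be i)) s)]].

Definition codiffP (p q : nat) (f : gform G w v) : gform G w v :=
  fun x => ext_op p q p (fun al s => (-1) ^+ p *: al s)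
    (kostant (np S) (fun Z (l : 'rV[R]_v) => - (l *m drep (rV S) Z)) q) (f x).

Definition starKx (p q : nat) (u : seq g -> 'M[R]_(w, v)) :
    seq g -> 'M[R]_(w, v) :=
  ext_op p q (dimK - p) (hodge p) idfun u.

Definition starK (p q : nat) (f : gform G w v) : gform G w v :=
  fun x => starKx p q (f x).

Definition starKV (p q : nat) (f : gform G w v) : gform G w v :=
  fun x => get [set u | bideg p q u /\ starKx p q u = f x].

Definition deltaK (p q : nat) (f : gform G w v) : gform G w v :=
  if p is p'.+1 then
    fun x s => (-1) ^+ p *:
      starKV p' q (dKtheta (dimK - p) q (starK p q f)) x s
  else fun _ _ => 0.

Definition LaplaceK (p q : nat) (f : gform G w v) : gform G w v :=
  fun x s => dK p.-1 q (deltaK p q f) x s + deltaK p.+1 q (dK p q f) x s.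

(* Integration over the fibre {x k M | k in K} of G/M -> G/K of a form of
   bidegree (p, dimP), base arguments first.  At the point x k M the vector
   [x, X] of T(G/K) is [x k, Ad(k^-1) X] and the value [x k, u] is [x, k u]. *)
Definition fibre_int (psi : gform G w 1) : gform G w 1 := fun x s =>
  \matrix_(i, j) Rintegral (haar S) (K S) (fun k : G =>
    (rW S k *m psi (x * k)%g (map (Ad k^-1%g) s ++ fibre S)) i j).

Definition PoissonTransform (k l : nat) (Phi : gform G v 1 -> gform G w 1)
    (phi : gform G w v) : Prop :=
  [/\ OmegaM l (dimP - k) phi,
      forall al, OmegaP k al -> OmegaK l (Phi al),
      forall x al, OmegaP k al -> Phi (translate x al) = translate x (Phi al) &
      forall al, OmegaP k al ->
        Phi al = fibre_int (fun x => wedge (l + (dimP - k)) mulmx (phi x) (al x))].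

Definition invariant_metric (theta : {linear g -> g}) : Prop :=
  [/\ (hW S)^T = hW S,
      forall u : 'cV[R]_w, u != 0 -> 0 < (u^T *m hW S *m u) 0 0,
      forall x, K S x -> (rW S x)^T *m hW S *m rW S x = hW S &
      forall X, (drep (rW S) X)^T *m hW S = - (hW S *m drep (rW S) (theta X))].

Definition oriented_frameK (theta : {linear g -> g}) : Prop :=
  [/\ size (frame S) = dimK,
      forall X, X \in frame S -> theta X = - X,
      forall i j, (i < dimK)%N -> (j < dimK)%N ->
        killing (frame S)`_i (frame S)`_j = (i == j)%:R &
      forall x s, K S x -> volK (map (Ad x) s) = volK s].

Definition oriented_fibreP : Prop :=
  {subset fibre S <= kk S} /\
  exists o : seq g -> R^o, [/\ altform dimP (pp S) o, 0 < o (fibre S) &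
    forall x, P S x -> exists2 c : R, 0 < c &
      forall s, o (map (Ad x) s) = c * o s].

Definition haar_on_K : Prop :=
  [/\ (0 < haar S (K S))%E, (haar S (K S) < +oo)%E &
      forall (x : G) (A : set (g_sigma_algebraType (@open G))),
        K S x -> measurable A -> A `<=` K S ->
        haar S [set (x * y)%g | y in (A : set G)] = haar S A /\
        haar S [set (y * x)%g | y in (A : set G)] = haar S A].

End Operators.

(* Main.v *)
(** Forms are pulled back to [G], where the covariant exterior derivative is
    Cartan's formula [dl] for a connection [LD X + sig X]; it satisfies the
    Leibniz rule and commutes with every pointwise operator commuting with the
    Lie derivatives [LL X].  As [k + p = g], a form of bidegree (p, q) is
    determined by its values on p vectors of [p] followed by q vectors of [k];
    there the Hodge star and the codifferential act on separate variables,
    which yields the commutation relations and their signs.  Fibre integration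
    is integration over [K]: the derivatives along [k] integrate to zero, after
    the fibre vectors have been replaced by a Gram-Schmidt basis, so that it
    commutes with [dl].  The kernels then follow from the Leibniz rule for
    [phi ^ alpha], whose other terms vanish for reasons of bidegree; the cases
    of [delta] and [Delta] are compositions. *)

Require Import Defs.
From HB Require Import structures.
From mathcomp Require Import all_boot all_order all_algebra perm.
From mathcomp Require Import all_classical all_reals all_analysis.
From mathcomp Require Import measurable_realfun.
From mathcomp Require Import ring lra zify.

Import Order.TTheory GRing.Theory Num.Theory.
Import numFieldNormedType.Exports.
Local Open Scope classical_set_scope.
Local Open Scope ring_scope.
Set Implicit Arguments.
Unset Strict Implicit.
Unset Printing Implicit Defensive.

(** Identities between forms are proved by inserting one vector at a time: [wedge_cons] (contraction
    is an antiderivation) and [dl_cons] (Cartan's [i_X d = L_X - d i_X]) reduce the Leibniz rule and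
    [d d = 0] to inductions on the list of arguments. Each notion chosen by [get] is first
    identified with a closed formula from which linearity, smoothness and invariance are read off:
    the bracket with [br], a mixed second derivative of the multiplication in a chart; the Hodge
    star with [Hs], a sum over an orthonormal frame; the codifferential with [kos], a sum over a
    frame of g/p and its dual frame in p_+. Only elements of k and of p come with one-parameter
    subgroups, and these are not assumed continuous: smooth bump functions give their continuity and
    uniqueness, and g = k + p is enough to differentiate integrals over K in every direction. The
    star changes the degree along G/K from p to N - p, where N = dim G/K. Operators along G/P pass
    this degree with the sign (-1)^p, whence the factor (-1)^N. They anticommute with both factors
    of each summand of the Laplacian, hence commute with the Laplacian. *)

Lemma funext2 (A B C : Type) (f h : A -> B -> C) : (forall x y, f x y = h x y) -> f = h.
Proof. by move=> e; apply/funext => x; apply/funext => y. Qed.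

Lemma linear_map0 (R : pzRingType) (A B : lmodType R) (f : A -> B) :
  (forall a x y, f (a *: x + y) = a *: f x + f y) -> f 0 = 0.
Proof. by move=> fl; have := fl (-1) 0 0; rewrite scaler0 addr0 scaleN1r addNr. Qed.

Lemma signr_sq (R : pzRingType) n : (-1) ^+ n * (-1) ^+ n = 1 :> R.
Proof. by rewrite -exprD addnn -mul2n exprM sqrrN !expr1n. Qed.

(** * Calculus on open subsets of R^m *)

Section Calculus.
Variable R : realType.

Lemma derive_ext (V W : normedModType R) (f g : V -> W) (x v : V) :
  (forall y, f y = g y) -> 'D_v f x = 'D_v g x.
Proof. by move=> /funext->. Qed.

Lemma derivative_lineE (V W : normedModType R) (f : V -> W) (x v : V) (t : R) :
  (fun h : R^o => h^-1 *: (((fun s : R^o => f (s *: v + x)) \o shift (t : R^o)) (h *: 1)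
     - f (t *: v + x)))
  = (fun h : R => h^-1 *: ((f \o shift (t *: v + x)) (h *: v) - f (t *: v + x))).
Proof.
apply/funext => h /=; congr (_ *: (f _ - _)).
by rewrite [h *: 1]mulr1 scalerDl addrA.
Qed.

Lemma is_derive_line (V W : normedModType R) (f : V -> W) (x v : V) (t : R) :
  derivable f (t *: v + x) v ->
  is_derive (t : R^o) (1 : R^o) (fun s : R^o => f (s *: v + x)) ('D_v f (t *: v + x)).
Proof. by move=> d; split; rewrite ?/derivable ?/derive derivative_lineE. Qed.

Lemma MVT_dir (V : normedModType R) (f : V -> R^o) (x v : V) (h : R) :
  (forall t : R, `|t| <= `|h| -> derivable f (t *: v + x) v) ->
  exists2 c : R, `|c| <= `|h| & f (h *: v + x) - f x = h * 'D_v f (c *: v + x).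
Proof.
move=> d; pose g (s : R^o) : R^o := f (s *: v + x).
have dg t : `|t| <= `|h| -> is_derive (t : R^o) (1 : R^o) g ('D_v f (t *: v + x)).
  by move=> th; apply: is_derive_line; exact: d.
have g0 : g 0 = f x by rewrite /g scale0r add0r.
have [h0|h0] := leP 0 h.
  have [||c] := @MVT_segment R g (fun t => 'D_v f (t *: v + x)) 0 h h0.
  - move=> t; rewrite in_itv /= => /andP[t0 th]; apply: dg.
    by rewrite !ger0_norm // ltW.
  - apply: derivable_within_continuous => t; rewrite in_itv /= => /andP[t0 th].
    by apply: ex_derive; apply: dg; rewrite !ger0_norm.
  rewrite in_itv /= => /andP[c0 ch] E; exists c; first by rewrite !ger0_norm.
  by move: E; rewrite g0 subr0 mulrC.
have [||c] := @MVT_segment R g (fun t => 'D_v f (t *: v + x)) h 0 (ltW h0).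
- move=> t; rewrite in_itv /= => /andP[t0 th]; apply: dg.
  by rewrite !ler0_norm ?lerN2 ltW.
- apply: derivable_within_continuous => t; rewrite in_itv /= => /andP[t0 th].
  by apply: ex_derive; apply: dg; rewrite !ler0_norm ?lerN2 // ltW.
rewrite in_itv /= => /andP[c0 ch] E; exists c; first by rewrite !ler0_norm ?lerN2 // ltW.
by move: E; rewrite g0 sub0r mulrN mulrC => /eqP; rewrite -eqr_opp opprK opprB => /eqP.
Qed.

Lemma rV_norm_le m (z : 'rV[R]_m) (r : R) :
  0 <= r -> (forall i, `|z 0 i| <= r) -> `|z| <= r.
Proof.
move=> r0 zr; rewrite /Num.norm /= mx_normrE; apply: bigmax_le => // -[i j] _ /=.
by rewrite ord1.
Qed.

Lemma rV_coord_le m (z : 'rV[R]_m) i : `|z 0 i| <= `|z|.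
Proof.
rewrite [leRHS]/Num.norm /= mx_normrE.
exact: (le_bigmax _ (fun ij : 'I_1 * 'I_m => `|z ij.1 ij.2|) (0, i)).
Qed.

Lemma linear_rV_continuous m (D : 'I_m -> R) :
  continuous (fun h : 'rV[R]_m => \sum_i h 0 i * D i : R^o).
Proof.
move=> z; elim: (index_enum _) => [|i r IH].
  rewrite (_ : (fun h : 'rV_m => _) = cst 0); first exact: cst_continuous.
  by apply/funext => h; rewrite big_nil.
rewrite (_ : (fun h : 'rV_m => _) = fun h : 'rV_m => h 0 i * D i + \sum_(i <- r) h 0 i * D i);
  last by apply/funext => h; rewrite big_cons.
apply: (@cvgD R R^o _ (nbhs z) _ (fun h : 'rV_m => h 0 i * D i) _ _ _ _ IH).
by apply: (@cvgMl R _ (nbhs z) _ (fun h : 'rV_m => h 0 i)); exact: coord_continuous.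
Qed.

Lemma differentiable_of_littleo (V W : normedModType R) (f : V -> W)
    (df : {linear V -> W}) x :
  continuous df -> f \o shift x = cst (f x) + df +o_ 0 id -> differentiable f x.
Proof.
move=> dfc dxf; have E := diff_unique dfc dxf.
by apply/diff_locallyP; split; rewrite E.
Qed.

Lemma near0_shift (V : normedModType R) (x : V) (A : set V) :
  nbhs x A -> exists2 r : R, 0 < r & forall z, `|z| < r -> A (z + x).
Proof.
move=> /nbhs_ballP[r /= r0 rA]; exists r => // z zr; apply: rA.
by rewrite -ball_normE /= opprD addrA addrAC subrr add0r normrN.
Qed.

(** The increment is telescoped over the coordinates; each step is a mean value theorem in one
    coordinate direction, and the intermediate partial derivative is close to the one at [x] by
    continuity. *)
Lemma partial_differentiable m (f : 'rV[R]_m -> R^o) x :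
  (forall i, \forall y \near x, derivable f y (delta_mx 0 i)) ->
  (forall i, {for x, continuous (fun y => 'D_(delta_mx 0 i) f y)}) ->
  differentiable f x /\ forall h, 'D_h f x = \sum_i h 0 i * 'D_(delta_mx 0 i) f x.
Proof.
move=> df cf; pose D i := 'D_(delta_mx 0 i) f x.
pose L (h : 'rV[R]_m) : R^o := \sum_i h 0 i * D i.
have Llin : linear L.
  move=> a u w; rewrite /L scaler_sumr -big_split; apply: eq_bigr => i _ /=.
  by rewrite !mxE mulrDl -mulrA.
pose dL : {linear 'rV[R]_m -> R^o} := HB.pack L (GRing.isLinear.Build _ _ _ _ _ Llin).
have dLc : continuous dL by exact: linear_rV_continuous.
have dLo : f \o shift x = cst (f x) + dL +o_ (0 : 'rV[R]_m) id.
  (* Each of the [m] steps below may cost [e']; dividing by [m.+1] keeps [e'] positive when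
     [m = 0]. *)
  apply/eqaddoP => e e0 /=; pose e' := e / m.+1%:R.
  have e'0 : 0 < e' by rewrite divr_gt0 // ltr0n.
  have : \forall y \near x, forall i, derivable f y (delta_mx 0 i) /\
      `|'D_(delta_mx 0 i) f x - 'D_(delta_mx 0 i) f y| <= e'.
    apply: (@filter_forall _ _ _ (nbhs x) _) => i; near=> y; split; first by near: y; exact: df.
    by near: y; move/cvgrPdist_le : (cf i) => /(_ _ e'0).
  move=> /near0_shift[r r0 rP]; near=> h.
  have hr : `|h| < r by near: h; exact: (@nbhs0_lt R 'rV[R]_m r r0).
  (* [T k] is [h] with the coordinates from [k] on replaced by 0. *)
  pose T k : 'rV[R]_m := \row_i (if (i < k)%N then h 0 i else 0).
  have TS (i : 'I_m) : T i.+1 = h 0 i *: delta_mx 0 i + T i.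
    apply/rowP => j; rewrite !mxE eqxx /= ltnS leq_eqVlt (eq_sym j).
    have [->|ij] := eqVneq i j; first by rewrite eqxx /= mulr1 ltnn addr0.
    by rewrite eq_sym -val_eqE /= in ij; rewrite (negbTE ij) /= mulr0 add0r.
  have Tle c (i : 'I_m) : `|c| <= `|h 0 i| -> `|c *: delta_mx 0 i + T i| < r.
    move=> ch; apply: le_lt_trans hr; apply: rV_norm_le => // j; rewrite !mxE eqxx /= (eq_sym j).
    have [<-|ij] := eqVneq i j; first by rewrite ltnn addr0 mulr1 (le_trans ch) // rV_coord_le.
    by rewrite mulr0 add0r; case: ifP => _; rewrite ?rV_coord_le // normr0.
  have step (i : 'I_m) :
      `|f (T i.+1 + x) - f (T i + x) - h 0 i * D i| <= e' * `|h|.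
    have [t th|c ch] := @MVT_dir _ f (T i + x) (delta_mx 0 i) (h 0 i).
      by rewrite addrA; apply: (proj1 (rP _ (Tle _ _ th) i)).
    rewrite TS addrA in ch * => ->; rewrite -mulrBr normrM mulrC ler_pM //.
      rewrite distrC addrA; exact: (proj2 (rP _ (Tle _ _ ch) i)).
    exact: rV_coord_le.
  have Tm : T m = h by apply/rowP => i; rewrite mxE ltn_ord.
  have T0 : T 0%N = 0 by apply/rowP => i; rewrite !mxE.
  have -> : (f \o shift x - (cst (f x) + dL)) h =
      \sum_(i < m) (f (T i.+1 + x) - f (T i + x) - h 0 i * D i).
    rewrite sumrB -(big_mkord xpredT (fun i => f (T i.+1 + x) - f (T i + x))).
    rewrite (@telescope_sumr _ 0 m (fun i => f (T i + x))) // Tm T0 add0r.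
    by rewrite !fctE /= opprD addrA.
  apply: (le_trans (ler_norm_sum _ _ _)).
  apply: (@le_trans _ _ (\sum_(i < m) e' * `|h|)); first by apply: ler_sum => i _; exact: step.
  rewrite sumr_const card_ord -mulr_natl mulrA ler_wpM2r //.
  by rewrite /e' mulrCA ler_piMr ?(ltW e0) // ler_pdivrMr ?ltr0n // mul1r ler_nat.
split; first exact: differentiable_of_littleo dLc dLo.
move=> h; rewrite deriveE; last exact: differentiable_of_littleo dLc dLo.
by rewrite (diff_unique dLc dLo).
Unshelve. all: by end_near. Qed.

(** Only a directional derivative of [g] is assumed, so [g] is restricted to the line through [x],
    where derivable means differentiable and the chain rule for differentials applies. *)
Lemma is_derive_chain (U V W : normedModType R) (g : U -> V) (F : V -> W) x v :
  derivable g x v -> differentiable F (g x) ->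
  is_derive x v (F \o g) ('D_('D_v g x) F (g x)).
Proof.
move=> dg dF; have g0 : (0 : R) *: v + x = x by rewrite scale0r add0r.
have dg' : derivable g ((0 : R) *: v + x) v by rewrite g0.
have [d1 e1] := is_derive_line dg'.
have d1' := (derivable1_diffP _ _).1 d1.
have dF' : differentiable F ((fun s : R^o => g (s *: v + x)) 0) by rewrite g0.
have dd := differentiable_comp d1' dF'.
have d2 : derivable (F \o g) x v by apply/derivable1P; apply/derivable1_diffP; exact: dd.
split => //.
have d2' : derivable (F \o g) ((0 : R) *: v + x) v by rewrite g0.
have [_] := is_derive_line d2'; rewrite g0 => <-.
transitivity ('D_1 (F \o (fun s : R^o => g (s *: v + x))) (0 : R^o)) => //; rewrite deriveE //.
by rewrite diff_comp //= -(deriveE _ d1') e1 g0 -deriveE.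
Qed.

Lemma is_derive_mul (V : normedModType R) (f g : V -> R^o) x v :
  derivable f x v -> derivable g x v ->
  is_derive x v (fun y => f y * g y : R^o) (f x * 'D_v g x + g x * 'D_v f x).
Proof.
by move=> df dg; have := is_deriveM (derivableP df) (derivableP dg).
Qed.

Definition sm m (U : set 'rV[R]_m) (f : 'rV[R]_m -> R^o) := forall n, Ck n U f.

Section OpenSet.
Variables (m : nat) (U : set 'rV[R]_m).
Hypothesis Uo : open U.
Implicit Types f g : 'rV[R]_m -> R^o.

Lemma sm_cont f x : sm U f -> U x -> {for x, continuous f}.
Proof. by move=> fU Ux; exact: (fU 0%N x Ux). Qed.

Lemma sm_derivable f x v : sm U f -> U x -> derivable f x v.
Proof. by move=> fU Ux; have [d _] := fU 1%N; exact: d. Qed.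

Arguments sm_derivable [f x] v _ _.

Lemma sm_derive f v : sm U f -> sm U (fun x => 'D_v f x).
Proof. by move=> fU n; have [_ d] := fU n.+1; exact: d. Qed.

Lemma sm_diffE f x : sm U f -> U x ->
  differentiable f x /\ forall h, 'D_h f x = \sum_i h 0 i * 'D_(delta_mx 0 i) f x.
Proof.
move=> fU Ux; apply: partial_differentiable => i; last first.
  by apply: sm_cont => //; exact: sm_derive.
by apply: filterS (open_nbhs_nbhs (conj Uo Ux)) => y; exact: sm_derivable.
Qed.

Lemma sm_differentiable f x : sm U f -> U x -> differentiable f x.
Proof. by move=> fU Ux; have [] := sm_diffE fU Ux. Qed.

Lemma near_open x (P : 'rV[R]_m -> Prop) : U x -> (forall y, U y -> P y) -> \forall y \near x, P y.
Proof. by move=> Ux UP; exact: filterS (open_nbhs_nbhs (conj Uo Ux)). Qed.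

Lemma Ck_eq n f g : (forall x, U x -> f x = g x) -> Ck n U f -> Ck n U g.
Proof.
elim: n f g => [|n IH] f g fg /=.
  move=> fc x Ux; rewrite /prop_for /continuous_at -fg //; apply: cvg_trans (fc x Ux).
  have nE : \forall y \near x, f y = g y.
    by apply: filterS (open_nbhs_nbhs (conj Uo Ux)) => y; exact: fg.
  exact: near_eq_cvg nE.
move=> [fd fC]; split=> [v x Ux|v].
  by apply: near_eq_derivable (fd v x Ux); apply: near_open.
apply: IH (fC v) => x Ux; apply: near_eq_derive; exact: near_open.
Qed.

Lemma sm_eq f g : (forall x, U x -> f x = g x) -> sm U f -> sm U g.
Proof. by move=> fg fU n; exact: Ck_eq (fU n). Qed.

Lemma sm_cst (c : R) : sm U (fun=> c).
Proof.
move=> n; elim: n c => [|n IH] c /=; first by move=> x _; exact: cst_continuous.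
split=> [v x Ux|v]; first exact: derivable_cst.
by apply: Ck_eq (IH 0) => x Ux; rewrite derive_cst.
Qed.

Lemma CkD n f g : Ck n U f -> Ck n U g -> Ck n U (fun x => f x + g x).
Proof.
elim: n f g => [|n IH] f g /=; first by move=> fc gc x Ux;
  exact: (@cvgD R R^o _ (nbhs x) _ f g _ _ (fc x Ux) (gc x Ux)).
move=> [fd fC] [gd gC]; split=> [v x Ux|v]; first exact: (derivableD (fd v x Ux) (gd v x Ux)).
apply: Ck_eq (IH _ _ (fC v) (gC v)) => x Ux.
by rewrite -(deriveD (fd v x Ux) (gd v x Ux)).
Qed.

Lemma smD f g : sm U f -> sm U g -> sm U (fun x => f x + g x).
Proof. by move=> fU gU n; exact: CkD. Qed.

Lemma sm_sum I (r : seq I) (F : I -> 'rV[R]_m -> R^o) :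
  (forall i, sm U (F i)) -> sm U (fun x => \sum_(i <- r) F i x).
Proof.
move=> FU; elim: r => [|i r IH].
  by apply: sm_eq (sm_cst 0) => x _; rewrite big_nil.
by apply: sm_eq (smD (FU i) IH) => x _; rewrite big_cons.
Qed.

Lemma smM f g : sm U f -> sm U g -> sm U (fun x => f x * g x).
Proof.
move=> fU gU n; elim: n f g fU gU => [|n IH] f g fU gU /=.
  by move=> x Ux; exact: (@cvgM R _ (nbhs x) _ f g _ _ (sm_cont fU Ux) (sm_cont gU Ux)).
split=> [v x Ux|v].
  by have [] := is_derive_mul (sm_derivable v fU Ux) (sm_derivable v gU Ux).
apply: (Ck_eq _ (CkD (IH _ _ fU (sm_derive v gU)) (IH _ _ gU (sm_derive v fU)))) => x Ux.
by have [_ ->] := is_derive_mul (sm_derivable v fU Ux) (sm_derivable v gU Ux).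
Qed.

Lemma is_derive_coord (i : 'I_m) (x v : 'rV[R]_m) :
  is_derive x v (fun y : 'rV[R]_m => y 0 i : R^o) (v 0 i).
Proof.
have E : (fun h : R => h^-1 *: (((fun y : 'rV[R]_m => y 0 i : R^o) \o shift x) (h *: v)
    - (x 0 i : R^o))) @ 0^' --> (v 0 i : R^o).
  apply: cvg_near_cst; near=> h; rewrite /= !mxE addrK scalerA mulVf ?scale1r //.
  by near: h; exact: nbhs_dnbhs_neq.
by split; [apply/cvg_ex; exists (v 0 i) | exact: cvg_lim E].
Unshelve. all: by end_near. Qed.

Lemma sm_coord i : sm U (fun x => x 0 i).
Proof.
case=> [|n] /=; first by move=> x _; exact: coord_continuous.
split=> [v x Ux|v]; first by apply: ex_derive; exact: is_derive_coord.
by apply: Ck_eq (sm_cst (v 0 i) n) => x _; have [_ ->] := is_derive_coord i x v.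
Qed.

Lemma derivable_coord d (g : 'rV[R]_m -> 'rV[R]_d) x v :
  (forall i, derivable (fun y => g y 0 i : R^o) x v) -> derivable g x v.
Proof. by move=> gd; apply/derivable_mxP => i j; rewrite ord1. Qed.

End OpenSet.
Arguments sm_derivable {m U f x} v _ _.

Lemma sm_sub m (U V : set 'rV[R]_m) f : U `<=` V -> sm V f -> sm U f.
Proof.
move=> UV fV n; elim: n f fV => [|n IH] f fV /=.
  by move=> x /UV; exact: (sm_cont fV).
by split=> [v x /UV|v]; [exact: sm_derivable|apply: IH; exact: sm_derive].
Qed.

Lemma sm_local m (U : set 'rV[R]_m) f :
  (forall x, U x -> exists V, [/\ open V, V x & sm V f]) -> sm U f.
Proof.
move=> loc n; elim: n f loc => [|n IH] f loc /=.
  by move=> x /loc[V [_ Vx fV]]; exact: sm_cont fV Vx.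
split=> [v x /loc[V [_ Vx fV]]|v]; first exact: sm_derivable _ fV Vx.
by apply: IH => x /loc[V [Vo Vx fV]]; exists V; split => //; exact: sm_derive.
Qed.

Lemma continuous_rV m d (g : 'rV[R]_m -> 'rV[R]_d) x :
  (forall i, {for x, continuous (fun y => g y 0 i : R^o)}) -> {for x, continuous g}.
Proof.
move=> gc; apply/(@cvgrPdist_le R _ _ (nbhs x)) => e e0; near=> y.
apply: rV_norm_le (ltW e0) _ => i; rewrite !mxE.
move: i; near: y; apply: (@filter_forall _ _ _ (nbhs x) _) => i.
by move/(@cvgrPdist_le R R^o _ (nbhs x)) : (gc i) => /(_ _ e0).
Unshelve. all: by end_near. Qed.

Lemma sm_comp m d (U : set 'rV[R]_m) (W : set 'rV[R]_d) (g : 'rV[R]_m -> 'rV[R]_d) F :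
  open U -> open W -> (forall i, sm U (fun x => g x 0 i)) ->
  (forall x, U x -> W (g x)) -> sm W F -> sm U (fun x => F (g x)).
Proof.
move=> Uo Wo gU UW FW.
have gd x v : U x -> derivable g x v.
  by move=> Ux; apply: derivable_coord => i; exact: sm_derivable _ (gU i) Ux.
(* Differentiating [F (g x)] produces smooth factors times partial derivatives of [F] at [g x]; the
   induction on the order therefore carries a factor [a] and an arbitrary [F']. *)
suff P n F' a : sm W F' -> sm U a -> Ck n U (fun x => a x * F' (g x)).
  move=> n; apply: Ck_eq (P n F (fun=> 1) FW (sm_cst Uo 1)) => // x _.
  by rewrite mul1r.
elim: n F' a {F FW} => [|n IH] F a FW aU.
  move=> x Ux; have Fc : {for g x, continuous F} by apply: sm_cont FW _; exact: UW.
  have gc : {for x, continuous g} by apply: continuous_rV => i; exact: sm_cont (gU i) Ux.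
  exact: (@cvgM R _ (nbhs x) _ a _ _ _ (sm_cont aU Ux) (@continuous_comp _ _ _ g F x gc Fc)).
have chain x v : U x -> is_derive x v (F \o g) ('D_('D_v g x) F (g x)).
  move=> Ux; apply: is_derive_chain; first exact: gd.
  by apply: sm_differentiable FW _ => //; exact: UW.
split=> [v x Ux|v].
  by have [d1 _] := chain x v Ux; have [] := is_derive_mul (sm_derivable v aU Ux) d1.
pose D x := \sum_i (a x * 'D_v (fun y => g y 0 i) x) * 'D_(delta_mx 0 i) F (g x).
apply: (Ck_eq Uo (f := fun x => 'D_v a x * F (g x) + D x)).
  move=> x Ux; have [d1 e1] := chain x v Ux.
  have [_] := is_derive_mul (sm_derivable v aU Ux) d1; rewrite e1 /= => ->.
  rewrite [RHS]addrC (mulrC ('D_v a x)); congr (_ + _).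
  have [_ ->] := sm_diffE Wo FW (UW _ Ux).
  rewrite /D mulr_sumr; apply: eq_bigr => i _; rewrite derive_mx ?mxE; last exact: gd.
  by rewrite mulrA.
apply: CkD => //; first exact: IH FW (sm_derive v aU).
rewrite /D; elim: (index_enum _) => [|i r IHr].
  by apply: Ck_eq (sm_cst Uo 0 n) => // x _; rewrite big_nil.
apply: Ck_eq (CkD Uo (IH _ _ (sm_derive (delta_mx 0 i) FW) (smM Uo aU (sm_derive v (gU i)))) IHr) => // x _.
by rewrite big_cons.
Qed.

(** Two mean value theorems: along [u] for the function sending [y] to [f (h v + y) - f y], then
    along [v] for the derivative of [f] along [u]. *)
Lemma second_difference m (U : set 'rV[R]_m) (f : 'rV[R]_m -> R^o) (x u v : 'rV[R]_m) (h : R) :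
  sm U f -> 0 < h ->
  (forall z, `|z| <= h * (`|u| + `|v|) -> U (z + x)) ->
  exists2 p, `|p| <= h * (`|u| + `|v|) &
    f (h *: u + (h *: v + x)) - f (h *: v + x) - (f (h *: u + x) - f x)
      = h * (h * 'D_v (fun y => 'D_u f y) (p + x)).
Proof.
move=> fU h0 hU; have nh : `|h| = h by rewrite gtr0_norm.
have le c c' : `|c| <= `|h| -> `|c'| <= `|h| -> `|c' *: v + c *: u| <= h * (`|u| + `|v|).
  rewrite nh => ch c'h; rewrite (le_trans (ler_normD _ _)) // !normrZ mulrDr addrC.
  by rewrite lerD // ler_wpM2r.
have h1 : `|h| <= `|h| by [].
have z0 : `|0 : R| <= `|h| by rewrite normr0.
pose g y : R^o := f (h *: v + y) - f y.
have dg t : `|t| <= `|h| ->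
    is_derive (t *: u + x) u g ('D_u f (h *: v + (t *: u + x)) - 'D_u f (t *: u + x)).
  move=> th; apply: is_deriveB; last first.
    apply: derivableP; apply: sm_derivable _ fU _.
    by have := hU _ (le _ _ th z0); rewrite scale0r add0r.
  have d : derivable f (h *: v + (t *: u + x)) u.
    by apply: sm_derivable _ fU _; rewrite addrA; apply: hU; exact: le.
  have sh : (fun k : R => k^-1 *: (((fun y => f (h *: v + y) : R^o) \o shift (t *: u + x)) (k *: u)
      - f (h *: v + (t *: u + x)))) =
    (fun k : R => k^-1 *: ((f \o shift (h *: v + (t *: u + x))) (k *: u) - f (h *: v + (t *: u + x)))).
    by apply/funext => k /=; rewrite addrCA.
  by split; rewrite /derivable /derive sh.
have [t th|c ch] := @MVT_dir _ g x u h; first by have [] := dg t th.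
have [_ ->] := dg c ch.
have [t th|c' ch'] := @MVT_dir _ (fun y => 'D_u f y) (c *: u + x) v h.
  by apply: sm_derivable _ (sm_derive u fU) _; rewrite addrA; apply: hU; exact: le.
move=> -> E; exists (c' *: v + c *: u); first exact: le.
have -> : c' *: v + c *: u + x = c' *: v + (c *: u + x) by exact/esym/addrA.
have -> : h *: u + (h *: v + x) = h *: v + (h *: u + x) by exact: addrCA.
rewrite -E /g; move: (f _) (f _) (f _) (f _) => a1 a2 a3 a4; rewrite !opprD !opprK.
by rewrite -!addrA; congr (_ + _); rewrite addrCA.
Qed.

Lemma cancel_sqr (h A B a a' b c d : R) : h != 0 -> a = a' ->
  a - b - (c - d) = h * (h * A) -> a' - c - (b - d) = h * (h * B) -> A = B.
Proof.
move=> h0 -> EA EB; apply: (mulfI h0); apply: (mulfI h0); rewrite -EA -EB.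
by rewrite !opprB !addrA; ring.
Qed.

Lemma norm_close (A B C e : R) : `|A - C| <= e / 2 -> `|B - C| <= e / 2 -> `|A - B| <= e.
Proof.
move=> AC BC; rewrite (splitr e) (le_trans (ler_distD C _ _)) // lerD //.
by rewrite distrC.
Qed.

(** The second difference is symmetric in [u] and [v], so the two iterated derivatives agree at a
    pair of points near [x]; their continuity moves both points to [x]. *)
Lemma schwarz m (U : set 'rV[R]_m) (f : 'rV[R]_m -> R^o) (x u v : 'rV[R]_m) :
  open U -> sm U f -> U x ->
  'D_u (fun y => 'D_v f y) x = 'D_v (fun y => 'D_u f y) x.
Proof.
move=> Uo fU Ux; apply/eqP; rewrite -subr_eq0 -normr_le0; apply/ler_addgt0Pr => e e0.
rewrite add0r.
have e20 : 0 < e / 2 by rewrite divr_gt0.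
have c1 : \forall y \near x, `|'D_u (fun y => 'D_v f y) x - 'D_u (fun y => 'D_v f y) y| <= e / 2.
  exact: (@cvgrPdist_le R R^o _ (nbhs x) _ _ _).1 (sm_cont (sm_derive u (sm_derive v fU)) Ux) _ e20.
have c2 : \forall y \near x, `|'D_v (fun y => 'D_u f y) x - 'D_v (fun y => 'D_u f y) y| <= e / 2.
  exact: (@cvgrPdist_le R R^o _ (nbhs x) _ _ _).1 (sm_cont (sm_derive v (sm_derive u fU)) Ux) _ e20.
have [r r0 rP] := near0_shift (filterI (filterI c1 c2) (open_nbhs_nbhs (conj Uo Ux))).
(* With this step length both intermediate points stay within [r] of [x]; the added 1 covers
   [u = v = 0]. *)
pose h := r / (2 * (`|u| + `|v| + 1)).
have N0 : 0 < `|u| + `|v| + 1 by rewrite ltr_wpDl // addr_ge0.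
have h0 : 0 < h by rewrite divr_gt0 // mulr_gt0.
have hr : h * (`|u| + `|v|) < r.
  apply: (@le_lt_trans _ _ (h * (`|u| + `|v| + 1))); first by rewrite ler_wpM2l ?(ltW h0) // lerDl.
  rewrite /h invfM mulrA -mulrA mulVf ?gt_eqF // mulr1 ltr_pdivrMr // ltr_pMr //.
  by rewrite ltr1n.
have hU z : `|z| <= h * (`|u| + `|v|) -> U (z + x).
  by move=> zh; apply: (rP _ (le_lt_trans zh hr)).2.
have [p ph Ep] := second_difference fU h0 hU.
have hU' z : `|z| <= h * (`|v| + `|u|) -> U (z + x) by rewrite addrC; exact: hU.
have [q qh Eq] := second_difference fU h0 hU'.
have pq : 'D_v (fun y => 'D_u f y) (p + x) = 'D_u (fun y => 'D_v f y) (q + x).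
  apply: (cancel_sqr (lt0r_neq0 h0) _ Ep Eq).
  by congr (f _); exact: addrCA.
have {}qh : `|q| < r by apply: (le_lt_trans qh); rewrite (addrC `|v| `|u|); exact: hr.
have [[q1 _] _] := rP _ qh.
have [[_ p1] _] := rP _ (le_lt_trans ph hr).
by apply: norm_close q1 _; rewrite -pq; exact: p1.
Qed.

End Calculus.
Arguments sm_derivable {R m U f x} v _ _.

(** * Functions of two vector variables *)

Section Slices.
Variable R : realType.

Lemma row_mx_lineR m n (u : 'rV[R]_m) (w X : 'rV[R]_n) (h : R) :
  h *: row_mx 0 X + row_mx u w = row_mx u (h *: X + w).
Proof. by rewrite scale_row_mx scaler0 add_row_mx add0r. Qed.

Lemma row_mx_lineL m n (u X : 'rV[R]_m) (w : 'rV[R]_n) (h : R) :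
  h *: row_mx X 0 + row_mx u w = row_mx (h *: X + u) w.
Proof. by rewrite scale_row_mx scaler0 add_row_mx add0r. Qed.

Lemma derive_sliceR m n (H : 'rV[R]_(m + n) -> R^o) u w X :
  'D_(row_mx 0 X) H (row_mx u w) = 'D_X (fun v => H (row_mx u v)) w.
Proof.
have E : (fun h : R => h^-1 *: ((H \o shift (row_mx u w)) (h *: row_mx 0 X) - H (row_mx u w))) =
    (fun h : R => h^-1 *: (((fun v => H (row_mx u v) : R^o) \o shift w) (h *: X) - H (row_mx u w))).
  by apply/funext => h /=; rewrite row_mx_lineR.
by rewrite /derive E.
Qed.

Lemma derive_sliceL m n (H : 'rV[R]_(m + n) -> R^o) u w X :
  'D_(row_mx X 0) H (row_mx u w) = 'D_X (fun v => H (row_mx v w)) u.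
Proof.
have E : (fun h : R => h^-1 *: ((H \o shift (row_mx u w)) (h *: row_mx X 0) - H (row_mx u w))) =
    (fun h : R => h^-1 *: (((fun v => H (row_mx v w) : R^o) \o shift u) (h *: X) - H (row_mx u w))).
  by apply/funext => h /=; rewrite row_mx_lineL.
by rewrite /derive E.
Qed.

Lemma sm_row_mx p m n (U : set 'rV[R]_p) (f : 'rV[R]_p -> 'rV[R]_m) (g : 'rV[R]_p -> 'rV[R]_n) :
  (forall i, sm U (fun v => f v 0 i)) -> (forall i, sm U (fun v => g v 0 i)) ->
  forall i, sm U (fun v => row_mx (f v) (g v) 0 i).
Proof.
move=> fU gU i n0; rewrite -(splitK i); case: (fintype.split i) => j /=.
  by under [X in Ck _ _ X]eq_fun do rewrite row_mxEl; exact: fU.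
by under [X in Ck _ _ X]eq_fun do rewrite row_mxEr; exact: gU.
Qed.

Lemma sm_lsubmx m n (U : set 'rV[R]_(m + n)) : open U ->
  forall i, sm U (fun z => lsubmx z 0 i).
Proof.
move=> Uo i n0; under [X in Ck _ _ X]eq_fun do rewrite mxE.
exact: sm_coord.
Qed.

Lemma sm_rsubmx m n (U : set 'rV[R]_(m + n)) : open U ->
  forall i, sm U (fun z => rsubmx z 0 i).
Proof.
move=> Uo i n0; under [X in Ck _ _ X]eq_fun do rewrite mxE.
exact: sm_coord.
Qed.

End Slices.

(** * Smooth maps from open sets of R^m to G *)

Section SmoothMaps.
Variables (R : realType) (G : lieGroup R).
Local Notation d := (ldim G).

(** Sources are open subsets of coordinate spaces, which covers charts, their products and slices
    without products of manifolds. Continuity is demanded separately: it makes the sets on which the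
    chart expressions are tested open. *)
Definition gsm m (U : set 'rV[R]_m) (phi : 'rV[R]_m -> G) :=
  (forall x, U x -> {for x, continuous phi}) /\
  forall c, latlas c -> forall i, sm (U `&` phi @^-1` cdom c) (fun v => cmap c (phi v) 0 i).

Lemma open_preimage_on (T T' : topologicalType) (U : set T) (phi : T -> T') (A : set T') :
  open U -> (forall x, U x -> {for x, continuous phi}) -> open A ->
  open (U `&` phi @^-1` A).
Proof.
move=> Uo pc Ao; rewrite openE => x [Ux Ax]; apply: filterI; first exact: open_nbhs_nbhs.
by apply: (pc x Ux); exact: open_nbhs_nbhs.
Qed.

Lemma cimg_open (c : chart R G d) : open (cimg c).
Proof. exact: chart_img_open. Qed.

Arguments cimg_open c : clear implicits.

Lemma cinvK (c : chart R G d) v : cimg c v -> cdom c (cinv c v) /\ cmap c (cinv c v) = v.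
Proof. by move=> [x cx <-]; rewrite chartK. Qed.

Lemma cimg_cmap (c : chart R G d) x : cdom c x -> cimg c (cmap c x).
Proof. by move=> cx; exists x. Qed.

Lemma gsm_open m (U : set 'rV[R]_m) phi (A : set G) : open U -> gsm U phi -> open A ->
  open (U `&` phi @^-1` A).
Proof. by move=> Uo [pc _]; exact: open_preimage_on. Qed.

Lemma smooth_gsm m (U : set 'rV[R]_m) phi a b (f : G -> 'M[R]_(a, b)) i j :
  open U -> gsm U phi -> smooth f -> sm U (fun v => f (phi v) i j : R^o).
Proof.
move=> Uo pU fs; apply: sm_local => x Ux; have [c lc cx] := lcover (phi x).
have Vo := gsm_open Uo pU (chart_open c).
exists (U `&` phi @^-1` cdom c); split => //.
have := @sm_comp R m d _ (cimg c) (fun v => cmap c (phi v)) (fun v => f (cinv c v) i j : R^o)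
  Vo (cimg_open c) (pU.2 c lc).
move=> /(_ (fun v h => cimg_cmap h.2) (fs c lc i j)).
by apply: sm_eq => // y [_ yc]; rewrite chartK.
Qed.

Lemma gsm_cinv c : latlas c -> gsm (cimg c) (cinv c).
Proof.
move=> lc; split=> [v|b lb i]; first exact: chart_inv_cont.
apply: sm_sub (lcompat lc lb 0 i) => v [[x cx <-]]; rewrite /= chartK // => bx.
by exists x.
Qed.

Lemma gsm_cst m (U : set 'rV[R]_m) (x : G) : open U -> gsm U (fun=> x).
Proof.
move=> Uo; split=> [v _|c lc i]; first exact: cst_continuous.
by apply: sm_cst; apply: gsm_open; [| |exact: chart_open];
  rewrite // ; split=> [v _|c0 l0 i0]; [exact: cst_continuous|
  apply: sm_cst; apply: open_preimage_on (chart_open c0) => // v _; exact: cst_continuous].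
Qed.

Lemma mul_continuous_at m (phi psi : 'rV[R]_m -> G) x :
  {for x, continuous phi} -> {for x, continuous psi} ->
  {for x, continuous (fun v => (phi v * psi v)%g)}.
Proof.
move=> pc sc; have := @lmul_cont R G (phi x, psi x) => mc.
exact: (@continuous_comp _ _ _ (fun v => (phi v, psi v)) (fun z : G * G => (z.1 * z.2)%g) x
  (cvg_pair pc sc) mc).
Qed.

Lemma mul_chart_open a b c : latlas a -> latlas b -> latlas c ->
  open [set z : 'rV[R]_(d + d) |
        [/\ cimg a (lsubmx z), cimg b (rsubmx z) &
            cdom c (cinv a (lsubmx z) * cinv b (rsubmx z))%g]].
Proof.
move=> la lb lc.
have lsc : continuous (fun z : 'rV[R]_(d + d) => lsubmx z).
  by move=> z; apply/differentiable_continuous/differentiable_lsubmx.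
have rsc : continuous (fun z : 'rV[R]_(d + d) => rsubmx z).
  by move=> z; apply/differentiable_continuous/differentiable_rsubmx.
have lo : open [set z : 'rV[R]_(d + d) | cimg a (lsubmx z)].
  by apply: open_comp (cimg_open a) => z _; exact: lsc.
have ro : open [set z : 'rV[R]_(d + d) | cimg b (rsubmx z)].
  by apply: open_comp (cimg_open b) => z _; exact: rsc.
have := @open_preimage_on _ G _ (fun z => (cinv a (lsubmx z) * cinv b (rsubmx z))%g) _
  (openI lo ro) _ (chart_open c).
set A := (X in open X); set B := (X in _ -> open X).
have -> : B = A by apply/seteqP; split=> z /=; [by move=> [? ? ?]; split|by move=> [[? ?] ?]; split].
apply => z [la' rb']; apply: mul_continuous_at.
  by apply: (@continuous_comp _ _ _ (fun z : 'rV_(d + d) => lsubmx z) (cinv a)); [exact: lsc|exact: chart_inv_cont].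
by apply: (@continuous_comp _ _ _ (fun z : 'rV_(d + d) => rsubmx z) (cinv b)); [exact: rsc|exact: chart_inv_cont].
Qed.

(** Locally the two factors and their product stay in three fixed charts, where the product is the
    chart expression of the multiplication composed with a pair of smooth coordinate maps. *)
Lemma gsm_mul m (U : set 'rV[R]_m) phi psi : open U -> gsm U phi -> gsm U psi ->
  gsm U (fun v => (phi v * psi v)%g).
Proof.
move=> Uo pU sU; have mc x : U x -> {for x, continuous (fun v => (phi v * psi v)%g)}.
  by move=> Ux; apply: mul_continuous_at; [exact: pU.1|exact: sU.1].
split => // c lc i; apply: sm_local => x [Ux cx].
have [a la ax] := lcover (phi x); have [b lb bx] := lcover (psi x).
pose Va := U `&` phi @^-1` cdom a; pose Vb := U `&` psi @^-1` cdom b.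
pose Vc := U `&` (fun v => (phi v * psi v)%g) @^-1` cdom c.
have Vao : open Va by exact: gsm_open (chart_open a).
have Vbo : open Vb by exact: gsm_open (chart_open b).
have Vco : open Vc by exact: open_preimage_on (chart_open c).
have Vo : open (Va `&` Vb `&` Vc) by do 2 apply: openI => //.
exists (Va `&` Vb `&` Vc); split => //.
have := @sm_comp R m (d + d) _ _ (fun v => row_mx (cmap a (phi v)) (cmap b (psi v))) _ Vo
  (mul_chart_open la lb lc).
move=> /(_ _ _ _ (lmul_smooth la lb lc 0 i)) H.
apply: sm_eq (H _ _) => //.
- by move=> y [[[_ ya] [_ yb]] _]; rewrite row_mxKl row_mxKr !chartK.
- apply: sm_row_mx => k.
    by apply: sm_sub (pU.2 a la k) => y [[]].
  by apply: sm_sub (sU.2 b lb k) => y [[]].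
- move=> y [[[_ ya] [_ yb]] [_ yc]]; rewrite /= row_mxKl row_mxKr !chartK //.
  by split => //; apply: cimg_cmap.
Qed.

Lemma gsm_inv m (U : set 'rV[R]_m) phi : open U -> gsm U phi ->
  gsm U (fun v => (phi v)^-1%g).
Proof.
move=> Uo pU; have mc x : U x -> {for x, continuous (fun v => (phi v)^-1%g)}.
  move=> Ux; apply: (@continuous_comp _ _ _ phi (fun z : G => z^-1%g)); first exact: pU.1.
  exact: linv_cont.
split => // c lc i; apply: sm_local => x [Ux cx].
have [a la ax] := lcover (phi x).
pose Va := U `&` phi @^-1` cdom a; pose Vc := U `&` (fun v => (phi v)^-1%g) @^-1` cdom c.
have Vao : open Va by exact: gsm_open (chart_open a).
have Vco : open Vc by exact: open_preimage_on (chart_open c).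
have Vo : open (Va `&` Vc) by apply: openI.
exists (Va `&` Vc); split => //.
have Wo : open [set v : 'rV[R]_d | cimg a v /\ cdom c (cinv a v)^-1%g].
  apply: (@open_preimage_on _ G (cimg a) (fun v => (cinv a v)^-1%g)) (chart_open c).
    exact: cimg_open.
  move=> v va; apply: (@continuous_comp _ _ _ (cinv a) (fun z : G => z^-1%g)); first exact: chart_inv_cont.
  exact: linv_cont.
have := @sm_comp R m d _ _ (fun v => cmap a (phi v)) _ Vo Wo.
move=> /(_ _ _ _ (linv_smooth la lc 0 i)) H.
apply: sm_eq (H _ _) => //.
- by move=> y [[_ ya] _]; rewrite chartK.
- by move=> k; apply: sm_sub (pU.2 a la k) => y [].
- move=> y [[_ ya] [_ yc]]; rewrite /= chartK //.
  by split => //; apply: cimg_cmap.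
Qed.

Lemma gsm_comp m n (U : set 'rV[R]_m) (V : set 'rV[R]_n) phi (z : 'rV[R]_m -> 'rV[R]_n) :
  open U -> open V -> gsm V phi -> (forall i, sm U (fun v => z v 0 i)) ->
  (forall x, U x -> V (z x)) -> gsm U (fun v => phi (z v)).
Proof.
move=> Uo Vo pV zU UV.
have zc x : U x -> {for x, continuous z}.
  by move=> Ux; apply: continuous_rV => i; exact: sm_cont (zU i) Ux.
split=> [x Ux|c lc i].
  apply: (@continuous_comp _ _ _ z phi); first exact: zc.
  by apply: pV.1; exact: UV.
have Wo := gsm_open Vo pV (chart_open c).
have U'o : open (U `&` z @^-1` (V `&` phi @^-1` cdom c)) by exact: open_preimage_on.
apply: (@sm_sub _ _ _ (U `&` z @^-1` (V `&` phi @^-1` cdom c))).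
  by move=> x [Ux cx]; split => //; split => //; exact: UV.
apply: (sm_comp U'o Wo _ _ (pV.2 c lc i)) => [k|x []] //.
by apply: sm_sub (zU k) => x [].
Qed.

End SmoothMaps.
Arguments cimg_open {R G} c.

(** * Smooth matrix-valued functions on G *)

Section SmoothFunctions.
Variables (R : realType) (G : lieGroup R).
Implicit Types X Y : lieAlg G.

Lemma smooth_ext a b (f g : G -> 'M[R]_(a, b)) : (forall x, f x = g x) -> smooth f -> smooth g.
Proof. by move=> /funext->. Qed.

Lemma smooth_mulL a b (f : G -> 'M[R]_(a, b)) x : smooth f -> smooth (fun y => f (x * y)%g).
Proof.
move=> fs c lc i j.
apply: (@smooth_gsm R G _ (cimg c) (fun v => x * cinv c v)%g a b f i j (cimg_open c) _ fs).
by apply: gsm_mul; [exact: cimg_open|apply: gsm_cst; exact: cimg_open|exact: gsm_cinv].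
Qed.

Lemma smooth_mulR a b (f : G -> 'M[R]_(a, b)) x : smooth f -> smooth (fun y => f (y * x)%g).
Proof.
move=> fs c lc i j.
apply: (@smooth_gsm R G _ (cimg c) (fun v => cinv c v * x)%g a b f i j (cimg_open c) _ fs).
by apply: gsm_mul; [exact: cimg_open|exact: gsm_cinv|apply: gsm_cst; exact: cimg_open].
Qed.

Lemma smooth_inv a b (f : G -> 'M[R]_(a, b)) : smooth f -> smooth (fun y => f y^-1%g).
Proof.
move=> fs c lc i j.
apply: (@smooth_gsm R G _ (cimg c) (fun v => (cinv c v)^-1)%g a b f i j (cimg_open c) _ fs).
by apply: gsm_inv; [exact: cimg_open|exact: gsm_cinv].
Qed.

Lemma smooth_cst a b (A : 'M[R]_(a, b)) : smooth (fun _ : G => A).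
Proof. by move=> c lc i j; apply: sm_cst; exact: cimg_open. Qed.

Lemma smoothD a b (f g : G -> 'M[R]_(a, b)) : smooth f -> smooth g -> smooth (fun x => f x + g x).
Proof.
move=> fs gs c lc i j.
apply: (@sm_eq _ _ _ (cimg_open c) _ _ _ (smD (cimg_open c) (fs c lc i j) (gs c lc i j))) => x _.
by rewrite mxE.
Qed.

Lemma smooth_sum I (r : seq I) (P : pred I) a b (F : I -> G -> 'M[R]_(a, b)) :
  (forall i, smooth (F i)) -> smooth (fun x => \sum_(i <- r | P i) F i x).
Proof.
move=> Fs; elim: r => [|i r IH].
  by apply: (smooth_ext _ (smooth_cst 0)) => x; rewrite big_nil.
case Pi: (P i).
  by apply: (smooth_ext _ (smoothD (Fs i) IH)) => x; rewrite big_cons Pi.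
by apply: (smooth_ext _ IH) => x; rewrite big_cons Pi.
Qed.

Lemma smoothM a b c (f : G -> 'M[R]_(a, b)) (g : G -> 'M[R]_(b, c)) :
  smooth f -> smooth g -> smooth (fun x => f x *m g x).
Proof.
move=> fs gs e le i j.
apply: (@sm_eq _ _ _ (cimg_open e) _ _ _ (sm_sum (cimg_open e) (index_enum _)
  (fun k => smM (cimg_open e) (fs e le i k) (gs e le k j)))) => x _.
by rewrite mxE.
Qed.

Lemma smoothZl a b (k : R) (f : G -> 'M[R]_(a, b)) : smooth f -> smooth (fun x => k *: f x).
Proof.
move=> fs; apply: (smooth_ext _ (smoothM (smooth_cst k%:M) fs)) => x.
by rewrite mul_scalar_mx.
Qed.

Lemma smooth_entry a b (f : G -> 'M[R]_(a, b)) i j : smooth f -> smooth (fun x => (f x i j)%:M : 'M[R]_1).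
Proof.
move=> fs c lc k l n.
rewrite (_ : (fun x => _) = fun v => f (cinv c v) i j); first exact: fs.
by apply/funext => v; rewrite !ord1 mxE eqxx mulr1n.
Qed.

Lemma smooth_mx a b (f : G -> 'M[R]_(a, b)) :
  (forall i j, smooth (fun x => (f x i j)%:M : 'M[R]_1)) -> smooth f.
Proof.
move=> fs c lc i j n; have := fs i j c lc 0 0 n.
rewrite (_ : (fun x => _) = fun v => f (cinv c v) i j) //.
by apply/funext => v; rewrite mxE eqxx mulr1n.
Qed.

End SmoothFunctions.
Arguments smooth_cst {R G a b} A.

(** [LD], [AD], [LB] and later [KF] are sealed copies of [Lder], [Ad], [lie] and [killing], so that
    conversion never reaches the limits and choices behind them. *)
HB.lock Definition LD (R : realType) (G : lieGroup R) (X : lieAlg G) a b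
  (f : G -> 'M[R]_(a, b)) (g : G) : 'M[R]_(a, b) := Lder X f g.

HB.lock Definition AD (R : realType) (G : lieGroup R) (x : G) (X : lieAlg G) : lieAlg G := Ad x X.

HB.lock Definition LB (R : realType) (G : lieGroup R) (X Y : lieAlg G) : lieAlg G := lie X Y.

(** * Left-invariant differentiation *)

Section Lder.
Variables (R : realType) (G : lieGroup R).
Local Notation d := (ldim G).
Local Notation e1 := (lchart1 G).
Local Notation o1 := (cmap (lchart1 G) 1%g).
Implicit Types X Y Z : lieAlg G.

Lemma o1_img : cimg e1 o1. Proof. by apply: cimg_cmap; exact: lchart1_dom. Qed.

Lemma cinv_o1 : cinv e1 o1 = 1%g.
Proof. by rewrite chartK //; exact: lchart1_dom. Qed.

Lemma cmapK_near : \forall v \near o1, cmap e1 (cinv e1 v) = v.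
Proof.
by apply: filterS (open_nbhs_nbhs (conj (cimg_open e1) o1_img)) => v /cinvK[].
Qed.

Lemma gsm_mul_cinv (x : G) : gsm (cimg e1) (fun v => x * cinv e1 v)%g.
Proof.
apply: gsm_mul; first exact: cimg_open; first by apply: gsm_cst; exact: cimg_open.
exact/gsm_cinv/lchart1_atlas.
Qed.

Lemma sm_mul_cinv a b (f : G -> 'M[R]_(a, b)) x i j :
  smooth f -> sm (cimg e1) (fun v => f (x * cinv e1 v)%g i j : R^o).
Proof. by move=> fs; exact: (smooth_gsm i j (cimg_open e1) (gsm_mul_cinv x) fs). Qed.

Lemma Lder_is_mx a b (f : G -> 'M[R]_(a, b)) x X :
  smooth f -> is_derive o1 X (fun v => f (x * cinv e1 v)%g) (LD X f x).
Proof.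
move=> fs; rewrite LD.unlock; apply: derivableP; apply/derivable_mxP => i j.
exact: (sm_derivable _ (sm_mul_cinv x i j fs) o1_img).
Qed.

Lemma LderE a b (f : G -> 'M[R]_(a, b)) x X i j : smooth f ->
  LD X f x i j = 'D_X (fun v => f (x * cinv e1 v)%g i j : R^o) o1.
Proof. by move=> fs; have [? _] := Lder_is_mx x X fs; rewrite LD.unlock /Lder derive_mx ?mxE. Qed.

Lemma Lder_is a b (f : G -> 'M[R]_(a, b)) x X i j : smooth f ->
  is_derive o1 X (fun v => f (x * cinv e1 v)%g i j : R^o) (LD X f x i j).
Proof.
move=> fs; rewrite LderE //; apply: derivableP.
exact: (sm_derivable _ (sm_mul_cinv x i j fs) o1_img).
Qed.

Lemma Lder_entry a b (f : G -> 'M[R]_(a, b)) x X i j : smooth f ->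
  LD X (fun y => (f y i j)%:M : 'M[R]_1) x 0 0 = LD X f x i j.
Proof.
move=> fs; rewrite (LderE _ _ _ _ (smooth_entry i j fs)) (LderE _ _ _ _ fs).
rewrite (_ : (fun v => _) = fun v => f (x * cinv e1 v)%g i j) //.
by apply/funext => v; rewrite mxE eqxx mulr1n.
Qed.

Lemma Lder_ext a b (f g : G -> 'M[R]_(a, b)) x X : (forall y, f y = g y) -> LD X f x = LD X g x.
Proof. by move=> /funext->. Qed.

Lemma Lder_cst a b (A : 'M[R]_(a, b)) x X : LD X (fun=> A) x = 0.
Proof. by rewrite LD.unlock; exact: derive_cst. Qed.

Lemma LderD a b (f g : G -> 'M[R]_(a, b)) x X : smooth f -> smooth g ->
  LD X (fun y => f y + g y) x = LD X f x + LD X g x.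
Proof.
by move=> fs gs; have [_ <-] := is_deriveD (Lder_is_mx x X fs) (Lder_is_mx x X gs); rewrite LD.unlock.
Qed.

Lemma LderZ a b (f : G -> 'M[R]_(a, b)) k x X : smooth f ->
  LD X (fun y => k *: f y) x = k *: LD X f x.
Proof. by move=> fs; have [_ <-] := is_deriveZ k (Lder_is_mx x X fs); rewrite LD.unlock. Qed.

Lemma LderN a b (f : G -> 'M[R]_(a, b)) x X : smooth f ->
  LD X (fun y => - f y) x = - LD X f x.
Proof.
by move=> fs; have [_ <-] := is_deriveN (Lder_is_mx x X fs); rewrite LD.unlock.
Qed.

Lemma Lder_sum I (r : seq I) (P : pred I) a b (F : I -> G -> 'M[R]_(a, b)) x X :
  (forall i, smooth (F i)) ->
  LD X (fun y => \sum_(i <- r | P i) F i y) x = \sum_(i <- r | P i) LD X (F i) x.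
Proof.
move=> Fs; elim: r => [|i r IH].
  rewrite big_nil -[RHS](Lder_cst (0 : 'M[R]_(a, b)) x X).
  by apply: Lder_ext => y; rewrite big_nil.
rewrite big_cons; case Pi: (P i).
  rewrite -IH -LderD //; last exact: smooth_sum.
  by apply: Lder_ext => y; rewrite big_cons Pi.
by rewrite -IH; apply: Lder_ext => y; rewrite big_cons Pi.
Qed.

Lemma LderM a b c (f : G -> 'M[R]_(a, b)) (g : G -> 'M[R]_(b, c)) x X :
  smooth f -> smooth g ->
  LD X (fun y => f y *m g y) x = LD X f x *m g x + f x *m LD X g x.
Proof.
move=> fs gs; apply/matrixP => i j; rewrite (LderE _ _ _ _ (smoothM fs gs)) !mxE.
rewrite (_ : (fun v => _) = fun v => \sum_k f (x * cinv e1 v)%g i k * g (x * cinv e1 v)%g k j);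
  last by apply/funext => v; rewrite mxE.
rewrite -big_split /=.
elim: (index_enum _) => [|k r IH].
  rewrite big_nil (_ : (fun v => _) = cst 0) ?derive_cst //.
  by apply/funext => v; rewrite big_nil.
have [d1 D1] := is_derive_mul (@ex_derive _ _ _ _ _ _ _ (Lder_is x X i k fs)) (@ex_derive _ _ _ _ _ _ _ (Lder_is x X k j gs)).
have d2 : derivable (fun v => \sum_(k <- r) f (x * cinv e1 v)%g i k * g (x * cinv e1 v)%g k j : R^o) o1 X.
  apply: (@sm_derivable _ _ (cimg e1)); last exact: o1_img.
  by apply: sm_sum => [|k0]; [exact: cimg_open|apply: smM; [exact: cimg_open|exact: sm_mul_cinv|exact: sm_mul_cinv]].
rewrite big_cons -IH.
rewrite (_ : (fun v => _) = (fun v => f (x * cinv e1 v)%g i k * g (x * cinv e1 v)%g k j) +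
   (fun v => \sum_(k <- r) f (x * cinv e1 v)%g i k * g (x * cinv e1 v)%g k j)); last first.
  by apply/funext => v; rewrite big_cons.
rewrite (deriveD d1 d2) D1 -!LderE //; congr (_ + _).
by rewrite cinv_o1 mulg1 addrC (mulrC (g _ _ _)).
Qed.

(** Unlike linearity in [f], this uses differentiability: a directional derivative is the
    combination of the partial derivatives. *)
Lemma Lder_linear a b (f : G -> 'M[R]_(a, b)) x k X Y : smooth f ->
  LD (k *: X + Y) f x = k *: LD X f x + LD Y f x.
Proof.
move=> fs; apply/matrixP => i j; rewrite mxE [X in _ = X + _]mxE.
have [_ E] := sm_diffE (cimg_open e1) (sm_mul_cinv x i j fs) o1_img.
pose F v : R^o := f (x * cinv e1 v)%g i j.
transitivity ('D_(k *: X + Y) F o1); first exact: LderE.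
transitivity (k * 'D_X F o1 + 'D_Y F o1); last by congr (k * _ + _); exact/esym/LderE.
rewrite !E mulr_sumr -big_split /=; apply: eq_bigr => l _.
by rewrite !mxE mulrDl mulrA.
Qed.

Lemma Lder_mulL a b (f : G -> 'M[R]_(a, b)) x y X :
  LD X (fun z => f (y * z)%g) x = LD X f (y * x)%g.
Proof. by rewrite LD.unlock; apply: derive_ext => v; rewrite mulgA. Qed.

(** [LD X f] is a partial derivative, at the unit in the second variable, of the function [f (x y)]
    of two variables, which is smooth because the multiplication is. *)
Lemma Lder_smooth a b (f : G -> 'M[R]_(a, b)) X : smooth f -> smooth (LD X f).
Proof.
move=> fs c lc i j; have lo := cimg_open c; have eo := cimg_open e1.
pose W := [set z : 'rV[R]_(d + d) | cimg c (lsubmx z) /\ cimg e1 (rsubmx z)].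
have Wo : open W.
  apply: openI; [apply: open_comp lo => z _|apply: open_comp eo => z _].
    exact/differentiable_continuous/differentiable_lsubmx.
  exact/differentiable_continuous/differentiable_rsubmx.
have pW : gsm W (fun z => cinv c (lsubmx z) * cinv e1 (rsubmx z))%g.
  apply: gsm_mul => //.
    by apply: (gsm_comp Wo lo (gsm_cinv lc)) => [k|z []] //; exact: sm_lsubmx.
  by apply: (gsm_comp Wo eo (gsm_cinv (lchart1_atlas G))) => [k|z []] //; exact: sm_rsubmx.
have HW := smooth_gsm i j Wo pW fs.
have HD : sm W (fun z => 'D_(row_mx 0 X) (fun z => f (cinv c (lsubmx z) * cinv e1 (rsubmx z))%g i j : R^o) z).
  exact: sm_derive.
apply: (@sm_eq _ _ _ lo _ _ _ (@sm_comp _ _ _ _ W (fun u => row_mx u o1) _ lo Wo _ _ HD)) => [u cu|k|u cu].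
- rewrite LderE // derive_sliceR; apply: derive_ext => v.
  by rewrite row_mxKl row_mxKr.
- by apply: sm_row_mx => l; [exact: sm_coord|exact: sm_cst].
- by rewrite /W /= row_mxKl row_mxKr; split => //; exact: o1_img.
Qed.

(** The logarithmic derivative of [phi]: its differential at [x], brought back to the unit by left
    translation. *)
Definition velocity m (phi : 'rV[R]_m -> G) x w : lieAlg G :=
  'D_w (fun v => cmap e1 ((phi x)^-1 * phi v)%g) x.

Lemma velocity_is m (U : set 'rV[R]_m) phi x w : open U -> gsm U phi -> U x ->
  is_derive x w (fun v => cmap e1 ((phi x)^-1 * phi v)%g) (velocity phi x w).
Proof.
move=> Uo pU Ux; have qU : gsm U (fun v => (phi x)^-1 * phi v)%g.
  by apply: gsm_mul => //; exact: gsm_cst.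
apply: derivableP; apply: derivable_coord => i.
apply: (sm_derivable _ (qU.2 e1 (lchart1_atlas G) i)); split => //.
by rewrite /= mulVg; exact: lchart1_dom.
Qed.

Lemma derive_velocity m (U : set 'rV[R]_m) phi a b (f : G -> 'M[R]_(a, b)) i j x w :
  open U -> gsm U phi -> U x -> smooth f ->
  is_derive x w (fun v => f (phi v) i j : R^o) (LD (velocity phi x w) f (phi x) i j).
Proof.
move=> Uo pU Ux fs; have qU : gsm U (fun v => (phi x)^-1 * phi v)%g.
  by apply: gsm_mul => //; exact: gsm_cst.
have Vo := gsm_open Uo qU (chart_open e1).
set V := _ `&` _ in Vo.
have Vx : V x by split => //; rewrite /= mulVg; exact: lchart1_dom.
pose F v : R^o := f (phi x * cinv e1 v)%g i j.
have z0 : cmap e1 ((phi x)^-1 * phi x)%g = o1 by rewrite mulVg.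
have dF : differentiable F (cmap e1 ((phi x)^-1 * phi x)%g).
  rewrite z0; apply: (sm_differentiable (cimg_open e1)); last exact: o1_img.
  exact: sm_mul_cinv.
have [d1 e1'] := velocity_is w Uo pU Ux.
have := is_derive_chain d1 dF; rewrite e1' z0 => D; rewrite LderE //.
apply: near_eq_is_derive D.
apply: filterS (open_nbhs_nbhs (conj Vo Vx)) => v [_ cv].
by rewrite /= /F chartK // mulgA mulgV mul1g.
Qed.

End Lder.

(** * The adjoint action *)

Section Adjoint.
Variables (R : realType) (G : lieGroup R).
Local Notation d := (ldim G).
Local Notation e1 := (lchart1 G).
Local Notation o1 := (cmap (lchart1 G) 1%g).
Implicit Types X Y Z : lieAlg G.

Lemma gsm_conj (x : G) : gsm (cimg e1) (fun v => x * cinv e1 v * x^-1)%g.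
Proof.
have o := cimg_open e1.
by apply: gsm_mul => //; [exact: gsm_mul_cinv|exact: gsm_cst].
Qed.

Lemma conj_dom (x : G) : open (cimg e1 `&` (fun v => x * cinv e1 v * x^-1)%g @^-1` cdom e1) /\
  (cimg e1 `&` (fun v => x * cinv e1 v * x^-1)%g @^-1` cdom e1) o1.
Proof.
split; first exact: gsm_open (cimg_open e1) (gsm_conj x) (chart_open e1).
split; first exact: o1_img.
by rewrite /= cinv_o1 mulg1 mulgV; exact: lchart1_dom.
Qed.

Lemma sm_conj (x : G) i : sm (cimg e1 `&` (fun v => x * cinv e1 v * x^-1)%g @^-1` cdom e1)
  (fun v => cmap e1 (x * cinv e1 v * x^-1)%g 0 i).
Proof. exact: (gsm_conj x).2 (lchart1_atlas G) i. Qed.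

Lemma Ad_is x X : is_derive o1 X (fun v => cmap e1 (x * cinv e1 v * x^-1)%g) (AD x X).
Proof.
rewrite AD.unlock; apply: derivableP; apply: derivable_coord => i.
exact: (sm_derivable _ (sm_conj x i) (conj_dom x).2).
Qed.

Lemma Ad_coord x X i : AD x X 0 i = 'D_X (fun v => cmap e1 (x * cinv e1 v * x^-1)%g 0 i : R^o) o1.
Proof. by have [? _] := Ad_is x X; rewrite AD.unlock /Ad derive_mx ?mxE. Qed.

Lemma Ad_linear (x : G) : linear (AD x : lieAlg G -> lieAlg G).
Proof.
move=> k X Y; apply/rowP => i; rewrite mxE [X in _ = X + _]mxE.
have [_ E] := sm_diffE (conj_dom x).1 (sm_conj x i) (conj_dom x).2.
pose F v : R^o := cmap e1 (x * cinv e1 v * x^-1)%g 0 i.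
transitivity ('D_(k *: X + Y) F o1); first exact: Ad_coord.
transitivity (k * 'D_X F o1 + 'D_Y F o1); last by congr (k * _ + _); exact/esym/Ad_coord.
rewrite !E mulr_sumr -big_split /=; apply: eq_bigr => l _.
by rewrite !mxE mulrDl mulrA.
Qed.

Lemma AdZ x k X : AD x (k *: X) = k *: AD x X.
Proof.
have := Ad_linear x k X 0; rewrite addr0 => ->.
suff -> : AD x 0 = 0 :> lieAlg G by rewrite addr0.
by have := Ad_linear x (-1) 0 0; rewrite scaler0 addr0 scaleN1r addNr.
Qed.

Lemma AdD x X Y : AD x (X + Y) = AD x X + AD x Y.
Proof. by have := Ad_linear x 1 X Y; rewrite !scale1r. Qed.

Lemma Ad1 X : AD 1%g X = X.
Proof.
apply/rowP => i; rewrite Ad_coord.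
have [_ <-] := is_derive_coord i o1 X.
apply: near_eq_derive; apply: filterS (@cmapK_near R G) => v E.
by rewrite mul1g invg1 mulg1 E.
Qed.

Lemma AdM x y X : AD (x * y)%g X = AD x (AD y X).
Proof.
apply/rowP => i; rewrite !Ad_coord.
have [d1 E1] := Ad_is y X.
have z0 : cmap e1 (y * cinv e1 o1 * y^-1)%g = o1 by rewrite cinv_o1 mulg1 mulgV.
pose F v : R^o := cmap e1 (x * cinv e1 v * x^-1)%g 0 i.
have dF : differentiable F (cmap e1 (y * cinv e1 o1 * y^-1)%g).
  by rewrite z0; exact: (sm_differentiable (conj_dom x).1 (sm_conj x i) (conj_dom x).2).
have [_ D] := is_derive_chain d1 dF.
rewrite E1 z0 in D; rewrite -D; apply: near_eq_derive.
apply: filterS (open_nbhs_nbhs (conj_dom y)) => v [_ cv].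
by rewrite /F /= chartK // invgM !mulgA.
Qed.

Lemma AdK (x : G) : cancel (AD x) (AD x^-1%g).
Proof. by move=> X; rewrite -AdM mulVg Ad1. Qed.

Lemma AdVK (x : G) : cancel (AD x^-1%g) (AD x).
Proof. by move=> X; rewrite -AdM mulgV Ad1. Qed.

(** Seen from the point [x y], the map [v] to [x v y] is conjugation by [y^-1], so its velocity at
    the unit is [AD y^-1 X]. *)
Lemma Lder_mulR a b (f : G -> 'M[R]_(a, b)) x y X : smooth f ->
  LD X (fun z => f (z * y)%g) x = LD (AD y^-1%g X) f (x * y)%g.
Proof.
move=> fs; apply/matrixP => i j; have o := cimg_open e1.
rewrite (LderE _ _ _ _ (smooth_mulR y fs)).
have pU : gsm (cimg e1) (fun v => x * cinv e1 v * y)%g.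
  by apply: gsm_mul => //; [exact: gsm_mul_cinv|exact: gsm_cst].
have [_ ->] := derive_velocity i j X o pU (@o1_img R G) fs.
have -> : velocity (fun v => x * cinv e1 v * y)%g o1 X = AD y^-1%g X.
  rewrite AD.unlock; apply: derive_ext => v; congr (cmap _ _).
  by rewrite cinv_o1 mulg1 invgK invgM !mulgA -(mulgA y^-1%g) mulVg mulg1.
by rewrite cinv_o1 mulg1.
Qed.

Lemma Lder_conj (f : G -> 'M[R]_(1, 1)) x y X : smooth f ->
  LD X (fun z => f (y * z * y^-1)%g) x = LD (AD y X) f (y * x * y^-1)%g.
Proof.
move=> fs; transitivity (LD X (fun z => f (z * y^-1)%g) (y * x)%g).
  by rewrite -(Lder_mulL _ x y X).
by have := Lder_mulR (y * x)%g y^-1%g X fs; rewrite invgK.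
Qed.

Lemma smooth_AdV X : smooth (fun y : G => AD y^-1%g X).
Proof.
move=> c lc i0 i n; rewrite {i0}ord1; move: n; have lo := cimg_open c; have eo := cimg_open e1.
pose W := [set z : 'rV[R]_(d + d) | cimg c (lsubmx z) /\ cimg e1 (rsubmx z)].
have Wo : open W.
  apply: openI; [apply: open_comp lo => z _|apply: open_comp eo => z _].
    exact/differentiable_continuous/differentiable_lsubmx.
  exact/differentiable_continuous/differentiable_rsubmx.
have pc : gsm W (fun z => cinv c (lsubmx z)).
  by apply: (gsm_comp Wo lo (gsm_cinv lc)) => [k|z []] //; exact: sm_lsubmx.
have pW : gsm W (fun z => (cinv c (lsubmx z))^-1 * cinv e1 (rsubmx z) * ((cinv c (lsubmx z))^-1)^-1)%g.
  apply: gsm_mul => //; last by do 2 apply: gsm_inv => //.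
  apply: gsm_mul => //; first exact: gsm_inv.
  by apply: (gsm_comp Wo eo (gsm_cinv (lchart1_atlas G))) => [k|z []] //; exact: sm_rsubmx.
have Vo := gsm_open Wo pW (chart_open e1).
have HD := sm_derive (row_mx 0 X) (pW.2 e1 (lchart1_atlas G) i).
apply: (@sm_eq _ _ _ lo _ _ _ (@sm_comp _ _ _ _ _ (fun u => row_mx u o1) _ lo Vo _ _ HD)) => [u cu|k|u cu].
- rewrite Ad_coord derive_sliceR; apply: derive_ext => v.
  by rewrite row_mxKl row_mxKr.
- by apply: sm_row_mx => l; [exact: sm_coord|exact: sm_cst].
- split; first by rewrite /W /= row_mxKl row_mxKr; split => //; exact: o1_img.
  by rewrite /= row_mxKl row_mxKr cinv_o1 mulg1 mulgV; exact: lchart1_dom.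
Qed.

End Adjoint.
Arguments smooth_AdV {R G} X.

(** * The bracket as a second derivative of the multiplication *)

Section Bracket.
Variables (R : realType) (G : lieGroup R).
Local Notation d := (ldim G).
Local Notation e1 := (lchart1 G).
Local Notation o1 := (cmap (lchart1 G) 1%g).
Implicit Types X Y Z : lieAlg G.

Definition mulc (z : 'rV[R]_(d + d)) : 'rV[R]_d := cmap e1 (cinv e1 (lsubmx z) * cinv e1 (rsubmx z))%g.
Definition mulc_dom := [set z : 'rV[R]_(d + d) |
        [/\ cimg e1 (lsubmx z), cimg e1 (rsubmx z) &
            cdom e1 (cinv e1 (lsubmx z) * cinv e1 (rsubmx z))%g]].
Local Notation oo := (row_mx o1 o1).

(** The antisymmetric part of the second-order term of the multiplication in the chart at the unit.
    Being a formula, it supplies the existence of a bracket independently of the choice in [lie]. *)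
Definition br (X Y : lieAlg G) : lieAlg G :=
  \row_k ('D_(row_mx X 0) (fun z => 'D_(row_mx 0 Y) (fun z => mulc z 0 k : R^o) z) oo
         - 'D_(row_mx Y 0) (fun z => 'D_(row_mx 0 X) (fun z => mulc z 0 k : R^o) z) oo).

Lemma mulc_open : open mulc_dom.
Proof. exact: mul_chart_open (lchart1_atlas G) (lchart1_atlas G) (lchart1_atlas G). Qed.

Lemma mulc_oo : mulc_dom oo.
Proof.
rewrite /mulc_dom /= row_mxKl row_mxKr cinv_o1 mulg1.
by split; [exact: o1_img|exact: o1_img|exact: lchart1_dom].
Qed.

Lemma mulc_sm k : sm mulc_dom (fun z => mulc z 0 k).
Proof. exact: lmul_smooth (lchart1_atlas G) (lchart1_atlas G) (lchart1_atlas G) 0 k. Qed.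

Lemma mulc_img z : mulc_dom z -> cimg e1 (mulc z).
Proof. by move=> [_ _ h]; exact: cimg_cmap. Qed.

Lemma mulc_l v : cimg e1 v -> mulc (row_mx v o1) = v.
Proof. by move=> vi; rewrite /mulc row_mxKl row_mxKr cinv_o1 mulg1; case: (cinvK vi). Qed.

Lemma mulc_r v : cimg e1 v -> mulc (row_mx o1 v) = v.
Proof. by move=> vi; rewrite /mulc row_mxKl row_mxKr cinv_o1 mul1g; case: (cinvK vi). Qed.

Lemma near_o1 (P : 'rV[R]_d -> Prop) : (forall v, cimg e1 v -> P v) -> \forall v \near o1, P v.
Proof. by move=> h; apply: filterS (open_nbhs_nbhs (conj (cimg_open e1) (@o1_img R G))). Qed.

Lemma near_oo (P : 'rV[R]_(d + d) -> Prop) :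
  (forall v, mulc_dom v -> P v) -> \forall v \near oo, P v.
Proof. by move=> h; apply: filterS (open_nbhs_nbhs (conj mulc_open mulc_oo)). Qed.

(** Writing [f (g u v)] as [f1] of the product in the chart, the chain rule leaves the second
    derivative of [f1] and its first derivatives times the mixed derivatives of [mulc]. *)
Lemma Lder2E (f : G -> 'M[R]_(1, 1)) g X Y : smooth f ->
  let f1 v : R^o := f (g * cinv e1 v)%g 0 0 in
  LD X (LD Y f) g 0 0 = 'D_X (fun v => 'D_Y f1 v) o1 +
   \sum_k 'D_(delta_mx 0 k) f1 o1 *
    'D_(row_mx X 0) (fun z => 'D_(row_mx 0 Y) (fun z => mulc z 0 k : R^o) z) oo.
Proof.
move=> fs f1; have f1s : sm (cimg e1) f1 by exact: sm_mul_cinv.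
have eo := cimg_open e1; have mo := mulc_open.
pose H z : R^o := f (g * cinv e1 (lsubmx z) * cinv e1 (rsubmx z))%g 0 0.
have LH v : LD Y f (g * cinv e1 v)%g 0 0 = 'D_(row_mx 0 Y) H (row_mx v o1).
  rewrite (LderE _ _ _ _ fs) derive_sliceR; apply: derive_ext => u.
  by rewrite /H row_mxKl row_mxKr.
rewrite (LderE _ _ _ _ (Lder_smooth Y fs)).
under derive_ext do rewrite LH.
rewrite -(derive_sliceL (fun z => 'D_(row_mx 0 Y) H z)).
have Hf z : mulc_dom z -> H z = f1 (mulc z).
  by move=> [_ _ mz]; rewrite /H /f1 /mulc chartK // mulgA.
have fm k : sm mulc_dom (fun z => 'D_(delta_mx 0 k) f1 (mulc z) : R^o).
  exact: (@sm_comp _ _ _ _ (cimg e1) mulc _ mo eo mulc_sm mulc_img (sm_derive _ f1s)).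
have HD z : mulc_dom z -> 'D_(row_mx 0 Y) H z =
   \sum_k 'D_(row_mx 0 Y) (fun z => mulc z 0 k : R^o) z * 'D_(delta_mx 0 k) f1 (mulc z).
  move=> mz; have md : derivable mulc z (row_mx 0 Y).
    by apply: derivable_coord => k; exact: (sm_derivable _ (mulc_sm k) mz).
  have -> : 'D_(row_mx 0 Y) H z = 'D_(row_mx 0 Y) (f1 \o mulc) z.
    apply: near_eq_derive; apply: filterS (open_nbhs_nbhs (conj mo mz)) => z'.
    exact: Hf.
  have [_ ->] := is_derive_chain md (sm_differentiable eo f1s (mulc_img mz)).
  have [_ ->] := sm_diffE eo f1s (mulc_img mz).
  by apply: eq_bigr => k _; rewrite derive_mx // mxE.
have -> : 'D_(row_mx X 0) (fun z => 'D_(row_mx 0 Y) H z) oo = 'D_(row_mx X 0)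
   (fun z => \sum_k 'D_(row_mx 0 Y) (fun z => mulc z 0 k : R^o) z * 'D_(delta_mx 0 k) f1 (mulc z)) oo.
  by apply: near_eq_derive; exact: near_oo.
have dprod k : is_derive oo (row_mx X 0)
    (fun z => 'D_(row_mx 0 Y) (fun z => mulc z 0 k : R^o) z * 'D_(delta_mx 0 k) f1 (mulc z) : R^o)
    (Y 0 k * 'D_X (fun v => 'D_(delta_mx 0 k) f1 v) o1 + 'D_(delta_mx 0 k) f1 o1 *
      'D_(row_mx X 0) (fun z => 'D_(row_mx 0 Y) (fun z => mulc z 0 k : R^o) z) oo).
  have := is_derive_mul (sm_derivable (row_mx X 0) (sm_derive (row_mx 0 Y) (mulc_sm k)) mulc_oo)
    (sm_derivable (row_mx X 0) (fm k) mulc_oo).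
  have V1 : mulc oo = o1 by rewrite mulc_l //; exact: o1_img.
  have V2 : 'D_(row_mx 0 Y) (fun z => mulc z 0 k : R^o) oo = Y 0 k.
    rewrite derive_sliceR; have [_ <-] := is_derive_coord k o1 Y.
    by apply: near_eq_derive; apply: near_o1 => v vi; rewrite mulc_r.
  have V3 : 'D_(row_mx X 0) (fun z => 'D_(delta_mx 0 k) f1 (mulc z) : R^o) oo =
      'D_X (fun v => 'D_(delta_mx 0 k) f1 v) o1.
    rewrite derive_sliceL; apply: near_eq_derive; apply: near_o1 => v vi.
    by rewrite mulc_l.
  by rewrite V3 V2 V1.
transitivity (\sum_k (Y 0 k * 'D_X (fun v => 'D_(delta_mx 0 k) f1 v) o1 + 'D_(delta_mx 0 k) f1 o1 *
      'D_(row_mx X 0) (fun z => 'D_(row_mx 0 Y) (fun z => mulc z 0 k : R^o) z) oo)).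
  have [_ <-] := is_derive_sum dprod.
  by apply: derive_ext => z; rewrite fct_sumE.
rewrite big_split /=; congr (_ + _).
have dcoord k : is_derive o1 X (fun v => Y 0 k * 'D_(delta_mx 0 k) f1 v : R^o)
    (Y 0 k * 'D_X (fun v => 'D_(delta_mx 0 k) f1 v) o1).
  have := is_deriveZ (Y 0 k) (derivableP (sm_derivable X (sm_derive (delta_mx 0 k) f1s) (@o1_img R G))).
  by [].
have [_ <-] := is_derive_sum dcoord.
apply: near_eq_derive; apply: near_o1 => v vi.
by have [_ ->] := sm_diffE eo f1s vi; rewrite fct_sumE.
Qed.

Lemma br_spec (f : G -> 'M[R]_(1, 1)) g X Y : smooth f ->
  LD (br X Y) f g = LD X (LD Y f) g - LD Y (LD X f) g.
Proof.
move=> fs; apply/matrixP => i j; rewrite {i}(ord1 i) {j}(ord1 j).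
rewrite [RHS]mxE [X in _ = _ + X]mxE.
apply: etrans (LderE g (br X Y) 0 0 fs) _.
apply: etrans _ (esym (congr2 (fun a b => a - b) (Lder2E g X Y fs) (Lder2E g Y X fs))).
set f1 := fun v : 'rV[R]_d => f (g * cinv e1 v)%g 0 0 : R^o.
have f1s : sm (cimg e1) f1 by exact: sm_mul_cinv.
have [_ ->] := sm_diffE (cimg_open e1) f1s (@o1_img R G).
(* The second derivatives of [f1] cancel by symmetry, and only the terms that define [br] are
   left. *)
rewrite (schwarz X Y (cimg_open e1) f1s (@o1_img R G)).
rewrite opprD addrACA subrr add0r -sumrB; apply: eq_bigr => k _.
by rewrite mxE mulrC mulrBr.
Qed.

End Bracket.

(** * Traces of operators *)

Lemma row_mul_delta (R : pzRingType) n m (Z : 'rV[R]_n) k (A : 'M[R]_(1, m)) :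
  Z *m delta_mx k 0 *m A = Z 0 k *: A.
Proof. by rewrite -colE [col _ _]mx11_scalar mul_scalar_mx mxE. Qed.

(* A = C B with C of full column rank and B of full row rank, tr (C B) = tr (B C), and the
   smaller matrix B C is nilpotent as well. *)
Lemma mxtrace_nilpotent (F : fieldType) k m (A : 'M[F]_m) : iter k (mulmx A) A = 0 -> \tr A = 0.
Proof.
elim: k m A => [|k IH] m A; first by move=> /= ->; rewrite linear0.
move=> /= Ak; rewrite -(mulmx_base A) mxtrace_mulC; apply: IH.
have E : forall r (C : 'M[F]_(m, r)) (B : 'M[F]_(r, m)) j, A = C *m B ->
    C *m (iter j (mulmx (B *m C)) (B *m C)) *m B = iter j.+1 (mulmx A) A.
  move=> r C B j ->; elim: j => [|j IHj]; first by rewrite /= !mulmxA.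
  by rewrite [in RHS]iterS -IHj /= !mulmxA.
have := E _ _ _ k (esym (mulmx_base A)); rewrite iterS Ak.
have pC : pinvmx (col_base A) *m col_base A = 1%:M := mulVpmx (col_base_full A).
have pB : row_base A *m pinvmx (row_base A) = 1%:M := mulmxVp (row_base_free A).
move: (iter k _ _) => M M0.
have -> : M = pinvmx (col_base A) *m (col_base A *m M *m row_base A) *m pinvmx (row_base A).
  by rewrite -(mulmxA (pinvmx _)) -(mulmxA (col_base A *m M)) pB mulmx1 mulmxA pC mul1mx.
by rewrite M0 mulmx0 mul0mx.
Qed.

Section Trace.
Variables (R : realType) (n : nat).
Local Notation g := ('rV[R]_n).
Implicit Types T S : g -> g.

Lemma lin1E T u : linear T -> u *m lin1_mx T = T u.
Proof.
move=> Tl; pose F : {linear g -> g} := HB.pack T (GRing.isLinear.Build _ _ _ _ T Tl).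
exact: (mul_rV_lin1 F).
Qed.

Lemma linear_comp T S : linear T -> linear S -> linear (fun x => T (S x)).
Proof. by move=> Tl Sl a x y; rewrite Sl Tl. Qed.

Lemma lin1_comp T S : linear T -> linear S -> lin1_mx (fun x => T (S x)) = lin1_mx S *m lin1_mx T.
Proof.
move=> Tl Sl; apply/row_matrixP => i; rewrite !rowE mulmxA lin1E ?lin1E //.
exact: linear_comp.
Qed.

Definition trop T : R := \tr (lin1_mx T).

Lemma trop_comp T S : linear T -> linear S -> trop (fun x => T (S x)) = trop (fun x => S (T x)).
Proof. by move=> Tl Sl; rewrite /trop (lin1_comp Tl Sl) (lin1_comp Sl Tl) mxtrace_mulC. Qed.

Lemma trop_ext T S : (forall x, T x = S x) -> trop T = trop S.
Proof. by move=> /funext->. Qed.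

Lemma tropD T S : trop (fun x => T x + S x) = trop T + trop S.
Proof.
rewrite /trop -linearD; congr (\tr _); apply/matrixP => i j.
by rewrite !mxE.
Qed.

Lemma tropZ a T : trop (fun x => a *: T x) = a * trop T.
Proof.
rewrite /trop -[RHS]mxtraceZ; congr (\tr _); apply/matrixP => i j.
by rewrite !mxE.
Qed.

Lemma trop_nilpotent k T : linear T -> (forall x, iter k T x = 0) -> trop T = 0.
Proof.
move=> Tl Tk; apply: (@mxtrace_nilpotent _ k); apply/row_matrixP => i.
rewrite row0 rowE.
have E j : delta_mx 0 i *m iter j (mulmx (lin1_mx T)) (lin1_mx T) = iter j.+1 T (delta_mx 0 i).
  elim: j (delta_mx 0 i) => [|j IH] x /=; first by rewrite lin1E.
  by rewrite mulmxA lin1E // IH -iterSr.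
by rewrite E iterSr Tk.
Qed.

End Trace.

HB.lock Definition KF (R : realType) (G : lieGroup R) := @killing R G.

(* Proves identities in commutative groups. *)
Ltac zcan := apply/eqP; rewrite -subr_eq0; apply/eqP; rewrite ?(opprD, opprK);
  rewrite -[LHS]add0r ?addrA;
  repeat match goal with
  | |- ?L + (- ?x) = 0 => rewrite ?(addrAC _ x); rewrite subrK
  | |- ?L + ?x = 0 => rewrite ?(addrAC _ (- x)); rewrite addrK
  end; rewrite ?addrN ?addNr ?addr0 //.

Lemma is_derive_of_line (R : realType) (V W : normedModType R) (f : V -> W) (x v : V) df :
  is_derive (0 : R^o) (1 : R^o) (fun s : R^o => f (s *: v + x)) df -> is_derive x v f df.
Proof.
move=> [d E]; have d' : derivable f x v by apply/derivable1P.
have d0 : derivable f ((0 : R) *: v + x) v by rewrite scale0r add0r.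
have [_ E'] := is_derive_line d0; split=> //.
by rewrite -E E' scale0r add0r.
Qed.

Lemma is_derive_of_line' (R : realType) (V W : normedModType R) (f : V -> W) (x v : V) (h : R -> W) t df :
  is_derive (t : R^o) (1 : R^o) (h : R^o -> W) df -> (forall s, f (s *: v + x) = h (s + t)) ->
  is_derive (0 : R^o) (1 : R^o) (fun s : R^o => f (s *: v + x)) df.
Proof.
move=> [d E] fh; rewrite (_ : (fun s => _) = fun s : R^o => h (s *: (1 : R^o) + t)).
  have d0 : derivable (h : R^o -> W) ((0 : R) *: (1 : R^o) + t) 1 by rewrite scale0r add0r.
  by apply: is_derive_eq (is_derive_line d0) _; rewrite scale0r add0r.
by apply/funext => s; rewrite fh /GRing.scale /= mulr1.
Qed.

(** * Flat functions *)

Section Bump.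
Variable R : realType.
Implicit Types x : R.

(** The derivative of a member of this family is a combination of two others, so smoothness of
    [exp (-1/x)] at 0 is an induction on the order for all [n] at once. *)
Definition flat n x : R := if 0 < x then x ^- n * expR (- x^-1) else 0.

Lemma flat_gt0 x : 0 < x -> 0 < flat 0 x.
Proof. by move=> x0; rewrite /flat x0 expr0 invr1 mul1r expR_gt0. Qed.

(** The exponential of [1/x] exceeds the term of order [n + 2] of its series; two orders more than
    [n] are taken because a quadratic bound makes the difference quotient at 0 tend to 0. *)
Lemma flat_bound n x : `|flat n x| <= (n.+2)`!%:R * x ^+ 2.
Proof.
rewrite /flat; case: ifPn => x0; last by rewrite normr0 mulr_ge0 // sqr_ge0.
have fn : 0 < (n.+2)`!%:R :> R by rewrite ltr0n fact_gt0.
rewrite ger0_norm ?mulr_ge0 ?invr_ge0 ?exprn_ge0 ?expR_ge0 ?(ltW x0) //.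
rewrite expRN ler_pdivrMr ?expR_gt0 //.
have := @expR_ge1Dxn R x^-1 n.+1; rewrite invr_ge0 (ltW x0) => /(_ isT) h.
apply: le_trans (ler_wpM2l _ h); last by rewrite mulr_ge0 ?sqr_ge0 // ltW.
rewrite mulrDr mulr1 exprVn.
have -> : (n.+2)`!%:R * x ^+ 2 * (x ^- n.+2 / (n.+2)`!%:R) = x ^- n.
  rewrite -[n.+2]addn2 exprD; field.
  by rewrite addn2 expf_neq0 ?gt_eqF.
by rewrite lerDr mulr_ge0 ?sqr_ge0 // ltW.
Qed.

Lemma flat_derive n x : is_derive x (1 : R) (flat n) (flat n.+2 x - n%:R * flat n.+1 x).
Proof.
have [x0|x0|<-] := ltgtP 0 x.
- have E : \forall y \near x, y ^- n * expR (- y^-1) = flat n y.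
    near=> y; rewrite /flat.
    have -> // : 0 < y by near: y; exact: lt_nbhsr.
  apply: near_eq_is_derive E _.
  have d1 : is_derive x (1 : R) (fun y : R => y ^- n) (- x ^+ n ^- 2 *: (n%:R * x ^+ n.-1)).
    apply: (@is_deriveV R (fun y => y ^+ n)); first by rewrite expf_neq0 ?gt_eqF.
    have d := @is_deriveX R R id n x 1 1 (is_derive_id _ _).
    by rewrite exprfctE /= scaler1 in d; exact: d.
  have d2 : is_derive x (1 : R) (fun y : R => expR (- y^-1)) (expR (- x^-1) * (x ^- 2)).
    apply: (@is_derive1_comp R expR (fun y => - y^-1)).
    have := @is_deriveV R id x 1 1; rewrite gt_eqF // => /(_ isT (is_derive_id _ _)) d.
    apply: is_derive_eq (is_deriveN d) _.
    by rewrite /= scaler1 opprK.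
  apply: is_derive_eq (is_deriveM d1 d2) _.
  rewrite /flat x0 /GRing.scale /=.
  case: n {d1} => [|n] /=; first by rewrite !mul0r; field; rewrite gt_eqF.
  by rewrite !exprS; field; rewrite ?expf_neq0 ?gt_eqF.
- have E : \forall y \near x, 0 = flat n y.
    near=> y; rewrite /flat ltNge.
    have -> // : y <= 0 by apply: ltW; near: y; exact: lt_nbhsl.
  apply: near_eq_is_derive E _; apply: is_derive_eq (is_derive_cst _ _ _) _.
  by rewrite /flat ltNge (ltW x0) /= mulr0 subr0.
have -> : flat n.+2 0 - n%:R * flat n.+1 0 = 0 :> R by rewrite /flat ltxx mulr0 subr0.
have cv : (fun h : R => h^-1 *: ((flat n \o shift (0 : R)) (h *: (1 : R)) - flat n 0)) @ 0^' --> (0 : R).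
  apply/cvgrPdist_le => e e0; near=> h.
  have h0 : h != 0 by near: h; exact: nbhs_dnbhs_neq.
  rewrite sub0r normrN /= addr0 {2}/flat ltxx subr0 scaler1 normrZ normfV.
  rewrite ler_pdivrMl ?normr_gt0 //; apply: le_trans (flat_bound _ _) _.
  rewrite -(ger0_norm (sqr_ge0 h)) expr2 normrM mulrCA ler_pM2l ?normr_gt0 //.
  rewrite -ler_pdivlMl ?ltr0n ?fact_gt0 //; near: h; apply: dnbhs0_le.
  by rewrite mulr_gt0 ?invr_gt0 ?ltr0n ?fact_gt0.
by split; [apply/cvg_ex; exists 0; exact: cv | exact: cvg_lim cv].
Unshelve. all: by end_near. Qed.

Lemma flat_rV n (v x : 'rV[R]_1) :
  is_derive x v (fun y : 'rV[R]_1 => flat n (y 0 0) : R^o)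
    (v 0 0 * flat n.+2 (x 0 0) + - (n%:R * v 0 0) * flat n.+1 (x 0 0)).
Proof.
have [d E] := flat_derive n (x 0 0).
have dF : differentiable (flat n : R^o -> R^o) (x 0 0) by apply/derivable1_diffP.
have [cd cE] := is_derive_coord 0 x v.
have := @is_derive_chain R _ _ _ (fun y : 'rV[R]_1 => y 0 0 : R^o) (flat n : R^o -> R^o) x v cd dF.
move=> h; apply: is_derive_eq h _; rewrite cE deriveE //.
rewrite -[v 0 0 in LHS]mulr1 -[_ * 1]/(v 0 0 *: (1 : R^o)) linearZ /= -deriveE //.
rewrite -[flat n.+2 _](subrK (n%:R * flat n.+1 (x 0 0))) -E /GRing.scale /=.
set dd := derive _ _ _; ring.
Qed.

Lemma sm_flat : sm setT (fun y : 'rV[R]_1 => flat 0 (y 0 0) : R^o).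
Proof.
suff h k : forall (c : R) n, Ck k setT (fun y : 'rV[R]_1 => c * flat n (y 0 0) : R^o).
  by move=> k; apply: Ck_eq (h k 1 0%N) => [|x _]; [exact: openT | rewrite mul1r].
have dd (c : R) n (x v : 'rV[R]_1) : is_derive x v (fun y : 'rV[R]_1 => c * flat n (y 0 0) : R^o)
  (c * v 0 0 * flat n.+2 (x 0 0) + - (c * n%:R * v 0 0) * flat n.+1 (x 0 0)).
  apply: is_derive_eq (@is_deriveZ R _ _ _ c x v _ (flat_rV n v x)) _.
  rewrite /GRing.scale /=; ring.
elim: k => [|k IH] c n /=.
  move=> x _; have [d _] := flat_derive n (x 0 0).
  have cf : {for x 0 0, continuous (fun t : R => c * flat n t : R^o)}.
    apply: differentiable_continuous; apply/derivable1_diffP.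
    by have [] := @is_deriveZ R R^o R^o _ c _ _ _ (flat_derive n (x 0 0)).
  by apply: (@continuous_comp _ _ _ (fun y : 'rV[R]_1 => y 0 0) _ x _ cf); exact: coord_continuous.
split=> [v x _|v]; first by have [] := dd c n x v.
apply: Ck_eq (CkD openT (IH (c * v 0 0) n.+2) (IH (- (c * n%:R * v 0 0)) n.+1)) => [|x _].
  exact: openT.
by have [_ ->] := dd c n x v.
Qed.
End Bump.

(** * Smooth functions separate points and determine the topology *)

Section Separation.
Variables (R : realType) (G : lieGroup R).
Local Notation d := (ldim G).

(** A bump in the squared Euclidean distance to [c]; the norm of row vectors is the maximum norm,
    which is not smooth. *)
Definition rball m (c : 'rV[R]_m) (e : R) (y : 'rV[R]_m) : R := flat 0 (e - \sum_i (y 0 i - c 0 i) ^+ 2).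

Lemma sm_rball m (c : 'rV[R]_m) e : sm setT (rball c e : 'rV[R]_m -> R^o).
Proof.
have oT := @openT 'rV[R]_m.
apply: (sm_eq oT (f := fun y => flat 0 ((e - \sum_i (y 0 i - c 0 i) ^+ 2)%:M 0 (0 : 'I_1)))).
  by move=> y _; rewrite /rball mxE eqxx mulr1n.
apply: (@sm_comp R m 1 setT setT (fun y => (e - \sum_i (y 0 i - c 0 i) ^+ 2)%:M)
  (fun z => flat 0 (z 0 0) : R^o) oT openT) => //; last exact: sm_flat.
move=> k; have h i : sm setT (fun y : 'rV[R]_m => y 0 i - c 0 i : R^o).
  by apply: smD => //; [exact: sm_coord | exact: sm_cst].
apply: (sm_eq oT (f := fun y => e + \sum_i (- 1) * ((y 0 i - c 0 i) * (y 0 i - c 0 i)))).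
  move=> y _; rewrite ord1 mxE eqxx mulr1n -mulr_sumr mulN1r; congr (_ - _).
apply: smD => //; first exact: sm_cst.
by apply: (sm_sum oT) => i; apply: (smM oT); [exact: sm_cst | exact: smM].
Qed.

Lemma rball_supp m (c : 'rV[R]_m) r y : 0 < r -> rball c (r ^+ 2) y != 0 -> `|y - c| <= r.
Proof.
move=> r0; rewrite /rball /flat; case: ifPn; rewrite ?eqxx // subr_gt0 => h _.
apply: rV_norm_le (ltW r0) _ => i; rewrite !mxE -(ler_pXn2r (n := 2)) ?nnegrE ?(ltW r0) //.
rewrite real_normK ?num_real //; apply: le_trans (ltW h).
by rewrite (bigD1 i) //= lerDl sumr_ge0 // => j _; exact: sqr_ge0.
Qed.

Lemma rball_center m (c : 'rV[R]_m) r : 0 < r -> 0 < rball c (r ^+ 2) c.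
Proof.
move=> r0; rewrite /rball big1 ?subr0; last by move=> i _; rewrite subrr expr0n.
by rewrite flat_gt0 // exprn_gt0.
Qed.

(** A bump in a chart, extended by 0. It is smooth across the edge of the chart because its support
    lies in the image of a closed ball, which is compact, hence closed in the Hausdorff space [G]:
    around any point outside the chart the function is 0. *)
Lemma bump_exists (x : G) (A : set G) : open A -> A x ->
  exists f : G -> 'M[R]_1, [/\ smooth f, f x 0 0 != 0 & forall y, f y 0 0 != 0 -> A y].
Proof.
move=> Ao Ax; have [c cL cx] := lcover x.
have gc := gsm_cinv cL; have co := cimg_open c.
have Wo : open (cimg c `&` cinv c @^-1` A) by apply: gsm_open.
have Wx : (cimg c `&` cinv c @^-1` A) (cmap c x) by split; [exact: cimg_cmap | rewrite /= chartK].
have [r r0 hr] := near0_shift (open_nbhs_nbhs (conj Wo Wx)).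
pose e := r / 2; have e0 : 0 < e by rewrite divr_gt0.
have supp v : rball (cmap c x) (e ^+ 2) v != 0 -> (cimg c `&` cinv c @^-1` A) v.
  move=> /(rball_supp e0) h; rewrite -[v](subrK (cmap c x)); apply: hr.
  by apply: le_lt_trans h _; rewrite ltr_pdivrMr // ltr_pMr // ltr1n.
pose f (y : G) : 'M[R]_1 := if `[< cdom c y >] then (rball (cmap c x) (e ^+ 2) (cmap c y))%:M else 0.
exists f; split.
- pose B := [set v : 'rV[R]_d | `|v - cmap c x| <= e].
  have Bc : compact B.
    apply: bounded_closed_compact.
      exists (e + `|cmap c x|); split; first by rewrite num_real.
      move=> t ht v Bv; apply: le_trans (ltW ht).
      by rewrite -[v in X in X <= _](subrK (cmap c x)); apply: le_trans (ler_normD _ _) _; rewrite lerD2r.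
    rewrite (_ : B = (fun v => `|v - cmap c x|) @^-1` [set t : R | t <= e]); last by [].
    apply: closed_comp (@closed_le R e) => v _.
    apply: (@continuous_comp _ _ _ (fun u : 'rV[R]_d => u - cmap c x) (fun u => `|u|)).
      exact: (@cvgB R 'rV[R]_d _ (nbhs v) _ id (cst (cmap c x)) _ _ cvg_id (cvg_cst _)).
    exact: norm_continuous.
  have BW v : B v -> cimg c v.
    move=> Bv; suff: (cimg c `&` cinv c @^-1` A) v by case.
    rewrite -[v](subrK (cmap c x)); apply: hr.
    by apply: le_lt_trans Bv _; rewrite ltr_pdivrMr // ltr_pMr // ltr1n.
  have Cc : compact (cinv c @` B).
    apply: continuous_compact Bc; apply: continuous_in_subspaceT => v /set_mem /BW cv.
    exact: chart_inv_cont.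
  have Cl : closed (cinv c @` B) := compact_closed (@lhausdorff _ G) Cc.
  move=> b bL i j; apply: sm_local => v cv.
  have gb := gsm_cinv bL; have bo := cimg_open b.
  have [cy|ncy] := pselect (cdom c (cinv b v)).
    exists (cimg b `&` cinv b @^-1` cdom c); split.
    + by apply: gsm_open => //; exact: chart_open.
    + by [].
    have Vo : open (cimg b `&` cinv b @^-1` cdom c) by apply: gsm_open => //; exact: chart_open.
    apply: (sm_eq Vo (f := fun v => rball (cmap c x) (e ^+ 2) (cmap c (cinv b v)))).
      by move=> w [_ hw]; rewrite /f asboolT // (ord1 i) (ord1 j) mxE eqxx mulr1n.
    apply: (sm_comp Vo openT _ _ (sm_rball _ _)) => // k; exact: gb.2.
  exists (cimg b `&` cinv b @^-1` (~` (cinv c @` B))); split.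
  + by apply: gsm_open => //; exact: closed_openC.
  + split=> // -[w Bw ew]; apply: ncy; rewrite -ew; exact: (cinvK (BW w Bw)).1.
  have Vo : open (cimg b `&` cinv b @^-1` (~` (cinv c @` B))).
    by apply: gsm_open => //; exact: closed_openC.
  apply: (sm_eq Vo (f := fun=> 0)); last exact: sm_cst.
  move=> w [_ nw]; rewrite /f; case: asboolP => [cw|]; last by rewrite mxE.
  rewrite (ord1 i) (ord1 j) mxE eqxx mulr1n; apply/esym/eqP/negPn/negP => /(rball_supp e0) h.
  by apply: nw; exists (cmap c (cinv b w)) => //; rewrite chartK.
- by rewrite /f asboolT // mxE eqxx mulr1n gt_eqF // rball_center.
move=> y; rewrite /f; case: asboolP => [cy|]; last by rewrite mxE eqxx.
by rewrite mxE eqxx mulr1n => /supp [_]; rewrite /= chartK.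
Qed.

Lemma smooth_sep (x y : G) : (forall f : G -> 'M[R]_1, smooth f -> f x = f y) -> x = y.
Proof.
move=> h; apply: contrapT => xy.
have : (~` [set y]) x by [].
have yo : open (~` [set y]) by apply: closed_openC; apply: accessible_closed_set1; apply: hausdorff_accessible; exact: lhausdorff.
move=> /(bump_exists yo) [f [fs fx fA]].
by apply: (fA y) => //; rewrite -(h f fs).
Qed.

(** The curves in [lie_algebra_of] are only known to be differentiable when composed with smooth
    functions; this yields their continuity as curves in [G]. *)
Lemma smooth_top (T : topologicalType) (c : T -> G) t :
  (forall f : G -> 'M[R]_1, smooth f -> {for t, continuous (fun s => f (c s) 0 0)}) ->
  {for t, continuous c}.
Proof.
move=> h A; rewrite nbhsE => -[B [Bo Bx] BA].
have [f [fs fx fA]] := bump_exists Bo Bx.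
have ho : open [set y : R | y != 0] by exact: open_neq.
have N0 : nbhs (f (c t) 0 0) [set y : R | y != 0] by apply: open_nbhs_nbhs.
have N : nbhs t ((fun s => f (c s) 0 0) @^-1` [set y : R | y != 0]) := h f fs _ N0.
have N' : nbhs t (c @^-1` A) by apply: (filterS _ N) => s /fA /BA.
exact: N'.
Qed.
End Separation.

(** * The Lie algebra of G *)

Section CartanInvolution.
Variables (R : realType) (G : lieGroup R) (theta : {linear lieAlg G -> lieAlg G}).
Hypothesis Tcartan : cartan_involution theta.
Local Notation g := (lieAlg G).
Local Notation K := (@KF R G).
Local Notation d := (ldim G).

Section LieSpec.
Local Notation o1 := (cmap (lchart1 G) 1%g).
Implicit Types X Y Z : lieAlg G.

Definition Lnull : set (lieAlg G) :=
  [set Z | forall f : G -> 'M[R]_(1, 1), smooth f -> forall g, LD Z f g = 0].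

Lemma Lder0 a b (f : G -> 'M[R]_(a, b)) g : smooth f -> LD 0 f g = 0.
Proof.
move=> fs; have := Lder_linear g (-1) 0 0 fs.
by rewrite scaler0 addr0 scaleN1r addNr.
Qed.

Lemma LBE : @lie R G = @LB R G.
Proof. by rewrite LB.unlock. Qed.

Lemma lie_charE X Y : LB X Y = get [set Z : lieAlg G | forall f : G -> 'M[R]_(1, 1), smooth f ->
  forall g, LD Z f g = LD X (LD Y f) g - LD Y (LD X f) g].
Proof. by rewrite LB.unlock LD.unlock. Qed.

Lemma lie_null X Y : Lnull X \/ Lnull Y -> LB X Y = get Lnull.
Proof.
move=> XY; rewrite lie_charE; congr (get _); apply/seteqP.
have H (f : G -> 'M[R]_(1, 1)) g : smooth f -> LD X (LD Y f) g - LD Y (LD X f) g = 0.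
  move=> fs; have fX := Lder_smooth X fs; have fY := Lder_smooth Y fs.
  case: XY => N; rewrite (N _ _) // (Lder_ext (g := fun=> 0)) ?Lder_cst ?subr0 //.
  - by move=> y; exact: N.
  - by move=> y; exact: N.
by split=> Z hZ f fs g; [rewrite hZ // H|rewrite hZ // H].
Qed.

(* If X <> 0 were annihilated by all smooth functions, [LB X] would be the
   constant map with value z := get Lnull, theta z = z, and so killing X (theta X)
   would be the square of the sum of the coordinates of z. *)
Lemma Lder_inj Z : (forall f : G -> 'M[R]_(1, 1), smooth f -> forall g, LD Z f g = 0) -> Z = 0.
Proof.
move=> ZN; apply/eqP; apply: contraT => Z0; have [T2 Tl Tk] := Tcartan; rewrite LBE in Tl.
pose z := get Lnull.
have L0 : Lnull 0 by move=> f fs g; rewrite Lder0.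
have ZL Y : LB Z Y = z by apply: lie_null; left.
have Tz : theta z = z by rewrite -{1}(ZL 0) Tl linear0; apply: lie_null; right.
have TZL Y : LB (theta Z) Y = z by rewrite -(T2 Y) -Tl ZL.
have := Tk Z Z0; rewrite /killing LBE.
have -> : lin1_mx (LB Z) = \matrix_(i, j) z 0 j by apply/matrixP => i j; rewrite !mxE ZL.
have -> : lin1_mx (LB (theta Z)) = \matrix_(i, j) z 0 j by apply/matrixP => i j; rewrite !mxE TZL.
rewrite /mxtrace ltNge; suff -> : \sum_i ((\matrix_(i, j) z 0 j : 'M[R]_d) *m (\matrix_(i, j) z 0 j)) i i
   = (\sum_i z 0 i) ^+ 2 by rewrite sqr_ge0.
transitivity (\sum_i \sum_k z 0 k * z 0 i).
  by apply: eq_bigr => i _; rewrite mxE; apply: eq_bigr => k _; rewrite !mxE.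
by rewrite exchange_big expr2 mulr_suml; apply: eq_bigr => i _; rewrite mulr_sumr.
Qed.

(** Vectors are compared through their derivations, which turns the bracket identities below into
    identities between iterated derivatives of functions. *)
Lemma Lder_eq X Y : (forall f : G -> 'M[R]_(1, 1), smooth f -> forall g, LD X f g = LD Y f g) -> X = Y.
Proof.
move=> XY; apply/eqP; rewrite -subr_eq0; apply/eqP; apply: Lder_inj => f fs g.
by rewrite addrC -scaleN1r Lder_linear // scaleN1r XY // addNr.
Qed.

(** Both sides induce the commutator of two derivations: [br_spec] gives existence, [Lder_eq]
    uniqueness. *)
Lemma lieE X Y : LB X Y = br X Y.
Proof.
apply: Lder_eq => f fs g.
rewrite br_spec // lie_charE.
apply: (@getPex _ [set Z : lieAlg G | forall f : G -> 'M[R]_(1, 1), smooth f -> forall g,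
    LD Z f g = LD X (LD Y f) g - LD Y (LD X f) g]) => //.
by exists (br X Y) => f0 fs0 g0; exact: br_spec.
Qed.

Lemma Lder_lie a b (f : G -> 'M[R]_(a, b)) g X Y : smooth f ->
  LD (LB X Y) f g = LD X (LD Y f) g - LD Y (LD X f) g.
Proof.
move=> fs; rewrite lieE; apply/matrixP => i j; have fij := smooth_entry i j fs.
pose F y : 'M[R]_1 := (f y i j)%:M.
have E Z : LD Z F = fun h => (LD Z f h i j)%:M.
  by apply/funext => h; rewrite [LHS]mx11_scalar Lder_entry.
have E2 A B : LD A (LD B F) g 0 0 = LD A (LD B f) g i j.
  by rewrite E; exact: Lder_entry (Lder_smooth B fs).
apply: etrans (esym (Lder_entry g (br X Y) i j fs)) _; rewrite (br_spec g X Y fij).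
rewrite [LHS]mxE [X in _ + X = _]mxE [RHS]mxE [X in _ = _ + X]mxE.
exact: (congr2 (fun a b => a - b) (E2 X Y) (E2 Y X)).
Qed.

Lemma lieC X Y : LB X Y = - LB Y X.
Proof. by rewrite !lieE; apply/rowP => k; rewrite !mxE opprB. Qed.

Lemma lieXX X : LB X X = 0.
Proof. by rewrite lieE; apply/rowP => k; rewrite !mxE subrr. Qed.

Lemma lie_linearl k X Y Z : LB (k *: X + Y) Z = k *: LB X Z + LB Y Z.
Proof.
apply: Lder_eq => f fs g; have fZ := Lder_smooth Z fs.
apply: etrans (Lder_lie g (k *: X + Y) Z fs) _.
apply: etrans _ (esym (Lder_linear g k (LB X Z) (LB Y Z) fs)).
rewrite (Lder_lie g X Z fs) (Lder_lie g Y Z fs) (Lder_linear g k X Y fZ).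
have -> : LD Z (LD (k *: X + Y) f) g = k *: LD Z (LD X f) g + LD Z (LD Y f) g.
  rewrite -(LderZ k g Z (Lder_smooth X fs)) -LderD; first by apply: Lder_ext => y; exact: Lder_linear.
    by apply: smoothZl; exact: Lder_smooth.
  exact: Lder_smooth.
by rewrite scalerBr opprD addrACA.
Qed.

Lemma lieDl X Y Z : LB (X + Y) Z = LB X Z + LB Y Z.
Proof. by have := lie_linearl 1 X Y Z; rewrite !scale1r. Qed.
Lemma lie0l Z : LB 0 Z = 0.
Proof. by have := lie_linearl (-1) 0 0 Z; rewrite scaler0 addr0 scaleN1r addNr. Qed.
Lemma lieZl k X Z : LB (k *: X) Z = k *: LB X Z.
Proof. by have := lie_linearl k X 0 Z; rewrite lie0l !addr0. Qed.
Lemma lieDr X Y Z : LB Z (X + Y) = LB Z X + LB Z Y.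
Proof. by rewrite (lieC Z (X + Y)) lieDl opprD -(lieC Z X) -(lieC Z Y). Qed.
Lemma lie0r Z : LB Z 0 = 0.
Proof. by rewrite (lieC Z 0) lie0l oppr0. Qed.
Lemma lieZr k X Z : LB Z (k *: X) = k *: LB Z X.
Proof. by rewrite (lieC Z (k *: X)) lieZl -scalerN -(lieC Z X). Qed.
Lemma lieNr X Z : LB Z (- X) = - LB Z X.
Proof. by rewrite -scaleN1r lieZr scaleN1r. Qed.
Lemma lie_linear X : linear (LB X).
Proof. by move=> k Y Z; rewrite lieDr lieZr. Qed.

Lemma Lder_lie2 (f : G -> 'M[R]_(1, 1)) g A B W : smooth f ->
  LD W (LD (LB A B) f) g = LD W (LD A (LD B f)) g - LD W (LD B (LD A f)) g.
Proof.
move=> fs; have sAB := Lder_smooth A (Lder_smooth B fs); have sBA := Lder_smooth B (Lder_smooth A fs).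
have sN : smooth (fun h => - LD B (LD A f) h).
  by apply: (smooth_ext _ (smoothZl (-1) sBA)) => y; rewrite scaleN1r.
rewrite -(LderN g W sBA) -(LderD g W sAB sN).
by apply: Lder_ext => y; exact: Lder_lie.
Qed.

Lemma lie_jacobi X Y Z : LB (LB X Y) Z = LB X (LB Y Z) - LB Y (LB X Z).
Proof.
apply: Lder_eq => f fs g; have sZ := Lder_smooth Z fs; have sY := Lder_smooth Y fs.
have sX := Lder_smooth X fs.
have -> : LB X (LB Y Z) - LB Y (LB X Z) = (-1) *: LB Y (LB X Z) + LB X (LB Y Z).
  by rewrite scaleN1r addrC.
rewrite (Lder_linear _ _ _ _ fs) (Lder_lie g (LB X Y) Z fs) (Lder_lie g X (LB Y Z) fs)
  (Lder_lie g Y (LB X Z) fs).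
rewrite (Lder_lie2 g X Y Z fs) (Lder_lie2 g Y Z X fs) (Lder_lie2 g X Z Y fs).
rewrite (Lder_lie g X Y sZ) (Lder_lie g Y Z sX) (Lder_lie g X Z sY).
move: (LD X (LD Y (LD Z f)) g) (LD Y (LD X (LD Z f)) g) (LD Z (LD X (LD Y f)) g)
  (LD Z (LD Y (LD X f)) g) (LD X (LD Z (LD Y f)) g) (LD Y (LD Z (LD X f)) g) => a b c e h k.
by apply/matrixP => i j; rewrite !mxE; ring.
Qed.

(** Pulling functions back along conjugation turns the derivation of [AD x Z] into that of [Z], and
    pullback respects commutators. *)
Lemma Ad_lie (x : G) X Y : AD x (LB X Y) = LB (AD x X) (AD x Y).
Proof.
apply: Lder_eq => f fs g.
pose C (h : G -> 'M[R]_(1, 1)) z := h (x * z * x^-1)%g.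
have Cs h : smooth h -> smooth (C h).
  by move=> hs; exact: (smooth_mulL x (smooth_mulR x^-1%g hs)).
have CL Z h : smooth h -> C (LD (AD x Z) h) = LD Z (C h).
  by move=> hs; apply/funext => y; rewrite /C (Lder_conj y x Z hs).
have Cg h : h g = C h (x^-1 * g * x)%g.
  by rewrite /C !mulgA mulgV mul1g -mulgA mulgV mulg1.
rewrite (Lder_lie g _ _ fs) (Cg (LD (AD x (LB X Y)) f)) (CL _ _ fs).
rewrite (Cg (LD (AD x X) (LD (AD x Y) f))) (Cg (LD (AD x Y) (LD (AD x X) f))).
rewrite (CL X _ (Lder_smooth _ fs)) (CL Y _ (Lder_smooth _ fs)) (CL X _ fs) (CL Y _ fs).
exact: Lder_lie (Cs _ fs).
Qed.

Lemma Lder_sumX I (r : seq I) (F : I -> lieAlg G) a b (f : G -> 'M[R]_(a, b)) g : smooth f ->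
  LD (\sum_(i <- r) F i) f g = \sum_(i <- r) LD (F i) f g.
Proof.
move=> fs; elim: r => [|i r IH]; first by rewrite !big_nil Lder0.
by rewrite !big_cons -IH -[F i]scale1r (Lder_linear _ _ _ _ fs) !scale1r.
Qed.

Lemma Lder_expand Z a b (f : G -> 'M[R]_(a, b)) g : smooth f ->
  LD Z f g = \sum_k Z 0 k *: LD (delta_mx 0 k) f g.
Proof.
move=> fs; rewrite {1}(row_sum_delta Z) (Lder_sumX _ _ _ fs); apply: eq_bigr => k _.
by rewrite -[_ *: delta_mx _ _]addr0 (Lder_linear _ _ _ _ fs) (Lder0 _ fs) addr0.
Qed.

(** Symmetry of second derivatives for [f (g u v)], with [u] moving along [W] and [v] along [X]. One
    order gives [LD W (LD X f)]; the other gives the derivative along [X] of [LD (AD v^-1 W) f] at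
    [g v], that is, the derivation of the wanted vector plus [LD X (LD W f)]. *)
Lemma Lder_AdV1 X W : LD X (fun z => AD z^-1%g W) 1%g = - LB X W.
Proof.
have o := cimg_open (lchart1 G); have oi := @o1_img R G.
apply: Lder_eq => f fs g.
pose U := [set z : 'rV[R]_(d + d) | cimg (lchart1 G) (lsubmx z) /\ cimg (lchart1 G) (rsubmx z)].
have Uo : open U.
  apply: openI; [apply: open_comp o => z _|apply: open_comp o => z _].
    exact/differentiable_continuous/differentiable_lsubmx.
  exact/differentiable_continuous/differentiable_rsubmx.
pose phi z := (g * cinv (lchart1 G) (lsubmx z) * cinv (lchart1 G) (rsubmx z))%g.
have pU : gsm U phi.
  apply: gsm_mul => //.
    apply: gsm_mul => //; first exact: gsm_cst.
    by apply: (gsm_comp Uo o (gsm_cinv (lchart1_atlas G))) => [k|z []] //; exact: sm_lsubmx.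
  by apply: (gsm_comp Uo o (gsm_cinv (lchart1_atlas G))) => [k|z []] //; exact: sm_rsubmx.
have oo : U (row_mx o1 o1) by rewrite /U /= row_mxKl row_mxKr.
pose H z : R^o := f (phi z) 0 0.
have HU : sm U H := smooth_gsm 0 0 Uo pU fs.
have S := schwarz (row_mx 0 X) (row_mx W 0) Uo HU oo.
have S2 : 'D_(row_mx W 0) (fun z => 'D_(row_mx 0 X) H z) (row_mx o1 o1) = LD W (LD X f) g 0 0.
  rewrite derive_sliceL; apply: etrans _ (esym (LderE g W 0 0 (Lder_smooth X fs))).
  apply: derive_ext => u; rewrite derive_sliceR.
  apply: etrans _ (esym (LderE _ X 0 0 fs)); apply: derive_ext => v.
  by rewrite /H /phi row_mxKl row_mxKr.
(* The derivative of [f] at [g z] along [AD z^-1 W], written in coordinates so that the product rule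
   separates the moving vector from the moving point. *)
pose Q z := \sum_k (AD z^-1%g W *m delta_mx k 0 : 'M[R]_1) *m LD (delta_mx 0 k) f (g * z)%g.
have QE z : Q z = LD (AD z^-1%g W) f (g * z)%g.
  rewrite (Lder_expand _ _ fs); apply: eq_bigr => k _.
  by rewrite row_mul_delta.
have Qk k : smooth (fun z => (AD z^-1%g W *m delta_mx k 0 : 'M[R]_1)).
  by apply: smoothM; [exact: smooth_AdV|exact: smooth_cst].
have Lk k : smooth (fun z => LD (delta_mx 0 k) f (g * z)%g).
  by apply: (smooth_mulL g); exact: Lder_smooth.
have Qs : smooth Q by apply: smooth_sum => k; exact: smoothM (Qk k) (Lk k).
have S1 : 'D_(row_mx 0 X) (fun z => 'D_(row_mx W 0) H z) (row_mx o1 o1) = LD X Q 1%g 0 0.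
  rewrite derive_sliceR; apply: etrans _ (esym (LderE 1%g X 0 0 Qs)).
  apply: derive_ext => v; rewrite derive_sliceL mul1g QE -(Lder_mulR g _ W fs).
  apply: etrans _ (esym (LderE _ W 0 0 (smooth_mulR _ fs))); apply: derive_ext => u.
  by rewrite /H /phi row_mxKl row_mxKr.
have Qd : LD X Q 1%g = LD (LD X (fun z => AD z^-1%g W) 1%g) f g + LD X (LD W f) g.
  rewrite /Q Lder_sum; last by move=> k; exact: smoothM (Qk k) (Lk k).
  rewrite (Lder_expand (LD X _ 1%g) g fs).
  have -> : LD X (LD W f) g = \sum_k W 0 k *: LD X (LD (delta_mx 0 k) f) g.
    transitivity (LD X (fun h => \sum_k W 0 k *: LD (delta_mx 0 k) f h) g).
      by apply: Lder_ext => y; exact: Lder_expand.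
    rewrite Lder_sum; last by move=> k; apply: smoothZl; exact: Lder_smooth.
    by apply: eq_bigr => k _; exact: (LderZ (W 0 k) g X (Lder_smooth _ fs)).
  rewrite -big_split /=; apply: eq_bigr => k _.
  rewrite (LderM _ _ (Qk k) (Lk k)) (LderM _ _ (smooth_AdV W) (smooth_cst _)) Lder_cst mulmx0 addr0.
  rewrite invg1 Ad1 mulg1 (row_mul_delta (LD X _ 1%g)) (row_mul_delta W).
  by rewrite (Lder_mulL (LD (delta_mx 0 k) f)) mulg1.
apply/matrixP => i j; rewrite {i}(ord1 i) {j}(ord1 j).
have -> : LD (- LB X W) f g = LD W (LD X f) g - LD X (LD W f) g.
  by rewrite -(lieC W X) (Lder_lie g W X fs).
have -> : LD (LD X (fun z => AD z^-1%g W) 1%g) f g = LD X Q 1%g - LD X (LD W f) g.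
  by rewrite Qd addrK.
rewrite [LHS]mxE [RHS]mxE; congr (_ + _).
by rewrite -S1 -S2.
Qed.

Lemma Lder_AdV (y : G) X Y : LD X (fun z => AD z^-1%g Y) y = - LB X (AD y^-1%g Y).
Proof.
rewrite -Lder_AdV1 -[in LHS](mulg1 y) -(Lder_mulL (fun z => AD z^-1%g Y) 1%g y X).
by apply: Lder_ext => z; rewrite invgM AdM.
Qed.

End LieSpec.

(** * Alternating forms on lists of vectors, with [io] the contraction *)

Definition io (A : Type) (X : g) (u : seq g -> A) : seq g -> A := fun s => u (X :: s).

Section Basic.
Variable A : lmodType R.
Implicit Types (u v : seq g -> A) (hh : {vspace g}) (s : seq g).

Definition slot_linear u := forall s1 s2 a x y, u (s1 ++ (a *: x + y) :: s2) =
        a *: u (s1 ++ x :: s2) + u (s1 ++ y :: s2).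

Lemma slot0 u s1 s2 : slot_linear u -> u (s1 ++ 0 :: s2) = 0.
Proof.
move=> ul; have := ul s1 s2 (-1) 0 0.
by rewrite scaler0 addr0 scaleN1r addNr.
Qed.
Lemma slotD u s1 s2 x y : slot_linear u ->
  u (s1 ++ (x + y) :: s2) = u (s1 ++ x :: s2) + u (s1 ++ y :: s2).
Proof. by move=> ul; have := ul s1 s2 1 x y; rewrite !scale1r. Qed.
Lemma slotZ u s1 s2 a x : slot_linear u ->
  u (s1 ++ (a *: x) :: s2) = a *: u (s1 ++ x :: s2).
Proof. by move=> ul; have := ul s1 s2 a x 0; rewrite !addr0 slot0 ?addr0. Qed.
Lemma slot_sum u s1 s2 I (r : seq I) (F : I -> g) : slot_linear u ->
  u (s1 ++ (\sum_(i <- r) F i) :: s2) = \sum_(i <- r) u (s1 ++ F i :: s2).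
Proof.
move=> ul; elim: r => [|i r IH]; first by rewrite !big_nil slot0.
by rewrite !big_cons slotD // IH.
Qed.

Lemma altform0 p hh : altform p hh (fun _ : seq g => 0 : A).
Proof. by split=> // s1 s2 a x y; rewrite scaler0 addr0. Qed.

Lemma altform_linear p hh a u v : altform p hh u -> altform p hh v ->
  altform p hh (fun s => a *: u s + v s).
Proof.
move=> [u1 u2 u3 u4] [v1 v2 v3 v4]; split=> [s sp|s1 s2 b x y|s su|s sh].
- by rewrite u1 // v1 // scaler0 addr0.
- by rewrite u2 v2 !scalerDr !scalerA (mulrC a b) -!addrA; congr (_ + _); rewrite addrCA.
- by rewrite u3 // v3 // scaler0 addr0.
- by rewrite u4 // v4 // scaler0 addr0.
Qed.

Lemma altformD p hh u v : altform p hh u -> altform p hh v -> altform p hh (fun s => u s + v s).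
Proof.
move=> ua va; have := altform_linear 1 ua va.
by congr altform; apply/funext => s; rewrite scale1r.
Qed.

Lemma altformZ p hh a u : altform p hh u -> altform p hh (fun s => a *: u s).
Proof.
move=> ua; have := altform_linear a ua (altform0 p hh).
by congr altform; apply/funext => s; rewrite addr0.
Qed.

Lemma altform_sum I (r : seq I) p hh (F : I -> seq g -> A) :
  (forall i, altform p hh (F i)) -> altform p hh (fun s => \sum_(i <- r) F i s).
Proof.
move=> Fa; elim: r => [|i r IH].
  by have := altform0 p hh; congr altform; apply/funext => s; rewrite big_nil.
by have := altformD (Fa i) IH; congr altform; apply/funext => s; rewrite big_cons.
Qed.

Lemma altform_sub p hh hh' u : (hh' <= hh)%VS -> altform p hh u -> altform p hh' u.
Proof.
move=> /subvP hs [u1 u2 u3 u4]; split => // s /hasP[x xs xh]; apply: u4.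
by apply/hasP; exists x => //; exact: hs.
Qed.

Lemma altform_io p hh u X : altform p hh u -> altform p.-1 hh (io X u).
Proof.
move=> [u1 u2 u3 u4]; split=> [s sp|s1 s2 a x y|s su|s sh]; rewrite /io.
- case: p u1 sp => [|p] u1 sp; first by rewrite u1.
  by apply: u1; rewrite /= eqSS.
- by have := u2 (X :: s1) s2 a x y.
- by apply: u3; rewrite /= negb_and su orbT.
- by apply: u4; rewrite /= sh orbT.
Qed.

Lemma altform_ios p hh u t : altform p hh u -> altform (p - size t) hh (fun s => u (t ++ s)).
Proof.
elim: t p u => [|X t IH] p u ua; first by rewrite subn0.
by have := IH _ _ (altform_io X ua); rewrite /io /= subnS -predn_sub.
Qed.

Lemma altform_io_hh p hh u X s : altform p hh u -> X \in hh -> u (X :: s) = 0.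
Proof. by move=> [_ _ _ u4] Xh; apply: u4; rewrite /= Xh. Qed.

Lemma alt_swap p hh u s1 s2 s3 x y : altform p hh u ->
  u (s1 ++ x :: s2 ++ y :: s3) = - u (s1 ++ y :: s2 ++ x :: s3).
Proof.
move=> [_ ul u3 _].
have nu z : ~~ uniq (s1 ++ z :: s2 ++ z :: s3).
  by rewrite cat_uniq /= mem_cat inE eqxx orbT /= !andbF.
have L z a b : u (s1 ++ z :: s2 ++ (a + b) :: s3) = u (s1 ++ z :: s2 ++ a :: s3) + u (s1 ++ z :: s2 ++ b :: s3).
  by have := slotD (s1 ++ z :: s2) s3 a b ul; rewrite -!catA.
have := u3 _ (nu (x + y)).
rewrite (slotD s1 _ x y ul) !L (u3 _ (nu x)) (u3 _ (nu y)) addr0 add0r.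
by move/eqP; rewrite addr_eq0 => /eqP.
Qed.

Lemma alt_front p hh u s1 s2 x : altform p hh u ->
  u (s1 ++ x :: s2) = (-1) ^+ size s1 *: u (x :: s1 ++ s2).
Proof.
elim: s1 p u => [|y s1 IH] p u ua; first by rewrite scale1r.
rewrite /= -[u (y :: _)]/(io y u _) (IH _ _ (altform_io y ua)) /io.
by have := alt_swap [::] [::] (s1 ++ s2) y x ua => /= ->; rewrite exprS mulN1r scalerN scaleNr.
Qed.

Lemma alt_catC p hh u s t : altform p hh u ->
  u (s ++ t) = (-1) ^+ (size s * size t) *: u (t ++ s).
Proof.
elim: t s p u => [|y t IH] s p u ua; first by rewrite cats0 muln0 scale1r.
rewrite (alt_front _ _ _ ua) -[u (y :: _)]/(io y u _) (IH _ _ _ (altform_io y ua)) /io.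
by rewrite scalerA -exprD mulnS.
Qed.

(** Inside a contraction a repeated vector, or one of [hh], can be moved to the front, so conditions
    on the first slots suffice. This is how wedge products, [adact] and [dl] are shown to be
    alternating by induction. *)
Lemma altform_cons p hh u :
  (p = 0%N -> forall X s, u (X :: s) = 0) -> (p != 0%N -> u [::] = 0) ->
  (forall X, altform p.-1 hh (io X u)) ->
  (forall s a x y, u ((a *: x + y) :: s) = a *: u (x :: s) + u (y :: s)) ->
  (forall X s, u (X :: X :: s) = 0) -> (forall X s, X \in hh -> u (X :: s) = 0) ->
  altform p hh u.
Proof.
move=> u00 u0 ui ul uXX uh; split.
- case=> [|X s] sp; first by apply: u0; rewrite eq_sym.
  case: p u00 u0 ui sp => [|p] u00 u0 ui sp; first exact: u00.
  by have [h _ _ _] := ui X; apply: h.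
- case=> [|X s1] s2 a x y; first exact: ul.
  by have [_ h _ _] := ui X; exact: (h s1 s2 a x y).
- case=> // X s; rewrite /= negb_and negbK => /orP[Xs|su].
    have /path.splitPr[s1 s2] := Xs.
    by rewrite -[u _]/(io X u _) (alt_front _ _ _ (ui X)) /io uXX scaler0.
  by have [_ _ h _] := ui X; exact: h.
- case=> // X s /= /orP[|sh]; first exact: uh.
  by have [_ _ _ h] := ui X; exact: h.
Qed.

Lemma altform_eq p hh u v : (forall s, u s = v s) -> altform p hh u -> altform p hh v.
Proof. by move=> /funext->. Qed.

Section Perm.
Variable p : nat.
Definition mkl (x : 'I_p -> g) : seq g := [seq x i | i <- enum 'I_p].
Definition upd (x : 'I_p -> g) i y : 'I_p -> g := fun k => if k == i then y else x k.

Lemma size_mkl x : size (mkl x) = p.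
Proof. by rewrite size_map size_enum_ord. Qed.

Lemma mkl_upd x i y :
  mkl (upd x i y) = take i (mkl x) ++ y :: drop i.+1 (mkl x).
Proof.
have ie : (i < size (enum 'I_p))%N by rewrite size_enum_ord.
have ei : nth i (enum 'I_p) i = i by rewrite nth_ord_enum.
have E : enum 'I_p = take i (enum 'I_p) ++ i :: drop i.+1 (enum 'I_p).
  by rewrite -{1}(cat_take_drop i (enum 'I_p)) (drop_nth i ie) ei.
have := enum_uniq 'I_p; rewrite E cat_uniq /= negb_or => /and3P[_ /andP[it _] /andP[id _]].
have ui : upd x i y i = y by rewrite /upd eqxx.
rewrite /mkl -map_take -map_drop [in LHS]E map_cat /= ui; congr (_ ++ _ :: _).
  apply/eq_in_map => k kt; rewrite /upd; case: eqP => // ki.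
  by rewrite ki (negbTE it) in kt.
apply/eq_in_map => k kt; rewrite /upd; case: eqP => // ki.
by rewrite ki (negbTE id) in kt.
Qed.

Lemma nth_mkl x (i : 'I_p) : (mkl x)`_i = x i.
Proof. by rewrite (nth_map i) ?size_enum_ord // nth_ord_enum. Qed.

Lemma mkl_inj_uniq x : uniq (mkl x) -> injective x.
Proof.
move=> xu i j xij; apply: val_inj => /=; apply/eqP.
rewrite -(nth_uniq 0 _ _ xu) ?size_mkl //.
by rewrite !nth_mkl xij.
Qed.

Lemma alt_tperm hh q u x (i j : 'I_p) : altform q hh u -> i != j ->
  u (mkl (x \o tperm i j)) = - u (mkl x).
Proof.
move=> [_ ul u3 _] ij.
have D z k a b : u (mkl (upd z k (a + b))) = u (mkl (upd z k a)) + u (mkl (upd z k b)).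
  by rewrite !mkl_upd slotD.
pose U2 a b := u (mkl (upd (upd x i a) j b)).
have U2C z a b : upd (upd z i a) j b = upd (upd z j b) i a.
  apply/funext => k; rewrite /upd; case: (eqVneq k j) => [->|//].
  by rewrite eq_sym (negbTE ij).
have U0 a : U2 a a = 0.
  apply: u3; apply/negP => /mkl_inj_uniq/(_ i j).
  by rewrite /upd eqxx (negbTE ij) eqxx => /(_ erefl) /eqP; rewrite (negbTE ij).
have Dl a b c : U2 (a + b) c = U2 a c + U2 b c by rewrite /U2 !U2C D.
have Dr a b c : U2 c (a + b) = U2 c a + U2 c b by rewrite /U2 D.
have := U0 (x i + x j); rewrite Dl !Dr !U0 addr0 add0r => /eqP; rewrite addr_eq0 => /eqP E.
have -> : u (mkl x) = U2 (x i) (x j).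
  congr (u (mkl _)); apply/funext => k; rewrite /upd.
  by case: eqP => [->//|_]; case: eqP => [->|].
rewrite E opprK; congr (u (mkl _)); apply/funext => k; rewrite /upd /=.
case: tpermP => [->|->|/eqP ki /eqP kj]; first by rewrite (negbTE ij) eqxx.
  by rewrite eqxx.
by rewrite (negbTE ki) (negbTE kj).
Qed.

Lemma alt_perm hh q u x (sg : 'S_p) : altform q hh u ->
  u (mkl (x \o sg)) = (-1) ^+ sg *: u (mkl x).
Proof.
move=> ua; have [ts -> dts] := prod_tpermP sg.
elim: ts x dts => [|[i j] ts IH] x /=.
  rewrite big_nil odd_perm1 scale1r => _; congr (u (mkl _)).
  by apply/funext => k; rewrite /= perm1.
move=> /andP[ij dts]; rewrite big_cons odd_mul_tperm /=.
rewrite -[X in mkl X](_ : (x \o (\prod_(t <- ts) tperm t.1 t.2)%g) \o tperm i j = _).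
  by rewrite (alt_tperm _ ua ij) IH // ij signr_addb expr1 mulN1r scaleNr.
by apply/funext => k; rewrite /= permM.
Qed.

End Perm.

Lemma mkl_nth s : mkl (fun i : 'I_(size s) => s`_i) = s.
Proof.
apply: (@eq_from_nth _ 0); rewrite ?size_mkl // => i il.
rewrite (nth_map (Ordinal il)) ?size_enum_ord //.
by rewrite (nth_ord_enum _ (Ordinal il)).
Qed.

Lemma alt_perm_list hh q u s (sg : 'S_(size s)) : altform q hh u ->
  u [seq s`_(sg i) | i <- enum 'I_(size s)] = (-1) ^+ sg *: u s.
Proof. by move=> ua; have := alt_perm (fun i : 'I_(size s) => s`_i) sg ua; rewrite mkl_nth. Qed.

Lemma alt_perm_eq hh q u s t : altform q hh u -> perm_eq s t -> u s = 0 -> u t = 0.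
Proof.
rewrite perm_sym => ua /(@tuple_permP _ _ t (in_tuple s))[sg E] us.
have -> : t = [seq s`_(sg i) | i <- enum 'I_(size s)].
  by rewrite E; apply: eq_map => i; rewrite (tnth_nth 0).
by rewrite (alt_perm_list _ ua) us scaler0.
Qed.

End Basic.

(** * Wedge products with a bilinear pairing of values *)

Section Wedge.
Variables (A B C : lmodType R) (mul : A -> B -> C).
Hypothesis mulL : forall a x y z, mul (a *: x + y) z = a *: mul x z + mul y z.
Hypothesis mulR : forall a x y z, mul z (a *: x + y) = a *: mul z x + mul z y.
Implicit Types (u : seq g -> A) (v : seq g -> B) (s : seq g).

Lemma bil0l z : mul 0 z = 0.
Proof. by have := mulL (-1) 0 0 z; rewrite scaler0 addr0 scaleN1r addNr. Qed.
Lemma bil0r z : mul z 0 = 0.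
Proof. by have := mulR (-1) 0 0 z; rewrite scaler0 addr0 scaleN1r addNr. Qed.
Lemma bilZl a x z : mul (a *: x) z = a *: mul x z.
Proof. by have := mulL a x 0 z; rewrite !addr0 bil0l addr0. Qed.
Lemma bilZr a x z : mul z (a *: x) = a *: mul z x.
Proof. by have := mulR a x 0 z; rewrite !addr0 bil0r addr0. Qed.

Definition plist s (sg : 'S_(size s)) := [seq s`_(sg i) | i <- enum 'I_(size s)].

Lemma plist_perm s (sg : 'S_(size s)) : perm_eq (plist sg) s.
Proof.
rewrite -[X in perm_eq _ X](mkl_nth s) /plist /mkl (map_comp (fun i : 'I_(size s) => s`_i) sg).
apply: perm_map; apply: uniq_perm; last 1 first; [|by rewrite map_inj_uniq ?enum_uniq //; exact: perm_inj|exact: enum_uniq].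
move=> i; rewrite mem_enum; apply/mapP; exists (sg^-1%g i); first by rewrite mem_enum.
by rewrite permKV.
Qed.

Lemma plist_count s (sg : 'S_(size s)) a : count a (plist sg) = count a s.
Proof. by move/seq.permP: (plist_perm sg) => ->. Qed.

Lemma wedgeE p u v s : wedge p mul u v s = (p`!%:R * (size s - p)`!%:R)^-1 *:
  \sum_(sg : 'S_(size s)) (-1) ^+ sg *: mul (u (take p (plist sg))) (v (drop p (plist sg))).
Proof. by []. Qed.

Lemma wedge_linearl p a u u' v s :
  wedge p mul (fun s => a *: u s + u' s) v s = a *: wedge p mul u v s + wedge p mul u' v s.
Proof.
rewrite !wedgeE [a *: (_ *: _)]scalerA (mulrC a) -scalerA -scalerDr; congr (_ *: _).
rewrite scaler_sumr -big_split; apply: eq_bigr => sg _ /=.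
by rewrite mulL scalerDr !scalerA mulrC.
Qed.

Lemma wedge_linearr p a u v v' s :
  wedge p mul u (fun s => a *: v s + v' s) s = a *: wedge p mul u v s + wedge p mul u v' s.
Proof.
rewrite !wedgeE [a *: (_ *: _)]scalerA (mulrC a) -scalerA -scalerDr; congr (_ *: _).
rewrite scaler_sumr -big_split; apply: eq_bigr => sg _ /=.
by rewrite mulR scalerDr !scalerA mulrC.
Qed.

Lemma wedge_eq p u u' v v' s : (forall s, u s = u' s) -> (forall s, v s = v' s) ->
  wedge p mul u v s = wedge p mul u' v' s.
Proof. by move=> /funext-> /funext->. Qed.

Lemma wedge0l p v s : wedge p mul (fun=> 0) v s = 0.
Proof. by rewrite wedgeE big1 ?scaler0 // => sg _; rewrite bil0l scaler0. Qed.
Lemma wedge0r p u s : wedge p mul u (fun=> 0) s = 0.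
Proof. by rewrite wedgeE big1 ?scaler0 // => sg _; rewrite bil0r scaler0. Qed.

Lemma wedgeZl p a u v s : wedge p mul (fun s => a *: u s) v s = a *: wedge p mul u v s.
Proof.
have := wedge_linearl p a u (fun=> 0) v s; rewrite wedge0l addr0 => <-.
by apply: wedge_eq => // t; rewrite addr0.
Qed.
Lemma wedgeZr p a u v s : wedge p mul u (fun s => a *: v s) s = a *: wedge p mul u v s.
Proof.
have := wedge_linearr p a u v (fun=> 0) s; rewrite wedge0r addr0 => <-.
by apply: wedge_eq => // t; rewrite addr0.
Qed.
Lemma wedgeDl p u u' v s : wedge p mul (fun s => u s + u' s) v s = wedge p mul u v s + wedge p mul u' v s.
Proof.
have := wedge_linearl p 1 u u' v s; rewrite scale1r => <-.
by apply: wedge_eq => // t; rewrite scale1r.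
Qed.
Lemma wedgeDr p u v v' s : wedge p mul u (fun s => v s + v' s) s = wedge p mul u v s + wedge p mul u v' s.
Proof.
have := wedge_linearr p 1 u v v' s; rewrite scale1r => <-.
by apply: wedge_eq => // t; rewrite scale1r.
Qed.
Lemma wedge_suml p I (r : seq I) (F : I -> seq g -> A) v s :
  wedge p mul (fun s => \sum_(i <- r) F i s) v s = \sum_(i <- r) wedge p mul (F i) v s.
Proof.
elim: r => [|i r IH].
  by rewrite big_nil -(wedge0l p v s); apply: wedge_eq => // t; rewrite big_nil.
by rewrite big_cons -IH -wedgeDl; apply: wedge_eq => // t; rewrite big_cons.
Qed.

(** Every summand feeds [p] of the vectors to [u]; with fewer than [p] of them outside [hu], one
    lies in [hu]. *)
Lemma wedge_vanishl p hu u v s : altform p hu u ->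
  (count (fun x => x \notin hu) s < p)%N -> wedge p mul u v s = 0.
Proof.
move=> [u1 _ _ u4] sp; rewrite wedgeE big1 ?scaler0 // => sg _.
rewrite (_ : u _ = 0) ?bil0l ?scaler0 //.
have [tp|pt] := ltnP (size (plist sg)) p.
  by apply: u1; rewrite (take_oversize (ltnW tp)) neq_ltn tp.
apply: u4; apply: contraTT sp; rewrite -all_predC => /allP h.
rewrite -leqNgt -(plist_count sg) -[X in (X <= _)%N](size_takel pt).
rewrite -[plist sg in X in (_ <= X)%N](cat_take_drop p) count_cat.
apply: leq_trans (leq_addr _ _); rewrite leq_eqVlt; apply/orP; left.
by rewrite eq_sym -all_count; apply/allP => x /h.
Qed.

Lemma wedge_vanishr p q hv u v s : altform q hv v ->
  (p < count (fun x => x \in hv) s)%N -> wedge p mul u v s = 0.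
Proof.
move=> [_ _ _ v4] sp; rewrite wedgeE big1 ?scaler0 // => sg _.
rewrite (_ : v _ = 0) ?bil0r ?scaler0 //.
apply: v4; apply: contraTT sp => h; rewrite -leqNgt -(plist_count sg).
rewrite -[plist sg](cat_take_drop p) count_cat.
have -> : count (fun x => x \in hv) (drop p (plist sg)) = 0%N.
  by apply/eqP; rewrite -leqn0 leqNgt -has_count.
rewrite addn0; apply: leq_trans (count_size _ _) _.
by rewrite size_take; case: ltnP.
Qed.

Lemma wedge0E q hv u v s : altform q hv v -> wedge 0 mul u v s = mul (u [::]) (v s).
Proof.
move=> va; rewrite wedgeE fact0 mul1r subn0.
transitivity (((size s)`!%:R)^-1 *: \sum_(sg : 'S_(size s)) mul (u [::]) (v s)).
  congr (_ *: _); apply: eq_bigr => sg _; rewrite take0 drop0 (alt_perm_list _ va) bilZr scalerA.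
  by rewrite -signr_addb addbb scale1r.
rewrite sumr_const card_Sn -[mul _ _ *+ _]scaler_nat scalerA mulVf ?scale1r //.
Qed.

(** The permutations are sorted by the position [i0] that receives the first letter. *)
Lemma sum_lift_perm n (F : 'S_n.+1 -> C) :
  \sum_sg F sg = \sum_(i0 < n.+1) \sum_(tau : 'S_n) F (lift_perm i0 ord0 tau).
Proof.
rewrite pair_big /= (reindex (fun x : 'I_n.+1 * 'S_n => lift_perm x.1 ord0 x.2)) //=.
apply: onW_bij; apply: inj_card_bij; last by rewrite card_prod card_ord !card_Sn factS.
move=> [i s] [j t] /= E.
have ij : i = j.
  by apply: (@perm_inj _ (lift_perm i ord0 s)); rewrite {2}E !lift_perm_id.
rewrite -{}ij in E *; congr pair; apply/permP => k.
by apply: (@lift_inj _ ord0); rewrite -!(lift_perm_lift i) E.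
Qed.

Lemma plist_lift X s (i0 : 'I_(size s).+1) (tau : 'S_(size s)) :
  @plist (X :: s) (lift_perm i0 ord0 tau) = take i0 (plist tau) ++ X :: drop i0 (plist tau).
Proof.
have st : size (plist tau) = size s by rewrite size_map size_enum_ord.
have i0s : (i0 <= size s)%N by rewrite -ltnS.
have sti : size (take i0 (plist tau)) = i0 by rewrite size_takel ?st.
apply: (@eq_from_nth _ 0).
  by rewrite size_cat sti /= size_drop st size_map size_enum_ord /= addnS subnKC.
rewrite size_map size_enum_ord => k kl.
pose k' := Ordinal kl; have -> : k = k' :> nat by [].
rewrite (nth_map k') ?size_enum_ord // nth_ord_enum; move: k' => {k kl} k.
case: (unliftP i0 k) => [j ->|->].
  rewrite lift_perm_lift lift0 /= nth_cat sti /bump.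
  have nj : s`_(tau j) = (plist tau)`_j by rewrite (nth_map j) ?size_enum_ord // nth_ord_enum.
  case: (leqP i0 j) => ij /=; last by rewrite add0n ij nth_take.
  by rewrite add1n ltnNge (leq_trans ij) //= subSn //= nth_drop subnKC.
by rewrite lift_perm_id nth_cat sti ltnn subnn.
Qed.

(** The permutations are sorted by the position given to [X]: one of the first [p] feeds it to [u],
    any other to [v], and the numbers of such positions absorb the change in the factorials. *)
Lemma wedge_cons p q hu hv u v X s : altform p hu u -> altform q hv v ->
  wedge p mul u v (X :: s) =
  wedge p.-1 mul (io X u) v s + (-1) ^+ p *: wedge p mul u (io X v) s.
Proof.
move=> ua va; case: p ua => [|p] ua /=.
  rewrite expr0 scale1r !(wedge0E _ _ va) (wedge0E _ _ (altform_io X va)) /io.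
  by have [u1 _ _ _] := ua; rewrite (u1 [:: X]) // bil0l add0r.
have [sp|ps] := ltnP (size s) p.
  have z (w : seq g -> A) k t (sg : 'S_(size t)) (v' : B) : (size t < k)%N -> altform k hu w ->
     (-1) ^+ sg *: mul (w (take k (plist sg))) v' = 0.
    move=> tk [w1 _ _ _]; rewrite w1 ?bil0l ?scaler0 //.
    by rewrite size_take size_map size_enum_ord ltnNge (ltnW tk) /= neq_ltn tk.
  rewrite !wedgeE !big1 ?scaler0 ?addr0 // => sg _.
  - by apply: z ua => //; rewrite ltnS ltnW.
  - by apply: z (altform_io X ua).
  - by apply: z ua => //.
have F n : (n`!%:R : R) != 0 by rewrite pnatr_eq0 -lt0n fact_gt0.
rewrite !wedgeE [\sum_(sg : 'S_(size (X :: s))) _]sum_lift_perm exchange_big /=.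
rewrite !scaler_sumr -big_split /=; apply: eq_bigr => tau _.
pose t := plist tau; rewrite -/t.
have st : size t = size s by rewrite size_map size_enum_ord.
(* Moving [X] to the front of its block cancels the dependence of the sign on [i0]; only the block
   in which [X] lands matters. *)
pose E i0 : C := if (i0 <= p)%N then (-1) ^+ tau *: mul (u (X :: take p t)) (v (drop p t))
   else (-1) ^+ tau *: ((-1) ^+ p.+1 *: mul (u (take p.+1 t)) (v (X :: drop p.+1 t))).
transitivity ((p.+1`!%:R * ((size s).+1 - p.+1)`!%:R)^-1 *: \sum_(i0 < (size s).+1) E i0).
  rewrite /E; congr (_ *: _); apply: eq_bigr => i0 _; rewrite plist_lift -/t odd_lift_perm addbF.
  rewrite signr_addb signr_odd.
  have i0s : (i0 <= size t)%N by rewrite st -ltnS.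
  have sti : size (take i0 t) = i0 by rewrite size_takel.
  rewrite take_cat drop_cat sti; case: (leqP i0 p) => [ip|pi].
    rewrite ltnNge (leq_trans ip (leqnSn p)) /= subSn //= (alt_front _ _ _ ua) sti.
    rewrite bilZl scalerA mulrAC -expr2 sqrr_sign mul1r.
    by rewrite take_drop subnK // -{1}(take_takel t ip) cat_take_drop drop_drop subnK.
  case: (ltnP p.+1 i0) => [pi'|ip'].
    rewrite (take_takel t (ltnW pi')) (alt_front _ _ _ va) size_drop sti bilZr !scalerA.
    congr (_ *: mul _ (v (X :: _))); last first.
      by rewrite -[in RHS](cat_take_drop i0 t) drop_cat sti pi'.
    have ss : (-1) ^+ (i0 - p.+1) * (-1) ^+ (i0 - p.+1) = 1 :> R by rewrite -expr2 sqrr_sign.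
    by rewrite -{1}(subnK (ltnW pi')) exprD mulrC !mulrA ss mul1r mulrC.
  have -> : nat_of_ord i0 = p.+1 by apply/eqP; rewrite eqn_leq pi ip'.
  by rewrite subnn take0 cats0 drop0 !scalerA mulrC.
rewrite -(big_mkord xpredT E) /E (@big_cat_nat _ _ _ p.+1) //=.
rewrite (eq_big_nat _ _ (F2 := fun=> (-1) ^+ tau *: mul (u (X :: take p t)) (v (drop p t)))); last first.
  by move=> i /andP[_]; rewrite ltnS => ->.
rewrite (@eq_big_nat _ _ _ p.+1 _ _ (fun=> (-1) ^+ tau *: ((-1) ^+ p.+1 *: mul (u (take p.+1 t)) (v (X :: drop p.+1 t))))); last first.
  by move=> i /andP[pi _]; rewrite leqNgt pi.
rewrite !sumr_const_nat subn0 !subSS scalerDr /io; congr (_ + _); rewrite -[(_ *: _) *+ _]scaler_nat !scalerA.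
  congr (_ *: _); rewrite factS natrM; have := F p; have := F (size s - p)%N.
  have : (p.+1%:R : R) != 0 by rewrite pnatr_eq0.
  move: (p.+1%:R : R) ((size s - p)`!%:R : R) (p`!%:R : R) ((-1) ^+ tau : R) => x y z e h1 h2 h3.
  by field; rewrite h1 h2 h3.
have [sp|ps'] := leqP (size s) p.
  have [u1 _ _ _] := ua; rewrite (u1 (take p.+1 t)) ?bil0l ?scaler0 //.
  by rewrite take_oversize st ?neq_ltn ?ltnS ?sp // ltnW ?ltnS.
congr (_ *: _); rewrite -(subnSK ps') (factS (size s - p.+1)) natrM; have := F p.+1; have := F (size s - p.+1)%N.
have : ((size s - p.+1).+1%:R : R) != 0 by rewrite pnatr_eq0.
move: ((size s - p.+1).+1%:R : R) ((size s - p.+1)`!%:R : R) (p.+1`!%:R : R) ((-1) ^+ tau : R) ((-1) ^+ p.+1 : R) => x y z e e' h1 h2 h3.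
by field; rewrite h1 h2 h3.
Qed.

Lemma wedge_size p q hu hv u v s : altform p hu u -> altform q hv v ->
  size s != (p + q)%N -> wedge p mul u v s = 0.
Proof.
move=> [u1 _ _ _] [v1 _ _ _] spq; rewrite wedgeE big1 ?scaler0 // => sg _.
have st : size (plist sg) = size s by rewrite size_map size_enum_ord.
have [sp|ps] := ltnP (size s) p.
  by rewrite u1 ?bil0l ?scaler0 // take_oversize st ?neq_ltn ?sp // ltnW.
rewrite v1 ?bil0r ?scaler0 // size_drop st; apply: contraNneq spq => <-.
by rewrite subnKC.
Qed.

Lemma altform0_io p hh (D : lmodType R) (u : seq g -> D) X : altform p hh u -> p = 0%N -> forall s, io X u s = 0.
Proof. by move=> [u1 _ _ _] p0 s; rewrite /io u1 // p0. Qed.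

Lemma wedge_alt p q hh u v : altform p hh u -> altform q hh v ->
  altform (p + q) hh (wedge p mul u v).
Proof.
move: {-1}(p + q)%N (erefl (p + q)%N) => N.
elim: N p q u v => [|N IH] p q u v pq ua va.
  have [p0 q0] : p = 0%N /\ q = 0%N by case: (p) (q) pq => [|?] [|?].
  have z X s : wedge p mul u v (X :: s) = 0 by rewrite (wedge_size ua va) // pq.
  have zz X : altform 0.-1 hh (io X (wedge p mul u v)).
    by apply: altform_eq (altform0 _ 0 hh) => s; rewrite /io z.
  by apply: altform_cons => //= s a x y; rewrite !z scaler0 addr0.
have u2 := let: And4 _ u2 _ _ := ua in u2; have v2 := let: And4 _ v2 _ _ := va in v2.
apply: altform_cons => //=.
- by move=> _; rewrite (wedge_size ua va) // pq.
- move=> X; have [p0|p0] := posnP p.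
    have q1 : (p + q.-1)%N = N by move: pq; rewrite p0 !add0n => ->.
    apply: altform_eq (IH _ _ _ _ q1 ua (altform_io X va)) => s.
    rewrite /io (wedge_cons _ _ ua va) (wedge_eq _ s (altform0_io X ua p0) (fun=> erefl)) wedge0l add0r.
    by rewrite p0 scale1r.
  have [q0|q0] := posnP q.
    have p1 : (p.-1 + q)%N = N by move: pq; rewrite q0 !addn0 => ->.
    apply: altform_eq (IH _ _ _ _ p1 (altform_io X ua) va) => s.
    rewrite /io (wedge_cons _ _ ua va) (wedge_eq p s (fun=> erefl) (altform0_io X va q0)) wedge0r.
    by rewrite scaler0 addr0.
  have p1 : (p.-1 + q)%N = N by case: (p) p0 pq => //= n _ [].
  have q1 : (p + q.-1)%N = N by case: (q) q0 pq => //= n _; rewrite addnS => -[].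
  apply: altform_eq (altformD (IH _ _ _ _ p1 (altform_io X ua) va)
    (altformZ ((-1) ^+ p) (IH _ _ _ _ q1 ua (altform_io X va)))) => s.
  by rewrite /io (wedge_cons _ _ ua va).
- move=> s a x y; rewrite !(wedge_cons _ _ ua va).
  have -> : wedge p.-1 mul (io (a *: x + y) u) v s = a *: wedge p.-1 mul (io x u) v s + wedge p.-1 mul (io y u) v s.
    by rewrite -wedge_linearl; apply: wedge_eq => // t; exact: (u2 [::]).
  have -> : wedge p mul u (io (a *: x + y) v) s = a *: wedge p mul u (io x v) s + wedge p mul u (io y v) s.
    by rewrite -wedge_linearr; apply: wedge_eq => // t; exact: (v2 [::]).
  move: (wedge _ _ _ _ _) (wedge _ _ _ _ _) (wedge _ _ _ _ _) (wedge _ _ _ _ _) => w1 w2 w3 w4.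
  rewrite !scalerDr !scalerA (mulrC a) -!addrA; congr (_ + _).
  by rewrite addrCA.
- move=> X s; rewrite (wedge_cons _ _ ua va) (wedge_cons _ _ (altform_io X ua) va)
    (wedge_cons _ _ ua (altform_io X va)).
  have u3 := let: And4 _ _ u3 _ := ua in u3; have v3 := let: And4 _ _ v3 _ := va in v3.
  have uu t : io X (io X u) t = 0 by rewrite /io u3 //= inE eqxx.
  have vv t : io X (io X v) t = 0 by rewrite /io v3 //= inE eqxx.
  rewrite (wedge_eq _ _ uu (fun=> erefl)) (wedge_eq _ _ (fun=> erefl) vv) wedge0l wedge0r scaler0 addr0 add0r.
  have [p0|p0] := posnP p.
    by rewrite (wedge_eq _ s (altform0_io X ua p0) (fun=> erefl)) wedge0l !scaler0 addr0.
  by rewrite -scalerDl -{2}(prednK p0) exprS mulN1r addrN scale0r.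
- move=> X s Xh; rewrite (wedge_cons _ _ ua va).
  rewrite (wedge_eq _ s (fun t => altform_io_hh t ua Xh) (fun=> erefl)).
  by rewrite (wedge_eq p s (fun=> erefl) (fun t => altform_io_hh t va Xh)) wedge0l wedge0r scaler0 addr0.
Qed.

(** Vectors of [hv] are annihilated by [v], so [u] has to take all of them. *)
Lemma wedge_catr p q hu hv u v s t : altform p hu u -> altform q hv v ->
  all (fun x => x \in hv) s -> (size s <= p)%N ->
  wedge p mul u v (s ++ t) = wedge (p - size s) mul (fun t => u (s ++ t)) v t.
Proof.
move=> ua va; elim: s p u ua => [|X s IH] p u ua /=; first by rewrite subn0.
move=> /andP[Xv sv] sp; rewrite (wedge_cons _ _ ua va).
rewrite (wedge_eq p _ (fun=> erefl) (fun t => altform_io_hh t va Xv)) wedge0r scaler0 addr0.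
rewrite (IH _ _ (altform_io X ua)) //; last by case: p sp {ua}.
by rewrite subnS predn_sub.
Qed.

(** The tail is annihilated by [u], which therefore takes exactly the head; neither a sign nor a
    factorial survives. *)
Lemma wedge_catl p q hu hv u v s t : altform p hu u -> altform q hv v ->
  all (fun x => x \in hu) t -> size s = p ->
  wedge p mul u v (s ++ t) = mul (u s) (v t).
Proof.
move=> ua va tu; elim: s p u ua => [|X s IH] p u ua /= sp.
  by rewrite -sp in ua *; rewrite (wedge0E _ _ va).
have sp' : p.-1 = size s by rewrite -sp.
rewrite (wedge_cons _ _ ua va) (IH _ _ (altform_io X ua)) //.
rewrite (_ : wedge p mul u (io X v) (s ++ t) = 0).
  by rewrite scaler0 addr0.
apply: (wedge_vanishl _ ua).
rewrite count_cat (_ : count _ t = 0%N); first by rewrite addn0 -sp ltnS count_size.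
by apply/eqP; rewrite -leqn0 leqNgt -has_count -all_predC; apply/allP => x /(allP tu) /= ->.
Qed.

Lemma wedge_catE p q hu hv u v s t : altform p hu u -> altform q hv v ->
  all (fun x => x \in hv) s -> size s = p ->
  wedge p mul u v (s ++ t) = mul (u s) (v t).
Proof.
move=> ua va sv sp; rewrite (wedge_catr _ ua va sv) ?sp // subnn.
by rewrite (wedge0E _ _ va) cats0.
Qed.

End Wedge.

(** * The Killing form and dual frames *)

Section Killing.
Implicit Types X Y Z : g.

Lemma KFE : @killing R G = @KF R G. Proof. by rewrite KF.unlock. Qed.

Lemma KF_trop X Y : K X Y = trop (fun x : g => LB Y (LB X x)).
Proof.
by have L := @lie_linear; rewrite KF.unlock /killing LBE /trop (lin1_comp (L Y) (L X)).
Qed.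

Lemma KFC X Y : K X Y = K Y X.
Proof. by have L := @lie_linear; rewrite !KF_trop trop_comp. Qed.

Lemma KF_linearl a X Y Z : K (a *: X + Y) Z = a * K X Z + K Y Z.
Proof.
rewrite !KF_trop -tropZ -tropD; apply: trop_ext => x.
by rewrite lie_linearl lie_linear.
Qed.
Lemma KFDl X Y Z : K (X + Y) Z = K X Z + K Y Z.
Proof. by have := KF_linearl 1 X Y Z; rewrite scale1r mul1r. Qed.
Lemma KF0l Z : K 0 Z = 0.
Proof. by have := KF_linearl (-1) 0 0 Z; rewrite scaler0 addr0 mulN1r addNr. Qed.
Lemma KFZl a X Z : K (a *: X) Z = a * K X Z.
Proof. by have := KF_linearl a X 0 Z; rewrite !addr0 KF0l addr0. Qed.
Lemma KFNl X Z : K (- X) Z = - K X Z.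
Proof. by rewrite -scaleN1r KFZl mulN1r. Qed.
Lemma KFBl X Y Z : K (X - Y) Z = K X Z - K Y Z.
Proof. by rewrite KFDl KFNl. Qed.
Lemma KFDr X Y Z : K Z (X + Y) = K Z X + K Z Y.
Proof. by rewrite !(KFC Z) KFDl. Qed.
Lemma KF0r Z : K Z 0 = 0. Proof. by rewrite KFC KF0l. Qed.
Lemma KFZr a X Z : K Z (a *: X) = a * K Z X. Proof. by rewrite !(KFC Z) KFZl. Qed.
Lemma KFNr X Z : K Z (- X) = - K Z X. Proof. by rewrite !(KFC Z) KFNl. Qed.
Lemma KFBr X Y Z : K Z (X - Y) = K Z X - K Z Y.
Proof. by rewrite KFDr KFNr. Qed.
Lemma KF_sumr I (r : seq I) (F : I -> g) Z : K Z (\sum_(i <- r) F i) = \sum_(i <- r) K Z (F i).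
Proof. by elim: r => [|i r IH]; rewrite ?big_nil ?KF0r // !big_cons KFDr IH. Qed.
Lemma KF_suml I (r : seq I) (F : I -> g) Z : K (\sum_(i <- r) F i) Z = \sum_(i <- r) K (F i) Z.
Proof. by rewrite KFC KF_sumr; apply: eq_bigr => i _; rewrite KFC. Qed.

(** Jacobi's identity and the cyclicity of the trace. *)
Lemma KF_inv X Y Z : K (LB Z X) Y = - K X (LB Z Y).
Proof.
have L := @lie_linear.
apply/eqP; rewrite -addr_eq0 !KF_trop -tropD.
rewrite (trop_ext (S := fun x => LB Y (LB Z (LB X x)) - LB Y (LB X (LB Z x)) + (LB Z (LB Y (LB X x)) - LB Y (LB Z (LB X x))))).
  rewrite (trop_ext (S := fun x => LB Z (LB Y (LB X x)) + -1 *: LB Y (LB X (LB Z x)))).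
    rewrite tropD tropZ mulN1r subr_eq0; apply/eqP.
    by apply: (trop_comp (T := LB Z) (S := fun x => LB Y (LB X x))); rewrite //; exact: linear_comp.
  by move=> x; rewrite scaleN1r addrC addrA subrK.
by move=> x; rewrite !lie_jacobi // lieDr lieNr.
Qed.

Lemma KF_auto (phi psi : g -> g) : linear phi -> linear psi -> cancel phi psi -> cancel psi phi ->
  (forall X Y, phi (LB X Y) = LB (phi X) (phi Y)) -> forall X Y, K (phi X) (phi Y) = K X Y.
Proof.
move=> pl ql pK qK pB X Y; rewrite !KF_trop; have L := @lie_linear.
rewrite (trop_ext (S := fun x => phi (LB Y (LB X (psi x))))).
  rewrite (trop_comp (T := phi) (S := fun x => LB Y (LB X (psi x)))) //; last first.
    by apply: linear_comp => //; exact: linear_comp.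
  by apply: trop_ext => x; rewrite pK.
by move=> x; rewrite !pB qK.
Qed.

Lemma KF_Ad x X Y : K (AD x X) (AD x Y) = K X Y.
Proof.
apply: (KF_auto (psi := AD x^-1%g)); [exact: Ad_linear|exact: Ad_linear|exact: AdK|exact: AdVK|].
by move=> A B; exact: Ad_lie.
Qed.

Lemma KF_theta X Y : K (theta X) (theta Y) = K X Y.
Proof.
have [T2 Tl _] := Tcartan; rewrite LBE in Tl.
by apply: (KF_auto (psi := theta)) => // a u v; exact: linearP.
Qed.

Lemma KF_neg X : X != 0 -> K X (theta X) < 0.
Proof. by have [_ _ Tk] := Tcartan => /Tk; rewrite KFE. Qed.

Lemma KF_nondeg X : (forall Y, K X Y = 0) -> X = 0.
Proof. by move=> h; apply/eqP; apply: contraT => /KF_neg; rewrite h ltxx. Qed.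

Lemma KF_mx X Y : K X Y = (X *m (\matrix_(i, j) K (delta_mx 0 i) (delta_mx 0 j)) *m Y^T) 0 0.
Proof.
rewrite [in LHS](row_sum_delta X) KF_suml -mulmxA mxE; apply: eq_bigr => i _.
rewrite KFZl; congr (_ * _); rewrite mxE [in LHS](row_sum_delta Y) KF_sumr.
by apply: eq_bigr => j _; rewrite KFZr !mxE mulrC.
Qed.

Lemma KF_repr (c : g -> R) : (forall a X Y, c (a *: X + Y) = a * c X + c Y) ->
  exists F, forall X, K F X = c X.
Proof.
move=> cl; pose B : 'M[R]_d := \matrix_(i, j) K (delta_mx 0 i) (delta_mx 0 j).
have Bu : B \in unitmx.
  rewrite -row_free_unit -kermx_eq0; apply/eqP/row_matrixP => i; rewrite row0.
  apply: KF_nondeg => Y; rewrite KF_mx -/B (sub_kermxP (row_sub i (kermx B))).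
  by rewrite mul0mx mxE.
have c0 : c 0 = 0 by have := cl (-1) 0 0; rewrite scaler0 addr0 mulN1r addNr.
exists ((\row_j c (delta_mx 0 j)) *m invmx B) => X.
rewrite KF_mx -/B mulmxKV // mxE {2}(row_sum_delta X).
have cs I (r : seq I) (a : I -> R) (F : I -> g) : c (\sum_(i <- r) a i *: F i) = \sum_(i <- r) a i * c (F i).
  by elim: r => [|i r IH]; rewrite ?big_nil ?c0 // !big_cons cl IH.
by rewrite cs; apply: eq_bigr => j _; rewrite !mxE mulrC.
Qed.

(** [E] represents a basis of [g / hh], and [F] is the dual basis of the annihilator of [hh],
    covectors being represented by vectors through the Killing form. *)
Definition dual_frame (hh : {vspace g}) n (E F : 'I_n -> g) :=
  [/\ forall i X, X \in hh -> K (F i) X = 0, forall i j, K (F i) (E j) = (i == j)%:R &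
      forall X, X - \sum_i K (F i) X *: E i \in hh].

(** A complement of [hh] is found inside [U]. With [k] and [p] in the roles of [hh] and [U], and
    conversely, this separates the two directions of G/M. *)
Lemma dual_frame_exists (hh U : {vspace g}) : (hh + U)%VS = fullv ->
  exists E F : 'I_(d - \dim hh) -> g, dual_frame hh E F /\ forall i, E i \in U.
Proof.
move=> hU; pose C := (U :\: hh)%VS.
have Ch : (C :&: hh = 0)%VS := capv_diff U hh.
have CD : (C + hh)%VS = fullv by rewrite addv_diff addvC.
have dC : \dim C = (d - \dim hh)%N.
  have := dimv_disjoint_sum Ch; rewrite CD dimvf /= => E.
  by rewrite -(addnK (\dim hh) (\dim C)) -E /dim /= mul1n.
rewrite -dC.
have hC : (hh :&: C = 0)%VS by rewrite capvC.
pose cc i (X : g) : R := coord (vbasis C) i (daddv_pi C hh X).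
have FE i : exists f, forall X, K f X = cc i X.
  by apply: KF_repr => a X Y; rewrite /cc !linearP.
have [F FP] := choice FE.
exists (fun i => (vbasis C)`_i), F; split; last first.
  move=> i; apply: (subvP (diffvSl U hh)); apply: vbasis_mem; apply: mem_nth.
  by rewrite size_tuple.
have Cm (i : 'I_(\dim C)) : (vbasis C)`_i \in C by apply: vbasis_mem; apply: mem_nth; rewrite size_tuple.
split=> [i X Xh|i j|X].
- rewrite FP /cc.
  have := daddv_pi_add Ch (w := X); rewrite CD memvf (daddv_pi_id hC Xh) => /(_ isT)/eqP.
  by rewrite addrC -subr_eq0 addrAC subrr add0r => /eqP->; rewrite linear0.
- rewrite FP /cc daddv_pi_id // coord_free ?(basis_free (vbasisP C)) // eq_sym //.
have D := daddv_pi_add Ch (w := X) (eq_ind_r (fun V : {vspace g} => X \in V) (memvf X) CD).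
under eq_bigr do rewrite FP /cc.
rewrite -(coord_vbasis (memv_pi C hh X)) -{1}D addrAC subrr add0r; exact: memv_pi.
Qed.

End Killing.

Lemma mkl0 (x : 'I_0 -> g) : mkl x = [::].
Proof. by apply: size0nil; rewrite size_mkl. Qed.

Lemma mklS p (x : 'I_p.+1 -> g) : mkl x = x ord0 :: mkl (fun k => x (lift ord0 k)).
Proof. by rewrite /mkl enum_ordSl /= -map_comp. Qed.

(** All tuples of frame vectors are summed, repetitions included; on an expression symmetric in the
    tuple and vanishing on repetitions this is [p!] times the sum over increasing tuples. *)
Definition fsum (T : finType) (A : nmodType) (E : T -> g) (p : nat) (F : seq g -> A) : A :=
  \sum_(I : {ffun 'I_p -> T}) F (mkl (fun k => E (I k))).

Section Fsum.
Variables (T : finType) (A : nmodType) (E : T -> g).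
Implicit Types F : seq g -> A.

Lemma sum_ffunS p (F : {ffun 'I_p.+1 -> T} -> A) :
  \sum_I F I = \sum_i \sum_(I : {ffun 'I_p -> T}) F [ffun k => oapp I i (unlift ord0 k)].
Proof.
rewrite pair_big /=.
rewrite (reindex (fun x : T * {ffun 'I_p -> T} => [ffun k => oapp x.2 x.1 (unlift ord0 k)])) //=.
exists (fun f => (f ord0, [ffun k => f (lift ord0 k)])) => [[i I] _|f _] /=.
  rewrite ffunE unlift_none /=; congr pair; apply/ffunP => k.
  by rewrite !ffunE liftK.
by apply/ffunP => k; rewrite ffunE; case: unliftP => [j ->|->]; rewrite /= ?ffunE.
Qed.

Lemma fsum0 F : fsum E 0 F = F [::].
Proof.
rewrite /fsum (big_pred1 [ffun k : 'I_0 => match k with Ordinal m H => False_rect T (notF H) end]).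
  by rewrite mkl0.
by move=> f; apply/esym/eqP/ffunP => -[].
Qed.

Lemma fsumS p F : fsum E p.+1 F = \sum_i fsum E p (fun s => F (E i :: s)).
Proof.
rewrite /fsum sum_ffunS; apply: eq_bigr => i _; apply: eq_bigr => I _.
rewrite mklS ffunE unlift_none /=; congr (F (_ :: mkl _)).
by apply/funext => k; rewrite ffunE liftK.
Qed.

Lemma eq_fsum p F F' : (forall s, size s = p -> all (fun x => x \in [seq E i | i : T]) s -> F s = F' s) -> fsum E p F = fsum E p F'.
Proof.
move=> FF; apply: eq_bigr => I _; apply: FF; first exact: size_mkl.
by apply/allP => x /mapP[k _ ->]; apply: map_f; rewrite mem_enum.
Qed.

Lemma fsum_ext p F F' : (forall s, size s = p -> F s = F' s) -> fsum E p F = fsum E p F'.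
Proof. by move=> FF; apply: eq_fsum => s sp _; exact: FF. Qed.

Lemma fsum_cat p q F : fsum E (p + q) F = fsum E p (fun s => fsum E q (fun t => F (s ++ t))).
Proof.
elim: p F => [|p IH] F; first by rewrite fsum0.
by rewrite addSn !fsumS; apply: eq_bigr => i _; rewrite IH.
Qed.

Lemma fsum_sum p I (r : seq I) (F : I -> seq g -> A) :
  fsum E p (fun s => \sum_(i <- r) F i s) = \sum_(i <- r) fsum E p (F i).
Proof. exact: exchange_big. Qed.

End Fsum.

Lemma fsumZ (T : finType) (A : lmodType R) (E : T -> g) p a (F : seq g -> A) :
  fsum E p (fun s => a *: F s) = a *: fsum E p F.
Proof. by rewrite /fsum scaler_sumr. Qed.

Lemma fsum_lin (T : finType) (A B : nmodType) (E : T -> g) p (F : seq g -> A) (L : A -> B) :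
  L 0 = 0 -> {morph L : x y / x + y} -> L (fsum E p F) = fsum E p (fun s => L (F s)).
Proof. by move=> L0 LD; rewrite /fsum (big_morph L LD L0). Qed.

Lemma nth_del i (s : seq g) k : (del i s)`_k = s`_(bump i k).
Proof.
rewrite /del nth_cat size_take /bump; case: (ltnP i (size s)) => [is_|si].
  case: (ltnP k i) => ki; first by rewrite nth_take.
  by rewrite nth_drop addSn subnKC // add1n.
case: (ltnP k (size s)) => ks.
  by rewrite (leqNgt i k) (leq_trans ks si) take_oversize.
rewrite (drop_oversize (leqW si)) nth_nil nth_default //.
by case: (i <= k)%N; [exact: leqW|].
Qed.

Lemma size_del i (s : seq g) : (i < size s)%N -> size (del i s) = (size s).-1.
Proof.
move=> is_; rewrite size_cat size_takel ?(ltnW is_) // size_drop.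
by case: (size s) is_ => // n; rewrite ltnS subSS => /subnKC.
Qed.

Lemma del_cons i x (s : seq g) : del i.+1 (x :: s) = x :: del i s.
Proof. by []. Qed.

Lemma del0 x (s : seq g) : del 0 (x :: s) = s.
Proof. by rewrite /del /= drop0. Qed.

Lemma del_del i j (s : seq g) : (i <= j)%N -> del j (del i s) = del i (del j.+1 s).
Proof.
elim: s i j => [|x s IH] [|i] [|j] //; rewrite ?del_cons ?del0 //.
by rewrite ltnS => /IH->.
Qed.

(** Indices of two successive deletions, the second counted in the shortened list, are regrouped by
    the unordered pair of positions that disappear. *)
Lemma sum_pairs (V : nmodType) n (F : nat -> nat -> V) :
  \sum_(i < n.+1) \sum_(j < n) F i j = \sum_(j < n.+1) \sum_(i < j) (F j i + F i j.-1).
Proof.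
elim: n => [|n IH]; first by rewrite !big_ord1 !big_ord0.
rewrite [RHS]big_ord_recr -IH /= big_ord_recr /=.
under eq_bigr do rewrite big_ord_recr.
by rewrite !big_split /= -addrA; congr (_ + _); rewrite addrC.
Qed.

(** * Decomposable forms *)

Section Decomp.
Variable A : lmodType R.
Implicit Types (Z s : seq g) (v : A).

Lemma decompE Z v s : decomp Z v s = if size s == size Z then
    \det (\matrix_(i < size Z, j < size Z) K Z`_i s`_j) *: v else 0.
Proof. by rewrite /decomp KFE. Qed.

Lemma decomp_mkl p (z x : 'I_p -> g) v :
  decomp (mkl z) v (mkl x) = \det (\matrix_(i, j) K (z i) (x j)) *: v.
Proof.
rewrite decompE !size_mkl eqxx.
suff E N : N = p -> \det (\matrix_(i < N, j < N) K (mkl z)`_i (mkl x)`_j) = \det (\matrix_(i, j) K (z i) (x j)).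
  by rewrite E // size_mkl.
by move=> ->; congr (\det _); apply/matrixP => i j; rewrite !mxE !nth_mkl.
Qed.

Lemma decomp_slot Z v : slot_linear (decomp Z v).
Proof.
move=> s1 s2 a x y; rewrite !decompE !size_cat /=.
case: eqP => // [sz|_]; last by rewrite scaler0 addr0.
rewrite scalerA -scalerDl; congr (_ *: _).
have i0P : (size s1 < size Z)%N by rewrite -sz -addSnnS leq_addr.
pose i0 := Ordinal i0P; pose M z := \matrix_(i < size Z, j < size Z) K Z`_i (s1 ++ z :: s2)`_j.
rewrite -/(M (a *: x + y)) -/(M x) -/(M y) -(det_tr (M x)) -(det_tr (M y)) -(det_tr (M _)).
rewrite -[\det (M y)^T]mul1r.
apply: (determinant_multilinear (i0 := i0)).
- apply/rowP => j; rewrite !mxE !nth_cat ltnn subnn /= KFC KF_linearl.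
  by rewrite !(KFC Z`_j) mul1r.
- apply/matrixP => i j; rewrite !mxE !nth_cat /= /bump; case: (ltnP _ (size s1)) => // h.
  by move: h; case: (leqP (size s1) i) => [si _|si]; [rewrite /= add1n subSn|rewrite add0n leqNgt si].
- apply/matrixP => i j; rewrite !mxE !nth_cat /= /bump; case: (ltnP _ (size s1)) => // h.
  by move: h; case: (leqP (size s1) i) => [si _|si]; [rewrite /= add1n subSn|rewrite add0n leqNgt si].
Qed.

Lemma decomp_alt (hh : {vspace g}) Z v : (forall z X, z \in Z -> X \in hh -> K z X = 0) ->
  altform (size Z) hh (decomp Z v).
Proof.
move=> Zh; split=> [s sZ||s su|s /hasP[X Xs Xh]].
- by rewrite decompE (negbTE sZ).
- exact: decomp_slot.
- rewrite decompE; case: eqP => // sz.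
  have [i [j [iZ jZ ij sij]]] : exists i j, [/\ (i < size Z)%N, (j < size Z)%N, i != j & s`_i = s`_j].
    move/(uniqPn 0): su => [i [j [ij js sij]]]; exists i, j; rewrite -sz; split=> //; first exact: ltn_trans js.
    by rewrite neq_ltn ij.
  rewrite -det_tr (determinant_alternate (i1 := Ordinal iZ) (i2 := Ordinal jZ)) ?scale0r //.
  by move=> k; rewrite !mxE /= sij.
have /path.splitPr[s1 s2] := Xs.
transitivity (decomp Z v (s1 ++ 0 :: s2)); last exact: (slot0 _ _ (@decomp_slot Z v)).
rewrite !decompE !size_cat /=; case: eqP => // sz; congr (\det _ *: _).
apply/matrixP => i j; rewrite !mxE !nth_cat; case: ltnP => // h.
case: (nat_of_ord j - size s1)%N => //=; rewrite KF0r Zh //.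
exact: mem_nth.
Qed.

(** Laplace expansion of the determinant along the column of [X]. *)
Lemma decomp_io Z v X s : decomp Z v (X :: s) =
  \sum_(k < size Z) (-1) ^+ k *: (K Z`_k X *: decomp (del k Z) v s).
Proof.
have [sz|sz] := eqVneq (size s).+1 (size Z); last first.
  rewrite decompE /= (negbTE sz) big1 // => k _; rewrite decompE size_del //.
  case: eqP => [h|_]; last by rewrite !scaler0.
  by case/eqP: sz; rewrite h prednK // (leq_ltn_trans _ (ltn_ord k)).
have sz' : size s = (size Z).-1 by rewrite -sz.
have i0P : (0 < size Z)%N by rewrite -sz.
rewrite decompE /= sz eqxx (expand_det_col _ (Ordinal i0P)) scaler_suml.
apply: eq_bigr => k _; rewrite decompE size_del // sz' eqxx !scalerA; congr (_ *: _).
rewrite mxE /cofactor /= addn0 [_ * ((-1) ^+ _ * _)]mulrCA -!mulrA; congr (_ * (_ * _)).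
suff E N (f : 'M[R]_N) M (h : nat -> nat -> R) : N.-1 = M -> (forall i j, f i j = h i j) ->
   forall k k', \det (row' k (col' k' f)) = \det (\matrix_(i < M, j < M) h (bump k i) (bump k' j)).
  rewrite (E _ _ (size Z).-1 (fun i j => K Z`_i (X :: s)`_j)) //; last by move=> i j; rewrite !mxE.
  by congr (\det _); apply/matrixP => i j; rewrite !mxE nth_del.
by move=> <- fh k1 k2; congr (\det _); apply/matrixP => i j; rewrite !mxE fh.
Qed.

End Decomp.

(** * Expansions in a dual frame *)

Section DualFrames.
Variables (hh : {vspace g}) (n : nat) (E F : 'I_n -> g).
Hypothesis EF : dual_frame hh E F.

Lemma frame_Fh i X : X \in hh -> K (F i) X = 0. Proof. by case: EF => h _ _; exact: h. Qed.
Lemma frame_FE i j : K (F i) (E j) = (i == j)%:R. Proof. by case: EF. Qed.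
Lemma frame_mod X : X - \sum_i K (F i) X *: E i \in hh. Proof. by case: EF. Qed.

Section Slot.
Variable A : lmodType R.

Lemma frame_slot (L : g -> A) X : {morph L : x y / x + y} -> (forall a x, L (a *: x) = a *: L x) ->
  (forall Y, Y \in hh -> L Y = 0) -> L X = \sum_i K (F i) X *: L (E i).
Proof.
move=> LD LZ Lh; have /Lh := frame_mod X.
have -> : L (X - \sum_i K (F i) X *: E i) = L X - L (\sum_i K (F i) X *: E i).
  by rewrite LD -[- \sum_i _]scaleN1r LZ scaleN1r.
move/eqP; rewrite subr_eq0 => /eqP->.
rewrite (big_morph L LD (id1 := 0)); last by rewrite -(scale0r 0) LZ scale0r.
by apply: eq_bigr => i _; rewrite LZ.
Qed.

End Slot.

Lemma frame_dual Z : (forall X, X \in hh -> K Z X = 0) -> Z = \sum_i K Z (E i) *: F i.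
Proof.
move=> Zh; apply/eqP; rewrite -subr_eq0; apply/eqP; apply: KF_nondeg => Y.
rewrite KFBl KF_suml.
have := frame_slot (L := fun X => K Z X : R^o) Y (fun a b => KFDr a b Z).
move=> ->; [|by move=> a x; rewrite (KFZr)|exact: Zh].
apply/eqP; rewrite subr_eq0; apply/eqP; apply: eq_bigr => i _.
by rewrite KFZl /GRing.scale /= mulrC.
Qed.

Section Values.
Variable A : lmodType R.
Implicit Types (u b : seq g -> A).

Lemma frame_slot_alt p u s1 s2 X : altform p hh u ->
  u (s1 ++ X :: s2) = \sum_i K (F i) X *: u (s1 ++ E i :: s2).
Proof.
move=> [_ ul _ uh]; apply: (frame_slot (L := fun Y => u (s1 ++ Y :: s2))).
- by move=> x y; exact: slotD.
- by move=> a x; exact: slotZ.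
- by move=> Y Yh; apply: uh; rewrite has_cat /= Yh orbT.
Qed.

Lemma frame_expand p q b (x : 'I_p -> g) : altform q hh b ->
  b (mkl x) = \sum_(I : {ffun 'I_p -> 'I_n}) (\prod_k K (F (I k)) (x k)) *: b (mkl (fun k => E (I k))).
Proof.
elim: p q b x => [|p IH] q b x ba.
  rewrite (big_pred1 [ffun k : 'I_0 => match k with Ordinal m H => False_rect 'I_n (notF H) end]).
    by rewrite big_ord0 scale1r !mkl0.
  by move=> f; apply/esym/eqP/ffunP => -[].
rewrite mklS (frame_slot_alt [::] _ _ ba) sum_ffunS; apply: eq_bigr => i _ /=.
rewrite -[b (E i :: _)]/(io (E i) b _) (IH _ _ _ (altform_io (E i) ba)) scaler_sumr.
apply: eq_bigr => I _; rewrite scalerA big_ord_recl mklS /io !ffunE unlift_none /=.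
have e k : [ffun k => oapp I i (unlift ord0 k)] (lift ord0 k) = I k by rewrite ffunE liftK.
have -> : mkl (fun k : 'I_p => E ([ffun k0 => oapp I i (unlift ord0 k0)] (lift ord0 k))) = mkl (fun k => E (I k)).
  by congr mkl; apply/funext => k; congr (E _); exact: e.
by congr (_ * _ *: _); apply: eq_bigr => k _; congr (K (F _) _); exact/esym/e.
Qed.

Lemma altform_over p u s : altform p hh u -> (n < p)%N -> u s = 0.
Proof.
move=> ua np; have [sp|sp] := eqVneq (size s) p; last by case: ua => h _ _ _; exact: h.
have -> : s = mkl (fun i : 'I_p => s`_i).
  by rewrite -[in LHS](mkl_nth s); move: sp => <-.
rewrite (frame_expand _ ua) big1 // => I _.
case: ua => _ _ h _; rewrite h ?scaler0 //; apply: contraL np => /mkl_inj_uniq EI.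
rewrite -leqNgt; have II : injective I by move=> i j ij; apply: EI; rewrite ij.
by have := leq_card I II; rewrite !card_ord.
Qed.

Lemma altform_frame_eq p u u' : altform p hh u -> altform p hh u' ->
  (forall I : {ffun 'I_p -> 'I_n}, u (mkl (fun k => E (I k))) = u' (mkl (fun k => E (I k)))) ->
  forall s, u s = u' s.
Proof.
move=> ua va uv s; have [sp|sp] := eqVneq (size s) p; last first.
  by case: ua va => h _ _ _ [h' _ _ _]; rewrite h // h'.
have -> : s = mkl (fun i : 'I_p => s`_i).
  by rewrite -[in LHS](mkl_nth s); move: sp => <-.
by rewrite (frame_expand _ ua) (frame_expand _ va); apply: eq_bigr => I _; rewrite uv.
Qed.

(** Averaging the plain expansion over the permutations of the arguments turns products of
    coordinates into determinants; the average is the origin of [1 / p!]. *)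
Lemma decomp_expand p b s : altform p hh b ->
  b s = \sum_(I : {ffun 'I_p -> 'I_n})
    decomp (mkl (fun k => F (I k))) ((p`!%:R)^-1 *: b (mkl (fun k => E (I k)))) s.
Proof.
move=> ba; have [sp|sp] := eqVneq (size s) p; last first.
  case: (ba) => h _ _ _; rewrite h // big1 // => I _.
  by rewrite decompE size_mkl (negbTE sp).
have -> : s = mkl (fun i : 'I_p => s`_i).
  by rewrite -[in LHS](mkl_nth s); move: sp => <-.
move: (fun i : 'I_p => s`_i) => x {sp s}.
have p0 : (p`!%:R : R) != 0 by rewrite pnatr_eq0 -lt0n fact_gt0.
apply: (scalerI p0); rewrite scaler_sumr.
transitivity (\sum_(I : {ffun 'I_p -> 'I_n}) \sum_(sg : 'S_p)
   ((-1) ^+ sg * \prod_k K (F (I k)) (x (sg k))) *: b (mkl (fun k => E (I k)))).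
  rewrite exchange_big /=.
  rewrite (eq_bigr (fun=> b (mkl x))); first by rewrite sumr_const card_Sn scaler_nat.
  move=> sg _; have := alt_perm x sg ba; rewrite (frame_expand _ ba) => /(congr1 (fun y => (-1) ^+ sg *: y)).
  rewrite [in X in _ = X -> _]scalerA -signr_addb addbb scale1r => <-.
  by rewrite scaler_sumr; apply: eq_bigr => I _; rewrite scalerA.
apply: eq_bigr => I _; rewrite decomp_mkl !scalerA mulrAC mulfV // mul1r -scaler_suml.
by congr (_ *: _); apply: eq_bigr => sg _; congr (_ * _); apply: eq_bigr => k _; rewrite mxE.
Qed.

(** The tensor formed by the pairs [F i], [E i] represents the identity of [g / hh], whatever the
    frame. *)
Lemma frame_casimir (E' F' : 'I_n -> g) (Psi : g -> g -> A) : dual_frame hh E' F' ->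
  (forall a X Y Z, Psi (a *: X + Y) Z = a *: Psi X Z + Psi Y Z) ->
  (forall a X Y Z, Psi Z (a *: X + Y) = a *: Psi Z X + Psi Z Y) ->
  (forall Z X, X \in hh -> (forall Y, Y \in hh -> K Z Y = 0) -> Psi Z X = 0) ->
  \sum_i Psi (F' i) (E' i) = \sum_i Psi (F i) (E i).
Proof.
move=> [F'h FE' mod'] Pl Pr Ph.
have P0 Z : Psi Z 0 = 0 by have := Pr (-1) 0 0 Z; rewrite scaler0 addr0 scaleN1r addNr.
have P0l Z : Psi 0 Z = 0 by have := Pl (-1) 0 0 Z; rewrite scaler0 addr0 scaleN1r addNr.
have PZ Z a X : Psi Z (a *: X) = a *: Psi Z X by have := Pr a X 0 Z; rewrite !addr0 P0 addr0.
have PZl Z a X : Psi (a *: X) Z = a *: Psi X Z by have := Pl a X 0 Z; rewrite !addr0 P0l addr0.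
transitivity (\sum_i \sum_j K (F j) (E' i) *: Psi (F' i) (E j)).
  apply: eq_bigr => i _; have := Ph (F' i) _ (frame_mod (E' i)) (F'h i).
  rewrite addrC -scaleN1r Pr scaleN1r addrC => /eqP; rewrite subr_eq0 => /eqP->.
  rewrite (big_morph (Psi (F' i)) (id1 := 0) (op1 := +%R)) //; first by apply: eq_bigr => j _; rewrite PZ.
  by move=> x y; have := Pr 1 x y (F' i); rewrite !scale1r.
rewrite exchange_big; apply: eq_bigr => j _.
have EF' : dual_frame hh E' F' by split.
have -> : Psi (F j) (E j) = Psi (\sum_i K (F j) (E' i) *: F' i) (E j).
  congr Psi; apply/eqP; rewrite -subr_eq0; apply/eqP; apply: KF_nondeg => Y.
  rewrite KFBl KF_suml.
  have := mod' Y => /(frame_Fh j)/eqP; rewrite KFBr subr_eq0 => /eqP->.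
  rewrite KF_sumr; apply/eqP; rewrite subr_eq0; apply/eqP; apply: eq_bigr => i _.
  by rewrite KFZr KFZl mulrC.
rewrite (big_morph (fun X => Psi X (E j)) (id1 := 0) (op1 := +%R)) //; first by apply: eq_bigr => i _; rewrite PZl.
by move=> x y; have := Pl 1 x y (E j); rewrite !scale1r.
Qed.

(** The identity tensor of [g / hh] is invariant under [ad X] when [X] normalises [hh]. *)
Lemma frame_casimir_lie (Psi : g -> g -> A) X : (forall Y, Y \in hh -> LB X Y \in hh) ->
  (forall a X Y Z, Psi (a *: X + Y) Z = a *: Psi X Z + Psi Y Z) ->
  (forall a X Y Z, Psi Z (a *: X + Y) = a *: Psi Z X + Psi Z Y) ->
  (forall i X, X \in hh -> Psi (F i) X = 0) ->
  \sum_i (Psi (LB X (F i)) (E i) + Psi (F i) (LB X (E i))) = 0.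
Proof.
move=> Xh Pl Pr Ph.
have P0 Z : Psi Z 0 = 0 by have := Pr (-1) 0 0 Z; rewrite scaler0 addr0 scaleN1r addNr.
have P0l Z : Psi 0 Z = 0 by have := Pl (-1) 0 0 Z; rewrite scaler0 addr0 scaleN1r addNr.
have PZ Z a Y : Psi Z (a *: Y) = a *: Psi Z Y by have := Pr a Y 0 Z; rewrite !addr0 P0 addr0.
have PZl Z a Y : Psi (a *: Y) Z = a *: Psi Y Z by have := Pl a Y 0 Z; rewrite !addr0 P0l addr0.
have PD Z x y : Psi Z (x + y) = Psi Z x + Psi Z y by have := Pr 1 x y Z; rewrite !scale1r.
have PDl Z x y : Psi (x + y) Z = Psi x Z + Psi y Z by have := Pl 1 x y Z; rewrite !scale1r.
rewrite big_split /=.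
have -> : \sum_i Psi (F i) (LB X (E i)) = \sum_i \sum_j K (F j) (LB X (E i)) *: Psi (F i) (E j).
  by apply: eq_bigr => i _; apply: (frame_slot (L := Psi (F i))) => // Y; exact: Ph.
have -> : \sum_i Psi (LB X (F i)) (E i) = \sum_i \sum_j K (LB X (F i)) (E j) *: Psi (F j) (E i).
  apply: eq_bigr => i _; rewrite {1}(@frame_dual (LB X (F i))); last first.
    by move=> Y Yh; rewrite KF_inv frame_Fh ?oppr0 // Xh.
  by rewrite (big_morph (fun Y => Psi Y (E i)) (PDl _) (P0l _)); apply: eq_bigr => j _; rewrite PZl.
rewrite exchange_big -big_split big1 //= => i _; rewrite -big_split big1 //= => j _.
by rewrite KF_inv -scalerDl addNr scale0r.
Qed.

End Values.

Section Top.
Variables (A B C : lmodType R) (mul : A -> B -> C).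
Hypothesis mulL : forall a x y z, mul (a *: x + y) z = a *: mul x z + mul y z.
Hypothesis mulR : forall a x y z, mul z (a *: x + y) = a *: mul z x + mul z y.
Variable del : seq g -> R^o.
Hypothesis dela : altform n hh del.

Lemma del_alt (D : lmodType R) (w : D) s : altform (n - size s) hh (fun t => del (s ++ t) *: w).
Proof.
have [d1 d2 d3 d4] := altform_ios s dela; split=> [t ts|s1 s2 a x y|t ts|t th].
- by rewrite d1 // scale0r.
- by rewrite d2 scalerDl scalerA.
- by rewrite d3 // scale0r.
- by rewrite d4 // scale0r.
Qed.

End Top.

Section TopLeft.
Variables (A B C : lmodType R) (mul : A -> B -> C).
Hypothesis mulL : forall a x y z, mul (a *: x + y) z = a *: mul x z + mul y z.
Hypothesis mulR : forall a x y z, mul z (a *: x + y) = a *: mul z x + mul z y.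
Variable del : seq g -> R^o.
Hypothesis dela : altform n hh del.

Lemma del_alt_left (D : lmodType R) (w : D) t : altform (n - size t) hh (fun s => del (s ++ t) *: w).
Proof.
apply: altform_eq (altformZ ((-1) ^+ ((n - size t) * size t)) (del_alt dela w t)) => s.
have [st|st] := eqVneq (size s) (n - size t)%N.
  by rewrite (alt_catC s t dela) st scalerA.
case: (dela) => d1 _ _ _; rewrite !d1 ?scale0r ?scaler0 // size_cat; apply: contraNneq st => <-.
  by rewrite addnK.
by rewrite addKn.
Qed.

(** Induction on [t]: a product of degree [n + 1] vanishes, and contracting it with the next vector
    trades a slot of the volume form for a slot of [c]. *)
Lemma wedge_top_l p c w t r : altform (size t) hh c -> (p + size t)%N = n ->
  wedge p mul (fun s => del (s ++ t) *: w) c r = del r *: mul w (c t).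
Proof.
elim: t p c r => [|X t IH] p c r ca pn.
  rewrite addn0 in pn.
  (* A form of degree 0 is annihilated by every vector, so the whole list may be given to the volume
     form. *)
  have c0 : altform 0 fullv c.
    case: ca => c1 c2 c3 c4; split=> // s; case: s => // x s _; exact: c1.
  have da : altform p hh (fun s => del (s ++ [::]) *: w) by have := del_alt_left w [::]; rewrite subn0 pn.
  have [rp|rp] := eqVneq (size r) p; last first.
    rewrite (wedge_size mulL mulR da ca) ?addn0 //.
    by case: dela => d1 _ _ _; rewrite d1 ?scale0r // -pn.
  rewrite -[in LHS](cats0 r) (wedge_catE mulL mulR _ da c0) ?cats0 ?(bilZl mulL) //.
  by apply/allP => x _; rewrite memvf.
have pn' : (p.+1 + size t)%N = n by rewrite -pn addSnnS.
have wa := del_alt_left w t; rewrite -pn' addnK in wa.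
have W0 := wedge_alt mulL mulR wa ca.
have n1 : (n < p.+1 + (size t).+1)%N by rewrite -pn' addnS.
have /eqP := altform_over (X :: r) W0 n1.
rewrite (wedge_cons mulL mulR _ _ wa ca) /= (IH _ _ _ (altform_io X ca)) // addr_eq0 => /eqP E1.
transitivity (wedge p mul (fun s => (-1) ^+ p *: io X (fun s => del (s ++ t) *: w) s) c r).
  apply: wedge_eq => // s; rewrite /io; have [sp|sp] := eqVneq (size s) p.
    by rewrite (alt_front _ _ _ dela) sp scalerA.
  case: (dela) => d1 _ _ _; rewrite !d1 ?scale0r ?scaler0 //= ?size_cat -pn /=; apply: contraNneq sp.
    by move=> h; apply/eqP; lia.
  by move=> h; apply/eqP; lia.
rewrite (wedgeZl mulL) E1 exprS mulN1r scaleNr opprK scalerA -expr2 sqrr_sign scale1r //.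
Qed.

End TopLeft.
End DualFrames.

Lemma altform_ios_r (A : lmodType R) p hh (u : seq g -> A) t : altform p hh u ->
  altform (p - size t) hh (fun s => u (s ++ t)).
Proof.
move=> ua; have [pt|tp] := ltnP p (size t).
  apply: altform_eq (altform0 _ _ hh) => s; case: ua => h _ _ _; rewrite h //.
  by rewrite size_cat neq_ltn orbC (leq_trans pt) ?leq_addl.
apply: altform_eq (altformZ ((-1) ^+ ((p - size t) * size t)) (altform_ios t ua)) => s.
have [st|st] := eqVneq (size s) (p - size t)%N; first by rewrite (alt_catC s t ua) st.
case: (ua) => d1 _ _ _; rewrite !d1 ?scaler0 // size_cat; apply: contraNneq st => <-.
  by rewrite addnK.
by rewrite addKn.
Qed.

(** * The action of g on the arguments of a form *)

Section Values.
Variable A : lmodType R.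
Implicit Types (u v : seq g -> A).

(** Minus the coadjoint action: [[X, -]] is applied to each argument in turn, and the result is
    moved to the front with its sign, as in the formula for the exterior derivative. *)
Definition adact (X : g) u : seq g -> A := fun s =>
  \sum_(m < size s) (-1) ^+ m *: u (LB X s`_m :: del m s).

Lemma adact_nil X u : adact X u [::] = 0. Proof. exact: big_ord0. Qed.

Lemma adact_ext X u v s : (forall t, size t = size s -> u t = v t) -> adact X u s = adact X v s.
Proof.
move=> uv; apply: eq_bigr => m _; rewrite uv //= size_del //.
by rewrite prednK // (leq_ltn_trans _ (ltn_ord m)).
Qed.

Lemma adact0 X s : adact X (fun=> 0 : A) s = 0.
Proof. by apply: big1 => m _; rewrite scaler0. Qed.

Lemma adact_linear X a u v s : adact X (fun s => a *: u s + v s) s = a *: adact X u s + adact X v s.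
Proof.
rewrite /adact scaler_sumr -big_split; apply: eq_bigr => m _ /=.
by rewrite scalerDr !scalerA mulrC.
Qed.

Lemma adactD X u v s : adact X (fun s => u s + v s) s = adact X u s + adact X v s.
Proof.
have := adact_linear X 1 u v s; rewrite scale1r => <-.
by apply: adact_ext => t _; rewrite scale1r.
Qed.
Lemma adactZ X a u s : adact X (fun s => a *: u s) s = a *: adact X u s.
Proof.
have := adact_linear X a u (fun=> 0) s; rewrite adact0 addr0 => <-.
by apply: adact_ext => t _; rewrite addr0.
Qed.
Lemma adact_sum X I (r : seq I) (F : I -> seq g -> A) s :
  adact X (fun s => \sum_(i <- r) F i s) s = \sum_(i <- r) adact X (F i) s.
Proof. by rewrite /adact exchange_big; apply: eq_bigr => m _; rewrite scaler_sumr. Qed.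

Lemma adact_cons p hh X u Y s : altform p hh u ->
  adact X u (Y :: s) = u (LB X Y :: s) + adact X (io Y u) s.
Proof.
move=> ua; rewrite /adact big_ord_recl expr0 scale1r del0; congr (_ + _).
apply: eq_bigr => m _; rewrite lift0 del_cons /io /=.
by rewrite (alt_swap [::] [::] _ _ _ ua) /= exprS mulN1r scalerN scaleNr opprK.
Qed.

Lemma adact_middle p hh X u s : altform p hh u ->
  adact X u s = \sum_(m < size s) u (take m s ++ LB X s`_m :: drop m.+1 s).
Proof.
move=> ua; apply: eq_bigr => m _.
by rewrite (alt_front _ _ _ ua) size_takel // ltnW.
Qed.

Lemma adact_alt p (hh : {vspace g}) X u : (forall Y, Y \in hh -> LB X Y \in hh) ->
  altform p hh u -> altform p hh (adact X u).
Proof.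
move=> Xh; elim: p u => [|p IH] u ua.
  have z Y s : adact X u (Y :: s) = 0.
    rewrite (adact_cons _ _ _ ua); case: (ua) => h _ _ _; rewrite h // add0r.
    by rewrite -[RHS](adact0 X s); apply: adact_ext => t _; rewrite /io h.
  have zz Y : altform 0.-1 hh (io Y (adact X u)).
    by apply: altform_eq (altform0 _ 0 hh) => s; rewrite /io z.
  by apply: altform_cons => //= s a x y; rewrite !z scaler0 addr0.
have ul := let: And4 _ h _ _ := ua in h.
apply: altform_cons => //=.
- by rewrite adact_nil.
- move=> Y; apply: altform_eq (altformD (altform_io (LB X Y) ua) (IH _ (altform_io Y ua))) => s.
  by rewrite /io (adact_cons _ _ _ ua).
- move=> s a x y; rewrite !(adact_cons _ _ _ ua) lie_linear (ul [::]) /=.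
  have -> : adact X (io (a *: x + y) u) s = a *: adact X (io x u) s + adact X (io y u) s.
    by rewrite -adact_linear; apply: adact_ext => t _; exact: (ul [::]).
  by rewrite scalerDr -!addrA; congr (_ + _); rewrite addrCA.
- move=> Y s; rewrite (adact_cons _ _ _ ua) (adact_cons _ _ _ (altform_io Y ua)) /io.
  rewrite (alt_swap [::] [::] _ _ _ ua) /= addrA addNr add0r -[RHS](adact0 X s).
  by apply: adact_ext => t _; case: ua => _ _ h _; rewrite h //= inE eqxx.
- move=> Y s Yh; rewrite (adact_cons _ _ _ ua) (altform_io_hh _ ua (Xh _ Yh)) add0r -[RHS](adact0 X s).
  by apply: adact_ext => t _; exact: altform_io_hh ua Yh.
Qed.

Lemma lie_0v X Y : Y \in (0%VS : {vspace g}) -> LB X Y \in (0%VS : {vspace g}).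
Proof. by rewrite !memv0 => /eqP->; rewrite lie0r. Qed.

Lemma altform_0v p hh u : altform p hh u -> altform p 0%VS u.
Proof. by apply: altform_sub; exact: sub0v. Qed.

Lemma adact_alt0 p hh X u : altform p hh u -> altform p 0%VS (adact X u).
Proof. by move=> ua; apply: adact_alt (altform_0v ua) => Y; exact: lie_0v. Qed.

Lemma adact_linearX p hh X Y a u s : altform p hh u ->
  adact (a *: X + Y) u s = a *: adact X u s + adact Y u s.
Proof.
move=> [_ ul _ _]; rewrite /adact scaler_sumr -big_split; apply: eq_bigr => m _ /=.
by rewrite lie_linearl (ul [::]) /= scalerDr !scalerA mulrC.
Qed.

Lemma adact_cat p hh X u s t : altform p hh u ->
  adact X u (s ++ t) = adact X (fun s => u (s ++ t)) s + adact X (fun t => u (s ++ t)) t.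
Proof.
elim: s p u => [|Y s IH] p u ua; first by rewrite adact_nil add0r.
rewrite (adact_cons _ _ _ (altform_ios_r t ua)) /= (adact_cons _ _ _ ua) (IH _ _ (altform_io Y ua)).
by rewrite addrA.
Qed.

(** Acting on arguments reverses the order of composition, hence the sign opposite to that of a
    representation. *)
Lemma adact_comm p hh X Y u s : altform p hh u ->
  adact (LB X Y) u s = adact Y (adact X u) s - adact X (adact Y u) s.
Proof.
elim: s p u => [|Z s IH] p u ua; first by rewrite !adact_nil subr0.
have := let: And4 _ h _ _ := ua in h; move=> ul.
rewrite (adact_cons _ _ _ ua) (adact_cons _ _ _ (adact_alt0 X ua)) (adact_cons _ _ _ (adact_alt0 Y ua)).
have io_ad W t : io Z (adact W u) t = u (LB W Z :: t) + adact W (io Z u) t by rewrite /io (adact_cons _ _ _ ua).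
rewrite (@adact_ext Y (io Z (adact X u)) (fun t => io (LB X Z) u t + adact X (io Z u) t)) //.
rewrite (@adact_ext X (io Z (adact Y u)) (fun t => io (LB Y Z) u t + adact Y (io Z u) t)) //.
rewrite !adactD !(adact_cons _ _ _ ua) (IH _ _ (altform_io Z ua)) lie_jacobi.
have -> : u ((LB X (LB Y Z) - LB Y (LB X Z)) :: s) = u (LB X (LB Y Z) :: s) - u (LB Y (LB X Z) :: s).
  by rewrite -[- LB Y _]scaleN1r addrC; have /= -> := ul [::] s; rewrite scaleN1r addrC.
rewrite /io.
move: (u _) (u _) (adact _ _ _) (adact _ _ _) (adact _ _ _) (adact _ _ _) => a b c e f h.
zcan.
Qed.

End Values.

Lemma adact_wedge (A B C : lmodType R) (mul : A -> B -> C) :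
  (forall a x y z, mul (a *: x + y) z = a *: mul x z + mul y z) ->
  (forall a x y z, mul z (a *: x + y) = a *: mul z x + mul z y) ->
  forall p q hu hv X (u : seq g -> A) (v : seq g -> B) s, altform p hu u -> altform q hv v ->
  adact X (wedge p mul u v) s = wedge p mul (adact X u) v s + wedge p mul u (adact X v) s.
Proof.
move=> mulL mulR p q hu hv X u v s ua va.
have {}ua := altform_0v ua; have {}va := altform_0v va.
elim: s p q u v ua va => [|Y s IH] p q u v ua va.
  rewrite adact_nil; have [p0|p0] := posnP p; last first.
    have wz (u' : seq g -> A) (v' : seq g -> B) : altform p 0%VS u' -> altform q 0%VS v' -> wedge p mul u' v' [::] = 0.
      move=> ua' va'; rewrite (wedge_size mulL mulR ua' va') //=.
      by rewrite neq_ltn addn_gt0 p0.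
    by rewrite (wz _ _ (adact_alt0 X ua) va) (wz _ _ ua (adact_alt0 X va)) addr0.
  rewrite p0 !(wedge0E mulR _ _ va) (wedge0E mulR _ _ (adact_alt0 X va)) !adact_nil.
  by rewrite (bil0l mulL) (bil0r mulR) addr0.
have aua := adact_alt0 X ua; have ava := adact_alt0 X va.
rewrite (adact_cons _ _ _ (wedge_alt mulL mulR ua va)) !(wedge_cons mulL mulR _ _ ua va).
rewrite (wedge_cons mulL mulR _ _ aua va) (wedge_cons mulL mulR _ _ ua ava).
rewrite (@adact_ext _ X (io Y (wedge p mul u v))
  (fun t => (-1) ^+ p *: wedge p mul u (io Y v) t + wedge p.-1 mul (io Y u) v t)); last first.
  by move=> t _; rewrite /io (wedge_cons mulL mulR _ _ ua va) addrC.
rewrite adact_linear (IH _ _ _ _ ua (altform_io Y va)) (IH _ _ _ _ (altform_io Y ua) va).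
have io_ad (D : lmodType R) r (w : seq g -> D) : altform r 0%VS w ->
  io Y (adact X w) = (fun t => io (LB X Y) w t + adact X (io Y w) t).
  by move=> wa; apply/funext => t; rewrite /io (adact_cons _ _ _ wa).
rewrite (io_ad _ _ _ ua) (io_ad _ _ _ va) (wedgeDl mulL) (wedgeDr mulR) !scalerDr.
move: (wedge _ _ _ _ _) (wedge _ _ _ _ _) (_ *: wedge _ _ _ _ _) (_ *: wedge _ _ _ _ _) (wedge _ _ _ _ _) (_ *: wedge _ _ _ _ _) => a b c e f h.
zcan.
Qed.

Section TopTrace.
Variables (hh : {vspace g}) (n : nat) (E F : 'I_n -> g).
Hypothesis EF : dual_frame hh E F.

Lemma top_form_eq (A : lmodType R) (u u' : seq g -> A) : altform n hh u -> altform n hh u' ->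
  u (mkl E) = u' (mkl E) -> forall s, u s = u' s.
Proof.
move=> ua va uv; apply: (altform_frame_eq EF ua va) => I.
case: (boolP (injectiveb I)) => [/injectiveP II|/injectiveP nI].
  have -> : (fun k => E (I k)) = (E \o perm II) by apply/funext => k /=; rewrite permE.
  by rewrite (alt_perm _ _ ua) (alt_perm _ _ va) uv.
have nu : ~~ uniq (mkl (fun k => E (I k))).
  apply/negP => /mkl_inj_uniq EI; apply: nI => i j ij; apply: EI; congr (E _); exact: ij.
by case: ua va => _ _ h _ [_ _ h' _]; rewrite h // h'.
Qed.

(** On the frame only the component of [[X, E m]] along [E m] contributes, the others repeating a
    frame vector; the scalar is the trace of [ad X] on [g / hh]. *)
Lemma adact_top (A : lmodType R) X (u : seq g -> A) s : (forall Y, Y \in hh -> LB X Y \in hh) ->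
  altform n hh u -> adact X u s = (\sum_m K (F m) (LB X (E m))) *: u s.
Proof.
move=> Xh ua; apply: (top_form_eq (u' := fun s => (\sum_m K (F m) (LB X (E m))) *: u s)).
- exact: adact_alt.
- exact: altformZ.
rewrite (adact_middle _ _ ua) scaler_suml; move: (size_mkl E).
have H N : N = n -> \sum_(m < N) u (take m (mkl E) ++ LB X (mkl E)`_m :: drop m.+1 (mkl E)) =
   \sum_(i < n) K (F i) (LB X (E i)) *: u (mkl E).
  move=> ->; apply: eq_bigr => m _; rewrite (frame_slot_alt EF _ _ _ ua) (bigD1 m) //= nth_mkl.
  rewrite [X in _ + X]big1 ?addr0.
    rewrite -mkl_upd (_ : upd E m (E m) = E) //.
    by apply/funext => k; rewrite /upd; case: eqP => [->|].
  move=> i im; rewrite -mkl_upd; case: ua => _ _ h _; rewrite h ?scaler0 //.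
  apply/negP => /mkl_inj_uniq/(_ i m); rewrite /upd eqxx (negbTE im) => /(_ erefl)/eqP.
  by rewrite (negbTE im).
exact: H.
Qed.

End TopTrace.

(** * The Hodge star in an orthonormal frame *)

Section ExplicitHodge.
Variables (hh : {vspace g}) (n : nat) (E : 'I_n -> g).
Hypothesis EE : dual_frame hh E E.
Variable del : seq g -> R^o.
Hypothesis dela : altform n hh del.
Hypothesis del1 : del (mkl E) = 1.

Section Values.
Variable A : lmodType R.
Implicit Types (u : seq g -> A).

(** The Hodge star as contraction with the volume form [del] over the frame [E], which is
    orthonormal because [EE] makes it its own dual. It touches the form part only, so the values may
    lie in any space. *)
Definition Hs p u t : A := (p`!%:R)^-1 *: fsum E p (fun s => del (s ++ t) *: u s).

Lemma Hs_ext p u u' t : (forall s, size s = p -> u s = u' s) -> Hs p u t = Hs p u' t.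
Proof. by move=> uu; congr (_ *: _); apply: fsum_ext => s /uu->. Qed.

Lemma Hs_linear p a u u' t : Hs p (fun s => a *: u s + u' s) t = a *: Hs p u t + Hs p u' t.
Proof.
rewrite /Hs scalerA [a * _]mulrC -scalerA -scalerDr; congr (_ *: _).
rewrite /fsum scaler_sumr -big_split; apply: eq_bigr => I _ /=.
by rewrite scalerDr !scalerA mulrC.
Qed.

Lemma HsD p u u' t : Hs p (fun s => u s + u' s) t = Hs p u t + Hs p u' t.
Proof.
have := Hs_linear p 1 u u' t; rewrite scale1r => <-.
by apply: Hs_ext => s _; rewrite scale1r.
Qed.

Lemma Hs0 p t : Hs p (fun=> 0 : A) t = 0.
Proof.
by rewrite /Hs /fsum big1 ?scaler0 // => I _; rewrite scaler0.
Qed.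

Lemma HsZ p a u t : Hs p (fun s => a *: u s) t = a *: Hs p u t.
Proof.
have := Hs_linear p a u (fun=> 0) t; rewrite Hs0 addr0 => <-.
by apply: Hs_ext => s _; rewrite addr0.
Qed.

Lemma Hs_sum p I (r : seq I) (F : I -> seq g -> A) t :
  Hs p (fun s => \sum_(i <- r) F i s) t = \sum_(i <- r) Hs p (F i) t.
Proof.
elim: r => [|i r IH].
  by rewrite big_nil -[RHS](Hs0 p t); apply: Hs_ext => s _; rewrite big_nil.
by rewrite big_cons -IH -HsD; apply: Hs_ext => s _; rewrite big_cons.
Qed.

Lemma Hs_alt p u : altform (n - p) hh (Hs p u).
Proof.
apply: altformZ; apply: altform_sum => I.
by have := del_alt dela (u (mkl (fun k => E (I k)))) (mkl (fun k => E (I k))); rewrite size_mkl.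
Qed.

Lemma Hs_over p u t : (n < p)%N -> Hs p u t = 0.
Proof.
move=> np; rewrite -(Hs0 p t) /Hs; congr (_ *: _); apply: fsum_ext => s sp.
case: dela => h _ _ _; rewrite h ?scale0r ?scaler0 // size_cat sp.
by rewrite neq_ltn orbC (leq_trans np) ?leq_addr.
Qed.

(** [ad X] is skew for the Killing form, so its trace on [g / hh] is 0 and [del] is invariant. The
    sum over the frame is invariant too, which moves the action from [u] to the free slots of
    [del]. *)
Lemma Hs_adact p u t X : (forall Y, Y \in hh -> LB X Y \in hh) -> altform p hh u ->
  Hs p (adact X u) t = adact X (Hs p u) t.
Proof.
move=> Xh ua.
have skew i j : K (E i) (LB X (E j)) = - K (E j) (LB X (E i)).
  by rewrite -KF_inv KFC.
have tr0 : \sum_m K (E m) (LB X (E m)) = 0.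
  apply: big1 => m _; have /eqP := skew m m; rewrite -addr_eq0 -mulr2n -mulr_natl mulf_eq0.
  by rewrite pnatr_eq0 /= => /eqP.
have adel s : adact X del s = 0 by rewrite (adact_top EE _ Xh dela) tr0 scale0r.
(* Summation by parts over tuples of frame vectors, one vector at a time. *)
have cas q r (v : seq g -> R^o) (w : seq g -> A) : altform q hh v -> altform r hh w ->
   forall p', fsum E p' (fun s => adact X v s *: w s + v s *: adact X w s) = 0.
  move=> va wa p'; elim: p' q r v w va wa => [|p' IH] q r v w va wa.
    by rewrite fsum0 !adact_nil scaler0 scale0r addr0.
  have [_ vl _ vh] := va; have [_ wl _ wh] := wa.
  have Z0 : \sum_i fsum E p' (fun s => adact X (io (E i) v) s *: w (E i :: s)
     + v (E i :: s) *: adact X (io (E i) w) s) = 0.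
    by apply: big1 => i _; exact: IH (altform_io (E i) va) (altform_io (E i) wa).
  rewrite fsumS -[RHS]Z0; apply/eqP; rewrite -subr_eq0; apply/eqP; rewrite -sumrB.
  have -> : \sum_i (fsum E p' (fun s => adact X v (E i :: s) *: w (E i :: s) + v (E i :: s) *: adact X w (E i :: s)) -
      fsum E p' (fun s => adact X (io (E i) v) s *: w (E i :: s) + v (E i :: s) *: adact X (io (E i) w) s)) =
      \sum_i fsum E p' (fun s => v (LB X (E i) :: s) *: w (E i :: s) + v (E i :: s) *: w (LB X (E i) :: s)).
    apply: eq_bigr => i _; rewrite -sumrB; apply: eq_bigr => I _.
    rewrite (adact_cons _ _ _ va) (adact_cons _ _ _ wa) scalerDl scalerDr.
    by zcan.
  rewrite -fsum_sum; apply: big1 => I _; set s := mkl _.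
  apply: (frame_casimir_lie EE (Psi := fun a b => v (a :: s) *: w (b :: s))) => //.
  - by move=> a Y Y' Z; rewrite (vl [::]) /= scalerDl scalerA.
  - by move=> a Y Y' Z; rewrite (wl [::]) /= scalerDr !scalerA mulrC.
  - by move=> i Y Yh; rewrite wh ?scaler0 //= Yh.
transitivity ((p`!%:R)^-1 *: adact X (fun t => fsum E p (fun s => del (s ++ t) *: u s)) t); last first.
  by rewrite -adactZ.
congr (_ *: _).
transitivity (fsum E p (fun s => adact X (fun t => del (s ++ t) *: u s) t)); last first.
  by rewrite /fsum adact_sum.
apply/eqP; rewrite -subr_eq0 /fsum -sumrB.
have C0 := cas _ _ _ _ (altform_ios_r t dela) ua p; apply/eqP; rewrite -[RHS]C0; apply: eq_bigr => I _; set s := mkl _.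
rewrite addrC; congr (_ + _).
have -> : adact X (fun t => del (s ++ t) *: u s) t = adact X (fun t => del (s ++ t)) t *: u s.
  by rewrite /adact scaler_suml; apply: eq_bigr => m _; rewrite scalerA.
rewrite -scaleNr; congr (_ *: _); have := adel (s ++ t); rewrite (adact_cat X _ _ dela).
by move/eqP; rewrite addr_eq0 => /eqP->.
Qed.

(** Substituting [phi] in all slots replaces the frame by its image, and the sum does not depend on
    the frame. *)
Lemma Hs_map p u t (phi : g -> g) : dual_frame hh (fun i => phi (E i)) (fun i => phi (E i)) ->
  (forall s, del (map phi s) = del s) -> altform p hh u ->
  Hs p (fun s => u (map phi s)) t = Hs p u (map phi t).
Proof.
move=> fE fdel ua; congr (_ *: _).
transitivity (fsum E p (fun s => del (map phi s ++ map phi t) *: u (map phi s))).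
  by apply: fsum_ext => s _; rewrite -map_cat fdel.
suff cas q (v : seq g -> R^o) : altform q hh v ->
    fsum E p (fun s => v (map phi s) *: u (map phi s)) = fsum E p (fun s => v s *: u s).
  exact: cas (altform_ios_r (map phi t) dela).
move=> va; elim: p q v u va ua => [|p IH] q v u va ua; first by rewrite !fsum0.
rewrite !fsumS /=.
transitivity (\sum_i fsum E p (fun s => v (phi (E i) :: s) *: u (phi (E i) :: s))).
  by apply: eq_bigr => i _; exact: IH (altform_io (phi (E i)) va) (altform_io (phi (E i)) ua).
rewrite -!fsum_sum; apply: fsum_ext => s _.
have [_ vl _ vh] := va; have [_ ul _ uh] := ua.
apply: (frame_casimir EE (Psi := fun a b => v (a :: s) *: u (b :: s)) fE).
- by move=> a Y Y' Z; rewrite (vl [::]) /= scalerDl scalerA.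
- by move=> a Y Y' Z; rewrite (ul [::]) /= scalerDr !scalerA mulrC.
- by move=> i Y Yh _; rewrite uh ?scaler0 //= Yh.
Qed.

End Values.

Lemma Hs_lin (A B : lmodType R) p (u : seq g -> A) (L : A -> B) t : L 0 = 0 -> {morph L : x y / x + y} ->
  (forall a x, L (a *: x) = a *: L x) -> L (Hs p u t) = Hs p (fun s => L (u s)) t.
Proof.
move=> L0 LD LZ; rewrite /Hs LZ (fsum_lin _ _ _ L0 LD); congr (_ *: _).
by apply: fsum_ext => s _; rewrite LZ.
Qed.

Section Bilinear.
Variables (A B C : lmodType R) (mul : A -> B -> C).
Hypothesis mulL : forall a x y z, mul (a *: x + y) z = a *: mul x z + mul y z.
Hypothesis mulR : forall a x y z, mul z (a *: x + y) = a *: mul z x + mul z y.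

(** [del] is the sign on permutations of the frame and 0 on tuples with a repetition, so it extends
    the sum over permutations to all tuples. *)
Lemma wedge_frame p q (a : seq g -> A) (c : seq g -> B) : (p + q)%N = n ->
  wedge p mul a c (mkl E) = (p`!%:R * q`!%:R)^-1 *:
    fsum E p (fun s => fsum E q (fun t => del (s ++ t) *: mul (a s) (c t))).
Proof.
move=> pq; rewrite wedgeE; have -> : (size (mkl E) - p)%N = q by rewrite size_mkl -pq addKn.
congr (_ *: _).
pose Phi L := mul (a (take p L)) (c (drop p L)).
have H N : N = n -> \sum_(sg : 'S_N) (-1) ^+ sg *: Phi [seq (mkl E)`_(sg i) | i <- enum 'I_N] =
   \sum_(sg : 'S_n) (-1) ^+ sg *: Phi (mkl (fun k => E (sg k))).
  move=> ->; apply: eq_bigr => sg _; congr (_ *: Phi _); apply: eq_map => i.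
  by rewrite nth_mkl.
transitivity (\sum_(sg : 'S_n) (-1) ^+ sg *: Phi (mkl (fun k => E (sg k)))).
  exact: (H _ (size_mkl E)).
transitivity (fsum E (p + q) (fun s => del s *: Phi s)); last first.
  rewrite fsum_cat; apply: fsum_ext => s sp; apply: fsum_ext => t tq.
  by rewrite /Phi take_cat drop_cat sp ltnn subnn take0 drop0 cats0.
rewrite pq /fsum (bigID (fun I : {ffun 'I_n -> 'I_n} => injectiveb I)) /= [X in _ + X]big1 ?addr0; last first.
  move=> I /injectiveP nI; case: dela => _ _ h _; rewrite h ?scale0r //.
  apply/negP => /mkl_inj_uniq EI; apply: nI => i j ij; apply: EI; congr (E _); exact: ij.
rewrite (reindex (@pval _)) /=; last first.
  pose h (I : {ffun 'I_n -> 'I_n}) := insubd (1%g : 'S_n) I.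
  by exists h => [sg _|I /= injI]; rewrite /h ?valKd // insubdK.
apply: eq_big => [sg|sg _]; first by rewrite (valP sg).
have -> : (fun k => E (pval sg k)) = E \o sg by apply/funext => k; rewrite /= pvalE.
by rewrite (alt_perm _ _ dela) del1 /GRing.scale /= mulr1.
Qed.

End Bilinear.

(** Evaluated on the frame, [wedge_top_l] says that contracting twice with the volume form returns
    [c]; the sign comes from exchanging the two blocks of arguments of [del]. *)
Lemma HsK (A : lmodType R) p q (c : seq g -> A) t : (p + q)%N = n -> altform q hh c ->
  Hs p (Hs q c) t = (-1) ^+ (p * q) *: c t.
Proof.
move=> pq ca; have [tq|tq] := eqVneq (size t) q; last first.
  have [h _ _ _] := Hs_alt p (Hs q c); rewrite h; last by rewrite -pq addKn.
  by case: ca => h' _ _ _; rewrite h' ?scaler0.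
pose mul (k : R^o) (y : A) := k *: y.
have mulL a x y z : mul (a *: x + y) z = a *: mul x z + mul y z by rewrite /mul scalerDl scalerA.
have mulR a x y z : mul z (a *: x + y) = a *: mul z x + mul z y.
  by rewrite /mul scalerDr !scalerA mulrC.
have ca' : altform (size t) hh c by rewrite tq.
have := wedge_top_l EE mulL mulR dela (1 : R^o) (mkl E) ca'; rewrite tq => /(_ p pq).
rewrite (wedge_frame mul _ _ pq) del1 scale1r {2}/mul scale1r => <-.
transitivity ((p`!%:R * q`!%:R)^-1 *: fsum E p (fun s => fsum E q (fun t' =>
    ((-1) ^+ (p * q) * del (s ++ t') * del (s ++ t)) *: c t'))).
  rewrite /Hs mulrC invfM mulrC -scalerA; congr (_ *: _); rewrite -fsumZ; apply: fsum_ext => s sp.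
  rewrite scalerA mulrC -scalerA; congr (_ *: _); rewrite -fsumZ; apply: fsum_ext => t' tq'.
  by rewrite (alt_catC t' s dela) sp tq' scalerA /GRing.scale /= mulrC (mulnC q).
rewrite [RHS]scalerA [X in _ = X *: _]mulrC -[RHS]scalerA; congr (_ *: _); rewrite /fsum scaler_sumr; apply: eq_bigr => I _.
rewrite scaler_sumr; apply: eq_bigr => J _; rewrite /mul !scalerA; congr (_ *: _).
by rewrite /GRing.scale /= mulr1 mulrA.
Qed.
End ExplicitHodge.

(** * Gradings, parabolic subalgebras and the nilradical *)

Section Parabolic.
Implicit Types (U I : {vspace g}) (X Y Z : g).

Lemma mem_lieV U I X Y : X \in U -> Y \in I -> LB X Y \in lieV U I.
Proof.
move=> XU YI; rewrite (coord_vbasis XU) (coord_vbasis YI) /lieV LBE.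
have lsum J (r : seq J) (F : J -> g) W : LB (\sum_(i <- r) F i) W = \sum_(i <- r) LB (F i) W.
  by elim: r => [|i r IH]; rewrite ?big_nil ?lie0l // !big_cons lieDl IH.
have rsum J (r : seq J) (F : J -> g) W : LB W (\sum_(i <- r) F i) = \sum_(i <- r) LB W (F i).
  by elim: r => [|i r IH]; rewrite ?big_nil ?lie0r // !big_cons lieDr IH.
rewrite lsum; apply: memv_suml => i _; rewrite rsum; apply: memv_suml => j _.
rewrite lieZl lieZr !memvZ //; apply: memv_span; apply: allpairs_f; apply: mem_nth; by rewrite size_tuple.
Qed.

Lemma lieV_sub U I (W : {vspace g}) : (forall X Y, X \in U -> Y \in I -> LB X Y \in W) -> (lieV U I <= W)%VS.
Proof.
move=> h; apply/span_subvP => Z /allpairsP[[x y] /= [xU yI ->]]; rewrite LBE; apply: h; exact: vbasis_mem.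
Qed.

Lemma lin_sum (T : g -> g) J (r : seq J) (F : J -> g) : linear T ->
  T (\sum_(i <- r) F i) = \sum_(i <- r) T (F i).
Proof.
move=> Tl; elim: r => [|i r IH]; last by rewrite !big_cons -[F i]scale1r Tl IH !scale1r.
by rewrite !big_nil; have := Tl (-1) 0 0; rewrite scaler0 addr0 scaleN1r addNr.
Qed.

Lemma lieV_ind (T : g -> g) U I (W : {vspace g}) Z : linear T -> (forall X Y, X \in U -> Y \in I -> T (LB X Y) \in W) ->
  Z \in lieV U I -> T Z \in W.
Proof.
move=> Tl h; rewrite /lieV => /(@coord_span _ _ _ (in_tuple _))->; rewrite (lin_sum _ _ Tl).
apply: memv_suml => i _; have TZ a x : T (a *: x) = a *: T x.
  have T0 := linear_map0 Tl.
  by have := Tl a x 0; rewrite !addr0 T0 addr0.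
rewrite TZ memvZ //; have : (in_tuple [seq lie x y | x <- vbasis U, y <- vbasis I])`_i \in [seq lie x y | x <- vbasis U, y <- vbasis I].
  exact: mem_nth.
by case/allpairsP => -[x y] /= [xU yI ->]; rewrite LBE; apply: h; exact: vbasis_mem.
Qed.

Lemma iter_linear k (T : g -> g) : linear T -> linear (iter k T).
Proof. by move=> Tl; elim: k => [|k IH] a x y //=; rewrite IH Tl. Qed.

Section Grading.
Variables (m : nat) (gr : int -> {vspace g}).
Hypothesis gr_full : (\sum_(i < m.*2.+1) gr (i%:Z - m%:Z)%R)%VS = fullv.
Hypothesis gr_big : forall i : int, (m%:Z < `|i|) -> gr i = 0%VS.
Hypothesis gr_lie : forall i j : int, (lieV (gr i) (gr j) <= gr (i + j)%R)%VS.

Lemma gr_mem i j X Y : X \in gr i -> Y \in gr j -> LB X Y \in gr (i + j).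
Proof. by move=> Xi Yj; apply: (subvP (gr_lie i j)); exact: mem_lieV. Qed.

Lemma gr_decomp X : exists2 x : 'I_(m.*2.+1) -> g, forall i, x i \in gr (i%:Z - m%:Z) & X = \sum_i x i.
Proof.
have : X \in (\sum_(i < m.*2.+1) gr (i%:Z - m%:Z)%R)%VS by rewrite gr_full memvf.
by case/memv_sumP => x xi ->; exists x => // i; exact: xi.
Qed.

(** Degrees lie between [- m] and [m], so [2 m + 1] shifts by a nonzero amount leave this range. *)
Lemma gr_shift (T : g -> g) d : linear T -> d != 0 -> (forall k X, X \in gr k -> T X \in gr (k + d)) ->
  forall X, iter m.*2.+1 T X = 0.
Proof.
move=> Tl d0 Td X; have [x xi ->] := gr_decomp X.
rewrite (lin_sum _ _ (iter_linear _ Tl)) big1 // => i _.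
have H N k Y : Y \in gr k -> iter N T Y \in gr (k + d *+ N).
  elim: N k Y => [|N IH] k Y Yk; first by rewrite mulr0n addr0.
  by rewrite iterSr mulrS addrA; apply: IH; exact: Td.
have := H m.*2.+1 _ _ (xi i); rewrite gr_big; first by rewrite memv0 => /eqP.
have := ltn_ord i; rewrite -mulr_natr natz; move: (nat_of_ord i) => j jm.
by move: d0; clear -jm; nia.
Qed.

(** The operator whose trace is taken shifts the degree by [i + j], hence is nilpotent. *)
Lemma gr_KF i j X Y : X \in gr i -> Y \in gr j -> i + j != 0 -> K X Y = 0.
Proof.
move=> Xi Yj ij; rewrite KF_trop; apply: (trop_nilpotent (k := m.*2.+1)).
  by move=> a x y; rewrite !lie_linear.
apply: (gr_shift (d := i + j)) => //; first by move=> a x y; rewrite !lie_linear.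
by move=> k Z Zk; rewrite (_ : k + (i + j) = j + (i + k)); [apply: gr_mem => //; exact: gr_mem|lia].
Qed.

Lemma gr_nondeg i X : X \in gr i -> (forall Y, Y \in gr (- i) -> K X Y = 0) -> X = 0.
Proof.
move=> Xi h; apply: KF_nondeg => Y; have [y yk ->] := gr_decomp Y.
rewrite KF_sumr big1 // => k _; have [ik|ik] := eqVneq (i + (k%:Z - m%:Z)) 0.
  by apply: h; have := yk k; rewrite (_ : k%:Z - m%:Z = - i) //; lia.
exact: gr_KF Xi (yk k) ik.
Qed.

(** The filtration of the grading: all degrees from [a] on, the summands of degree above [m] being
    0. *)
Definition gs (a : nat) := (\sum_(i < m.+1) gr (i%:Z + a%:Z)%R)%VS.

Lemma gr_gs a (k : int) X : (a%:Z <= k) -> X \in gr k -> X \in gs a.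
Proof.
move=> ak Xk; have [km|mk] := lerP k m%:Z; last first.
  by move: Xk; rewrite gr_big ?memv0 => [/eqP->|]; rewrite ?mem0v //; lia.
have im : (`|k - a%:Z|%N < m.+1)%N by lia.
have := sumv_sup (Ordinal im) (P := xpredT) (Vs := fun i : 'I_m.+1 => gr (i%:Z + a%:Z)) (U := gr k) isT.
move=> /(_ _)/subvP; apply=> //; rewrite /= (_ : `|k - a%:Z|%N%:Z + a%:Z = k) //; lia.
Qed.

Lemma gs_lie a b X Y : X \in gs a -> Y \in gs b -> LB X Y \in gs (a + b).
Proof.
move=> /memv_sumP[x xi ->] /memv_sumP[y yj ->].
rewrite (lin_sum _ _ (lie_linear _)); apply: memv_suml => j _.
rewrite lieC (lin_sum _ _ (lie_linear _)) memvN; apply: memv_suml => i _.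
rewrite lieC memvN; apply: gr_gs (gr_mem (xi i isT) (yj j isT)); lia.
Qed.

Lemma gs_top : gs m.+1 = 0%VS.
Proof. by apply: big1 => i _; apply: gr_big; lia. Qed.

Lemma gs_sub a b : (a <= b)%N -> (gs b <= gs a)%VS.
Proof.
move=> ab; apply/subvP => X /memv_sumP[x xi ->]; apply: memv_suml => i _.
apply: gr_gs (xi i isT); lia.
Qed.

Lemma perp_gs1 X : (forall Y, Y \in gs 0 -> K X Y = 0) -> X \in gs 1.
Proof.
have [x xi ->] := gr_decomp X => h; apply: memv_suml => i _.
have [im|mi] := leqP i m; last by apply: gr_gs (xi i); lia.
rewrite (_ : x i = 0) ?mem0v //; apply: gr_nondeg (xi i) _ => Y Yi.
have : Y \in gs 0 by apply: gr_gs Yi; lia.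
move/h; rewrite KF_suml (bigD1 i) //= big1 ?addr0 // => j ji.
by apply: gr_KF (xi j) Yi _; move: ji; rewrite -val_eqE /=; lia.
Qed.

Lemma gs1_perp X Y : X \in gs 1 -> Y \in gs 0 -> K X Y = 0.
Proof.
move=> /memv_sumP[x xi ->] /memv_sumP[y yj ->].
rewrite KF_suml big1 // => i _; rewrite KF_sumr big1 // => j _.
by apply: gr_KF (xi i isT) (yj j isT) _; lia.
Qed.

Lemma perp1_gs0 X : (forall Y, Y \in gs 1 -> K X Y = 0) -> X \in gs 0.
Proof.
have [x xi ->] := gr_decomp X => h; apply: memv_suml => i _.
have [mi|im] := leqP m i; first by apply: gr_gs (xi i); lia.
rewrite (_ : x i = 0) ?mem0v //; apply: gr_nondeg (xi i) _ => Y Yi.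
have : Y \in gs 1 by apply: gr_gs Yi; lia.
move/h; rewrite KF_suml (bigD1 i) //= big1 ?addr0 // => j ji.
by apply: gr_KF (xi j) Yi _; move: ji; rewrite -val_eqE /=; lia.
Qed.

End Grading.

Variables (pp np : {vspace g}).
Hypothesis ppP : parabolic pp.
Hypothesis npP : nilradical pp np.

Let grading : exists (m : nat) (gr : int -> {vspace g}),
  [/\ (\sum_(i < m.*2.+1) gr (i%:Z - m%:Z)%R)%VS = fullv,
      forall i : int, (m%:Z < `|i|) -> gr i = 0%VS,
      forall i j : int, (lieV (gr i) (gr j) <= gr (i + j)%R)%VS & pp = gs m gr 0].
Proof.
have [m [gr [_ g1 g2 g3 [_ ->]]]] := ppP; exists m, gr; split=> //.
by apply: eq_bigr => i _; rewrite addr0.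
Qed.

Lemma pp_lie X Y : X \in pp -> Y \in pp -> LB X Y \in pp.
Proof. by have [m [gr [g1 g2 g3 ->]]] := grading; exact: (gs_lie g2 g3). Qed.

Lemma ad_np X Z : X \in pp -> Z \in np -> LB X Z \in np.
Proof. by have [[_ /subvP nI] _ _] := npP => Xp Zn; apply: nI; exact: mem_lieV. Qed.

Lemma np_pp Z : Z \in np -> Z \in pp.
Proof. by have [[/subvP h _] _ _] := npP; exact: h. Qed.

Lemma ad_iter_np k X Y : X \in pp -> Y \in iter k (lieV np) np -> LB X Y \in iter k (lieV np) np.
Proof.
move=> Xp; elim: k Y => [|k IH] Y /=; first exact: ad_np.
apply: (lieV_ind (T := LB X)); first exact: lie_linear.
move=> A B An Bk; have -> : LB X (LB A B) = LB (LB X A) B + LB A (LB X B).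
  by rewrite lie_jacobi subrK.
by rewrite memvD // mem_lieV // ?ad_np // IH.
Qed.

(** [np] is only given as the largest nilpotent ideal, so orthogonality is a trace argument. On [pp]
    both [T = ad Z ad X] and its Killing adjoint [T' = ad X ad Z] run down the lower central series
    of [np]. As a power of [T'] kills [pp], and so [gs 1], the same power of [T] maps [g] into the
    orthogonal of [gs 1], that is into [pp], and as many further steps give 0. *)
Lemma np_perp Z X : Z \in np -> X \in pp -> K Z X = 0.
Proof.
move=> Zn Xp; have [_ [N NN] _] := npP; have [m [gr [g1 g2 g3 ppE]]] := grading.
have L := @lie_linear.
rewrite KFC KF_trop.
pose T x := LB Z (LB X x); pose T' x := LB X (LB Z x).
have Tl : linear T by move=> a x y; rewrite /T !L.
have Tit k x : x \in pp -> iter k.+1 T x \in iter k (lieV np) np.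
  move=> xp; elim: k => [|k IH].
    have H := ad_np (pp_lie Xp xp) Zn.
    by rewrite /= /T lieC memvN.
  rewrite iterS {1}/T; apply: mem_lieV => //; exact: ad_iter_np.
have Tit' k x : x \in pp -> iter k.+1 T' x \in iter k (lieV np) np.
  move=> xp; elim: k => [|k IH].
    have H : LB Z x \in np by rewrite lieC memvN; exact: ad_np.
    exact: ad_np.
  rewrite iterS {1}/T'; apply: ad_iter_np => //; exact: mem_lieV.
have adj k A B : K (iter k T A) B = K A (iter k T' B).
  elim: k B => // k IH B; rewrite iterS iterSr {1}/T !KF_inv opprK -/(T' B) IH //.
apply: (trop_nilpotent (k := (N.+1 + N.+1)%N) Tl) => x.
rewrite iterD; have /Tit : iter N.+1 T x \in pp.
  rewrite ppE; apply: (perp1_gs0 g1 g2 g3) => W W1; rewrite adj.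
  have : W \in pp by rewrite ppE; apply: (subvP (gs_sub g2 (leq0n 1))).
  by move=> /(Tit' N); rewrite NN memv0 => /eqP->; rewrite KF0r.
by move=> /(_ N); rewrite NN memv0 => /eqP.
Qed.

(** The orthogonal of [pp] lies in [gs 1], a nilpotent ideal, and [np] contains all of these. *)
Lemma perp_np Z : (forall X, X \in pp -> K Z X = 0) -> Z \in np.
Proof.
have [_ _ nmax] := npP; have [m [gr [g1 g2 g3 ppE]]] := grading.
rewrite ppE => /(perp_gs1 g1 g2 g3); apply/subvP/nmax.
  split; first by rewrite ppE; exact: (gs_sub g2).
  by apply: lieV_sub => A B; rewrite ppE => Ap Bp; have := gs_lie g2 g3 Ap Bp.
exists m; suff H k : (iter k (lieV (gs m gr 1)) (gs m gr 1) <= gs m gr k.+1)%VS.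
  by apply/eqP; rewrite -subv0 -(gs_top g2); exact: H.
elim: k => [|k /subvP IH] //=; apply: lieV_sub => A B A1 /IH Bk.
by have := gs_lie g2 g3 A1 Bk.
Qed.

Lemma perp_np_pp X : (forall Z, Z \in np -> K X Z = 0) -> X \in pp.
Proof.
have [m [gr [g1 g2 g3 ppE]]] := grading => h; rewrite ppE.
apply: (perp1_gs0 g1 g2 g3) => Y Y1; apply: h; apply: perp_np => A.
by rewrite ppE => A0; exact: (gs1_perp g1 g2 g3).
Qed.

Variables (n : nat) (E F : 'I_n -> g).
Hypothesis EF : dual_frame pp E F.

Lemma frame_np i : F i \in np.
Proof. by apply: perp_np => X; exact: (frame_Fh EF). Qed.

(* The trace of ad Z on g/p vanishes for Z in p_+, since ad Z is nilpotent. *)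
Lemma trace_np Z : Z \in np -> \sum_i K (F i) (LB Z (E i)) = 0.
Proof.
move=> Zn; have [m [gr [g1 g2 g3 ppE]]] := grading; have L := @lie_linear.
have : Z \in gs m gr 1 by apply: (perp_gs1 g1 g2 g3) => Y; rewrite -ppE; exact: np_perp.
move=> {Zn}.
case/memv_sumP => z zi ->.
transitivity (\sum_(k < m.+1) \sum_i K (F i) (LB (z k) (E i))).
  rewrite exchange_big; apply: eq_bigr => i _.
  rewrite lieC (lin_sum _ _ (L _)) -sumrN KF_sumr.
  by apply: eq_bigr => k _; rewrite (lieC (E i)) opprK.
apply: big1 => k _; have {zi} := zi k isT; move: (z k) => {z} {}Z Zk.
have Zp Y : Y \in pp -> LB Z Y \in pp.
  by apply: pp_lie; rewrite ppE; apply: gr_gs Zk => //; lia.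
pose T X := \sum_i K (F i) (LB Z X) *: E i.
have Tl : linear T.
  move=> a x y; rewrite /T scaler_sumr -big_split; apply: eq_bigr => i _ /=.
  by rewrite L KFDr KFZr scalerDl scalerA.
transitivity (trop T).
  transitivity (\sum_i \sum_j K (F i) (LB Z (delta_mx 0 j)) * E i 0 j).
    apply: eq_bigr => i _; rewrite {1}(row_sum_delta (E i)) (lin_sum _ _ (L Z)) KF_sumr.
    by apply: eq_bigr => j _; rewrite lieZr KFZr mulrC.
  rewrite exchange_big; apply: eq_bigr => j _; rewrite mxE /T summxE.
  by apply: eq_bigr => i _; rewrite mxE.
have Tmod X : LB Z X - T X \in pp by exact: (frame_mod EF).
have iterT N X : iter N (LB Z) X - iter N T X \in pp.
  elim: N => [|N IH] /=; first by rewrite subrr mem0v.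
  have -> : LB Z (iter N (LB Z) X) - T (iter N T X) =
     LB Z (iter N (LB Z) X - iter N T X) + (LB Z (iter N T X) - T (iter N T X)).
    by rewrite lieDr lieNr addrA subrK.
  by rewrite memvD // Zp.
apply: (trop_nilpotent (k := m.*2.+2) Tl) => X.
have dk : (k%:Z + 1 : int) != 0 by lia.
have Z0 : iter m.*2.+1 (LB Z) X = 0.
  apply: (gr_shift g1 g2 (L Z) dk) => j Y Yj; rewrite addrC; exact: (gr_mem g3).
have := iterT m.*2.+1 X; rewrite Z0 sub0r memvN => /Zp TX.
by rewrite iterS /T big1 // => i _; rewrite (frame_Fh EF) ?scale0r.
Qed.

End Parabolic.

(** * The Kostant codifferential in a dual frame *)

Section Kostant.
Variables (pp np : {vspace g}).
Hypothesis ppP : parabolic pp.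
Hypothesis npP : nilradical pp np.
Variables (n : nat) (E F : 'I_n -> g).
Hypothesis EF : dual_frame pp E F.

Lemma altform_lin (A B : lmodType R) p (hh : {vspace g}) (u : seq g -> A) (L : A -> B) :
  (forall a x y, L (a *: x + y) = a *: L x + L y) -> altform p hh u -> altform p hh (fun s => L (u s)).
Proof.
move=> Ll [u1 u2 u3 u4].
have L0 := linear_map0 Ll.
split=> [s sp|s1 s2 a x y|s su|s sh]; [by rewrite u1|by rewrite u2 Ll|by rewrite u3|by rewrite u4].
Qed.

Lemma decomp_sym (A : lmodType R) (Z s : seq g) (v : A) : decomp Z v s = decomp s v Z.
Proof.
rewrite !decompE [size Z == _]eq_sym; case: eqP => // sz; rewrite -det_tr.
suff H N M (a : nat -> nat -> R) : N = M -> \det (\matrix_(i < N, j < N) a j i)^T = \det (\matrix_(i < M, j < M) a i j).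
  rewrite -(H _ _ (fun i j => K s`_i Z`_j) (esym sz)).
  by congr (\det _ *: _); apply/matrixP => i j; rewrite !mxE KFC.
by move=> ->; congr (\det _); apply/matrixP => i j; rewrite !mxE.
Qed.

Lemma decomp_lin (A B : lmodType R) (Z s : seq g) (v : A) (L : A -> B) :
  (forall a x y, L (a *: x + y) = a *: L x + L y) -> L (decomp Z v s) = decomp Z (L v) s.
Proof.
move=> Ll; have L0 := linear_map0 Ll.
rewrite /decomp; case: ifP => // _.
by have := Ll (\det (\matrix_(i < size Z, j < size Z) killing Z`_i s`_j)) v 0; rewrite L0 !addr0.
Qed.

Section Values.
Variables (A : lmodType R) (act : g -> A -> A).
Hypothesis actl : forall a X Y v, act (a *: X + Y) v = a *: act X v + act Y v.
Hypothesis actr : forall X a x y, act X (a *: x + y) = a *: act X x + act X y.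
Implicit Types u : seq g -> A.

Lemma act0 X : act X 0 = 0.
Proof. by have := actr X (-1) 0 0; rewrite scaler0 addr0 scaleN1r addNr. Qed.
Lemma actD X x y : act X (x + y) = act X x + act X y.
Proof. by have := actr X 1 x y; rewrite !scale1r. Qed.
Lemma actZ X a x : act X (a *: x) = a *: act X x.
Proof. by have := actr X a x 0; rewrite act0 !addr0. Qed.
Lemma act_suml I (r : seq I) (a : I -> R) (f : I -> g) v :
  act (\sum_(i <- r) a i *: f i) v = \sum_(i <- r) a i *: act (f i) v.
Proof.
elim: r => [|i r IH]; last by rewrite !big_cons actl IH.
by rewrite !big_nil; have := actl (-1) 0 0 v; rewrite scaler0 addr0 scaleN1r addNr.
Qed.

(** One summand of the codifferential: contract with the frame vector and act with its dual, on the
    values and on the remaining arguments. The factor 1/2 compensates that the brackets of [Z_i] and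
    [Z_j] are met twice, once from each side. *)
Definition kos_pair (Z X : g) u s : A := - act Z (u (X :: s)) + 2^-1 *: adact Z (io X u) s.
Definition kos u s : A := \sum_i kos_pair (F i) (E i) u s.

Lemma kos_pair_linear Z X a u u' s :
  kos_pair Z X (fun s => a *: u s + u' s) s = a *: kos_pair Z X u s + kos_pair Z X u' s.
Proof.
rewrite /kos_pair actr (adact_linear Z a (io X u) (io X u') s) opprD !scalerDr !scalerA scalerN.
rewrite (mulrC _ a); zcan.
Qed.

Lemma kos_linear a u u' s : kos (fun s => a *: u s + u' s) s = a *: kos u s + kos u' s.
Proof.
by rewrite /kos scaler_sumr -big_split; apply: eq_bigr => i _; rewrite kos_pair_linear.
Qed.

Lemma kos0 s : kos (fun=> 0) s = 0.
Proof.
rewrite /kos big1 // => i _; rewrite /kos_pair act0 oppr0 add0r.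
by rewrite (adact_ext (F i) (v := fun=> 0)) // adact0 scaler0.
Qed.

Lemma kos_eq u u' s : (forall s, u s = u' s) -> kos u s = kos u' s.
Proof. by move=> /funext->. Qed.

Lemma kosD u u' s : kos (fun s => u s + u' s) s = kos u s + kos u' s.
Proof.
have := kos_linear 1 u u' s; rewrite scale1r => <-.
by apply: kos_eq => t; rewrite scale1r.
Qed.
Lemma kos_sum I (r : seq I) (f : I -> seq g -> A) s :
  kos (fun s => \sum_(i <- r) f i s) s = \sum_(i <- r) kos (f i) s.
Proof.
elim: r => [|i r IH].
  by rewrite big_nil -[RHS](kos0 s); apply: kos_eq => t; rewrite big_nil.
by rewrite big_cons -IH -kosD; apply: kos_eq => t; rewrite big_cons.
Qed.

(** By [np_perp] the members of [Z] annihilate [pp]; contracting with [E i] and acting with [F i]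
    therefore reassembles each of them. *)
Lemma kostant_decompE Z v s : {subset Z <= np} ->
  kostant_decomp act Z v s = kos (decomp Z v) s.
Proof.
move=> Zn; have Zp k X : (k < size Z)%N -> X \in pp -> K Z`_k X = 0.
  by move=> kZ Xp; apply: (np_perp ppP npP) => //; apply: Zn; exact: mem_nth.
have Zs (k : nat) : (k < size Z)%N -> Z`_k = \sum_i K Z`_k (E i) *: F i.
  by move=> kZ; apply: (frame_dual EF) => X; exact: Zp.
rewrite /kos /kos_pair big_split /= /kostant_decomp; congr (_ + _).
  under [RHS]eq_bigr => i _.
    rewrite decomp_io (big_morph _ (actD (F i)) (act0 (F i))) -sumrN.
    over.
  rewrite exchange_big; apply: eq_bigr => k _ /=.
  rewrite {1}(Zs k (ltn_ord k)) act_suml.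
  have := @decomp_lin A A (del k Z) s v (fun x : A => \sum_i K Z`_k (E i) *: act (F i) x).
  move=> <-.
    rewrite scaler_sumr; apply: eq_bigr => i _.
    by rewrite !actZ exprS mulN1r scaleNr.
  move=> a x y; rewrite scaler_sumr -big_split; apply: eq_bigr => i _ /=.
  by rewrite actr scalerDr !scalerA mulrC.
have rowE Y W : decomp (W :: Y) v s = \sum_(m < size s) (-1) ^+ m *: (K W s`_m *: decomp Y v (del m s)).
  rewrite decomp_sym decomp_io; apply: eq_bigr => m _.
  by rewrite KFC decomp_sym.
(* Expanding two slots of the determinant deletes two members of [Z] in either order. Up to the sign
   of the position the orders contribute [K Z_i [Z_j, x]] and [- K Z_j [Z_i, x]], both equal to [K
   [Z_i, Z_j] x], hence the factor 2. *)
have pairE x t : \sum_i decomp Z v (E i :: LB (F i) x :: t) =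
    \sum_(j < size Z) \sum_(i < j) (-1) ^+ (i + j) *: ((2 * K (LB Z`_i Z`_j) x) *: decomp (del i (del j Z)) v t).
  move: Zs Zp => {rowE}; case E0 : (size Z) => [|N] Zs Zp.
    by rewrite big_ord0 big1 // => i _; rewrite decompE E0.
  pose f X Y k l : A := (-1) ^+ k *: (K Z`_k X *: ((-1) ^+ l *: (K (del k Z)`_l Y *: decomp (del l (del k Z)) v t))).
  transitivity (\sum_a \sum_(k < N.+1) \sum_(l < N) f (E a) (LB (F a) x) k l).
    apply: eq_bigr => a _; rewrite decomp_io E0; apply: eq_bigr => k _.
    rewrite decomp_io size_del E0 //= 2!scaler_sumr; apply: eq_bigr => l _; by [].
  under eq_bigr do rewrite sum_pairs.
  rewrite exchange_big; apply: eq_bigr => j _; rewrite exchange_big; apply: eq_bigr => i _ /=.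
  have jN : (j < N.+1)%N by [].
  have iN : (i < N.+1)%N := ltn_trans (ltn_ord i) jN.
  have j0 : (0 < j)%N := leq_ltn_trans (leq0n i) (ltn_ord i).
  have ij1 : (i <= j.-1)%N by rewrite -ltnS prednK.
  have dd : del j.-1 (del i Z) = del i (del j Z) by rewrite del_del // prednK.
  have n1 : (del j Z)`_i = Z`_i by rewrite nth_del /bump leqNgt ltn_ord.
  have n2 : (del i Z)`_j.-1 = Z`_j by rewrite nth_del /bump ij1 /= add1n prednK.
  rewrite /f dd n1 n2; under eq_bigr do rewrite !scalerA -scalerDl.
  rewrite -scaler_suml scalerA; congr (_ *: _).
  have contr Y W : (forall X, X \in pp -> K Y X = 0) -> \sum_a K Y (E a) * K W (LB (F a) x) = K W (LB Y x).
    move=> Yp; rewrite [in RHS](frame_dual EF Yp).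
    have -> : LB (\sum_a K Y (E a) *: F a) x = \sum_a K Y (E a) *: LB (F a) x.
      elim: (index_enum _) => [|a r IH]; first by rewrite !big_nil lie0l.
      by rewrite !big_cons lie_linearl IH.
    by rewrite KF_sumr; apply: eq_bigr => a _; rewrite KFZr.
  have e1 : K Z`_i (LB Z`_j x) = K (LB Z`_i Z`_j) x.
    by rewrite (lieC Z`_i) KFNl KF_inv opprK.
  have e2 : K Z`_j (LB Z`_i x) = - K (LB Z`_i Z`_j) x by rewrite KF_inv opprK.
  transitivity ((-1) ^+ (i + j) * (\sum_a K Z`_j (E a) * K Z`_i (LB (F a) x)) -
     (-1) ^+ (i + j) * (\sum_a K Z`_i (E a) * K Z`_j (LB (F a) x))); last first.
    rewrite !contr ?e1 ?e2; [ring|by move=> X; apply: Zp|by move=> X; apply: Zp].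
  rewrite !mulr_sumr -sumrB; apply: eq_bigr => a _.
  have sj : (-1) ^+ j = - (-1) ^+ j.-1 :> R by rewrite -{1}(prednK j0) exprS mulN1r.
  by rewrite exprD sj; ring.
transitivity (\sum_(m < size s) (-1) ^+ m *: (2^-1 *: \sum_i decomp Z v (E i :: LB (F i) s`_m :: del m s))); last first.
  rewrite /adact; under [RHS]eq_bigr do rewrite scaler_sumr.
  rewrite exchange_big; apply: eq_bigr => m _; rewrite !scaler_sumr; apply: eq_bigr => i _ /=.
  by rewrite !scalerA mulrC.
rewrite LBE; under eq_bigr do under eq_bigr do rewrite rowE scaler_sumr.
transitivity (\sum_(j < size Z) \sum_(m < size s) \sum_(i < j) (-1) ^+ (i + j) *: ((-1) ^+ m *: (K (LB Z`_i Z`_j) s`_m *: decomp (del i (del j Z)) v (del m s)))).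
  by apply: eq_bigr => j _; rewrite exchange_big.
rewrite exchange_big; apply: eq_bigr => m _ /=; rewrite pairE !scaler_sumr; apply: eq_bigr => j _.
rewrite !scaler_sumr; apply: eq_bigr => i _; rewrite !scalerA; congr (_ *: _).
by rewrite mulrA -!mulrA; field.
Qed.

Lemma altform_expand_np k u : altform k pp u -> exists ts : seq (seq g * A),
  (forall t, t \in ts -> size t.1 = k /\ {subset t.1 <= np}) /\
  u = (fun s => \sum_(t <- ts) decomp t.1 t.2 s).
Proof.
move=> ua; exists [seq (mkl (fun i => F (J i)), (k`!%:R)^-1 *: u (mkl (fun i => E (J i)))) | J : {ffun 'I_k -> 'I_n}].
split.
  move=> t /mapP[I _ ->] /=; rewrite size_mkl; split=> // x /mapP[i _ ->].
  exact: (frame_np ppP npP EF).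
apply/funext => s; rewrite (decomp_expand EF s ua) big_map big_enum //=.
Qed.

Lemma kos_alt k u : altform k pp u -> altform k.-1 pp (kos u).
Proof.
move=> ua; apply: altform_sum => i; apply: altformD.
  have := altform_lin (L := fun x => - act (F i) x) _ (altform_io (E i) ua); apply.
  by move=> a x y; rewrite actr opprD scalerN.
apply: altformZ; apply: adact_alt (altform_io (E i) ua).
by move=> Y Yp; apply: (pp_lie ppP) => //; apply: (np_pp npP); exact: (frame_np ppP npP EF).
Qed.

Lemma kos_pair_bilinear p u s : altform p pp u ->
  [/\ forall a X Y Z, kos_pair (a *: X + Y) Z u s = a *: kos_pair X Z u s + kos_pair Y Z u s,
      forall a X Y Z, kos_pair Z (a *: X + Y) u s = a *: kos_pair Z X u s + kos_pair Z Y u s &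
      forall Z X, X \in pp -> kos_pair Z X u s = 0].
Proof.
move=> ua; have [_ ul _ _] := ua; split.
- move=> a X Y Z; rewrite /kos_pair actl (adact_linearX _ _ _ _ (altform_io Z ua)).
  by rewrite opprD !scalerDr !scalerA scalerN (mulrC _ a); zcan.
- move=> a X Y Z; rewrite /kos_pair (ul [::]) /= actr.
  rewrite (adact_ext Z (v := fun t => a *: io X u t + io Y u t)); last by move=> t _; exact: (ul [::]).
  by rewrite adact_linear opprD !scalerDr !scalerA scalerN (mulrC _ a); zcan.
- move=> Z X Xp; rewrite /kos_pair (altform_io_hh _ ua Xp) act0 oppr0 add0r.
  rewrite (adact_ext Z (v := fun=> 0)) ?adact0 ?scaler0 // => t _.
  exact: altform_io_hh ua Xp.
Qed.

(** The sum is independent of the dual frame by [frame_casimir], so the frame may be carried along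
    by [phi]. *)
Lemma kos_map k u (phi : g -> g) (L : A -> A) s : dual_frame pp (fun i => phi (E i)) (fun i => phi (F i)) ->
  (forall X Y, phi (LB X Y) = LB (phi X) (phi Y)) ->
  (forall a x y, L (a *: x + y) = a *: L x + L y) ->
  (forall Z v, act Z (L v) = L (act (phi Z) v)) -> altform k pp u ->
  kos (fun s => L (u (map phi s))) s = L (kos u (map phi s)).
Proof.
move=> fE fl Ll La ua; have [kl kr kp] := kos_pair_bilinear (map phi s) ua.
have L0 := linear_map0 Ll.
have LD x y : L (x + y) = L x + L y by have := Ll 1 x y; rewrite !scale1r.
have LZ a x : L (a *: x) = a *: L x by have := Ll a x 0; rewrite L0 !addr0.
have LN x : L (- x) = - L x by rewrite -scaleN1r LZ scaleN1r.
rewrite {2}/kos -(frame_casimir EF (Psi := fun Z X => kos_pair Z X u (map phi s)) fE) //; last first.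
  by move=> Z X Xp _; exact: kp.
rewrite (big_morph L LD L0); apply: eq_bigr => i _; rewrite /kos_pair LD LN LZ La; congr (_ + _ *: _).
rewrite /adact (big_morph L LD L0) size_map; apply: eq_bigr => m _.
by rewrite LZ /io /= fl (nth_map 0) // /del map_cat map_take map_drop.
Qed.

(** Infinitesimal form of [kos_map], for the operator [D - adact X] in which Lie derivatives act on
    a form. *)
Lemma kos_lie k u (D : A -> A) X s : X \in pp ->
  (forall a x y, D (a *: x + y) = a *: D x + D y) ->
  (forall Z v, D (act Z v) - act Z (D v) = act (LB X Z) v) -> altform k pp u ->
  kos (fun s => D (u s) - adact X u s) s = D (kos u s) - adact X (kos u) s.
Proof.
move=> Xp Dl DA ua; have [kl kr kp] := kos_pair_bilinear s ua.
have D0 := linear_map0 Dl.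
have DD x y : D (x + y) = D x + D y by have := Dl 1 x y; rewrite !scale1r.
have DZ a x : D (a *: x) = a *: D x by have := Dl a x 0; rewrite D0 !addr0.
have DN x : D (- x) = - D x by rewrite -scaleN1r DZ scaleN1r.
have cas := frame_casimir_lie EF (Psi := fun Z X => kos_pair Z X u s) (fun Y Yp => pp_lie ppP Xp Yp) kl kr (fun i Y Yp => kp _ _ Yp).
apply/eqP; rewrite -subr_eq0; apply/eqP; rewrite -[RHS]oppr0 -[in RHS]cas -[RHS]sumrN.
have -> : D (kos u s) = \sum_i D (kos_pair (F i) (E i) u s) by rewrite /kos (big_morph D DD D0).
have -> : adact X (kos u) s = \sum_i adact X (kos_pair (F i) (E i) u) s by exact: adact_sum.
rewrite /kos -sumrB -sumrB; apply: eq_bigr => i _.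
rewrite /kos_pair.
have uai := altform_io (E i) ua.
have ioX t : adact X u (E i :: t) = u (LB X (E i) :: t) + adact X (io (E i) u) t by rewrite (adact_cons _ _ _ ua).
have e1 : adact (F i) (io (E i) (fun t => D (u t) - adact X u t)) s =
    D (adact (F i) (io (E i) u) s) - adact (F i) (io (LB X (E i)) u) s - adact (F i) (adact X (io (E i) u)) s.
  rewrite (adact_ext (F i) (v := fun t => -1 *: (io (LB X (E i)) u t + adact X (io (E i) u) t) + D (u (E i :: t)))); last first.
    by move=> t _; rewrite /io ioX scaleN1r addrC.
  rewrite adact_linear adactD scaleN1r opprD addrC addrA; congr (_ - _ - _).
  rewrite /adact (big_morph D DD D0); apply: eq_bigr => m _; by rewrite DZ.
have e2 : adact X (fun t => - act (F i) (u (E i :: t)) + 2^-1 *: adact (F i) (io (E i) u) t) s =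
   - act (F i) (adact X (io (E i) u) s) + 2^-1 *: adact X (adact (F i) (io (E i) u)) s.
  rewrite (adact_ext X (v := fun t => 2^-1 *: adact (F i) (io (E i) u) t + - act (F i) (u (E i :: t)))); last by move=> t _; rewrite addrC.
  rewrite adact_linear addrC; congr (_ + _).
  rewrite /adact (big_morph _ (actD (F i)) (act0 (F i))) -sumrN; apply: eq_bigr => m _.
  by rewrite actZ scalerN.
rewrite e1 [adact X (kos_pair _ _ _) s]e2 ioX.
have actN Z x : act Z (- x) = - act Z x by rewrite -scaleN1r actZ scaleN1r.
rewrite !actD !actN !actD DD DN DZ (adact_comm X (F i) s uai) -DA !opprD !opprK !scalerDr !scalerN.
zcan.
Qed.

End Values.

(** Any decomposition into decomposable forms has the same image [kos act u], so the choice made by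
    [kostant] does not matter. *)
Lemma kostantE a b (act : g -> 'M[R]_(a, b) -> 'M[R]_(a, b)) k (u : seq g -> 'M[R]_(a, b)) :
  (forall c X Y v, act (c *: X + Y) v = c *: act X v + act Y v) ->
  (forall X c x y, act X (c *: x + y) = c *: act X x + act X y) ->
  altform k pp u -> kostant np act k u = kos act u.
Proof.
move=> actl actr ua; rewrite /kostant; set P := (X in get X).
have uniq_w w : P w -> w = kos act u.
  move=> [ts [tn -> ->]]; apply/funext => s; rewrite (kos_sum actr).
  by rewrite big_seq [RHS]big_seq; apply: eq_bigr => t /tn[_ tn']; rewrite (kostant_decompE actl actr).
have [ts [tn uE]] := altform_expand_np ua.
by apply: uniq_w; apply: getPex; exists (fun s => \sum_(t <- ts) kostant_decomp act t.1 t.2 s), ts; split.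
Qed.

Section Adjoint.
Variables (A B C : lmodType R) (mul : A -> B -> C).
Hypothesis mulL : forall a x y z, mul (a *: x + y) z = a *: mul x z + mul y z.
Hypothesis mulR : forall a x y z, mul z (a *: x + y) = a *: mul z x + mul z y.
Variables (actA : g -> A -> A) (actB : g -> B -> B).
Hypothesis actAr : forall X a x y, actA X (a *: x + y) = a *: actA X x + actA X y.
Hypothesis actBr : forall X a x y, actB X (a *: x + y) = a *: actB X x + actB X y.
Hypothesis actm : forall X a b, mul a (actB X b) = - mul (actA X a) b.

Lemma wedge_act X p (u : seq g -> A) (v : seq g -> B) s :
  wedge p mul u (fun t => actB X (v t)) s = - wedge p mul (fun t => actA X (u t)) v s.
Proof.
rewrite !wedgeE -scalerN -sumrN; congr (_ *: _); apply: eq_bigr => sg _.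
by rewrite actm scalerN.
Qed.

(** Integration by parts in top degree. Contractions pass from [al] to [be] because products of
    degree [n + 1] vanish, and [F i] acts on top forms by a trace that is 0 on [np]. The vector
    [\sum_i [F i, E i]] left over lies in [pp] for the same reason, so [be] kills it. *)
Lemma kos_wedge q k (be : seq g -> A) (al : seq g -> B) s : altform q pp be -> altform k.+1 pp al ->
  (q + k)%N = n ->
  wedge q mul be (kos actB al) s = (-1) ^+ q *: wedge q.-1 mul (kos actA be) al s.
Proof.
move=> ba aa qk.
have n1 : (n < q + k.+1)%N by rewrite addnS qk.
have Fp i Y : Y \in pp -> LB (F i) Y \in pp.
  by apply: (pp_lie ppP); apply: (np_pp npP); exact: (frame_np ppP npP EF).
have vanish (b : seq g -> A) i : altform q pp b ->
    wedge q mul b (io (E i) al) s = - ((-1) ^+ q *: wedge q.-1 mul (io (E i) b) al s).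
  move=> ba'; have /eqP := altform_over EF (E i :: s) (wedge_alt mulL mulR ba' aa) n1.
  rewrite (wedge_cons mulL mulR _ _ ba' aa) addrC addr_eq0 => /eqP/(congr1 (fun x => (-1) ^+ q *: x)).
  by rewrite scalerA -expr2 sqrr_sign scale1r scalerN.
have W0 t : \sum_i be (LB (F i) (E i) :: t) = 0.
  have -> : \sum_i be (LB (F i) (E i) :: t) = be ((\sum_i LB (F i) (E i)) :: t).
    by case: ba => _ bl _ _; rewrite (slot_sum [::] t _ _ bl).
  apply: altform_io_hh ba _; apply: (perp_np_pp ppP npP) => Z Zn.
  have T0 := trace_np ppP npP EF Zn.
  apply: oppr_inj; rewrite oppr0 KF_suml -sumrN -[RHS]T0.
  apply: eq_bigr => i _.
  by rewrite KF_inv opprK lieC KFNr (KFC (E i)) KF_inv opprK.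
have -> : wedge q mul be (kos actB al) s = \sum_i wedge q mul be (kos_pair actB (F i) (E i) al) s.
  rewrite /kos; elim: (index_enum _) => [|i r IH].
    by rewrite big_nil -[RHS](wedge0r mulR q be s); apply: wedge_eq => // t; rewrite big_nil.
  by rewrite big_cons -IH -(wedgeDr mulR); apply: wedge_eq => // t; rewrite big_cons.
have -> : wedge q.-1 mul (kos actA be) al s = \sum_i wedge q.-1 mul (kos_pair actA (F i) (E i) be) al s.
  by rewrite /kos (wedge_suml mulL).
have pairA i : wedge q.-1 mul (kos_pair actA (F i) (E i) be) al s =
   - wedge q.-1 mul (fun t => actA (F i) (be (E i :: t))) al s + 2^-1 *: wedge q.-1 mul (adact (F i) (io (E i) be)) al s.
  rewrite /kos_pair (wedgeDl mulL) (wedgeZl mulL); congr (_ + _).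
  by rewrite -scaleN1r -(wedgeZl mulL); apply: wedge_eq => // t; rewrite scaleN1r.
have pairB i : wedge q mul be (kos_pair actB (F i) (E i) al) s = (-1) ^+ q *:
   (- wedge q.-1 mul (fun t => actA (F i) (be (E i :: t))) al s +
    2^-1 *: (wedge q.-1 mul (adact (F i) (io (E i) be)) al s + wedge q.-1 mul (fun t => be (LB (F i) (E i) :: t)) al s)).
  rewrite /kos_pair (wedgeDr mulR) (wedgeZr mulR) scalerDr; congr (_ + _).
    have -> : wedge q mul be (fun s => - actB (F i) (al (E i :: s))) s = - wedge q mul be (fun s => actB (F i) (al (E i :: s))) s.
      by rewrite -scaleN1r -(wedgeZr mulR); apply: wedge_eq => // t; rewrite scaleN1r.
    rewrite (wedge_act _ _ _ (io (E i) al)) opprK vanish; first by rewrite scalerN.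
    by apply: altform_lin ba => a x y; rewrite actAr.
  have top0 : adact (F i) (wedge q mul be (io (E i) al)) s = 0.
    have wa := wedge_alt mulL mulR ba (altform_io (E i) aa); rewrite /= qk in wa.
    rewrite (adact_top EF _ (Fp i) wa) (trace_np ppP npP EF) ?scale0r //.
    exact: (frame_np ppP npP EF).
  have := adact_wedge mulL mulR (F i) s ba (altform_io (E i) aa); rewrite top0 => /esym/eqP.
  rewrite addrC addr_eq0 => /eqP->; rewrite (vanish _ _ (adact_alt (Fp i) ba)) opprK.
  rewrite scalerA mulrC -scalerA; congr (_ *: (_ *: _)); rewrite -(wedgeDl mulL); apply: wedge_eq => // t.
  by rewrite {1}/io (adact_cons _ _ _ ba) addrC.
rewrite (eq_bigr _ (fun i _ => pairB i)) (eq_bigr _ (fun i _ => pairA i)) -scaler_sumr; congr (_ *: _).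
transitivity (\sum_i (- wedge q.-1 mul (fun t => actA (F i) (be (E i :: t))) al s + 2^-1 *: wedge q.-1 mul (adact (F i) (io (E i) be)) al s)
   + 2^-1 *: \sum_i wedge q.-1 mul (fun t => be (LB (F i) (E i) :: t)) al s).
  by rewrite scaler_sumr -big_split; apply: eq_bigr => i _ /=; rewrite scalerDr addrA.
rewrite -(wedge_suml mulL) (_ : (fun _ => _) = fun=> 0) ?(wedge0l mulL) ?scaler0 ?addr0 //.
by apply/funext => t; exact: W0.
Qed.

End Adjoint.
End Kostant.

(** * Forms on G, connections and the exterior derivative *)

Definition sform a b (p : nat) (f : gform G a b) : Prop :=
  (forall x, altform p 0%VS (f x)) /\ forall s, smooth (fun x => f x s).

Definition gio a b (X : g) (f : gform G a b) : gform G a b := fun y => io X (f y).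

Lemma sform_io a b p X (f : gform G a b) : sform p f -> sform p.-1 (gio X f).
Proof. by move=> [fa fs]; split=> [x|s]; [exact: altform_io|exact: fs]. Qed.

Lemma sform0 a b p : sform p (fun _ _ => 0 : 'M[R]_(a, b)).
Proof. by split=> [x|s]; [exact: altform0|exact: smooth_cst]. Qed.

Lemma sform_linear a b p c (f h : gform G a b) : sform p f -> sform p h ->
  sform p (fun x s => c *: f x s + h x s).
Proof.
move=> [fa fs] [ha hs]; split=> [x|s]; first exact: altform_linear.
by apply: smoothD; [exact: smoothZl|exact: hs].
Qed.

Lemma sform_eq a b p (f h : gform G a b) : (forall x s, f x s = h x s) -> sform p f -> sform p h.
Proof. by move=> fh; have -> : h = f by apply: funext2 => x s; rewrite fh. Qed.

Section Conn.
Variables (a b : nat) (sig : g -> 'M[R]_a) (tau : g -> 'M[R]_b).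
Hypothesis sigl : forall c X Y, sig (c *: X + Y) = c *: sig X + sig Y.
Hypothesis taul : forall c X Y, tau (c *: X + Y) = c *: tau X + tau Y.
Implicit Types (f h : gform G a b) (A B : G -> 'M[R]_(a, b)) (X Y : g).

(** The action on homomorphisms, by [sig] on the target and [tau] on the source. They need not be
    differentials of representations of [G], which makes room for the connection twisted by the
    Cartan involution. *)
Definition lact X (M : 'M[R]_(a, b)) : 'M[R]_(a, b) := sig X *m M - M *m tau X.

Lemma lact_linear X c M N : lact X (c *: M + N) = c *: lact X M + lact X N.
Proof. by rewrite /lact mulmxDr mulmxDl -scalemxAr -scalemxAl scalerBr opprD; zcan. Qed.
Lemma lact_linearX M c X Y : lact (c *: X + Y) M = c *: lact X M + lact Y M.
Proof. by rewrite /lact sigl taul mulmxDr mulmxDl -scalemxAr -scalemxAl scalerBr opprD; zcan. Qed.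
Lemma lact0 X : lact X 0 = 0. Proof. by rewrite /lact mulmx0 mul0mx subrr. Qed.
Lemma lactD X M N : lact X (M + N) = lact X M + lact X N.
Proof. by have := lact_linear X 1 M N; rewrite !scale1r. Qed.

Lemma smooth_lact X A : smooth A -> smooth (fun x => lact X (A x)).
Proof.
move=> As; apply: smoothD; first by apply: smoothM => //; exact: smooth_cst.
apply: smooth_ext (smoothZl (-1) (smoothM As (smooth_cst (tau X)))) => x.
by rewrite scaleN1r.
Qed.

Definition nab X A x := LD X A x + lact X (A x).

Lemma nab_ext X A B x : (forall y, A y = B y) -> nab X A x = nab X B x.
Proof. by move=> AB; rewrite /nab (Lder_ext _ _ AB) AB. Qed.

Lemma nab_linear X c A B x : smooth A -> smooth B ->
  nab X (fun y => c *: A y + B y) x = c *: nab X A x + nab X B x.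
Proof.
move=> As Bs; rewrite /nab LderD //; last exact: smoothZl.
by rewrite LderZ // lact_linear [c *: (LD _ _ _ + _)]scalerDr; move: (lact _ _) (lact _ _) => U V; zcan.
Qed.

Lemma nab0 X x : nab X (fun=> 0) x = 0.
Proof. by rewrite /nab Lder_cst lact0 addr0. Qed.

Lemma nabZ X c A x : smooth A -> nab X (fun y => c *: A y) x = c *: nab X A x.
Proof.
move=> As; have := nab_linear X c x As (smooth_cst 0); rewrite nab0 addr0 => <-.
by apply: nab_ext => y; rewrite addr0.
Qed.

Lemma nabD X A B x : smooth A -> smooth B -> nab X (fun y => A y + B y) x = nab X A x + nab X B x.
Proof.
move=> As Bs; have := nab_linear X 1 x As Bs; rewrite scale1r => <-.
by apply: nab_ext => y; rewrite scale1r.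
Qed.

Lemma nab_sum X I (r : seq I) (F : I -> G -> 'M[R]_(a, b)) x : (forall i, smooth (F i)) ->
  nab X (fun y => \sum_(i <- r) F i y) x = \sum_(i <- r) nab X (F i) x.
Proof.
move=> Fs; elim: r => [|i r IH].
  by rewrite big_nil -[RHS](nab0 X x); apply: nab_ext => y; rewrite big_nil.
rewrite big_cons -IH -nabD //; last exact: smooth_sum.
by apply: nab_ext => y; rewrite big_cons.
Qed.

Lemma nab_linearX c X Y A x : smooth A -> nab (c *: X + Y) A x = c *: nab X A x + nab Y A x.
Proof. by move=> As; rewrite /nab Lder_linear // lact_linearX [c *: (LD _ _ _ + _)]scalerDr; move: (lact _ _) (lact _ _) => U V; zcan. Qed.

Lemma smooth_nab X A : smooth A -> smooth (nab X A).
Proof. by move=> As; apply: smoothD; [exact: Lder_smooth|exact: smooth_lact]. Qed.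

Definition dl f : gform G a b := fun x s =>
    \sum_(i < size s) (-1) ^+ i *: nab s`_i (fun y => f y (del i s)) x
    + \sum_(j < size s) \sum_(i < j)
        (-1) ^+ (i + j) *: f x (LB s`_i s`_j :: del i (del j s)).

Definition LL X f : gform G a b := fun x s => nab X (fun y => f y s) x - adact X (f x) s.

Lemma dcovE (nb : conn G a b) f x s : (forall X A, smooth A -> nb X A x = nab X A x) ->
  (forall s, smooth (fun x => f x s)) -> dcov nb f x s = dl f x s.
Proof.
move=> nbE fs; rewrite /dcov LBE; congr (_ + _).
by apply: eq_bigr => i _; rewrite nbE.
Qed.

Lemma dl_eq f h x s : (forall y t, f y t = h y t) -> dl f x s = dl h x s.
Proof. by move=> fh; have -> : f = h by apply: funext2 => y t. Qed.
Lemma LL_eq X f h x s : (forall y t, f y t = h y t) -> LL X f x s = LL X h x s.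
Proof. by move=> fh; have -> : f = h by apply: funext2 => y t. Qed.

Lemma dl_nil f x : dl f x [::] = 0.
Proof. by rewrite /dl !big_ord0 addr0. Qed.

Lemma dl0 x s : dl (fun _ _ => 0) x s = 0.
Proof.
rewrite /dl !big1 ?addr0 // => i _; first by rewrite big1 // => j _; rewrite scaler0.
by rewrite nab0 scaler0.
Qed.

Lemma dl_linear c f h x s : (forall s, smooth (fun x => f x s)) -> (forall s, smooth (fun x => h x s)) ->
  dl (fun x s => c *: f x s + h x s) x s = c *: dl f x s + dl h x s.
Proof.
move=> fs hs; rewrite /dl scalerDr addrACA; congr (_ + _).
  rewrite scaler_sumr -big_split; apply: eq_bigr => i _ /=.
  by rewrite nab_linear // scalerDr !scalerA mulrC.
rewrite scaler_sumr -big_split; apply: eq_bigr => j _ /=.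
rewrite scaler_sumr -big_split; apply: eq_bigr => i _ /=.
by rewrite scalerDr !scalerA mulrC.
Qed.

Lemma dlD f h x s : (forall s, smooth (fun x => f x s)) -> (forall s, smooth (fun x => h x s)) ->
  dl (fun x s => f x s + h x s) x s = dl f x s + dl h x s.
Proof.
move=> fs hs; have := dl_linear 1 x s fs hs; rewrite scale1r => <-.
by apply: dl_eq => y t; rewrite scale1r.
Qed.

Lemma dlZ c f x s : (forall s, smooth (fun x => f x s)) ->
  dl (fun x s => c *: f x s) x s = c *: dl f x s.
Proof.
move=> fs; have := dl_linear c x s fs (fun=> smooth_cst 0); rewrite dl0 addr0 => <-.
by apply: dl_eq => y t; rewrite addr0.
Qed.

Lemma LL_linear X c f h x s : (forall s, smooth (fun x => f x s)) -> (forall s, smooth (fun x => h x s)) ->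
  LL X (fun x s => c *: f x s + h x s) x s = c *: LL X f x s + LL X h x s.
Proof.
move=> fs hs; rewrite /LL nab_linear // adact_linear scalerBr; zcan.
Qed.

(** The terms in which [X] differentiates or enters a bracket make up the Lie derivative; the others
    are those of the contracted form, each with one sign more. *)
Lemma dl_cons p f x X s : sform p f ->
  dl f x (X :: s) = LL X f x s - dl (gio X f) x s.
Proof.
move=> [fa fs]; rewrite /dl /LL /= !big_ord_recl !big_ord0 expr0 scale1r del0 add0r -!addrA; congr (_ + _).
have -> : \sum_(i < size s) (-1) ^+ lift ord0 i *: nab s`_i (fun y => f y (del (lift ord0 i) (X :: s))) x =
   - \sum_(i < size s) (-1) ^+ i *: nab s`_i (fun y => gio X f y (del i s)) x.
  by rewrite -sumrN; apply: eq_bigr => i _; rewrite lift0 exprS mulN1r scaleNr.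
have -> : \sum_(i < size s) \sum_(i0 < lift ord0 i) (-1) ^+ (i0 + lift ord0 i) *:
     f x (LB (X :: s)`_i0 s`_i :: del i0 (del (lift ord0 i) (X :: s))) =
   - adact X (f x) s - \sum_(j < size s) \sum_(i < j) (-1) ^+ (i + j) *: gio X f x (LB s`_i s`_j :: del i (del j s)).
  rewrite -opprD -big_split -sumrN; apply: eq_bigr => j _ /=.
  rewrite /bump /= add1n big_ord_recl /= add0n del_cons del0 exprS mulN1r scaleNr opprD; congr (_ + _).
  rewrite -sumrN; apply: eq_bigr => i _; rewrite /bump /= add1n del_cons addSn addnS !exprS !mulN1r opprK.
  rewrite -scalerN; congr (_ *: _); exact: (alt_swap [::] [::] _ _ _ (fa x)).
by zcan.
Qed.

Lemma sform_nab p X f : sform p f -> sform p (fun x s => nab X (fun y => f y s) x).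
Proof.
move=> [fa fs]; split=> [x|s]; last exact: smooth_nab.
split=> [s sp|s1 s2 c Y Z|s su|s sh].
- by rewrite (nab_ext X (B := fun=> 0)) ?nab0 // => y; case: (fa y) => h _ _ _; exact: h.
- by rewrite -nab_linear //; apply: nab_ext => y; case: (fa y) => _ h _ _; exact: h.
- by rewrite (nab_ext X (B := fun=> 0)) ?nab0 // => y; case: (fa y) => _ _ h _; exact: h.
- by rewrite (nab_ext X (B := fun=> 0)) ?nab0 // => y; case: (fa y) => _ _ _ h; exact: h.
Qed.

Lemma smooth_adact X f s : (forall s, smooth (fun x => f x s)) -> smooth (fun x => adact X (f x) s).
Proof. by move=> fs; apply: smooth_sum => m; apply: smoothZl. Qed.

Lemma sform_adact p X f : sform p f -> sform p (fun x => adact X (f x)).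
Proof.
move=> [fa fs]; split=> [x|s]; first exact: adact_alt0.
exact: smooth_adact.
Qed.

Lemma sform_LL p X f : sform p f -> sform p (LL X f).
Proof.
move=> ff; apply: sform_eq (sform_linear (-1) (sform_adact X ff) (sform_nab X ff)) => x s.
by rewrite scaleN1r addrC.
Qed.

Lemma smooth_dl f s : (forall s, smooth (fun x => f x s)) -> smooth (fun x => dl f x s).
Proof.
move=> fs; apply: smoothD; apply: smooth_sum => i; first by apply/smoothZl/smooth_nab.
by apply: smooth_sum => j; apply: smoothZl.
Qed.

Lemma sform_dl p f : sform p f -> sform p.+1 (dl f).
Proof.
have aux q h x : sform q h -> (forall X, altform q 0%VS (io X (dl h x))) -> altform q.+1 0%VS (dl h x).
  move=> hh; have [ha hs] := hh => hio.
  have ul y := let: And4 _ e _ _ := ha y in e.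
  have lin s c Y Z : dl h x (c *: Y + Z :: s) = c *: dl h x (Y :: s) + dl h x (Z :: s).
    rewrite !(dl_cons _ _ _ hh) scalerBr.
    have -> : dl (gio (c *: Y + Z) h) x s = c *: dl (gio Y h) x s + dl (gio Z h) x s.
      by rewrite -dl_linear; [apply: dl_eq => y t; exact: (ul y [::])|move=> t; exact: hs|move=> t; exact: hs].
    by rewrite /LL nab_linearX // (adact_linearX _ _ _ _ (ha x)) scalerBr; zcan.
  apply: altform_cons => //.
  - by rewrite dl_nil.
  - move=> X s; rewrite (dl_cons _ _ _ hh) (dl_cons _ _ _ (sform_io X hh)).
    rewrite (_ : dl (gio X (gio X h)) x s = 0); last first.
      by rewrite -[RHS](dl0 x s); apply: dl_eq => y t; case: (ha y) => _ _ e _; rewrite /gio /io e //= inE eqxx.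
    rewrite subr0 /LL (adact_cons _ _ _ (ha x)) lieXX /gio /io.
    have := ul x [::] s (-1) 0 0; rewrite scaler0 addr0 scaleN1r addNr /= => ->; rewrite add0r.
    by rewrite subrr.
  - move=> X s; rewrite memv0 => /eqP->; have := lin s (-1) 0 0.
    by rewrite scaler0 addr0 scaleN1r addNr.
elim: p f => [|p IH] f ff; have [fa fs] := ff; split=> [x|s]; try exact: smooth_dl.
  apply: (aux _ _ _ ff) => X; apply: altform_eq (proj1 (sform_LL X ff) x) => s.
  rewrite /io (dl_cons _ _ _ ff) (_ : dl (gio X f) x s = 0) ?subr0 //.
  by rewrite -[RHS](dl0 x s); apply: dl_eq => y t; case: (fa y) => h _ _ _; exact: h.
apply: (aux _ _ _ ff) => X; apply: altform_eq (altform_linear (-1) (proj1 (IH _ (sform_io X ff)) x) (proj1 (sform_LL X ff) x)) => s.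
by rewrite /io (dl_cons _ _ _ ff) scaleN1r addrC.
Qed.

(** For [X] in [hh] both terms of Cartan's formula vanish. *)
Lemma dl_hor p (hh : {vspace g}) f x : sform p f -> (forall x, altform p hh (f x)) ->
  (forall X s, X \in hh -> LL X f x s = 0) -> altform p.+1 hh (dl f x).
Proof.
move=> ff fh Lf; have [u1 u2 u3 _] := proj1 (sform_dl ff) x; split=> // s /hasP[X Xs Xh].
have /path.splitPr[s1 s2] := Xs.
rewrite (alt_front _ _ _ (proj1 (sform_dl ff) x)) (dl_cons _ _ _ ff) Lf // (_ : dl _ x _ = 0) ?subr0 ?scaler0 //.
by rewrite -[RHS](dl0 x (s1 ++ s2)); apply: dl_eq => y t; exact: altform_io_hh (fh y) Xh.
Qed.

Lemma LL_io p X Y f x s : sform p f -> LL X (gio Y f) x s = LL X f x (Y :: s) + f x (LB X Y :: s).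
Proof. by move=> [fa _]; rewrite /LL (adact_cons _ _ _ (fa x)) /gio /io; zcan. Qed.

Section Flat.
Hypothesis sigh : forall X Y, sig (LB X Y) = sig X *m sig Y - sig Y *m sig X.
Hypothesis tauh : forall X Y, tau (LB X Y) = tau X *m tau Y - tau Y *m tau X.

(** Flatness of the connection: [sig] and [tau] are representations of the Lie algebra. *)
Lemma nab_comm X Y A x : smooth A ->
  nab X (nab Y A) x - nab Y (nab X A) x = nab (LB X Y) A x.
Proof.
move=> As.
have E Z W : nab Z (nab W A) x = LD Z (LD W A) x + lact W (LD Z A x) + lact Z (LD W A x) + lact Z (lact W (A x)).
  rewrite /nab lactD LderD; [|exact: Lder_smooth|exact: smooth_lact].
  have -> : LD Z (fun x0 => lact W (A x0)) x = lact W (LD Z A x).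
    rewrite /lact LderD; [|by apply: smoothM => //; exact: smooth_cst|]; last first.
      by apply: smooth_ext (smoothZl (-1) (smoothM As (smooth_cst (tau W)))) => y; rewrite scaleN1r.
    rewrite LderM //; last exact: smooth_cst.
    rewrite Lder_cst mul0mx add0r LderN; last by apply: smoothM => //; exact: smooth_cst.
    by rewrite LderM //; [rewrite Lder_cst mulmx0 addr0|exact: smooth_cst].
  by rewrite !addrA.
rewrite !E /nab Lder_lie // /lact sigh tauh !(mulmxBl, mulmxBr) !mulmxA.
zcan.
Qed.

Lemma nab_adact p X Y f x s : sform p f ->
  nab X (fun y => adact Y (f y) s) x = adact Y (fun s => nab X (fun y => f y s) x) s.
Proof.
move=> [fa fs]; rewrite nab_sum; last by move=> m; apply: smoothZl.
by apply: eq_bigr => m _; rewrite nabZ.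
Qed.

Lemma LL_LL p X Y f x s : sform p f -> LL X (LL Y f) x s =
  nab X (nab Y (fun y => f y s)) x - adact Y (fun s => nab X (fun y => f y s) x) s
  - adact X (fun s => nab Y (fun y => f y s) x) s + adact X (adact Y (f x)) s.
Proof.
move=> ff; have [fa fs] := ff; rewrite {1}/LL.
have -> : nab X (fun y => LL Y f y s) x = nab X (nab Y (fun y => f y s)) x - nab X (fun y => adact Y (f y) s) x.
  rewrite -scaleN1r -nabZ; last exact: smooth_adact.
  rewrite -nabD; [|exact: smooth_nab|by apply: smoothZl; exact: smooth_adact].
  by apply: nab_ext => y; rewrite scaleN1r.
rewrite (nab_adact _ _ _ _ ff).
rewrite (@adact_ext _ X (LL Y f x) (fun t => -1 *: adact Y (f x) t + nab Y (fun y => f y t) x)); last first.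
  by move=> t _; rewrite scaleN1r addrC.
rewrite adact_linear scaleN1r.
repeat match goal with |- context [adact ?X ?u ?t] => generalize (adact X u t); intro end.
by zcan.
Qed.

Lemma LL_comm p X Y f x s : sform p f ->
  LL Y (LL X f) x s = LL X (LL Y f) x s - LL (LB X Y) f x s.
Proof.
move=> ff; have [fa fs] := ff; rewrite !(LL_LL _ _ _ _ ff) {1}/LL -(nab_comm _ _ _ (fs s)) (adact_comm X Y s (fa x)).
repeat match goal with |- context [adact ?X ?u ?t] => generalize (adact X u t); intro end.
repeat match goal with |- context [nab ?X ?A ?z] => generalize (nab X A z); intro end.
zcan.
Qed.

Lemma LL_dl p X f x s : sform p f -> dl (LL X f) x s = LL X (dl f) x s.
Proof.
elim: s p f => [|Y s IH] p f ff.
  rewrite dl_nil /LL adact_nil subr0 -[LHS](nab0 X x).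
  by apply: nab_ext => y; rewrite dl_nil.
have ffY := sform_io Y ff; have [fa fs] := ff.
have E1 : LL X (dl f) x (Y :: s) = LL X (gio Y (dl f)) x s - dl f x (LB X Y :: s).
  by rewrite (LL_io _ _ _ _ (sform_dl ff)) addrK.
rewrite E1 (dl_cons _ _ _ (sform_LL X ff)) (dl_cons _ _ _ ff) (LL_comm _ _ _ _ ff).
have -> : dl (gio Y (LL X f)) x s = LL X (dl (gio Y f)) x s - dl (gio (LB X Y) f) x s.
  rewrite -(IH _ _ ffY) -scaleN1r -dlZ; last by move=> t; exact: fs.
  rewrite -dlD; [|by case: (sform_LL X ffY)|by move=> t; apply: smoothZl; exact: fs].
  by apply: dl_eq => y t; rewrite (LL_io _ _ _ _ ff) scaleN1r /gio /io addrK.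
have -> : LL X (gio Y (dl f)) x s = LL X (LL Y f) x s - LL X (dl (gio Y f)) x s.
  rewrite (@LL_eq X (gio Y (dl f)) (fun x s => -1 *: dl (gio Y f) x s + LL Y f x s)).
    rewrite LL_linear ?scaleN1r 1?addrC //; first by case: (sform_dl ffY).
    by case: (sform_LL Y ff).
  by move=> y t; rewrite /gio /io (dl_cons _ _ _ ff) scaleN1r addrC.
zcan.
Qed.

(** Inserting [X] gives [L_X d - d L_X + d d i_X]; the first two terms cancel by flatness, and the
    last is the induction hypothesis. *)
Lemma dl_dl p f x s : sform p f -> dl (dl f) x s = 0.
Proof.
elim: s p f => [|X s IH] p f ff; first by rewrite dl_nil.
have [fa fs] := ff; rewrite (dl_cons _ _ _ (sform_dl ff)).
have -> : dl (gio X (dl f)) x s = dl (LL X f) x s - dl (dl (gio X f)) x s.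
  rewrite -scaleN1r -dlZ; last by case: (sform_dl (sform_io X ff)).
  rewrite -dlD; [|by case: (sform_LL X ff)|by move=> t; apply: smoothZl; case: (sform_dl (sform_io X ff)) => _ h; exact: h].
  by apply: dl_eq => y t; rewrite /gio /io (dl_cons _ _ _ ff) scaleN1r.
by rewrite (LL_dl _ _ _ ff) (IH _ _ (sform_io X ff)) subr0 subrr.
Qed.

End Flat.
End Conn.

(** * Differentiating forms on moving vectors *)

Lemma scalar_mx_sum a (c : 'M[R]_1) : (c 0 0)%:M = \sum_(i < a) delta_mx i 0 *m c *m delta_mx 0 i :> 'M[R]_a.
Proof.
apply/matrixP => i j; rewrite summxE (bigD1 i) //= big1 ?addr0 => [|k ki]; last first.
  by rewrite [c]mx11_scalar mul_mx_scalar -scalemxAl mul_delta_mx !mxE eq_sym (negbTE ki) mulr0.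
by rewrite [in RHS](mx11_scalar c) mul_mx_scalar -scalemxAl mul_delta_mx !mxE eqxx /= mulr_natr eq_sym.
Qed.

Lemma smooth_scalar_mx a (c : G -> 'M[R]_1) : smooth c -> smooth (fun x => (c x 0 0)%:M : 'M[R]_a).
Proof.
move=> cs; apply: smooth_ext (fun x => esym (scalar_mx_sum a (c x))) _.
by apply: smooth_sum => i; apply: smoothM; [apply: smoothM => //; exact: smooth_cst|exact: smooth_cst].
Qed.

Lemma Lder_scalar_mx a (c : G -> 'M[R]_1) X x : smooth c ->
  LD X (fun x => (c x 0 0)%:M : 'M[R]_a) x = (LD X c x 0 0)%:M.
Proof.
move=> cs; rewrite (Lder_ext x X (fun x => scalar_mx_sum a (c x))) scalar_mx_sum.
have sd i : smooth (fun x => (delta_mx i 0 : 'M[R]_(a, 1)) *m c x) by apply: smoothM => //; exact: smooth_cst.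
rewrite Lder_sum; last by move=> i; apply: smoothM => //; exact: smooth_cst.
apply: eq_bigr => i _; rewrite LderM //; last exact: smooth_cst.
by rewrite Lder_cst mulmx0 addr0 LderM //; [rewrite Lder_cst mul0mx add0r|exact: smooth_cst].
Qed.

Lemma smooth_scale a b (c : G -> 'M[R]_1) (A : G -> 'M[R]_(a, b)) : smooth c -> smooth A ->
  smooth (fun x => c x 0 0 *: A x).
Proof.
move=> cs As; apply: smooth_ext (smoothM (smooth_scalar_mx (a := a) cs) As) => x.
by rewrite mul_scalar_mx.
Qed.

Lemma Lder_scale a b (c : G -> 'M[R]_1) (A : G -> 'M[R]_(a, b)) X x : smooth c -> smooth A ->
  LD X (fun x => c x 0 0 *: A x) x = LD X c x 0 0 *: A x + c x 0 0 *: LD X A x.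
Proof.
move=> cs As; rewrite (Lder_ext x X (g := fun x => (c x 0 0)%:M *m A x)); last by move=> y; rewrite mul_scalar_mx.
rewrite LderM //; last exact: smooth_scalar_mx.
by rewrite Lder_scalar_mx // !mul_scalar_mx.
Qed.

(** Each moving vector is expanded in the standard basis, which reduces the claim to the product
    rule for functions. *)
Lemma Lder_multi a b p (h : gform G a b) (vs : seq (G -> g)) : sform p h -> (forall v, List.In v vs -> smooth v) ->
  smooth (fun y => h y [seq v y | v <- vs]) /\ forall X x,
  LD X (fun y => h y [seq v y | v <- vs]) x = LD X (fun y => h y [seq v x | v <- vs]) x +
    \sum_(m < size vs) h x (take m [seq v x | v <- vs] ++ [seq LD X v x | v <- vs]`_m :: drop m.+1 [seq v x | v <- vs]).
Proof.
elim: vs p h => [|v vs IH] p h hh vss; have [ha hs] := hh.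
  by split=> [|X x]; [exact: hs|rewrite big_ord0 addr0].
have vsm : smooth v by apply: vss; left.
have vis i : smooth (fun y => (v y 0 i)%:M : 'M[R]_1) by exact: smooth_entry.
have ve i y : ((v y 0 i)%:M : 'M[R]_1) 0 0 = v y 0 i by rewrite mxE eqxx.
have slot y x t : h y (x :: t) = \sum_i x 0 i *: h y (delta_mx 0 i :: t).
  case: (ha y) => _ hl _ _; rewrite {1}(row_sum_delta x) (slot_sum [::] t _ _ hl).
  by apply: eq_bigr => i _; rewrite (slotZ [::] t _ _ hl).
have IHi i := IH _ _ (sform_io (delta_mx 0 i) hh) (fun w wvs => vss w (or_intror wvs)).
have Fs i : smooth (fun y => ((v y 0 i)%:M : 'M[R]_1) 0 0 *: h y (delta_mx 0 i :: [seq v y | v <- vs])).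
  by apply: smooth_scale => //; exact: (proj1 (IHi i)).
have E y : h y [seq v y | v <- v :: vs] = \sum_i ((v y 0 i)%:M : 'M[R]_1) 0 0 *: h y (delta_mx 0 i :: [seq v y | v <- vs]).
  by rewrite /= slot; apply: eq_bigr => i _; rewrite ve.
split; first by apply: smooth_ext (fun y => esym (E y)) _; exact: smooth_sum.
move=> X x; rewrite (Lder_ext x X E) Lder_sum; last by move=> i; exact: Fs.
rewrite big_ord_recl /= drop0 (slot x).
have E2 : LD X (fun y => h y (v x :: [seq v x | v <- vs])) x = \sum_i v x 0 i *: LD X (fun y => h y (delta_mx 0 i :: [seq v x | v <- vs])) x.
  rewrite (Lder_ext x X (fun y => slot y (v x) _)) Lder_sum; last by move=> i; exact: smoothZl.
  by apply: eq_bigr => i _; rewrite LderZ.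
rewrite E2.
rewrite [X in _ = _ + (_ + X)](_ : _ =
  \sum_i v x 0 i *: \sum_(m < size vs) h x (delta_mx 0 i :: take m [seq v x | v <- vs] ++ [seq LD X v x | v <- vs]`_m :: drop m.+1 [seq v x | v <- vs])); last first.
  by under eq_bigr do rewrite slot; rewrite exchange_big; apply: eq_bigr => i _; rewrite scaler_sumr.
rewrite -!big_split /=; apply: eq_bigr => i _.
rewrite Lder_scale //; last exact: (proj1 (IHi i)).
rewrite ve (Lder_entry x X 0 i vsm) (proj2 (IHi i) X x) scalerDr /gio /io; zcan.
Qed.

Lemma Lder_AdV_multi a b p (h : gform G a b) s : sform p h ->
  smooth (fun y => h y (map (AD y^-1%g) s)) /\ forall X x,
  LD X (fun y => h y (map (AD y^-1%g) s)) x = LD X (fun y => h y (map (AD x^-1%g) s)) x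
    - adact X (h x) (map (AD x^-1%g) s).
Proof.
move=> hh; have [ha hs] := hh.
pose vs := [seq (fun y : G => AD y^-1%g Y) | Y <- s].
have vss v : List.In v vs -> smooth v.
  rewrite /vs; elim: s {vs} => //= Y s IH [<-|]; [exact: smooth_AdV|exact: IH].
have mE y : [seq v y | v <- vs] = map (AD y^-1%g) s by rewrite /vs -map_comp.
have [S1 S2] := Lder_multi hh vss.
split; first by apply: smooth_ext S1 => y; rewrite mE.
move=> X x; rewrite (Lder_ext x X (g := fun y => h y [seq v y | v <- vs])); last by move=> y; rewrite mE.
rewrite S2 mE; congr (_ + _); rewrite (adact_middle _ _ (ha x)) !size_map -sumrN; apply: eq_bigr => m _.
have [_ hl _ _] := ha x.
rewrite (nth_map (fun=> 0)) ?size_map // (nth_map 0) // Lder_AdV (nth_map 0) //.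
by rewrite -scaleN1r (slotZ _ _ _ _ hl) scaleN1r.
Qed.

(** * Representations and their differentials *)

Lemma drepE m (r : rep G m) X : drep r X = LD X r 1%g.
Proof. by rewrite /drep LD.unlock. Qed.

Lemma drep_linear m (r : rep G m) c X Y : drep r (c *: X + Y) = c *: drep r X + drep r Y.
Proof. by rewrite !drepE Lder_linear //; exact: rep_smooth. Qed.

Lemma Lder_rep m (r : rep G m) X x : LD X r x = r x *m drep r X.
Proof.
have rs := rep_smooth r.
rewrite drepE -{1}[x]mulg1 -Lder_mulL (Lder_ext 1%g X (repM r x)) LderM //; last exact: smooth_cst.
by rewrite Lder_cst mul0mx add0r.
Qed.

Lemma Lder_repV m (r : rep G m) X x : LD X (fun k => r k^-1%g) x = - drep r X *m r x^-1%g.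
Proof.
have rs := rep_smooth r; have rvs := smooth_inv rs.
have : LD X (fun k => r k *m r k^-1%g) x = 0.
  rewrite (Lder_ext x X (g := fun=> 1%:M)) ?Lder_cst // => y.
  by rewrite -repM mulgV rep1.
rewrite LderM // Lder_rep => /(congr1 (fun M => r x^-1%g *m M)).
rewrite mulmx0 mulmxDr !mulmxA -repM mulVg rep1 !mul1mx => /eqP; rewrite addrC addr_eq0 => /eqP->.
by rewrite mulNmx.
Qed.

Lemma drep_lie m (r : rep G m) X Y : drep r (LB X Y) = drep r X *m drep r Y - drep r Y *m drep r X.
Proof.
have rs := rep_smooth r.
have E Z W : LD Z (LD W r) 1%g = drep r Z *m drep r W.
  rewrite (Lder_ext 1%g Z (Lder_rep r W)) LderM //; last exact: smooth_cst.
  by rewrite Lder_cst mulmx0 addr0 Lder_rep rep1 mul1mx.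
by rewrite drepE Lder_lie // !E.
Qed.

Lemma triv_smooth : smooth (fun _ : G => 1%:M : 'M[R]_1). Proof. exact: smooth_cst. Qed.
(** Columns are homomorphisms from the trivial line, so with this representation on the source the
    calculus for Hom bundles also covers sections of V and W. *)
Definition triv_rep : rep G 1 := @Rep R G 1 (fun=> 1%:M) erefl (fun _ _ => esym (mulmx1 _)) triv_smooth.

Lemma drep_triv X : drep triv_rep X = 0.
Proof. by rewrite drepE Lder_cst. Qed.

Section Total.
Variables (a b : nat) (r : rep G a) (r' : rep G b).

(* The derivative of the pullback along right translation is a Lie derivative. *)
Lemma total_der p (f : gform G a b) s : sform p f ->
  (forall x, smooth (fun k => r k *m f (x * k)%g (map (AD k^-1%g) s) *m r' k^-1%g)) /\
  forall X x k, LD X (fun k => r k *m f (x * k)%g (map (AD k^-1%g) s) *m r' k^-1%g) k =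
   r k *m LL (drep r) (drep r') X f (x * k)%g (map (AD k^-1%g) s) *m r' k^-1%g.
Proof.
move=> [fa fs]; have rs := rep_smooth r; have rvs := smooth_inv (rep_smooth r').
have hx x : sform p (fun k s => f (x * k)%g s).
  by split=> [y|t]; [exact: fa|exact: (smooth_mulL x (fs t))].
have S x := Lder_AdV_multi s (hx x).
split=> [x|X x k].
  by apply: smoothM => //; apply: smoothM => //; exact: (proj1 (S x)).
rewrite LderM //; last by apply: smoothM => //; exact: (proj1 (S x)).
rewrite LderM //; last exact: (proj1 (S x)).
rewrite Lder_repV Lder_rep (proj2 (S x)) /LL /nab /lact; set t := map _ _.
rewrite (_ : LD X (fun y => f (x * y)%g t) k = LD X (fun y => f y t) (x * k)%g); last exact: (Lder_mulL (fun y => f y t)).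
move: (LD _ _ _) (adact _ _ _) => D A.
by rewrite !(mulmxDr, mulmxDl, mulmxN, mulNmx, mulmxA); zcan.
Qed.

End Total.

Lemma mxL m n p (a : R) (x y : 'M[R]_(m, n)) (z : 'M[R]_(n, p)) : (a *: x + y) *m z = a *: (x *m z) + y *m z.
Proof. by rewrite mulmxDl -scalemxAl. Qed.
Lemma mxR m n p (a : R) (x y : 'M[R]_(n, p)) (z : 'M[R]_(m, n)) : z *m (a *: x + y) = a *: (z *m x) + z *m y.
Proof. by rewrite mulmxDr -scalemxAr. Qed.

(** * The Leibniz rule *)

Section Wedge.
Variables (a b c : nat) (sig : g -> 'M[R]_a) (tau : g -> 'M[R]_b) (rho : g -> 'M[R]_c).

Lemma nab_mul X (A : G -> 'M[R]_(a, b)) (B : G -> 'M[R]_(b, c)) x : smooth A -> smooth B ->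
  nab sig rho X (fun y => A y *m B y) x = nab sig tau X A x *m B x + A x *m nab tau rho X B x.
Proof.
move=> As Bs; rewrite /nab /lact LderM // !(mulmxDl, mulmxDr, mulmxN, mulNmx, mulmxA).
zcan.
Qed.

Lemma smooth_wedge p (f : gform G a b) (h : gform G b c) s : (forall s, smooth (fun x => f x s)) ->
  (forall s, smooth (fun x => h x s)) -> smooth (fun x => wedge p mulmx (f x) (h x) s).
Proof.
move=> fs hs; apply: smoothZl; apply: smooth_sum => sg; apply: smoothZl.
by apply: smoothM.
Qed.

Lemma sform_wedge p q (f : gform G a b) (h : gform G b c) : sform p f -> sform q h ->
  sform (p + q) (fun x => wedge p mulmx (f x) (h x)).
Proof.
move=> [fa fs] [ha hs]; split=> [x|s]; last exact: smooth_wedge.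
by apply: wedge_alt => // *; [exact: mxL|exact: mxR].
Qed.

Lemma nab_wedge X p (f : gform G a b) (h : gform G b c) x s : (forall s, smooth (fun x => f x s)) ->
  (forall s, smooth (fun x => h x s)) ->
  nab sig rho X (fun y => wedge p mulmx (f y) (h y) s) x =
  wedge p mulmx (fun s => nab sig tau X (fun y => f y s) x) (h x) s +
  wedge p mulmx (f x) (fun s => nab tau rho X (fun y => h y s) x) s.
Proof.
move=> fs hs; rewrite !wedgeE -scalerDr -big_split nabZ; last first.
  by apply: smooth_sum => sg; apply: smoothZl; apply: smoothM.
congr (_ *: _); rewrite nab_sum; last by move=> sg; apply: smoothZl; apply: smoothM.
apply: eq_bigr => sg _ /=; rewrite nabZ; last by apply: smoothM.
by rewrite nab_mul // scalerDr.
Qed.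

Hypothesis sigl : forall c X Y, sig (c *: X + Y) = c *: sig X + sig Y.
Hypothesis taul : forall c X Y, tau (c *: X + Y) = c *: tau X + tau Y.
Hypothesis rhol : forall c X Y, rho (c *: X + Y) = c *: rho X + rho Y.

Lemma LL_wedge X p q (f : gform G a b) (h : gform G b c) x s : sform p f -> sform q h ->
  LL sig rho X (fun x => wedge p mulmx (f x) (h x)) x s =
  wedge p mulmx (LL sig tau X f x) (h x) s + wedge p mulmx (f x) (LL tau rho X h x) s.
Proof.
move=> [fa fs] [ha hs]; rewrite /LL nab_wedge //.
rewrite (adact_wedge (@mxL _ _ _) (@mxR _ _ _) X s (fa x) (ha x)).
have -> : (fun s => nab sig tau X (fun y => f y s) x - adact X (f x) s) =
   (fun s => -1 *: adact X (f x) s + nab sig tau X (fun y => f y s) x).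
  by apply/funext => t; rewrite scaleN1r addrC.
have -> : (fun s => nab tau rho X (fun y => h y s) x - adact X (h x) s) =
   (fun s => -1 *: adact X (h x) s + nab tau rho X (fun y => h y s) x).
  by apply/funext => t; rewrite scaleN1r addrC.
rewrite (wedge_linearl (@mxL _ _ _)) (wedge_linearr (@mxR _ _ _)) !scaleN1r.
move: (wedge _ _ _ _ _) (wedge _ _ _ _ _) (wedge _ _ _ _ _) (wedge _ _ _ _ _) => u1 u2 u3 u4; zcan.
Qed.

(** Induction on the arguments: both sides are contracted with the first vector, by Cartan's formula
    and by the antiderivation property. *)
Lemma dl_wedge p q (f : gform G a b) (h : gform G b c) x s : sform p f -> sform q h ->
  dl sig rho (fun x => wedge p mulmx (f x) (h x)) x s =
  wedge p.+1 mulmx (dl sig tau f x) (h x) s + (-1) ^+ p *: wedge p mulmx (f x) (dl tau rho h x) s.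
Proof.
elim: s p q f h => [|X s IH] p q f h ff hh.
  have wz m n (u : seq g -> 'M[R]_(a, b)) (v : seq g -> 'M[R]_(b, c)) : altform m 0%VS u -> altform n 0%VS v -> (0 < m + n)%N ->
     wedge m mulmx u v [::] = 0.
    move=> ua va mn; rewrite (wedge_size (@mxL _ _ _) (@mxR _ _ _) ua va) //= eq_sym -lt0n //.
  have df := sform_dl sigl taul ff; have dh := sform_dl taul rhol hh.
  rewrite dl_nil (wz _ _ _ _ (proj1 df x) (proj1 hh x)) // (wz _ _ _ _ (proj1 ff x) (proj1 dh x)) ?addnS //.
  by rewrite scaler0 addr0.
have df := sform_dl sigl taul ff; have dh := sform_dl taul rhol hh.
have [fa fs] := ff; have [ha hs] := hh.
have fX := sform_io X ff; have hX := sform_io X hh.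
have W u v t m n : altform m 0%VS u -> altform n 0%VS v -> wedge m mulmx u v (X :: t) = _ :=
  @wedge_cons _ _ _ mulmx (@mxL a b c) (@mxR a b c) m n 0%VS 0%VS u v X t.
rewrite (dl_cons _ _ _ _ _ (sform_wedge ff hh)) (LL_wedge _ _ _ ff hh).
rewrite (W _ _ _ _ _ (proj1 df x) (ha x)) (W _ _ _ _ _ (fa x) (proj1 dh x)) /=.
have -> : dl sig rho (gio X (fun x => wedge p mulmx (f x) (h x))) x s =
  dl sig rho (fun x => wedge p.-1 mulmx (gio X f x) (h x)) x s + (-1) ^+ p *: dl sig rho (fun x => wedge p mulmx (f x) (gio X h x)) x s.
  rewrite -dlZ; last by move=> t; apply: smooth_wedge => // t'; exact: hs.
  rewrite -dlD; first by apply: dl_eq => y t; rewrite /gio /io (W _ _ _ _ _ (fa y) (ha y)).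
    by move=> t; apply: smooth_wedge => // t'; exact: fs.
  by move=> t; apply: smoothZl; apply: smooth_wedge => // t'; exact: hs.
rewrite (IH _ _ _ _ fX hh) (IH _ _ _ _ ff hX).
have -> : io X (dl sig tau f x) = (fun t => -1 *: dl sig tau (gio X f) x t + LL sig tau X f x t).
  by apply/funext => t; rewrite /io (dl_cons _ _ _ _ _ ff) scaleN1r addrC.
have -> : io X (dl tau rho h x) = (fun t => -1 *: dl tau rho (gio X h) x t + LL tau rho X h x t).
  by apply/funext => t; rewrite /io (dl_cons _ _ _ _ _ hh) scaleN1r addrC.
rewrite (wedge_linearl (@mxL _ _ _)) (wedge_linearr (@mxR _ _ _)) !scaleN1r.
have f0 : p = 0%N -> gio X f = (fun _ _ => 0).
  by move=> p0; apply: funext2 => y t; rewrite /gio /io; case: (fa y) => e _ _ _; rewrite e // p0.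
(* For [p = 0] the degree [p.-1.+1] is not [p], but then the contraction of [f] is 0. *)
have B1 : wedge p.-1.+1 mulmx (dl sig tau (gio X f) x) (h x) s = wedge p mulmx (dl sig tau (gio X f) x) (h x) s.
  have [/f0->|p0] := posnP p; last by rewrite prednK.
  have -> : dl sig tau (fun _ _ => 0) x = fun=> 0 by apply/funext => t; rewrite dl0.
  by rewrite !(wedge0l (@mxL _ _ _)).
have B2 : (-1) ^+ p.-1 *: wedge p.-1 mulmx (gio X f x) (dl tau rho h x) s =
    - ((-1) ^+ p *: wedge p.-1 mulmx (io X (f x)) (dl tau rho h x) s).
  have [p0|p0] := posnP p; last by rewrite -{3}(prednK p0) exprS mulN1r scaleNr opprK.
  have := f0 p0; rewrite /gio => /(congr1 (fun k => k x)) /= ->.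
  by rewrite !(wedge0l (@mxL _ _ _)) !scaler0 oppr0.
rewrite B1 B2.
have ss : (-1) ^+ p * (-1) ^+ p = 1 :> R by rewrite -expr2 sqrr_sign.
rewrite exprS mulN1r /gio; move: ((-1) ^+ p : R) ss => e ss.
repeat match goal with |- context [wedge ?m ?n ?u ?v ?t] => let w := fresh "w" in set w := (wedge m n u v t); move: w => w end.
rewrite !scalerDr !scalerN !scaleNr !scalerA !ss !scale1r; zcan.
Qed.

End Wedge.

Lemma drep_Ad m (r : rep G m) h X : r h *m drep r X = drep r (AD h X) *m r h.
Proof.
have rs := rep_smooth r.
have : LD X (fun z => r (h * (z * h^-1))%g) 1%g = LD (AD h X) r 1%g.
  by rewrite (Lder_mulR 1%g h^-1%g X (smooth_mulL h rs)) invgK mul1g Lder_mulL mulgV.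
rewrite -drepE => <-.
rewrite (Lder_ext 1%g X (g := fun z => r h *m (r z *m r h^-1%g))); last by move=> y; rewrite !repM.
rewrite LderM; [|exact: smooth_cst|by apply: smoothM => //; exact: smooth_cst].
rewrite Lder_cst mul0mx add0r LderM //; last exact: smooth_cst.
by rewrite Lder_cst mulmx0 addr0 -drepE -!mulmxA -repM mulVg rep1 mulmx1.
Qed.

(** * Equivariance of d, and operators commuting with d *)

Section Equivariance.
Variables (a b : nat) (sig : g -> 'M[R]_a) (tau : g -> 'M[R]_b).

(** Right translation by [h] turns [LD X] into [LD (AD h X)], and [AD h] respects brackets. *)
Lemma dl_equiv p (f : gform G a b) h (r : 'M[R]_a) (r' : 'M[R]_b) : sform p f ->
  (forall x s, f (x * h)%g s = r *m f x (map (AD h) s) *m r') ->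
  (forall X, sig X *m r = r *m sig (AD h X)) -> (forall X, r' *m tau X = tau (AD h X) *m r') ->
  forall x s, dl sig tau f (x * h)%g s = r *m dl sig tau f x (map (AD h) s) *m r'.
Proof.
move=> [fa fs] fh sr tr x s.
have nabE X t : nab sig tau X (fun y => f y t) (x * h)%g = r *m nab sig tau (AD h X) (fun y => f y (map (AD h) t)) x *m r'.
  have Ft := fs (map (AD h) t).
  rewrite /nab /lact fh !mulmxA sr -(mulmxA _ r' (tau X)) tr !(mulmxDl, mulmxDr, mulmxN, mulNmx) !mulmxA.
  congr (_ + _); rewrite -{1}(AdK h X) -Lder_mulR //.
  rewrite (Lder_ext x _ (g := fun y => r *m f y (map (AD h) t) *m r')); last by move=> y; exact: fh.
  rewrite LderM; [|by apply: smoothM => //; exact: smooth_cst|exact: smooth_cst].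
  by rewrite Lder_cst mulmx0 addr0 LderM //; [rewrite Lder_cst mul0mx add0r|exact: smooth_cst].
have mdel i t : map (AD h) (del i t) = del i (map (AD h) t) by rewrite /del map_cat map_take map_drop.
have ms (F : 'M[R]_(a, b) -> 'M[R]_(a, b)) : True by [].
have sumE I (q : seq I) (P : pred I) (F : I -> 'M[R]_(a, b)) :
    r *m (\sum_(i <- q | P i) F i) *m r' = \sum_(i <- q | P i) r *m F i *m r'.
  by rewrite mulmx_sumr mulmx_suml.
rewrite /dl mulmxDr mulmxDl !sumE !size_map; congr (_ + _).
  apply: eq_bigr => i _; rewrite nabE mdel -scalemxAr -scalemxAl.
  by rewrite (nth_map 0).
apply: eq_bigr => j _; rewrite sumE; apply: eq_bigr => i _.
rewrite fh /= !mdel -scalemxAr -scalemxAl Ad_lie !(nth_map 0) //.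
by rewrite (ltn_trans (ltn_ord i)).
Qed.

Lemma dl_translate p (f : gform G a b) z x s : sform p f ->
  dl sig tau (translate z f) x s = translate z (dl sig tau f) x s.
Proof.
move=> [fa fs]; rewrite /translate /dl; congr (_ + _); apply: eq_bigr => i _; congr (_ *: _).
by rewrite /nab; congr (_ + _); exact: (Lder_mulL (fun y => f y (del i s))).
Qed.

Variables (U hh : {vspace g}) (q : nat) (T : (seq g -> 'M[R]_(a, b)) -> seq g -> 'M[R]_(a, b)).
Hypothesis sigl : forall c X Y, sig (c *: X + Y) = c *: sig X + sig Y.
Hypothesis taul : forall c X Y, tau (c *: X + Y) = c *: tau X + tau Y.
Hypothesis Ulie : forall X Y, X \in U -> Y \in U -> LB X Y \in U.
Hypothesis Tlin : forall c u v s, T (fun s => c *: u s + v s) s = c *: T u s + T v s.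
Hypothesis TLL : forall X (h : gform G a b), X \in U -> (forall x, altform q hh (h x)) ->
  (forall s, smooth (fun x => h x s)) -> forall x s,
  LL sig tau X (fun y => T (h y)) x s = T (LL sig tau X h x) s.

Lemma opT0 s : T (fun=> 0) s = 0.
Proof.
transitivity (-1 *: T (fun=> 0) s + T (fun=> 0) s); last by rewrite scaleN1r addNr.
rewrite -(Tlin (-1) (fun=> 0) (fun=> 0)); congr (T _ s); apply/funext => t; by rewrite scaler0 addr0.
Qed.

Lemma opT_sum I (r : seq I) (c : I -> R) (F : I -> seq g -> 'M[R]_(a, b)) s :
  T (fun s => \sum_(i <- r) c i *: F i s) s = \sum_(i <- r) c i *: T (F i) s.
Proof.
elim: r => [|i r IH].
  by rewrite big_nil -[RHS](opT0 s); congr T; apply/funext => t; rewrite big_nil.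
by rewrite big_cons -IH -Tlin; congr T; apply/funext => t; rewrite big_cons.
Qed.

(** Since [f] and [f'] vanish on [k + 1] vectors of [U], inserting that many into [dl] leaves only
    Lie derivatives along [U]; an operator on the other arguments that commutes with these commutes
    with [dl]. It is applied to the Hodge star with [U = k] and to the codifferential with
    [U = p]. *)
Lemma dl_comm k p p' (f f' : gform G a b) : sform p f -> sform p' f' ->
  (forall x t s, all (fun X => X \in U) t -> size t = k -> f' x (t ++ s) = T (fun s => f x (t ++ s)) s) ->
  (forall x t, all (fun X => X \in U) t -> size t = k -> altform q hh (fun s => f x (t ++ s))) ->
  (forall x t s, all (fun X => X \in U) t -> size t = k.+1 -> f x (t ++ s) = 0 /\ f' x (t ++ s) = 0) ->
  forall x t s, all (fun X => X \in U) t -> size t = k.+1 ->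
  dl sig tau f' x (t ++ s) = T (fun s => dl sig tau f x (t ++ s)) s.
Proof.
elim: k p p' f f' => [|k IH] p p' f f' ff ff' fT fq fz x [|X t] s //= /andP[XU tU] [tk];
  have [fa fs] := ff; have [fa' fs'] := ff'.
- move: tk tU => /size0nil-> _ /=.
  have z y u : f y (X :: u) = 0 /\ f' y (X :: u) = 0 by apply: (fz y [:: X] u); rewrite //= XU.
  have dz (h : gform G a b) w : (forall y u, h y (X :: u) = 0) -> dl sig tau (gio X h) x w = 0.
    by move=> hz; rewrite -[RHS](dl0 sig tau x w); apply: dl_eq.
  have E w : dl sig tau f x (X :: w) = LL sig tau X f x w.
    by rewrite (dl_cons _ _ _ _ _ ff) dz ?subr0 // => y u; case: (z y u).
  rewrite (dl_cons _ _ _ _ _ ff') dz ?subr0; last by move=> y u; case: (z y u).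
  rewrite (_ : (fun s => dl sig tau f x (X :: s)) = LL sig tau X f x); last by apply/funext => w.
  rewrite -TLL //; last by move=> y; exact: (fq y [::]).
  by apply: LL_eq => y w; exact: (fT y [::]).
have EX := IH _ _ _ _ (sform_io X ff) (sform_io X ff').
have {EX} : dl sig tau (gio X f') x (t ++ s) = T (fun s => dl sig tau (gio X f) x (t ++ s)) s.
  apply: EX => //.
  - by move=> y u w uU uk; apply: (fT y (X :: u)); rewrite /= ?XU ?uk.
  - by move=> y u uU uk; apply: (fq y (X :: u)); rewrite /= ?XU ?uk.
  - by move=> y u w uU uk; apply: (fz y (X :: u)); rewrite /= ?XU ?uk.
move=> EX; rewrite (dl_cons _ _ _ _ _ ff') EX.
(* The Lie derivative on the full list differs from the one on the last arguments by brackets inside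
   [t], which stay in [U]. *)
have LLc (h : gform G a b) m w : sform m h -> LL sig tau X h x (t ++ w) =
    LL sig tau X (fun y w => h y (t ++ w)) x w - adact X (fun u => h x (u ++ w)) t.
  by move=> [ha hs]; rewrite /LL (adact_cat X t w (ha x)); zcan.
have E2 : LL sig tau X f' x (t ++ s) = T (fun s => LL sig tau X f x (t ++ s)) s.
  have -> : (fun s => LL sig tau X f x (t ++ s)) =
     (fun w => -1 *: (\sum_(m < size t) (-1) ^+ m *: f x (LB X t`_m :: del m t ++ w)) + LL sig tau X (fun y w => f y (t ++ w)) x w).
    by apply/funext => w; rewrite (LLc _ _ _ ff) scaleN1r addrC.
  rewrite Tlin opT_sum (LLc _ _ _ ff') addrC scaleN1r; congr (- _ + _).
    apply: eq_bigr => m _; congr (_ *: _); apply: (fT x (LB X t`_m :: del m t)).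
      rewrite /= Ulie //=; last by apply: (allP tU); exact: mem_nth.
      rewrite all_cat; apply/andP; split; apply/allP => Y.
        by move/mem_take; exact: (allP tU).
      by move/mem_drop; exact: (allP tU).
    by rewrite /= size_del // prednK // (leq_ltn_trans _ (ltn_ord m)).
  rewrite -TLL //; last by move=> y; exact: fq.
  by apply: LL_eq => y w; exact: fT.
rewrite E2; have -> : (fun s => dl sig tau f x (X :: t ++ s)) =
    (fun s => -1 *: dl sig tau (gio X f) x (t ++ s) + LL sig tau X f x (t ++ s)).
  by apply/funext => w; rewrite (dl_cons _ _ _ _ _ ff) scaleN1r addrC.
by rewrite Tlin scaleN1r addrC.
Qed.

End Equivariance.

(** * The star and the codifferential commute with Lie derivatives *)

Section Instances.
Variables (a b : nat) (sig : g -> 'M[R]_a) (tau : g -> 'M[R]_b).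
Variables (hh : {vspace g}) (n : nat) (E F : 'I_n -> g).

Lemma smooth_Hs (del : seq g -> R^o) p (f : gform G a b) s : (forall s, smooth (fun x => f x s)) ->
  smooth (fun x => Hs E del p (f x) s).
Proof. by move=> fs; apply: smoothZl; apply: smooth_sum => I; apply: smoothZl. Qed.

Lemma LL_Hs (del : seq g -> R^o) p X (h : gform G a b) x s : dual_frame hh E E -> altform n hh del ->
  del (mkl E) = 1 -> (forall Y, Y \in hh -> LB X Y \in hh) ->
  (forall x, altform p hh (h x)) -> (forall s, smooth (fun x => h x s)) ->
  LL sig tau X (fun y => Hs E del p (h y)) x s = Hs E del p (LL sig tau X h x) s.
Proof.
move=> EE dela del1 Xh ha hs; rewrite /LL.
have -> : (fun s => nab sig tau X (fun y => h y s) x - adact X (h x) s) =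
   (fun s => -1 *: adact X (h x) s + nab sig tau X (fun y => h y s) x).
  by apply/funext => t; rewrite scaleN1r addrC.
rewrite Hs_linear (Hs_adact EE dela) // scaleN1r addrC; congr (_ + _).
rewrite /Hs nabZ; last by apply: smooth_sum => I; apply: smoothZl.
congr (_ *: _); rewrite nab_sum; last by move=> I; apply: smoothZl.
by apply: eq_bigr => I _; rewrite nabZ.
Qed.

Variable r' : rep G b.
Hypothesis EF : dual_frame hh E F.
Hypothesis pphh : parabolic hh.

(** The dual action on rows, extended to matrices by acting on each row; values in W are thus not
    affected. *)
Definition dact (Z : g) (M : 'M[R]_(a, b)) : 'M[R]_(a, b) := - (M *m drep r' Z).

Lemma dact_r X c M N : dact X (c *: M + N) = c *: dact X M + dact X N.
Proof. by rewrite /dact mulmxDl -scalemxAl opprD scalerN. Qed.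
Lemma dact_l c X Y M : dact (c *: X + Y) M = c *: dact X M + dact Y M.
Proof. by rewrite /dact drep_linear mulmxDr -scalemxAr opprD scalerN. Qed.

Lemma smooth_kos (act : g -> 'M[R]_(a, b) -> 'M[R]_(a, b)) (f : gform G a b) s :
  (forall Z (A : G -> 'M[R]_(a, b)), smooth A -> smooth (fun x => act Z (A x))) ->
  (forall s, smooth (fun x => f x s)) -> smooth (fun x => kos E F act (f x) s).
Proof.
move=> as_ fs; apply: smooth_sum => i; apply: smoothD.
  by apply: smooth_ext (smoothZl (-1) (as_ (F i) _ (fs (E i :: s)))) => x; rewrite scaleN1r.
apply: smoothZl; apply: smooth_sum => m; apply: smoothZl; exact: fs.
Qed.

Lemma smooth_dact Z A : smooth A -> smooth (fun x : G => dact Z (A x)).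
Proof.
move=> As; apply: smooth_ext (smoothZl (-1) (smoothM As (smooth_cst (drep r' Z)))) => x.
by rewrite scaleN1r.
Qed.

Lemma LL_kos q X (h : gform G a b) x s : X \in hh ->
  (forall x, altform q hh (h x)) -> (forall s, smooth (fun x => h x s)) ->
  LL sig (drep r') X (fun y => kos E F dact (h y)) x s = kos E F dact (LL sig (drep r') X h x) s.
Proof.
move=> Xh ha hs; rewrite /LL.
have -> : (fun s => nab sig (drep r') X (fun y => h y s) x - adact X (h x) s) =
   (fun s => 1 *: LD X (fun y => h y s) x + (lact sig (drep r') X (h x s) - adact X (h x) s)).
  by apply/funext => t; rewrite /nab scale1r -[LHS]addrA.
rewrite (kos_linear E F dact_r) scale1r.
rewrite (kos_lie pphh EF dact_l dact_r (D := lact sig (drep r') X) s Xh _ _ (ha x)); first last.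
- move=> Z M; rewrite /lact /dact (drep_lie r' X Z); move: (drep r' X) (drep r' Z) (sig X) => rx rz sx.
  rewrite mulmxN mulNmx !opprK mulmxBl mulmxBr !mulmxA.
  by zcan.
- by move=> c M N; exact: lact_linear.
rewrite addrA; congr (_ - _); rewrite {1}/nab; congr (_ + _).
rewrite Lder_sum; last first.
  move=> i; apply: smoothD; last by apply: smoothZl; apply: smooth_sum => m; apply: smoothZl; exact: hs.
  by apply: smooth_ext (smoothZl (-1) (smooth_dact (F i) (hs (E i :: s)))) => y; rewrite scaleN1r.
apply: eq_bigr => i _; rewrite /kos_pair.
have S1 : smooth (fun y => - dact (F i) (h y (E i :: s))).
  by apply: smooth_ext (smoothZl (-1) (smooth_dact (F i) (hs (E i :: s)))) => y; rewrite scaleN1r.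
have S2 : smooth (fun y => adact (F i) (io (E i) (h y)) s).
  by apply: smooth_sum => m; apply: smoothZl; exact: hs.
rewrite LderD //; last exact: smoothZl.
rewrite LderZ //; congr (_ + _ *: _).
  rewrite /dact (Lder_ext x X (g := fun y => h y (E i :: s) *m drep r' (F i))); last by move=> y; rewrite opprK.
  by rewrite LderM //; [rewrite Lder_cst mulmx0 addr0 opprK|exact: smooth_cst].
rewrite Lder_sum; last by move=> m; apply: smoothZl; exact: hs.
by apply: eq_bigr => m _; rewrite LderZ //; exact: hs.
Qed.

End Instances.

(** * One-parameter subgroups *)

Lemma smooth_continuous a b (f : G -> 'M[R]_(a, b)) i j : smooth f ->
  continuous (fun x : G => f x i j : R^o).
Proof.
move=> fs x; have [c cL cx] := lcover x.
have fc : {for cmap c x, continuous (fun v => f (cinv c v) i j : R^o)}.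
  by apply: (sm_cont (fs c cL i j)); exact: cimg_cmap.
have h := @continuous_comp _ _ _ (cmap c) (fun v => f (cinv c v) i j : R^o) x (chart_cont cx) fc.
apply: cvg_trans (_ : ((fun v => f (cinv c v) i j : R^o) \o cmap c) @ x --> f x i j); last first.
  by have := h; rewrite /prop_for /continuous_at /= chartK.
apply: near_eq_cvg; apply: filterS (open_nbhs_nbhs (conj (chart_open c) cx)) => y cy /=.
by rewrite chartK.
Qed.

Definition onepar (H : set G) (X : g) (c : R -> G) : Prop :=
  [/\ forall s t, c (s + t) = (c s * c t)%g, forall t, H (c t) &
        forall f : G -> 'M[R]_(1, 1), smooth f ->
          is_derive (0 : R^o) (1 : R^o) (fun t : R^o => f (c t)) (LD X f 1%g)].

Lemma oneparE (H : set G) U X : lie_algebra_of H U -> X \in U <-> exists c, onepar H X c.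
Proof.
move=> HU; rewrite (HU X); split=> -[c [c1 c2 c3]]; exists c; split=> // f /c3.
  by rewrite LD.unlock.
by rewrite LD.unlock.
Qed.

Section Curve.
Variables (H : set G) (X : g) (c : R -> G).
Hypothesis cX : onepar H X c.

Lemma onepar0 : c 0 = 1%g.
Proof.
have [cD _ _] := cX; apply: (@mulgI _ (c 0)).
by rewrite -cD addr0 mulg1.
Qed.

Lemma oneparN t : c (- t) = (c t)^-1%g.
Proof.
have [cD _ _] := cX; apply: (@mulgI _ (c t)).
by rewrite -cD subrr onepar0 mulgV.
Qed.

Lemma onepar_derive1 (f : G -> 'M[R]_1) y t : smooth f ->
  is_derive (t : R^o) (1 : R^o) (fun s : R^o => f (y * c s)%g 0 0 : R^o) (LD X f (y * c t)%g 0 0).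
Proof.
move=> fs; have [cD _ cd] := cX.
have fs' := smooth_mulL (y * c t)%g fs.
have [d E] := cd _ fs'.
have := is_derive_of_line (f := fun s : R^o => f (y * c s)%g 0 0 : R^o) (x := t : R^o) (v := 1 : R^o).
apply; have -> : (fun s : R^o => f (y * c (s *: (1 : R^o) + t))%g 0 0 : R^o) =
  (fun s : R^o => (f (y * c t * c s)%g) 0 0 : R^o).
  by apply/funext => s; rewrite /GRing.scale /= mulr1 addrC cD mulgA.
split.
  have := (derivable_mxP _ _ _).1 d; exact.
by have := Lder_mulL f 1%g (y * c t)%g X; rewrite mulg1 => <-; rewrite -E derive_mx // mxE.
Qed.

Lemma onepar_derive (f : G -> 'M[R]_1) y z t : smooth f ->
  is_derive (t : R^o) (1 : R^o) (fun s : R^o => f (y * c s * z)%g 0 0 : R^o)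
    (LD (AD z^-1%g X) f (y * c t * z)%g 0 0).
Proof.
move=> fs; rewrite -(Lder_mulR _ _ _ fs).
exact: (@onepar_derive1 (fun w => f (w * z)%g) y t (smooth_mulR z fs)).
Qed.

Lemma onepar_continuous : continuous (c : R^o -> G).
Proof.
move=> t; apply: smooth_top => f fs; apply: differentiable_continuous.
apply/derivable1_diffP; have [d _] := onepar_derive1 1%g t fs.
by rewrite (_ : (fun s => f (c s) 0 0) = (fun s : R^o => f (1 * c s)%g 0 0)) //; apply/funext => s; rewrite mul1g.
Qed.

(** Conjugating the curve by one of its own points does not change it. *)
Lemma onepar_Ad t : AD (c t) X = X.
Proof.
apply: Lder_eq => f fs y.
rewrite -[y]mulg1 -!(Lder_mulL f 1%g y).
have fs' := smooth_mulL y fs; move: fs'; set h := (fun z => _) => hs.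
have [cD _ cd] := cX.
have e : LD X (fun z => h (c t * z * (c t)^-1)%g) 1%g = LD X h 1%g.
  have hs' : smooth (fun z => h (c t * z * (c t)^-1)%g).
    exact: (@smooth_mulL _ _ _ _ (fun z => h (z * (c t)^-1)%g) (c t) (smooth_mulR _ hs)).
  have [_ <-] := cd _ hs'; have [_ <-] := cd _ hs; apply: derive_ext => s.
  by rewrite -cD addrC cD mulgK.
by rewrite -e (Lder_conj _ _ _ hs) mulg1 mulgV.
Qed.
End Curve.

(** The product [c1 (s) c2 (- s)] is constant: both partial derivatives of [f (c1 s * c2 t)] are
    [LD X f], the first because [AD (c2 t)] fixes [X]. *)
Lemma onepar_unique H1 H2 X c1 c2 t : onepar H1 X c1 -> onepar H2 X c2 -> c1 t = c2 t.
Proof.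
move=> o1 o2; have k1 := onepar_continuous o1; have k2 := onepar_continuous o2.
suff h s : (c1 s * c2 (- s) = 1)%g.
  by apply: (@mulIg _ (c2 t)^-1%g); rewrite mulgV -(oneparN o2); exact: h.
apply: smooth_sep => f fs.
pose F (u : 'rV[R]_(1 + 1)) : R^o := f (c1 (lsubmx u 0 0) * c2 (rsubmx u 0 0))%g 0 0.
pose dF (u : 'rV[R]_(1 + 1)) : R^o := LD X f (c1 (lsubmx u 0 0) * c2 (rsubmx u 0 0))%g 0 0.
have coo m (i : 'I_m) : continuous (fun z : 'rV[R]_m => z 0 i : R^o) by move=> z; exact: coord_continuous.
have cc (q : G -> 'M[R]_1) : smooth q ->
  continuous (fun u : 'rV[R]_(1 + 1) => q (c1 (lsubmx u 0 0) * c2 (rsubmx u 0 0))%g 0 0 : R^o).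
  move=> qs u.
  have := @smooth_continuous 1 1 q 0 0 qs; set qq := (fun x : G => q x 0 0 : R^o) => qc.
  have c1u : {for u, continuous (fun u : 'rV[R]_(1 + 1) => c1 (lsubmx u 0 0))}.
    apply: (@continuous_comp _ _ _ (fun u : 'rV[R]_(1 + 1) => lsubmx u 0 0) c1); last exact: k1.
    rewrite (_ : (fun u => _) = fun u : 'rV[R]_(1 + 1) => u 0 (lshift 1 0)); first exact: coo.
    by apply/funext => w; rewrite mxE.
  have c2u : {for u, continuous (fun u : 'rV[R]_(1 + 1) => c2 (rsubmx u 0 0))}.
    apply: (@continuous_comp _ _ _ (fun u : 'rV[R]_(1 + 1) => rsubmx u 0 0) c2); last exact: k2.
    rewrite (_ : (fun u => _) = fun u : 'rV[R]_(1 + 1) => u 0 (rshift 1 0)); first exact: coo.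
    by apply/funext => w; rewrite mxE.
  exact: (@continuous_comp _ _ _ (fun u => (c1 (lsubmx u 0 0) * c2 (rsubmx u 0 0))%g) qq u
    (mul_continuous_at c1u c2u) (qc _)).
have dd i u : is_derive u (delta_mx 0 i) F (dF u).
  apply: is_derive_of_line; have [j ->|j ->] := split_ordP i; rewrite (ord1 j) {j}.
    have := onepar_derive o1 1%g (c2 (rsubmx u 0 0)) (lsubmx u 0 0) fs.
    rewrite mul1g -(oneparN o2) (onepar_Ad o2) => d.
    apply: is_derive_of_line' d _ => s'; rewrite /F mul1g.
    by congr (f (c1 _ * c2 _)%g 0 0); rewrite !mxE ?eqxx ?eq_rlshift ?mulr1 ?mulr0 ?add0r.
  have := onepar_derive1 o2 (c1 (lsubmx u 0 0)) (rsubmx u 0 0) fs => d.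
  apply: is_derive_of_line' d _ => s'; rewrite /F.
  by congr (f (c1 _ * c2 _)%g 0 0); rewrite !mxE ?eqxx ?eq_lrshift ?mulr1 ?mulr0 ?add0r.
(* Differentiability is known in each variable separately; continuity of the common partial
   derivative makes it joint. *)
have Fd u : differentiable F u /\ forall h, 'D_h F u = \sum_i h 0 i * 'D_(delta_mx 0 i) F u.
  apply: partial_differentiable => i; first by near=> y; have [] := dd i y.
  rewrite (_ : (fun y => _) = dF); last by apply/funext => y; have [_ ->] := dd i y.
  exact: (cc (LD X f) (Lder_smooth X fs)).
pose w : 'rV[R]_(1 + 1) := row_mx (1%:M : 'M[R]_1) (- 1%:M : 'M[R]_1).
have wE (x : R) : f (c1 x * c2 (- x))%g 0 0 = F (x *: w + 0).
  by rewrite addr0 /F /w scale_row_mx row_mxKl row_mxKr !mxE eqxx mulr1 mulrN1.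
apply/matrixP => i j; rewrite !ord1 wE.
transitivity (F ((0 : R) *: w + 0)); last first.
  by rewrite -wE oppr0 (onepar0 o1) (onepar0 o2) mulg1.
apply: (@is_derive_0_is_cst R (fun x : R => F (x *: w + 0))) => x.
have := @is_derive_line R _ _ F 0 w x (diff_derivable (Fd _).1) => d.
apply: is_derive_eq d _; rewrite (Fd _).2 big_split_ord /= !big_ord1.
have [_ ->] := dd (lshift 1 0) (x *: w + 0); have [_ ->] := dd (rshift 1 0) (x *: w + 0).
by rewrite /w row_mxEl row_mxEr !mxE eqxx mul1r mulN1r subrr.
Unshelve. all: by end_near. Qed.

(** A vector of both algebras has a curve in each subgroup; the curves coincide by uniqueness, hence
    run in the intersection. *)
Lemma lie_algebra_cap (H1 H2 : set G) U1 U2 : lie_algebra_of H1 U1 -> lie_algebra_of H2 U2 ->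
  lie_algebra_of (H1 `&` H2) (U1 :&: U2)%VS.
Proof.
move=> h1 h2 X; rewrite memv_cap; split=> [/andP[/(oneparE X h1)[c1 o1] /(oneparE X h2) [c2 o2]]|].
  have [a1 a2 a3] := o1; exists c1; split=> //; last by move=> f /a3; rewrite LD.unlock.
  by move=> t; split=> //; rewrite (onepar_unique t o1 o2); case: o2.
case=> c [a1 a2 a3]; apply/andP; split; [apply/(h1 X)|apply/(h2 X)]; exists c; split=> // t; by case: (a2 t).
Qed.

Lemma Lder_const_on (H : set G) U X a b (f : G -> 'M[R]_(a, b)) : lie_algebra_of H U -> X \in U ->
  smooth f -> (forall h, H h -> f h = f 1%g) -> LD X f 1%g = 0.
Proof.
move=> HU /(oneparE X HU) [c [c1 c2 c3]] fs fH; apply/matrixP => i j.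
rewrite -(Lder_entry _ _ _ _ fs) mxE; have [_ <-] := c3 _ (smooth_entry i j fs).
rewrite (derive_ext (g := fun=> (f 1%g i j)%:M)); last by move=> t; rewrite fH.
by rewrite derive_cst mxE.
Qed.

Lemma lie_algebra_Ad (H : set G) U X h : subgroup H -> lie_algebra_of H U -> X \in U -> H h ->
  AD h X \in U.
Proof.
move=> [H1 HM HV] HU /(oneparE X HU) [c o] Hh; apply/(oneparE _ HU).
have [c1 c2 c3] := o; exists (fun t => h * c t * h^-1)%g; split.
- by move=> s t; rewrite c1 -!mulgA; congr (_ * (_ * _))%g; rewrite mulKg.
- by move=> t; exact: (HM _ _ (HM _ _ Hh (c2 t)) (HV _ Hh)).
move=> f fs; have hs := smooth_mulL h (smooth_mulR h^-1%g fs).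
have := c3 _ hs; have := Lder_conj 1%g h X fs; rewrite mulg1 mulgV => <-; exact.
Qed.

(** Equivariance makes the pullback of [f] along right translation constant on [H], and [total_der]
    identifies its derivative. *)
Lemma inf_equivariant (H : set G) U X a b p (r : rep G a) (r' : rep G b) (f : gform G a b) x s :
  lie_algebra_of H U -> subgroup H -> X \in U -> sform p f ->
  (forall x h s, H h -> f (x * h)%g s = r h^-1%g *m f x (map (AD h) s) *m r' h) ->
  LL (drep r) (drep r') X f x s = 0.
Proof.
move=> HU [_ _ HV] XU fs fH; have [ts td] := total_der r r' s fs.
have := td X x 1%g; rewrite (rep1 r) invg1 (rep1 r') mul1mx mulmx1 mulg1.
rewrite (eq_map (Ad1 (G := G))) map_id => <-.
apply: (Lder_const_on HU XU (ts x)) => h Hh.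
rewrite fH // -!map_comp !mulmxA -repM mulgV rep1 mul1mx -mulmxA -repM mulgV rep1 mulmx1.
by rewrite mulg1 invg1 !rep1 mul1mx mulmx1 (eq_map (Ad1 (G := G))) (eq_map (AdVK h)).
Qed.

(** * Integration over a compact subgroup *)

Section Integral.
Local Notation T := (g_sigma_algebraType (@open G)).
Variables (H : set G) (hh : {vspace g}) (mu : {measure set T -> \bar R}).
Hypothesis Hgrp : subgroup H.
Hypothesis Hcpt : compact H.
Hypothesis Hlie : lie_algebra_of H hh.
Hypothesis mufin : (mu H < +oo)%E.
Hypothesis muR : forall (x : G) (A : set T), H x -> measurable A -> A `<=` H ->
  mu [set (y * x)%g | y in (A : set G)] = mu A.

Definition II (h : G -> R) : R := Rintegral mu H h.

Lemma open_meas (A : set G) : open A -> measurable (A : set T).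
Proof. exact: sub_sigma_algebra. Qed.

Lemma H_meas : measurable (H : set T).
Proof.
rewrite -[H]setCK; apply: measurableC; apply: open_meas; apply: closed_openC.
exact: compact_closed (@lhausdorff _ G) Hcpt.
Qed.

Lemma cont_meas D (h : G -> R) : measurable D -> continuous (h : G -> R^o) ->
  measurable_fun D (h : T -> R).
Proof.
move=> mD hc; apply: (measurability _ (measurable_realfun.RGenOInfty.measurableE R)) => _ [_ [x ->] <-].
apply: measurableI => //; apply: open_meas.
have -> : h @^-1` `]x, +oo[%classic = h @^-1` [set y | x < y].
  by apply/seteqP; split => y /=; rewrite in_itv /= andbT.
by apply: open_comp (@open_gt R x) => y _; exact: hc.
Qed.

Lemma cont_bounded (C : set G) (h : G -> R) : compact C -> continuous (h : G -> R^o) ->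
  exists2 M, 0 < M & forall x, C x -> `|h x| <= M.
Proof.
move=> Cc hc.
have : compact (h @` C : set R^o) by apply: continuous_compact Cc; exact: continuous_subspaceT.
move=> /compact_bounded [M [_ hM]]; exists (`|M| + 1); first by rewrite ltr_wpDl.
move=> x Cx; apply: hM; last by exists x.
by rewrite ltr_pwDr // ler_norm.
Qed.

Lemma cont_integrable (h : G -> R) : continuous (h : G -> R^o) -> mu.-integrable H (EFin \o (h : T -> R)).
Proof.
move=> hc; apply: measurable_bounded_integrable H_meas mufin _ _; first exact: (cont_meas H_meas hc).
have [M M0 hM] := cont_bounded Hcpt hc.
exists M; split; first by rewrite num_real.
by move=> y My x Hx; apply: le_trans (ltW My); exact: hM.
Qed.

Lemma II_ext h1 h2 : (forall k, H k -> h1 k = h2 k) -> II h1 = II h2.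
Proof. by move=> h; apply: eq_Rintegral => k /set_mem; exact: h. Qed.

Lemma II_linear (c : R) h1 h2 : continuous (h1 : G -> R^o) -> continuous (h2 : G -> R^o) ->
  II (fun k => c * h1 k + h2 k) = c * II h1 + II h2.
Proof.
move=> c1 c2; have i1 := cont_integrable c1; have i2 := cont_integrable c2.
rewrite /II -(RintegralZl _ H_meas i1) RintegralD //; first exact: H_meas.
by apply: cont_integrable => x; apply: (@cvgM R _ (nbhs x) _ (cst c) h1 _ _ (cvg_cst _) (c1 x)).
Qed.

Lemma II0 : II (fun=> 0) = 0.
Proof.
have c0 : continuous (cst 0 : G -> R^o) by exact: cst_continuous.
have e : (fun k : G => 1 * cst 0 k + cst 0 k) = cst (0 : R).
  by apply/funext => k; rewrite /= mulr0 addr0.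
have := II_linear 1 c0 c0; rewrite e mul1r => /eqP.
by rewrite -subr_eq0 opprD addNKr oppr_eq0 => /eqP.
Qed.

Lemma mulR_meas (c : G) : measurable_fun setT (fun y : T => (y * c)%g : T).
Proof.
apply: (@measurability _ _ T T setT _ (@open G)) => // _ [A Ao <-]; rewrite setTI.
apply: open_meas; apply: open_comp Ao => y _.
have -> : (fun z : G => (z * c)%g) = (fun z : G * G => (z.1 * z.2)%g) \o (fun z => (z, c)) by [].
apply: continuous_comp; last exact: lmul_cont.
by apply: cvg_pair; [exact: cvg_id | exact: cvg_cst].
Qed.

Lemma mulR_cont (c : G) : continuous (fun y : G => (y * c)%g).
Proof.
move=> y.
have -> : (fun z : G => (z * c)%g) = (fun z : G * G => (z.1 * z.2)%g) \o (fun z => (z, c)) by [].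
apply: continuous_comp; last exact: lmul_cont.
by apply: cvg_pair; [exact: cvg_id | exact: cvg_cst].
Qed.

Lemma II_mulR h c : continuous (h : G -> R^o) -> H c -> II (fun k => h (k * c)%g) = II h.
Proof.
move=> hc Hc; have [H1 HM HV] := Hgrp; rewrite /II /Rintegral; congr fine.
have pK : (fun y : T => (y * c)%g : T) @^-1` H = H.
  apply/seteqP; split=> y /= Hy; last exact: HM.
  by rewrite -(mulgK c y); apply: HM => //; exact: HV.
have hcc : continuous (fun k => h (k * c)%g : R^o).
  by move=> y; exact: (continuous_comp (@mulR_cont c y) (hc _)).
have := @integral_pushforward _ _ T T R _ (mulR_meas c) mu H (EFin \o h).
rewrite pK => /(_ _ (cont_integrable hcc) H_meas).
have mh : measurable_fun setT (h : T -> R) by exact: (cont_meas measurableT hc).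
move/measurable_EFinP: mh => mh /(_ mh) /= <-; apply: eq_measure_integral => [|mphi A mA AH]; first exact: mulR_meas.
rewrite /pushforward; have <- := muR (HV _ Hc) mA AH; congr (mu _).
apply/seteqP; split=> [y /= Ay|_ [z Az <-] /=].
  by exists (y * c)%g => //; rewrite mulgK.
by rewrite -mulgA mulVg mulg1.
Qed.

(** Differentiation under the integral; the dominating function is a constant, integrable because
    [H] has finite measure. *)
Lemma derive_II (F f : R -> G -> R) M : (forall t, continuous (F t : G -> R^o)) ->
  (forall t k, H k -> is_derive (t : R^o) (1 : R^o) (fun s : R^o => F s k : R^o) (f t k)) ->
  (forall t k, `|t| < 1 -> H k -> `|f t k| <= M) ->
  is_derive (0 : R^o) (1 : R^o) (fun t : R^o => II (F t) : R^o) (II (f 0)).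
Proof.
move=> Fc Fd fM; have M0 : 0 <= `|M| by [].
have dE t k : H k -> partial1of2 F t k = f t k.
  by move=> Hk; rewrite /partial1of2 derive1E; have [_ ->] := Fd t k Hk.
have cM : continuous (cst `|M| : G -> R^o) by exact: cst_continuous.
have a0 : `](- 1), 1[%classic (0 : R) by rewrite /= in_itv /= ltrN10 ltr01.
have c := @cvg_differentiation_under_integral R _ T mu F H H_meas 0 (-1) 1 a0
  (fun t _ => cont_integrable (Fc t)) (fun t k _ Hk => @ex_derive _ _ _ _ _ _ _ (Fd t k Hk))
  (cst `|M|) (fun _ => M0) (cont_integrable cM).
have cv : h^-1 *: (II (F (h + 0)) - II (F 0)) @[h --> 0^'] --> II (f 0).
  have e : II (partial1of2 F 0) = II (f 0) by apply: II_ext => k; exact: (dE 0).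
  rewrite -e.
  apply: c => t k; rewrite /= in_itv /= => tI Hk; rewrite dE //.
  by apply: le_trans (ler_norm M); apply: fM => //; rewrite ltr_norml.
have cv' : (fun h : R^o => h^-1 *: (((fun t : R^o => II (F t) : R^o) \o shift 0) (h *: (1 : R^o)) - II (F 0))) @ 0^' --> II (f 0).
  by rewrite (_ : (fun h : R^o => _) = fun h : R => h^-1 *: (II (F (h + 0)) - II (F 0))) //;
    apply/funext => h; rewrite /= /GRing.scale /= mulr1.
by split; [apply/cvg_ex; exists (II (f 0)); exact: cv' | exact: cvg_lim cv'].
Qed.

(** By right invariance of the measure the integral of [h (k c (t))] over [k] does not depend on
    [t]. *)
Lemma II_Lder (X : g) (h : G -> 'M[R]_1) : X \in hh -> smooth h -> II (fun k => LD X h k 0 0) = 0.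
Proof.
move=> /(oneparE X Hlie) [c o] hs; have [c1 c2 c3] := o.
have hc := smooth_continuous (i := 0) (j := 0) hs.
have Lc := smooth_continuous (i := 0) (j := 0) (Lder_smooth X hs).
have [M M0 hM] := cont_bounded Hcpt Lc; have [_ HM _] := Hgrp.
have [] := @derive_II (fun t k => h (k * c t)%g 0 0) (fun t k => LD X h (k * c t)%g 0 0) M.
- by move=> t k; exact: (continuous_comp (@mulR_cont (c t) k) (hc _)).
- by move=> t k _; exact: (onepar_derive1 o k t hs).
- by move=> t k _ Hk; apply: hM; exact: HM.
move=> _; rewrite (derive_ext (g := cst (II (fun k => h k 0 0)))); last first.
  by move=> t; rewrite (II_mulR hc (c2 t)).
rewrite derive_cst => /esym E; rewrite -[RHS]E; apply: II_ext => k _.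
by rewrite (onepar0 o) mulg1.
Qed.

(** Finite sums of products of a smooth function of [k] and one of [y]. This suffices to
    differentiate in [y] under the integral over [k], and avoids smoothness on the product of two
    groups. *)
Definition sep (q : G -> G -> R) : Prop := exists r : seq ((G -> 'M[R]_1) * (G -> 'M[R]_1)),
  (forall e, List.In e r -> smooth e.1 /\ smooth e.2) /\
  forall k y, q k y = \sum_(e <- r) e.1 k 0 0 * e.2 y 0 0.

Lemma sep_cst0 : sep (fun _ _ => 0).
Proof. by exists [::]; split=> // k y; rewrite big_nil. Qed.

Lemma sepD q1 q2 : sep q1 -> sep q2 -> sep (fun k y => q1 k y + q2 k y).
Proof.
move=> [r1 [s1 e1]] [r2 [s2 e2]]; exists (r1 ++ r2); split=> [e /List.in_app_iff [/s1|/s2] //|k y].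
by rewrite big_cat e1 e2.
Qed.

Lemma sepM q (b : G -> 'M[R]_1) : smooth b -> sep q -> sep (fun k y => b k 0 0 * q k y).
Proof.
move=> bs [r [s e]]; exists [seq ((fun k => b k *m p.1 k), p.2) | p <- r]; split.
  by move=> ? /List.in_map_iff [p [<- /s [s1 s2]]]; split=> //=; exact: smoothM.
move=> k y; rewrite e big_map mulr_sumr; apply: eq_bigr => p _.
by rewrite mulrA /= mxE big_ord1.
Qed.

Lemma sep_smooth (a : G -> 'M[R]_1) : smooth a -> sep (fun _ y => a y 0 0).
Proof.
move=> s; exists [:: ((fun=> 1%:M), a)]; split=> [e [<-|[]]|k y]; last first.
  by rewrite big_seq1 mxE eqxx mul1r.
by split=> //; exact: smooth_cst.
Qed.

Lemma sep_ext q1 q2 : (forall k y, q1 k y = q2 k y) -> sep q1 -> sep q2.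
Proof. by move=> h [r [s e]]; exists r; split=> // k y; rewrite -h. Qed.

Lemma sep_sum I (r : seq I) (q : I -> G -> G -> R) : (forall i, sep (q i)) ->
  sep (fun k y => \sum_(i <- r) q i k y).
Proof.
move=> h; elim: r => [|i r IH].
  by apply: sep_ext sep_cst0 => k y; rewrite big_nil.
by apply: sep_ext (sepD (h i) IH) => k y; rewrite big_cons.
Qed.

Lemma sep_multi a b p (h : gform G a b) (vs : seq (G -> g)) pre post i j : sform p h ->
  (forall v, List.In v vs -> smooth v) ->
  sep (fun k y => h y (pre ++ [seq v k | v <- vs] ++ post) i j).
Proof.
move=> hs; elim: vs pre => [|v vs IH] pre vsm /=.
  by apply: sep_ext (sep_smooth (smooth_entry i j (hs.2 (pre ++ post)))) => k y; rewrite mxE eqxx.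
have vS : smooth v by apply: vsm; left.
have IH' := fun m : 'I_(ldim G) => IH (pre ++ [:: delta_mx 0 m]) (fun w wI => vsm w (or_intror wI)).
apply: sep_ext (sep_sum (index_enum 'I_(ldim G)) (fun m => sepM (smooth_entry 0 m vS) (IH' m))) => k y.
rewrite /= [in RHS](row_sum_delta (v k)).
have [_ lin _ _] := hs.1 y; rewrite (slot_sum _ _ _ _ lin).
rewrite summxE; apply: eq_bigr => m _.
by rewrite (slotZ _ _ _ _ lin) !mxE eqxx -!catA /=.
Qed.

Lemma mul_contM (U : topologicalType) (f h : U -> R) : continuous (f : U -> R^o) -> continuous (h : U -> R^o) ->
  continuous (fun k => f k * h k : R^o).
Proof. by move=> fc hc k; exact: (@cvgM R _ (nbhs k) _ f h _ _ (fc k) (hc k)). Qed.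

Lemma smooth_LderAd (X : g) (a : G -> 'M[R]_1) y : smooth a ->
  smooth (fun k => LD (AD k^-1%g X) a (y * k)%g).
Proof.
move=> as_; apply: (smooth_ext (f := fun k => \sum_m (AD k^-1%g X) 0 m *: LD (delta_mx 0 m) a (y * k)%g)).
  by move=> k; rewrite Lder_expand.
apply: smooth_sum => m; have := smooth_scale (smooth_entry 0 m (smooth_AdV X)) (smooth_mulL y (Lder_smooth (delta_mx 0 m) as_)).
by apply: smooth_ext => k; rewrite mxE eqxx.
Qed.

Lemma der_base (H' : set G) X c x (a b : G -> 'M[R]_1) : onepar H' X c -> smooth a -> smooth b ->
  is_derive (0 : R^o) (1 : R^o) (fun t : R^o => II (fun k => b k 0 0 * a (x * c t * k)%g 0 0) : R^o)
    (II (fun k => b k 0 0 * LD (AD k^-1%g X) a (x * k)%g 0 0)).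
Proof.
move=> o as_ bs; have ac := smooth_continuous (i := 0) (j := 0) as_.
have bc := smooth_continuous (i := 0) (j := 0) bs.
(* A compact set containing all the points [x c(t) k] with [t] in [-1, 1]; derivatives are bounded
   on it, which dominates the integrand. *)
pose C := [set (x * c p.1 * p.2)%g | p in `[(-1 : R), 1] `*` H].
have Cc : compact C.
  apply: continuous_compact (compact_setX (@segment_compact R (-1) 1) Hcpt).
  apply: continuous_subspaceT => p.
  have c1 : {for p, continuous (fun p : R * G => (x * c p.1)%g)}.
    have -> : (fun p : R * G => (x * c p.1)%g) = (fun z : G * G => (z.1 * z.2)%g) \o (fun p => (x, c p.1)) by [].
    apply: continuous_comp; last exact: lmul_cont.
    apply: cvg_pair; first exact: cvg_cst.
    by apply: (@continuous_comp _ _ _ (fun p : R * G => p.1) c); [exact: cvg_fst | exact: (onepar_continuous o)].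
  have -> : (fun p : R * G => (x * c p.1 * p.2)%g) = (fun z : G * G => (z.1 * z.2)%g) \o (fun p => (x * c p.1, p.2)%g) by [].
  by apply: continuous_comp; [apply: cvg_pair; [exact: c1 | exact: cvg_snd] | exact: lmul_cont].
have [B B0 hB] := cont_bounded Hcpt bc.
have [A hA] : exists A, forall k y, H k -> C y -> `|LD (AD k^-1%g X) a y 0 0| <= A.
  have h1 m : {M | forall k, H k -> `|AD k^-1%g X 0 m| <= M}.
    by apply: cid; have [M _ ?] := cont_bounded Hcpt (smooth_continuous (i := 0) (j := m) (smooth_AdV X)); exists M.
  have h2 m : {M | forall y, C y -> `|LD (delta_mx 0 m) a y 0 0| <= M}.
    by apply: cid; have [M _ ?] := cont_bounded Cc (smooth_continuous (i := 0) (j := 0) (Lder_smooth (delta_mx 0 m) as_)); exists M.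
  exists (\sum_m sval (h1 m) * sval (h2 m)) => k y Hk Cy.
  rewrite Lder_expand // summxE; apply: le_trans (ler_norm_sum _ _ _) _.
  apply: ler_sum => m _; rewrite mxE normrM ler_pM //.
    exact: (svalP (h1 m)).
  exact: (svalP (h2 m)).
have [] := @derive_II (fun t k => b k 0 0 * a (x * c t * k)%g 0 0)
  (fun t k => b k 0 0 * LD (AD k^-1%g X) a (x * c t * k)%g 0 0) (B * A).
- move=> t; apply: mul_contM => // k.
  exact: (smooth_continuous (i := 0) (j := 0) (smooth_mulL (x * c t)%g as_)).
- move=> t k Hk; exact: (is_deriveZ (b k 0 0) (onepar_derive o x k t as_)).
- move=> t k t1 Hk; rewrite normrM ler_pM //; first exact: hB.
  apply: hA => //; exists (t, k) => //; split=> //=.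
  by rewrite in_itv /=; move: t1; rewrite ltr_norml => /andP[/ltW -> /ltW ->].
by move=> d E; split=> //; rewrite E; apply: II_ext => k _; rewrite (onepar0 o) mulg1.
Qed.

Lemma sep_term (r : seq ((G -> 'M[R]_1) * (G -> 'M[R]_1))) q k :
  (forall e, List.In e r -> smooth e.1 /\ smooth e.2) ->
  (forall y, q y = \sum_(e <- r) e.1 k 0 0 * e.2 y 0 0) ->
  smooth (fun y => (q y)%:M : 'M[R]_1) /\
  forall Y y, LD Y (fun y => (q y)%:M : 'M[R]_1) y 0 0 = \sum_(e <- r) e.1 k 0 0 * LD Y e.2 y 0 0.
Proof.
elim: r q => [|e r IH] q rs qE.
  have q0 y : (q y)%:M = 0 :> 'M[R]_1 by rewrite qE big_nil raddf0.
  split; first by apply: (smooth_ext (f := fun=> 0)); [move=> y; rewrite q0 | exact: smooth_cst].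
  by move=> Y y; rewrite big_nil (Lder_ext (g := fun=> 0)) ?Lder_cst ?mxE.
have s1 : smooth e.2 by case: (rs e (or_introl erefl)).
have [s2 d2] := IH _ (fun e' H => rs e' (or_intror H)) (fun y => erefl).
have qs y : (q y)%:M = e.1 k 0 0 *: e.2 y + (\sum_(e <- r) e.1 k 0 0 * e.2 y 0 0)%:M :> 'M[R]_1.
  by rewrite qE big_cons; apply/matrixP => i j; rewrite !ord1 !mxE eqxx !mulr1n.
split; first by have := smoothD (smoothZl (e.1 k 0 0) s1) s2; apply: smooth_ext => y; rewrite qs.
move=> Y y; rewrite (Lder_ext _ _ qs) (LderD _ _ (smoothZl _ s1) s2) (LderZ _ _ _ s1) big_cons.
by rewrite mxE d2 mxE.
Qed.

Lemma sep_cont (r : seq ((G -> 'M[R]_1) * (G -> 'M[R]_1))) (A : (G -> 'M[R]_1) -> G -> R) :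
  (forall e, List.In e r -> smooth e.1 /\ smooth e.2) ->
  (forall a, smooth a -> continuous (A a : G -> R^o)) ->
  continuous (fun k => \sum_(e <- r) e.1 k 0 0 * A e.2 k : R^o).
Proof.
move=> rs Ac; elim: r rs => [|e' r IH'] rs3.
  by rewrite (_ : (fun k => _) = cst 0); [exact: cst_continuous | apply/funext => k; rewrite big_nil].
rewrite (_ : (fun k => _) = fun k => e'.1 k 0 0 * A e'.2 k + \sum_(e <- r) e.1 k 0 0 * A e.2 k); last first.
  by apply/funext => k; rewrite big_cons.
have [s3 s4] := rs3 e' (or_introl erefl); have c1 := mul_contM (smooth_continuous (i := 0) (j := 0) s3) (Ac _ s4).
have c2 := IH' (fun e' H => rs3 e' (or_intror H)) => k.
exact: (@cvgD R R^o _ (nbhs k) _ _ _ _ _ (c1 k) (c2 k)).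
Qed.

Lemma sep_LD_cont X x q : sep q ->
  continuous (fun k => LD (AD k^-1%g X) (fun y => (q k y)%:M : 'M[R]_1) (x * k)%g 0 0 : R^o).
Proof.
move=> [r [rs re]].
rewrite (_ : (fun k => _) = fun k => \sum_(e <- r) e.1 k 0 0 * LD (AD k^-1%g X) e.2 (x * k)%g 0 0).
  apply: (sep_cont (A := fun a k => LD (AD k^-1%g X) a (x * k)%g 0 0) rs) => a as_.
  exact: (smooth_continuous (i := 0) (j := 0) (smooth_LderAd X x as_)).
by apply/funext => k; rewrite (sep_term rs (re k)).2.
Qed.

Lemma IID h1 h2 : continuous (h1 : G -> R^o) -> continuous (h2 : G -> R^o) ->
  II (fun k => h1 k + h2 k) = II h1 + II h2.
Proof.
move=> c1 c2; rewrite -[II h1]mul1r -(II_linear 1 c1 c2).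
by apply: II_ext => k _; rewrite mul1r.
Qed.

(** When [x] moves along [c], the point [x k] moves with velocity [AD k^-1 X], which depends on
    [k]. *)
Lemma Lder_II (H' : set G) X c x (F : G -> 'M[R]_1) q : onepar H' X c -> sep q -> smooth F ->
  (forall y, F y 0 0 = II (fun k => q k (y * k)%g)) ->
  LD X F x 0 0 = II (fun k => LD (AD k^-1%g X) (fun y => (q k y)%:M : 'M[R]_1) (x * k)%g 0 0).
Proof.
move=> o [r [rs re]] Fs FE.
suff d : is_derive (0 : R^o) (1 : R^o) (fun t : R^o => II (fun k => \sum_(e <- r) e.1 k 0 0 * e.2 (x * c t * k)%g 0 0) : R^o)
    (II (fun k => \sum_(e <- r) e.1 k 0 0 * LD (AD k^-1%g X) e.2 (x * k)%g 0 0)).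
  have [_ E] := onepar_derive1 o x 0 Fs; have [_ E'] := d.
  rewrite -[in LHS](mulg1 x) -(onepar0 o) -E.
  rewrite (derive_ext (g := fun t : R^o => II (fun k => \sum_(e <- r) e.1 k 0 0 * e.2 (x * c t * k)%g 0 0) : R^o)); last first.
    by move=> t; rewrite FE; apply: II_ext => k _; rewrite re.
  by rewrite E'; apply: II_ext => k _; rewrite (sep_term rs (re k)).2.
elim: r rs {re} => [|e r IH] rs.
  have z (A : (G -> 'M[R]_1) * (G -> 'M[R]_1) -> G -> R) : II (fun k => \sum_(e <- [::]) A e k) = 0.
    by rewrite -[RHS]II0; apply: II_ext => k _; rewrite big_nil.
  rewrite z (_ : (fun t => _) = cst (0 : R^o)); first exact: is_derive_cst.
  by apply/funext => t; exact: z.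
have [s1 s2] := rs e (or_introl erefl); have rs2 := fun e' H => rs e' (or_intror H).
have d1 := der_base x o s2 s1; have d2 := IH rs2.
have ca t : forall a : G -> 'M[R]_1, smooth a -> continuous (fun k => a (x * c t * k)%g 0 0 : R^o).
  by move=> a as_; exact: (smooth_continuous (i := 0) (j := 0) (smooth_mulL (x * c t)%g as_)).
have cb : forall a : G -> 'M[R]_1, smooth a -> continuous (fun k => LD (AD k^-1%g X) a (x * k)%g 0 0 : R^o).
  by move=> a as_; exact: (smooth_continuous (i := 0) (j := 0) (smooth_LderAd X x as_)).
have bc := smooth_continuous (i := 0) (j := 0) s1.
have E1 : (fun t : R^o => II (fun k => \sum_(e <- e :: r) e.1 k 0 0 * e.2 (x * c t * k)%g 0 0) : R^o) =
  (fun t => II (fun k => e.1 k 0 0 * e.2 (x * c t * k)%g 0 0)) \+ (fun t => II (fun k => \sum_(e <- r) e.1 k 0 0 * e.2 (x * c t * k)%g 0 0)).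
  apply/funext => t; rewrite /= -IID; first by apply: II_ext => k _; rewrite big_cons.
    by apply: mul_contM => //; exact: ca.
  exact: (sep_cont (A := fun a k => a (x * c t * k)%g 0 0) rs2 (ca t)).
rewrite E1; apply: is_derive_eq (is_deriveD d1 d2) _; rewrite -IID.
- by apply: II_ext => k _; rewrite big_cons.
- by apply: mul_contM => //; exact: cb.
exact: (sep_cont (A := fun a k => LD (AD k^-1%g X) a (x * k)%g 0 0) rs2 cb).
Qed.

(** One-parameter subgroups are given for elements of [hh] and of [U] only; [X] is a sum of two such
    elements, and both sides are additive in [X]. *)
Lemma Lder_II_full (H' : set G) U X x (F : G -> 'M[R]_1) q : lie_algebra_of H' U -> (hh + U)%VS = fullv ->
  sep q -> smooth F -> (forall y, F y 0 0 = II (fun k => q k (y * k)%g)) ->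
  LD X F x 0 0 = II (fun k => LD (AD k^-1%g X) (fun y => (q k y)%:M : 'M[R]_1) (x * k)%g 0 0).
Proof.
move=> HU full qs Fs FE.
have /memv_addP [X1 X1h [X2 X2U ->]] : X \in (hh + U)%VS by rewrite full memvf.
have [c1 o1] := (oneparE X1 Hlie).1 X1h; have [c2 o2] := (oneparE X2 HU).1 X2U.
rewrite -[X1 in LHS]scale1r (Lder_linear _ _ _ _ Fs) scale1r mxE.
rewrite (Lder_II x o1 qs Fs FE) (Lder_II x o2 qs Fs FE) -IID; try exact: sep_LD_cont.
apply: II_ext => k _; rewrite AdD -[AD _ X1 in RHS]scale1r.
have [r [rs re]] := qs; have [qk _] := sep_term rs (re k).
by rewrite (Lder_linear _ _ _ _ qk) scale1r mxE.
Qed.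

Definition MI a b (h : G -> 'M[R]_(a, b)) : 'M[R]_(a, b) := \matrix_(i, j) II (fun k => h k i j).

Lemma MI_ext a b (h1 h2 : G -> 'M[R]_(a, b)) : (forall k, H k -> h1 k = h2 k) -> MI h1 = MI h2.
Proof. by move=> h; apply/matrixP => i j; rewrite !mxE; apply: II_ext => k Hk; rewrite h. Qed.

Lemma MI_linear a b c (h1 h2 : G -> 'M[R]_(a, b)) : smooth h1 -> smooth h2 ->
  MI (fun k => c *: h1 k + h2 k) = c *: MI h1 + MI h2.
Proof.
move=> s1 s2; apply/matrixP => i j; rewrite !mxE -II_linear; try exact: smooth_continuous.
by apply: II_ext => k _; rewrite !mxE.
Qed.

Lemma MI0 a b : MI (fun=> 0) = 0 :> 'M[R]_(a, b).
Proof. by apply/matrixP => i j; rewrite !mxE -[RHS]II0; apply: II_ext => k _; rewrite ?mxE. Qed.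

Lemma MIZ a b c (h : G -> 'M[R]_(a, b)) : smooth h -> MI (fun k => c *: h k) = c *: MI h.
Proof.
move=> s; have := MI_linear c s (@smooth_cst _ G _ _ (0 : 'M[R]_(a, b))).
by rewrite MI0 addr0 => <-; apply: MI_ext => k _; rewrite addr0.
Qed.

Lemma MID a b (h1 h2 : G -> 'M[R]_(a, b)) : smooth h1 -> smooth h2 ->
  MI (fun k => h1 k + h2 k) = MI h1 + MI h2.
Proof.
move=> s1 s2; rewrite -[MI h1]scale1r -MI_linear //.
by apply: MI_ext => k _; rewrite scale1r.
Qed.

Lemma MI_sum I (r : seq I) (P : pred I) a b (h : I -> G -> 'M[R]_(a, b)) : (forall i, smooth (h i)) ->
  MI (fun k => \sum_(i <- r | P i) h i k) = \sum_(i <- r | P i) MI (h i).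
Proof.
move=> hs; elim: r => [|i r IH].
  by rewrite big_nil -[RHS]MI0; apply: MI_ext => k _; rewrite big_nil.
rewrite big_cons -IH; case: ifP => Pi; last by apply: MI_ext => k _; rewrite big_cons Pi.
by rewrite -MID //; [apply: MI_ext => k _; rewrite big_cons Pi | exact: smooth_sum].
Qed.

Lemma MI_mull a b c (A : 'M[R]_(a, b)) (h : G -> 'M[R]_(b, c)) : smooth h ->
  MI (fun k => A *m h k) = A *m MI h.
Proof.
move=> hs.
have e k : A *m h k = \sum_i \sum_j A i j *: (delta_mx i j *m h k).
  rewrite {1}(matrix_sum_delta A) mulmx_suml; apply: eq_bigr => i _.
  by rewrite mulmx_suml; apply: eq_bigr => j _; rewrite scalemxAl.
have sd i j : smooth (fun k => delta_mx i j *m h k) by apply: smoothM => //; exact: smooth_cst.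
rewrite (MI_ext (h2 := fun k => \sum_i \sum_j A i j *: (delta_mx i j *m h k))); last by move=> k _.
rewrite MI_sum; last by move=> i; apply: smooth_sum => j; exact: smoothZl.
rewrite {2}(matrix_sum_delta A) mulmx_suml; apply: eq_bigr => i _.
rewrite MI_sum; last by move=> j; exact: smoothZl.
rewrite mulmx_suml; apply: eq_bigr => j _; rewrite MIZ // -scalemxAl; congr (_ *: _).
apply/matrixP => i' j'; rewrite !mxE.
rewrite (bigD1 j) //= big1 ?addr0 => [|m mj]; last by rewrite mxE (negPf mj) andbF mul0r.
rewrite !mxE eqxx andbT.
have [<-|ne] := eqVneq i' i; rewrite ?mul1r ?mul0r.
  by apply: II_ext => k _; rewrite mxE (bigD1 j) //= big1 ?addr0 => [|m mj]; rewrite mxE ?eqxx ?mul1r // (negPf mj) andbF mul0r.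
rewrite -[RHS]II0; apply: II_ext => k _; rewrite mxE big1 // => m _.
by rewrite mxE (negPf ne) mul0r.
Qed.
End Integral.

(** * Gram-Schmidt in the fibre direction *)

Section Fibre.
Variables (hh m : {vspace g}).
Hypothesis Tfix : forall X, X \in hh -> theta X = X.
Hypothesis hh_lie : forall X Y, X \in hh -> Y \in hh -> LB X Y \in hh.
Hypothesis m_hh : (m <= hh)%VS.

Lemma KF_def X : X \in hh -> K X X = 0 -> X = 0.
Proof.
move=> Xh KX; apply/eqP/negPn/negP => /KF_neg.
by rewrite (Tfix Xh) KX ltxx.
Qed.

Lemma orth_span X (L : seq g) : (forall Y, Y \in L -> K X Y = 0) -> forall Y, Y \in <<L>>%VS -> K X Y = 0.
Proof.
move=> h Y /(@coord_span _ _ _ (in_tuple L)) ->; rewrite KF_sumr big1 // => i _.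
by rewrite KFZr h ?mulr0 // mem_nth.
Qed.

Lemma span_sub (L : seq g) (U : {vspace g}) : {subset L <= U} -> (<<L>> <= U)%VS.
Proof. by move=> h; apply/span_subvP. Qed.

(** Gram-Schmidt for a list that need not be free: a remainder of square 0 is 0, because the Killing
    form is definite on the fixed vectors of [theta]. *)
Lemma orth_proj (L : seq g) X : {subset L <= hh} -> X \in hh ->
  exists2 Z, Z \in <<L>>%VS & forall Y, Y \in <<L>>%VS -> K (X - Z) Y = 0.
Proof.
elim: L X => [|a L IH] X Lh Xh.
  exists 0; first exact: mem0v.
  by move=> Y; rewrite span_nil memv0 => /eqP ->; rewrite KF0r.
have ah : a \in hh by apply: Lh; exact: mem_head.
have Lh' : {subset L <= hh} by move=> y yL; apply: Lh; rewrite in_cons yL orbT.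
have [Za ZaL Zao] := IH a Lh' ah; have [Zx ZxL Zxo] := IH X Lh' Xh.
have sub : (<<L>> <= <<a :: L>>)%VS by apply: sub_span => y yL; rewrite in_cons yL orbT.
have aS : a \in <<a :: L>>%VS by apply: memv_span; exact: mem_head.
(* If [a'] is 0 the quotient is taken to be 0, and the correction vanishes in any case. *)
pose a' := a - Za; pose c := K (X - Zx) a' / K a' a'.
exists (Zx + c *: a').
  by apply: rpredD; [exact: (subvP sub) | apply: rpredZ; apply: rpredB => //; exact: (subvP sub)].
have a'h : a' \in hh by apply: rpredB => //; exact: (subvP (span_sub Lh')).
have e Y : K (X - (Zx + c *: a')) Y = K (X - Zx) Y - c * K a' Y.
  by rewrite opprD addrA KFBl KFZl.
have o1 Y : Y \in <<L>>%VS -> K (X - (Zx + c *: a')) Y = 0.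
  by move=> YL; rewrite e Zxo // Zao // mulr0 subr0.
apply: orth_span => Y; rewrite in_cons => /orP [/eqP ->|YL]; last first.
  by apply: o1; exact: memv_span.
rewrite -[a](subrK Za) KFDr (o1 Za ZaL) addr0 -/a' e.
have [K0|K0] := eqVneq (K a' a') 0; last by rewrite /c divfK // subrr.
by rewrite (KF_def a'h K0) !KF0r mulr0 subr0.
Qed.

(** The family replaces [fib] inside every form vanishing on [m]. Its orthogonality, also to [m],
    removes the brackets of fibre vectors with each other, which an arbitrary basis would leave in
    the derivative. *)
Definition gram_of (f fib : seq g) : Prop :=
  [/\ size f = size fib /\ {subset f <= hh},
      forall i j, (i < j < size f)%N -> K f`_i f`_j = 0,
      forall i Y, (i < size f)%N -> Y \in m -> K f`_i Y = 0,
      forall a b p (u : seq g -> 'M[R]_(a, b)) pre post, altform p m u ->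
        u (pre ++ f ++ post) = u (pre ++ fib ++ post) &
      (<<f>> + m = <<fib>> + m)%VS].

Lemma gram_exists (fib : seq g) : {subset fib <= hh} -> exists f, gram_of f fib.
Proof.
elim/last_ind: fib => [|fib x IH] xh.
  by exists [::]; split=> // i j; rewrite /= ltn0 andbF.
have fh : {subset fib <= hh} by move=> y yf; apply: xh; rewrite mem_rcons in_cons yf orbT.
have xh' : x \in hh by apply: xh; rewrite mem_rcons mem_head.
have [f [[sf fh'] fo fm fu fs]] := IH fh.
pose L := f ++ vbasis m.
have Lh : {subset L <= hh}.
  move=> y; rewrite mem_cat => /orP [/fh' //|/vbasis_mem ym]; exact: (subvP m_hh).
have [Z ZL Zo] := orth_proj Lh xh'.
have ZL' : Z \in (<<f>> + m)%VS by move: ZL; rewrite /L span_cat (span_basis (vbasisP m)).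
have LE Y : Y \in (<<f>> + m)%VS -> K (x - Z) Y = 0.
  by move=> YL; apply: Zo; rewrite /L span_cat (span_basis (vbasisP m)).
have Zh : Z \in hh.
  by move: ZL'; apply: subvP; rewrite subv_add (span_sub fh').
exists (rcons f (x - Z)); split.
- split; first by rewrite !size_rcons sf.
  by move=> y; rewrite mem_rcons in_cons => /orP [/eqP ->|/fh' //]; exact: rpredB.
- move=> i j; rewrite size_rcons ltnS => /andP[ij]; rewrite leq_eqVlt => /orP [/eqP jE|jl].
    rewrite !nth_rcons -jE ij jE ltnn eqxx KFC; apply: LE.
    by apply: (subvP (addvSl _ _)); apply: memv_span; apply: mem_nth; rewrite -jE.
  by rewrite !nth_rcons (ltn_trans ij jl) jl; apply: fo; rewrite ij.
- move=> i Y; rewrite size_rcons ltnS leq_eqVlt => /orP [/eqP -> Ym|il Ym].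
    by rewrite nth_rcons ltnn eqxx; apply: LE; exact: (subvP (addvSr _ _)).
  by rewrite nth_rcons il; apply: fm.
- move=> a b p u pre post ua; rewrite -!cats1 -!catA !cat1s.
  have [_ ul un um] := ua; rewrite -(fu _ _ _ _ pre (x :: post) ua).
  rewrite (catA pre f (x - Z :: post)) (slotD _ _ _ _ ul) -scaleN1r (slotZ _ _ _ _ ul) -catA.
  suff -> : u ((pre ++ f) ++ Z :: post) = 0 by rewrite scaler0 addr0.
  have [y yf [z zm ->]] := memv_addP ZL'.
  rewrite (slotD _ _ _ _ ul) [X in _ + X]um ?addr0; last by rewrite has_cat /= zm orbT.
  rewrite (@coord_span _ _ _ (in_tuple f) y yf) (slot_sum _ _ _ _ ul) big1 // => i _.
  rewrite (slotZ _ _ _ _ ul) un ?scaler0 //.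
  rewrite cat_uniq negb_and; apply/orP; right; rewrite negb_and; apply/orP; left.
  by rewrite /= negbK mem_cat mem_nth ?orbT.
rewrite -!cats1 !span_cat !span_seq1.
have e : (<<f>> + <[x - Z]> + m = <<f>> + <[x]> + m)%VS.
  have h (y z : g) : z \in (<<f>> + m)%VS -> (<<f>> + <[y - z]> + m <= <<f>> + <[y]> + m)%VS.
    move=> zl; rewrite !subv_add addvSr -!andbA andbT /=.
    have s1 : (<<f>> <= <<f>> + <[y]> + m)%VS by rewrite -addvA addvSl.
    rewrite s1 -memvE /=; apply: rpredB.
      by apply: (subvP (addvSl _ _)); apply: (subvP (addvSr _ _)); exact: memv_line.
    by apply: (subvP _ z zl); rewrite subv_add s1 addvSr.
  apply/eqP; rewrite eqEsubv h //=.
  by have := h (x - Z) (- Z); rewrite opprK subrK rpredN; apply.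
by rewrite e -addvA (addvC <[x]>%VS) addvA fs -!addvA (addvC m).
Qed.

Lemma sform_gios a b p (f : gform G a b) t : sform p f -> sform (p - size t) (fun y s => f y (t ++ s)).
Proof.
elim: t p f => [|X t IH] p f fs; first by rewrite subn0.
by rewrite /= subnS -subn1 subnAC subn1; exact: (IH _ _ (sform_io X fs)).
Qed.

(** Cartan's formula applied to the members of [L] in turn; the signs count the contractions already
    made. *)
Lemma dl_cat a b (sig : g -> 'M[R]_a) (tau : g -> 'M[R]_b) p (f : gform G a b) L Y x :
  (forall c X Y, sig (c *: X + Y) = c *: sig X + sig Y) ->
  (forall c X Y, tau (c *: X + Y) = c *: tau X + tau Y) -> sform p f ->
  dl sig tau f x (L ++ Y) = \sum_(j < size L) (-1) ^+ j *:
     LL sig tau L`_j (fun y s => f y (take j L ++ s)) x (drop j.+1 L ++ Y)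
   + (-1) ^+ size L *: dl sig tau (fun y s => f y (L ++ s)) x Y.
Proof.
move=> sl tl; elim: L p f => [|X L IH] p f fs.
  by rewrite big_ord0 add0r expr0 scale1r.
rewrite /= (dl_cons _ _ _ _ _ fs) (IH _ _ (sform_io X fs)) big_ord_recl /= expr0 scale1r drop0.
rewrite opprD addrA; congr (_ + _ + _); last by rewrite exprS mulN1r scaleNr.
by rewrite -sumrN; apply: eq_bigr => j _; rewrite exprS mulN1r scaleNr.
Qed.

Section Gram.
Variables (f fib : seq g).
Hypothesis fg : gram_of f fib.
Hypothesis fibh : (hh <= <<fib>> + m)%VS.

(** By invariance of the Killing form [[f_j, f_i]] is orthogonal to [f_i] and to [f_j]; modulo [m]
    it is therefore a combination of the other members, on which [L] vanishes. *)
Lemma gram_lie (A : lmodType R) (L : g -> A) i j : (forall c X Y, L (c *: X + Y) = c *: L X + L Y) ->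
  (i < size f)%N -> (j < size f)%N -> i != j -> (forall Y, Y \in m -> L Y = 0) ->
  (forall k, (k < size f)%N -> k != i -> k != j -> L f`_k = 0) -> L (LB f`_j f`_i) = 0.
Proof.
move=> Ll il jl ij Lm Lf; have [[_ fh] fo fm _ fs] := fg.
have orth a b : (a < size f)%N -> (b < size f)%N -> a != b -> K f`_a f`_b = 0.
  by move=> al bl; rewrite neq_ltn => /orP [ab|ba]; [|rewrite (KFC)]; apply: fo; rewrite ?ab ?ba.
have L0 := linear_map0 Ll.
have LD' X Y : L (X + Y) = L X + L Y by have := Ll 1 X Y; rewrite !scale1r.
have LZ c X : L (c *: X) = c *: L X by have := Ll c X 0; rewrite L0 !addr0.
have Xh : LB f`_j f`_i \in hh by apply: hh_lie; apply: fh; exact: mem_nth.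
have o1 : K (LB f`_j f`_i) f`_j = 0 by rewrite KF_inv lieXX KF0r oppr0.
have o2 : K (LB f`_j f`_i) f`_i = 0.
  by rewrite lieC KFNl KF_inv lieXX KF0r !oppr0.
move: Xh o1 o2; move: (LB _ _) => X Xh o1 o2.
have := subvP fibh X Xh; rewrite -fs => /memv_addP [y yf [z zm XE]].
have yE := @coord_span _ _ _ (in_tuple f) y yf.
pose c (k : 'I_(size f)) := coord (in_tuple f) k y.
have {}yE : y = \sum_k c k *: f`_k by rewrite {1}yE.
have zero (k : 'I_(size f)) : K X f`_k = 0 -> c k *: f`_k = 0.
  rewrite XE KFDl [K z _](KFC) fm // addr0 yE KF_suml.
  rewrite (bigD1 k) //= big1 ?addr0 ?KFZl => [/eqP|k' kk']; last by rewrite KFZl orth ?mulr0.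
  rewrite mulf_eq0 => /orP [/eqP ->|/eqP h]; first by rewrite scale0r.
  by rewrite (KF_def _ h) ?scaler0 //; apply: fh; exact: mem_nth.
rewrite XE LD' (Lm z zm) addr0 yE (big_morph L LD' L0) big1 // => k _.
have [ki|ki] := eqVneq (k : nat) i; first by rewrite zero ?L0 // ki.
have [kj|kj] := eqVneq (k : nat) j; first by rewrite zero ?L0 // kj.
by rewrite LZ Lf ?scaler0.
Qed.

(** In a slot occupied by a fibre vector [[f_j, -]] only yields vectors of [m] and members of the
    family that already occur elsewhere, so the arguments [Y] alone contribute. *)
Lemma gram_adact a b p (u : seq g -> 'M[R]_(a, b)) j Y : altform p m u -> (j < size f)%N ->
  adact f`_j (fun t => u (take j f ++ t)) (drop j.+1 f ++ Y) = adact f`_j (fun t => u (del j f ++ t)) Y.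
Proof.
move=> ua jl; rewrite (adact_cat _ _ _ (altform_ios _ ua)) [X in X + _](_ : _ = 0) ?add0r; last first.
  have ua' : altform (p - size (take j f) - size Y) m (fun s => u (take j f ++ s ++ Y)).
    exact: altform_ios_r (altform_ios _ ua).
  rewrite (adact_middle _ _ ua'); apply: big1 => k0 _; set D := drop j.+1 f.
  have kl : (k0 < size f - j.+1)%N by case: k0 => /= k; rewrite size_drop.
  move: (nat_of_ord k0) kl => k kl.
  have il : (j.+1 + k < size f)%N by lia.
  have [_ ul un um] := ua; rewrite nth_drop.
  apply: (@gram_lie _ (fun X => u (take j f ++ (take k D ++ X :: drop k.+1 D) ++ Y)) (j.+1 + k) j) => //.
  - move=> c X Y'; rewrite -!catA !cat_cons catA ul.
    by congr (_ *: u _ + u _); rewrite catA.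
  - by rewrite neq_ltn; apply/orP; right; lia.
  - by move=> X Xm; apply: um; rewrite !has_cat /= Xm !orbT.
  move=> k' k'l ki kj; apply: un; rewrite -catA cat_cons catA.
  have : f`_k' \in (take j f ++ take k D) ++ drop k.+1 D ++ Y.
    rewrite !mem_cat; have [k'j|jk'] := ltnP k' j.
      by rewrite -(nth_take 0 k'j) mem_nth // size_take jl.
    have {}jk' : (j < k')%N by lia.
    have [k'i|ik'] := ltnP k' (j.+1 + k).
      have e : f`_k' = (take k D)`_(k' - j.+1) by rewrite nth_take ?nth_drop; [congr nth|]; lia.
      have h : (k' - j.+1 < size (take k D))%N by rewrite size_takel /D ?size_drop; lia.
      by rewrite e (mem_nth 0 h) ?orbT.
    have e : f`_k' = (drop k.+1 D)`_(k' - j.+1 - k.+1) by rewrite !nth_drop; congr nth; lia.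
    have h : (k' - j.+1 - k.+1 < size (drop k.+1 D))%N by rewrite /D !size_drop; lia.
    by rewrite e (mem_nth 0 h) !orbT.
  by rewrite cat_uniq /= mem_cat => /orP [h|h]; rewrite ?h ?orbT ?andbF //= andbF.
by apply: adact_ext => t _; rewrite /del -catA.
Qed.
End Gram.
End Fibre.

(** * Fibre integration commutes with d *)

Section FibreIntegral.
Local Notation T := (g_sigma_algebraType (@open G)).
Variables (H H' : set G) (hh U m : {vspace g}) (mu : {measure set T -> \bar R}).
Hypothesis Hgrp : subgroup H.
Hypothesis Hcpt : compact H.
Hypothesis Hlie : lie_algebra_of H hh.
Hypothesis Hlie' : lie_algebra_of H' U.
Hypothesis hU : (hh + U)%VS = fullv.
Hypothesis mufin : (mu H < +oo)%E.
Hypothesis muR : forall (x : G) (A : set T), H x -> measurable A -> A `<=` H ->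
  mu [set (y * x)%g | y in (A : set G)] = mu A.
Hypothesis Tfix : forall X, X \in hh -> theta X = X.
Hypothesis hh_lie : forall X Y, X \in hh -> Y \in hh -> LB X Y \in hh.
Hypothesis m_lie : forall X Y, X \in m -> Y \in m -> LB X Y \in m.
Hypothesis m_hh : (m <= hh)%VS.
Variable fib : seq g.
Hypothesis fib_sub : {subset fib <= hh}.
Hypothesis fibh : (hh <= <<fib>> + m)%VS.
Variables (w : nat) (r : rep G w).
Local Notation sr := (drep r).
Local Notation t0 := (drep triv_rep).
Variable sig : g -> 'M[R]_w.
Hypothesis sigl : forall c X Y, sig (c *: X + Y) = c *: sig X + sig Y.
Hypothesis sigh : forall X, X \in hh -> sig X = sr X.
Hypothesis sigA : forall h X, H h -> r h *m sig X = sig (AD h X) *m r h.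

Definition FI (f : gform G w 1) : gform G w 1 := fun x s =>
  MI H mu (fun k => r k *m f (x * k)%g (map (AD k^-1%g) s ++ fib)).

Lemma total_smooth p (f : gform G w 1) x s : sform p f ->
  smooth (fun k => r k *m f (x * k)%g (map (AD k^-1%g) s)).
Proof.
move=> fs; have [h _] := total_der r triv_rep s fs.
by apply: smooth_ext (h x) => k; rewrite mulmx1.
Qed.

(** By [total_der] the integrand is the derivative along [X] of a function on [G], to which
    [II_Lder] applies entrywise. *)
Lemma total_LL p (f : gform G w 1) x s X : sform p f ->
  smooth (fun k => r k *m LL sr t0 X f (x * k)%g (map (AD k^-1%g) s)) /\
  (X \in hh -> MI H mu (fun k => r k *m LL sr t0 X f (x * k)%g (map (AD k^-1%g) s)) = 0).
Proof.
move=> fs; have [h1 h2] := total_der r triv_rep s fs.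
have h2' k := esym (h2 X x k).
split; first by apply: smooth_ext (Lder_smooth X (h1 x)) => k; rewrite h2 mulmx1.
move=> Xh; apply/matrixP => i j; rewrite !mxE.
rewrite -[RHS](II_Lder Hgrp Hcpt Hlie mufin muR Xh (smooth_entry i j (h1 x))).
apply: II_ext => k _; rewrite (Lder_entry _ _ _ _ (h1 x)) h2 mulmx1.
by [].
Qed.

Lemma sform_Lder a b p (f : gform G a b) X : sform p f -> sform p (fun y s => LD X (fun y => f y s) y).
Proof.
move=> fs; have := @sform_nab a b (fun=> 0) (fun=> 0) p X f fs.
by apply: sform_eq => y s; rewrite /nab /lact mul0mx mulmx0 subrr addr0.
Qed.

Lemma LderMl a b c (A : 'M[R]_(a, b)) (f : G -> 'M[R]_(b, c)) X x : smooth f ->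
  LD X (fun y => A *m f y) x = A *m LD X f x.
Proof.
by move=> fs; rewrite (LderM _ _ (@smooth_cst _ G _ _ A) fs) Lder_cst mul0mx add0r.
Qed.

Lemma smooth_LderAd_form p (f : gform G w 1) x s X : sform p f ->
  smooth (fun k => r k *m LD (AD k^-1%g X) (fun y => f y (map (AD k^-1%g) s)) (x * k)%g).
Proof.
move=> fs.
apply: (smooth_ext (f := fun k => \sum_m (AD k^-1%g X) 0 m *:
  (r k *m LD (delta_mx 0 m) (fun y => f y (map (AD k^-1%g) s)) (x * k)%g))).
  move=> k; rewrite (Lder_expand (AD k^-1%g X) _ (fs.2 _)) mulmx_sumr.
  by apply: eq_bigr => i _; rewrite scalemxAr.
apply: smooth_sum => i; have h := total_smooth x s (sform_Lder (delta_mx 0 i) fs).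
apply: smooth_ext (smooth_scale (smooth_entry 0 i (smooth_AdV X)) h) => k.
by rewrite mxE eqxx.
Qed.

Lemma Lder_MI p (f : gform G w 1) x s X : sform p f ->
  smooth (fun y => MI H mu (fun k => r k *m f (y * k)%g (map (AD k^-1%g) s))) ->
  LD X (fun y => MI H mu (fun k => r k *m f (y * k)%g (map (AD k^-1%g) s))) x =
  MI H mu (fun k => r k *m LD (AD k^-1%g X) (fun y => f y (map (AD k^-1%g) s)) (x * k)%g).
Proof.
move=> fs Fs; apply/matrixP => i j; rewrite -(Lder_entry _ _ _ _ Fs) [RHS]mxE.
pose q k y := (r k *m f y (map (AD k^-1%g) s)) i j.
have qs : sep q.
  have vsP : forall v, List.In v [seq (fun k : G => AD k^-1%g Y) | Y <- s] -> smooth v.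
    by move=> v /List.in_map_iff [Y [<- _]]; exact: smooth_AdV.
  have h a := sepM (smooth_entry i a (rep_smooth r)) (sep_multi [::] [::] a j fs vsP).
  apply: sep_ext (sep_sum (index_enum 'I_w) h) => k y; rewrite /q mxE; apply: eq_bigr => a _.
  by rewrite mxE eqxx mulr1n /= cats0 -map_comp.
have := Lder_II_full Hcpt Hlie mufin X x Hlie' hU qs (smooth_entry i j Fs).
move=> -> => [|y]; last by rewrite !mxE eqxx.
apply: II_ext => k _; rewrite /q.
have fk : smooth (fun y => r k *m f y (map (AD k^-1%g) s)).
  by apply: smoothM; [exact: smooth_cst | exact: fs.2].
by rewrite (Lder_entry _ _ _ _ fk) LderMl //; exact: fs.2.
Qed.

(** At [x k] the arguments are [AD k^-1 s_i]: the derivative comes out by differentiation under the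
    integral, [sig] by its equivariance under [H], and the brackets because [AD] is an
    automorphism. *)
Lemma MI_dl p (f : gform G w 1) x s : sform p f ->
  let F := fun y t => MI H mu (fun k => r k *m f (y * k)%g (map (AD k^-1%g) t)) in
  (forall t, smooth (fun y => F y t)) ->
  MI H mu (fun k => r k *m dl sig t0 f (x * k)%g (map (AD k^-1%g) s)) = dl sig t0 F x s.
Proof.
move=> fs F Fs.
pose T1 i k : 'M[R]_(w, 1) := r k *m LD (AD k^-1%g s`_i) (fun y => f y (map (AD k^-1%g) (del i s))) (x * k)%g.
pose T2 t k : 'M[R]_(w, 1) := r k *m f (x * k)%g (map (AD k^-1%g) t).
have s1 i : smooth (T1 i) by exact: smooth_LderAd_form fs.
have s2 t : smooth (T2 t) by exact: total_smooth fs.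
have t00 X M : lact sig t0 X M = sig X *m M :> 'M[R]_(w, 1) by rewrite /lact drep_triv mulmx0 subr0.
transitivity (MI H mu (fun k => \sum_(i < size s) (-1) ^+ i *: (T1 i k + sig s`_i *m T2 (del i s) k)
  + \sum_(j < size s) \sum_(i < j) (-1) ^+ (i + j) *: T2 (LB s`_i s`_j :: del i (del j s)) k)).
  apply: MI_ext => k Hk; rewrite /dl size_map mulmxDr !mulmx_sumr.
  have nthA i : (i < size s)%N -> (map (AD k^-1%g) s)`_i = AD k^-1%g s`_i by move=> il; rewrite (nth_map 0).
  have delA i t : del i (map (AD k^-1%g) t) = map (AD k^-1%g) (del i t) by rewrite /del map_cat map_take map_drop.
  congr (_ + _); apply: eq_bigr => i _.
    rewrite -scalemxAr; congr (_ *: _); rewrite /nab t00 mulmxDr /T1 /T2 nthA // delA mulmxA.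
    by rewrite !mulmxA sigA // AdVK.
  rewrite mulmx_sumr; apply: eq_bigr => j _; rewrite -scalemxAr; congr (_ *: _).
  by rewrite /T2 !nthA ?(ltn_trans (ltn_ord j)) // !delA /= Ad_lie.
have s3 i : smooth (fun k => T1 i k + sig s`_i *m T2 (del i s) k).
  by apply: smoothD => //; apply: smoothM => //; exact: smooth_cst.
rewrite (MID Hcpt mufin); first last.
- by apply: smooth_sum => i; apply: smooth_sum => j; exact: smoothZl.
- by apply: smooth_sum => i; exact: smoothZl.
rewrite (MI_sum Hcpt mufin); last by move=> i; exact: smoothZl.
rewrite (MI_sum Hcpt mufin); last by move=> i; apply: smooth_sum => j; exact: smoothZl.
congr (_ + _); apply: eq_bigr => i _.
  rewrite (MIZ Hcpt mufin _ (s3 i)) (MID Hcpt mufin) //; last by apply: smoothM => //; exact: smooth_cst.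
  rewrite (MI_mull Hcpt mufin) // /nab t00; congr (_ *: (_ + _)).
  exact: esym (Lder_MI x s`_i fs (Fs (del i s))).
rewrite (MI_sum Hcpt mufin); last by move=> j; exact: smoothZl.
by apply: eq_bigr => j _; rewrite (MIZ Hcpt mufin).
Qed.

(** With the orthogonal family [L] in front, iterated contraction writes [dl f] as Lie derivatives
    along the [L_j], which integrate to 0, plus [dl] of the form contracted with all of [L]. The
    signs come from moving [L] to the front and from these contractions. *)
Lemma FI_dl_aux p (f : gform G w 1) x s : sform p f -> (forall y, altform p m (f y)) ->
  (forall X y t, X \in m -> LL sig t0 X f y t = 0) -> (size s + size fib = p.+1)%N ->
  exists L, [/\ size L = size fib,
    forall q (u : seq g -> 'M[R]_(w, 1)) Y, altform q m u -> u (Y ++ fib) = (-1) ^+ (size Y * size fib) *: u (L ++ Y) &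
    FI (dl sig t0 f) x s = (-1) ^+ (size s * size fib + size fib) *:
      MI H mu (fun k => r k *m dl sig t0 (fun y t => f y (L ++ t)) (x * k)%g (map (AD k^-1%g) s))].
Proof.
move=> fs fm fL; have [L Lg] := gram_exists Tfix m_hh fib_sub.
have [[sL Lh] _ _ Lu _] := Lg; set n := size fib in sL *; move=> sl.
have E0 q (u : seq g -> 'M[R]_(w, 1)) Y : altform q m u -> u (Y ++ fib) = (-1) ^+ (size Y * n) *: u (L ++ Y).
  by move=> ua; have := Lu _ _ _ _ Y [::] ua; rewrite !cats0 => <-; rewrite (alt_catC _ _ ua) sL.
exists L; split=> //.
have fLs := sform_gios L fs; set fL' : gform G w 1 := fun y t => f y (L ++ t).
have tl := drep_linear triv_rep; have sl' := sigl.
have fd z : altform p.+1 m (dl sig t0 f z) by exact: (dl_hor sl' tl fs fm (fun X t Xm => fL X z t Xm)).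
have dE z Y : size Y = size s -> dl sig t0 f z (Y ++ fib) = (-1) ^+ (size s * n) *:
  (\sum_(j < size L) (-1) ^+ j *: LL sr t0 L`_j (fun y t => f y (del j L ++ t)) z Y
  + (-1) ^+ n *: dl sig t0 fL' z Y).
  move=> sY; rewrite (E0 _ _ _ (fd z)) sY (dl_cat _ _ _ sl' tl fs) sL; congr (_ *: (_ + _)).
  apply: eq_bigr => j _; congr (_ *: _); rewrite /LL; congr (_ - _).
    have Lj : L`_j \in hh by apply: Lh; apply: mem_nth; rewrite sL.
    transitivity (nab sig t0 L`_j (fun y => f y (del j L ++ Y)) z); last by rewrite /nab /lact sigh.
    by apply: nab_ext => y; rewrite /del catA.
  (* The Lie derivative has to act on the base arguments only, as in [total_LL]; here the
     orthogonality of [L] is needed. *)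
  by rewrite (gram_adact Tfix hh_lie m_hh Lg fibh _ (fm z)) ?sL.
have h1 (j : nat) : (j < size L)%N -> smooth (fun k => r k *m LL sr t0 L`_j (fun y t => f y (del j L ++ t)) (x * k)%g (map (AD k^-1%g) s)) /\
  MI H mu (fun k => r k *m LL sr t0 L`_j (fun y t => f y (del j L ++ t)) (x * k)%g (map (AD k^-1%g) s)) = 0.
  move=> jl; have [a1 a2] := total_LL x s L`_j (sform_gios (del j L) fs).
  by split=> //; apply: a2; apply: Lh; exact: mem_nth.
have h2 := total_smooth x s (sform_dl sl' tl fLs).
transitivity (MI H mu (fun k => (-1) ^+ (size s * n) *: (\sum_(j < size L) (-1) ^+ j *:
  (r k *m LL sr t0 L`_j (fun y t => f y (del j L ++ t)) (x * k)%g (map (AD k^-1%g) s)) +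
  (-1) ^+ n *: (r k *m dl sig t0 fL' (x * k)%g (map (AD k^-1%g) s))))).
  apply: MI_ext => k _; rewrite dE ?size_map // -scalemxAr mulmxDr mulmx_sumr -scalemxAr.
  by congr (_ *: (_ + _)); apply: eq_bigr => j _; rewrite scalemxAr.
have s1 : smooth (fun k => \sum_(j < size L) (-1) ^+ j *:
  (r k *m LL sr t0 L`_j (fun y t => f y (del j L ++ t)) (x * k)%g (map (AD k^-1%g) s))).
  by apply: smooth_sum => j; apply: smoothZl; exact: (h1 j (ltn_ord j)).1.
rewrite (MIZ Hcpt mufin); last by apply: smoothD => //; exact: smoothZl.
rewrite (MID Hcpt mufin) //; last exact: smoothZl.
rewrite (MI_sum Hcpt mufin); last by move=> j; apply: smoothZl; exact: (h1 j (ltn_ord j)).1.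
rewrite big1 ?add0r => [|j _]; last first.
  by rewrite (MIZ Hcpt mufin) ?(h1 j (ltn_ord j)).2 ?scaler0 //; exact: (h1 j (ltn_ord j)).1.
by rewrite (MIZ Hcpt mufin) // scalerA -exprD.
Qed.

Lemma FI_dl l (f : gform G w 1) x s : sform (l + size fib) f ->
  (forall y, altform (l + size fib) m (f y)) ->
  (forall X y t, X \in m -> LL sig t0 X f y t = 0) ->
  (forall t, smooth (fun y => FI f y t)) -> size s = l.+1 ->
  FI (dl sig t0 f) x s = dl sig t0 (FI f) x s.
Proof.
move=> fs fm fL Fs sl; have [|L [sL E0 ->]] := FI_dl_aux x (s := s) fs fm fL; first by rewrite sl.
set n := size fib in fs fm sL E0 *; rewrite sl.
pose fL' : gform G w 1 := fun y t => f y (L ++ t).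
have fLs : sform l fL' by have := sform_gios L fs; rewrite sL addnK.
pose F' y t := MI H mu (fun k => r k *m fL' (y * k)%g (map (AD k^-1%g) t)).
have FF y t : FI f y t = (-1) ^+ (l * n) *: F' y t.
  rewrite -(MIZ Hcpt mufin); last exact: total_smooth fLs.
  apply: MI_ext => k _; rewrite (E0 _ _ _ (fm _)) -scalemxAr size_map.
  have [->//|st] := eqVneq (size t) l.
  have [f0 _ _ _] := fm (y * k)%g; have [g0 _ _ _] := fLs.1 (y * k)%g.
  rewrite f0 ?g0 ?mulmx0 ?scaler0 ?mulmx0 ?size_map //.
  by rewrite size_cat size_map sL; move: st; apply: contra => /eqP st; apply/eqP; lia.
pose c : R := (-1) ^+ (l * n).
have F's t : smooth (fun y => F' y t).
  apply: smooth_ext (smoothZl c (Fs t)) => y.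
  by rewrite FF scalerA /c signr_sq scale1r.
rewrite [RHS](dl_eq _ _ _ _ (FF : forall y t, FI f y t = c *: F' y t)).
rewrite dlZ // -(MI_dl x s fLs F's) /c; congr (_ *: _).
(* [(l + 1) n + n] and [l n] have the same parity. *)
by rewrite mulSn addnAC addnn exprD -mul2n exprM sqrrN !expr1n mul1r.
Qed.

(** There are no base arguments, and contracting with the whole fibre basis already exceeds the
    degree of [f]. *)
Lemma FI_dl_nil p (f : gform G w 1) x : sform p f -> (forall y, altform p m (f y)) ->
  (forall X y t, X \in m -> LL sig t0 X f y t = 0) -> size fib = p.+1 -> FI (dl sig t0 f) x [::] = 0.
Proof.
move=> fs fm fL sf; have [|L [sL _ ->]] := FI_dl_aux x (s := [::]) fs fm fL; first by rewrite sf.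
rewrite [X in _ *: X](_ : _ = 0) ?scaler0 // -[RHS](MI0 Hcpt mufin w 1); apply: MI_ext => k _.
have z y t : f y (L ++ t) = (fun _ _ => 0) y t.
  by have [h0 _ _ _] := fm y; rewrite h0 // size_cat sL sf; apply/eqP; lia.
by rewrite (dl_eq _ _ _ _ z) dl0 mulmx0.
Qed.
End FibreIntegral.

Lemma dual_span_full (U : {vspace g}) (L : seq g) (c : nat -> g -> R) :
  (forall i a X Y, c i (a *: X + Y) = a * c i X + c i Y) ->
  (forall i X, (i < size L)%N -> X \in U -> c i X = 0) ->
  (forall i j, (i < size L)%N -> (j < size L)%N -> c i L`_j = (i == j)%:R) ->
  size L = (ldim G - \dim U)%N -> (<<L>> + U)%VS = fullv.
Proof.
move=> cl cU cL sL.
have c0 i : c i 0 = 0 by have := cl i (-1) 0 0; rewrite scaler0 addr0 mulN1r addNr.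
have cD i X Y : c i (X + Y) = c i X + c i Y by have := cl i 1 X Y; rewrite scale1r mul1r.
have cZ i a X : c i (a *: X) = a * c i X by have := cl i a X 0; rewrite !addr0 c0 addr0.
have csum (k : 'I_(size L) -> R) (i : 'I_(size L)) : c i (\sum_j k j *: L`_j) = k i.
  rewrite (big_morph (c i) (cD i) (c0 i)) (bigD1 i) //= cZ cL // eqxx mulr1 big1 ?addr0 // => j ji.
  by rewrite cZ cL // eq_sym -val_eqE in ji *; rewrite (negPf ji) mulr0.
have fL : free L.
  change (free (in_tuple L)); apply/freeP => k k0 i; rewrite -(csum k i).
  by apply: etrans (c0 i); congr (c i _); exact: k0.
have cap : (<<L>> :&: U)%VS = 0%VS.
  apply/eqP; rewrite -subv0; apply/subvP => y; rewrite memv_cap => /andP [yL yU].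
  rewrite memv0 (@coord_span _ _ _ (in_tuple L) y yL); apply/eqP/big1 => i _.
  have := csum (fun i => coord (in_tuple L) i y) i.
  rewrite -(@coord_span _ _ _ (in_tuple L) y yL) cU // => <-; exact: scale0r.
have dsum := dimv_disjoint_sum cap.
apply/eqP; rewrite eqEdim subvf /= dsum (eqP (fL : \dim <<L>> == size L)) sL dimvf /dim /=.
by rewrite mul1n subnK // -[X in (_ <= X)%N]mul1n; have := dimvS (subvf U); rewrite dimvf.
Qed.

(** * Vector-valued forms on G/H *)

Section Columns.
Local Notation t0 := (drep triv_rep).
Variables (H : set G) (hh : {vspace g}) (m : nat) (r : rep G m).
Hypothesis Hgrp : subgroup H.
Hypothesis Hlie : lie_algebra_of H hh.
Local Notation OC := (Omega H hh (fun x (u : 'cV[R]_m) => r x *m u)).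

Lemma OmegaC_P p (f : gform G m 1) : OC p f <->
  [/\ forall x, altform p hh (f x), forall s, smooth (fun x => f x s) &
    forall x h s, H h -> f (x * h)%g s = r h^-1%g *m f x (map (AD h) s)].
Proof.
by split=> [[fa fs fh]|[fa fs fh]]; split=> // x h s Hh; rewrite fh // AD.unlock.
Qed.

Lemma OmegaC_sform p (f : gform G m 1) : OC p f -> sform p f.
Proof. by move=> [fa fs _]; split=> // x; exact: altform_0v (fa x). Qed.

Lemma OmegaC_linear p c (f f' : gform G m 1) : OC p f -> OC p f' -> OC p (fun x s => c *: f x s + f' x s).
Proof.
move=> [fa fs fh] [fa' fs' fh']; split.
- by move=> x; exact: altform_linear.
- by move=> s; apply: smoothD => //; exact: smoothZl.
by move=> x h s Hh; rewrite fh // fh' // mulmxDr -scalemxAr.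
Qed.

Lemma OmegaC0 p : OC p (fun _ _ => 0).
Proof.
split=> [x|s|x h s _]; [exact: altform0 | exact: smooth_cst | by rewrite mulmx0].
Qed.

Lemma OmegaC_translate p z (f : gform G m 1) : OC p f -> OC p (translate z f).
Proof.
move=> [fa fs fh]; split=> [x|s|x h s Hh]; first exact: fa.
  exact: smooth_mulL (fs s).
by rewrite /translate mulgA fh.
Qed.

Section Connection.
Variables (sig : g -> 'M[R]_m) (nb : conn G m 1).
Hypothesis sigl : forall c X Y, sig (c *: X + Y) = c *: sig X + sig Y.
Hypothesis sigAd : forall h X, H h -> sig X *m r h^-1%g = r h^-1%g *m sig (AD h X).
Hypothesis sigh : forall X, X \in hh -> sig X = drep r X.
Hypothesis nbE : forall X A x, smooth A -> nb X A x = nab sig t0 X A x.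
Local Notation tl := (drep_linear triv_rep).

Lemma dcov_dl (f : gform G m 1) x s : (forall s, smooth (fun x => f x s)) -> dcov nb f x s = dl sig t0 f x s.
Proof. by move=> fs; apply: dcovE => // X A As; exact: nbE. Qed.

Lemma OmegaC_LL p (f : gform G m 1) X x s : OC p f -> X \in hh -> LL sig t0 X f x s = 0.
Proof.
move=> fO Xh; have /OmegaC_P [_ _ fh] := fO.
have e y h t : H h -> f (y * h)%g t = r h^-1%g *m f y (map (AD h) t) *m triv_rep h.
  by move=> Hh; rewrite fh // mulmx1.
by rewrite -[RHS](inf_equivariant x s Hlie Hgrp Xh (OmegaC_sform fO) e) /LL /nab /lact sigh.
Qed.

Lemma OmegaC_d p (f : gform G m 1) : OC p f -> OC p.+1 (dcov nb f).
Proof.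
move=> fO; have ff := OmegaC_sform fO; have /OmegaC_P [fa fs fh] := fO.
have -> : dcov nb f = dl sig t0 f.
  by apply: funext2 => x s; exact: dcov_dl.
apply/OmegaC_P; split=> [x|s|x h s Hh].
- by apply: (dl_hor sigl tl ff fa) => X s Xh; exact: OmegaC_LL fO Xh.
- exact: smooth_dl.
rewrite -[RHS]mulmx1; apply: (dl_equiv ff) => [y t|X|X].
- by rewrite fh // mulmx1.
- exact: sigAd.
- by rewrite !drep_triv mulmx0 mul0mx.
Qed.

Lemma dcov_translate p z (f : gform G m 1) : OC p f -> dcov nb (translate z f) = translate z (dcov nb f).
Proof.
move=> fO; have ff := OmegaC_sform fO; have [_ fs _] := fO.
apply: funext2 => x s.
rewrite dcov_dl; last by move=> t; exact: smooth_mulL (fs t).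
by rewrite (dl_translate _ _ _ _ _ ff) /translate dcov_dl.
Qed.
End Connection.
End Columns.
End CartanInvolution.

(** * The geometry of G/K and G/P *)

Record geometry (R : realType) (G : lieGroup R) (v w : nat) (S : setting G v w)
    (theta : {linear lieAlg G -> lieAlg G}) : Prop := Geometry {
  geomK : maximal_compact (K S);
  geomKlie : lie_algebra_of (K S) (kk S);
  geomP : subgroup (P S);
  geomPlie : lie_algebra_of (P S) (pp S);
  geomPar : parabolic (pp S);
  geomNil : nilradical (pp S) (np S);
  geomT : cartan_involution theta;
  geomFix : forall X : lieAlg G, X \in kk S <-> theta X = X;
  geomMetric : invariant_metric S theta;
  geomFrame : oriented_frameK S theta;
  geomFibre : oriented_fibreP S;
  geomHaar : haar_on_K S }.

Section Geometry.
Variables (R : realType) (G : lieGroup R) (v w : nat) (S : setting G v w).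
Variable theta : {linear lieAlg G -> lieAlg G}.
Hypothesis geo : geometry S theta.
Local Notation g := (lieAlg G).
Local Notation B := (@KF R G).
Local Notation kk := (kk S).
Local Notation pp := (pp S).
Local Notation mm := (kk :&: pp)%VS.
Local Notation nK := (dimK S).
Local Notation nP := (dimP S).
Local Notation sg := (drep (rW S)).
Local Notation tv := (drep (rV S)).
Local Notation t0 := (drep (triv_rep G)).
Local Notation tl := (drep_linear (rV S)).
Local Notation OM := (OmegaM S).
Local Notation PT := (PoissonTransform S).
Local Notation fint := (FI (K S) (haar S) (fibre S) (rW S)).
Let Tcartan := geomT geo.

Definition allp (s : seq g) := all (fun X => X \in pp) s.
Definition allk (s : seq g) := all (fun X => X \in kk) s.

Lemma Kgrp : subgroup (K S). Proof. by case: (geomK geo). Qed.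
Lemma Kcpt : compact (K S). Proof. by case: (geomK geo). Qed.

Lemma kk_fix X : X \in kk -> theta X = X. Proof. by move/(geomFix geo). Qed.

Lemma theta_lie X Y : theta (LB X Y) = LB (theta X) (theta Y).
Proof. by have [_ h _] := Tcartan; have := h X Y; rewrite LBE. Qed.

Lemma kk_lie X Y : X \in kk -> Y \in kk -> LB X Y \in kk.
Proof. by move=> /kk_fix XE /kk_fix YE; apply/(geomFix geo); rewrite theta_lie XE YE. Qed.

Lemma pplie X Y : X \in pp -> Y \in pp -> LB X Y \in pp.
Proof. exact: (pp_lie Tcartan (geomPar geo)). Qed.

Lemma mm_alg : lie_algebra_of (K S `&` P S) mm.
Proof. exact: lie_algebra_cap Tcartan _ _ _ _ (geomKlie geo) (geomPlie geo). Qed.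

Lemma KPgrp : subgroup (K S `&` P S).
Proof.
have [a b c] := Kgrp; have [d e f] := geomP geo.
by split=> [|x y [? ?] [? ?]|x [? ?]]; split; auto.
Qed.

Lemma Ad_kk x X : K S x -> X \in kk -> AD x X \in kk.
Proof. by move=> Kx Xk; exact: lie_algebra_Ad Kgrp (geomKlie geo) Xk Kx. Qed.

Lemma Ad_pp x X : P S x -> X \in pp -> AD x X \in pp.
Proof. by move=> Px Xp; exact: lie_algebra_Ad (geomP geo) (geomPlie geo) Xp Px. Qed.

Definition fE (i : 'I_(dimK S)) : g := (frame S)`_i.
Local Notation E := fE.

Lemma size_frame : size (frame S) = dimK S. Proof. by case: (geomFrame geo). Qed.
Lemma mkl_frame : mkl fE = frame S.
Proof.
rewrite /fE; have := size_frame; move: (dimK S) => n <-; exact: mkl_nth.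
Qed.

Lemma frame_theta X : X \in frame S -> theta X = - X.
Proof. by case: (geomFrame geo) => _ h _ _; exact: h. Qed.

Lemma frame_orth i j : (i < dimK S)%N -> (j < dimK S)%N -> B (frame S)`_i (frame S)`_j = (i == j)%:R.
Proof. by move=> il jl; case: (geomFrame geo) => _ _ h _; rewrite -h // KFE. Qed.

(** [theta] preserves the Killing form, fixes [Y] and changes the sign of [X]. *)
Lemma frame_kk X Y : X \in frame S -> Y \in kk -> B X Y = 0.
Proof.
move=> /frame_theta Xt /kk_fix Yt; have := KF_theta Tcartan X Y.
rewrite Xt Yt (KFNl Tcartan) => h; have : B X Y + B X Y = 0 by rewrite -{1}h addNr.
by rewrite -mulr2n => /eqP; rewrite mulrn_eq0 => /eqP.
Qed.

Lemma frameK_dual : dual_frame kk fE fE.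
Proof.
have mf (i : 'I_(dimK S)) : fE i \in frame S by rewrite mem_nth // size_frame.
split=> [i X Xk|i j|X]; first exact: frame_kk.
  by rewrite /fE frame_orth.
have full : (<<frame S>> + kk)%VS = fullv.
  apply: (dual_span_full (c := fun i X => if (i < dimK S)%N then B (frame S)`_i X else 0)).
  - move=> i a Y Z; case: ifP => _; last by rewrite mulr0 addr0.
    by rewrite (KFDr Tcartan) (KFZr Tcartan).
  - by move=> i Y; rewrite size_frame => il Yk; rewrite il frame_kk // mem_nth ?size_frame.
  - by move=> i j; rewrite size_frame => il jl; rewrite il frame_orth.
  exact: size_frame.
have /memv_addP [y yf [z zk ->]] : X \in (<<frame S>> + kk)%VS by rewrite full memvf.
suff -> : \sum_i B (fE i) (y + z) *: fE i = y by rewrite addrAC subrr add0r.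
have yE : exists c : 'I_(dimK S) -> R, y = \sum_i c i *: fE i.
  have := @coord_span _ _ _ (in_tuple (frame S)) y yf.
  move: (coord (in_tuple (frame S))) => c e.
  have sf := size_frame.
  exists (fun i => c (cast_ord (esym sf) i) y); rewrite {1}e (reindex (cast_ord (esym sf))) //.
  by exists (cast_ord sf) => i _; apply: val_inj.
have [c ->] := yE; apply: eq_bigr => i _; congr (_ *: _).
rewrite (KFDr Tcartan) (frame_kk (mf i) zk) addr0 (KF_sumr Tcartan) (bigD1 i) //= big1 ?addr0.
  by rewrite (KFZr Tcartan) /fE frame_orth // eqxx mulr1.
by move=> j ji; rewrite (KFZr Tcartan) /fE frame_orth // eq_sym val_eqE (negPf ji) mulr0.
Qed.
Local Notation EE := frameK_dual.

Lemma fibre_kk : {subset fibre S <= kk}. Proof. by case: (geomFibre geo). Qed.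

Lemma size_fibre : size (fibre S) = dimP S.
Proof.
have [_ [vo [[vo0 _ _ _] opos _]]] := geomFibre geo; apply/eqP/negPn/negP => h.
by move: opos; rewrite vo0 ?ltxx.
Qed.

Lemma fibre_full : (<<fibre S>> + pp)%VS = fullv.
Proof.
have [_ [vo [oa opos _]]] := geomFibre geo; have [vo0 ol ou om] := oa.
(* Cramer's rule: the coordinate of [X] along a fibre vector is a quotient of two values of the
   positive form [vo]. *)
pose c i X : R := (vo (fibre S))^-1 * vo (take i (fibre S) ++ X :: drop i.+1 (fibre S)).
apply: (dual_span_full (c := c)).
- by move=> i a X Y; rewrite /c ol mulrDr mulrCA.
- by move=> i X _ Xp; rewrite /c [vo (_ ++ _)]om ?mulr0 // has_cat /= Xp orbT.
- move=> i j il jl; rewrite /c; have [<-|ij] := eqVneq i j.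
    by rewrite -drop_nth // cat_take_drop mulVf // gt_eqF.
  rewrite [vo (_ ++ _)]ou ?mulr0 // cat_uniq negb_and; apply/orP; right; rewrite negb_and.
  have [ji|ij'] := ltnP j i.
    apply/orP; left; rewrite negbK /=; apply/orP; left.
    by rewrite -(nth_take 0 ji) mem_nth // size_take il.
  have {ij'} ij' : (i < j)%N by rewrite ltn_neqAle ij.
  apply/orP; right; rewrite /= negb_and negbK; apply/orP; left.
  have -> : (fibre S)`_j = (drop i.+1 (fibre S))`_(j - i.+1) by rewrite nth_drop subnKC.
  by rewrite mem_nth // size_drop ltn_sub2r // (leq_ltn_trans ij').
by rewrite size_fibre.
Qed.

Lemma kp_full : (kk + pp)%VS = fullv.
Proof.
apply/eqP; rewrite eqEsubv subvf /= -fibre_full.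
by apply: addvS => //; apply: span_sub; exact: fibre_kk.
Qed.

Lemma fibre_span : (kk <= <<fibre S>> + mm)%VS.
Proof.
apply/subvP => X Xk; have : X \in (<<fibre S>> + pp)%VS by rewrite fibre_full memvf.
move=> /memv_addP [y yf [z zp XE]]; apply/memv_addP; exists y => //; exists z => //.
rewrite memv_cap zp andbT; have -> : z = X - y by rewrite XE addrAC subrr add0r.
by apply: rpredB => //; apply: (subvP (span_sub fibre_kk)).
Qed.

(** The twisted connection is the [h]-adjoint of the tractor connection, and the invariance of [h]
    exchanges the action of [X] for that of [theta X]. *)
Definition sgth (X : g) : 'M[R]_w := drep (rW S) (theta X).

Lemma sgth_linear c X Y : sgth (c *: X + Y) = c *: sgth X + sgth Y.
Proof. by rewrite /sgth linearP drep_linear. Qed.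

Lemma sgth_lie X Y : sgth (LB X Y) = sgth X *m sgth Y - sgth Y *m sgth X.
Proof. by rewrite /sgth theta_lie (drep_lie Tcartan). Qed.

Lemma nab_t0 a (sig : g -> 'M[R]_a) X (A : G -> 'M[R]_(a, 1)) x :
  nab sig t0 X A x = LD X A x + sig X *m A x.
Proof. by rewrite /nab /lact drep_triv mulmx0 subr0. Qed.

Lemma nabla_nab n (rho : rep G n) X A x : smooth A -> nabla rho X A x = nab (drep rho) t0 X A x.
Proof.
move=> As; rewrite nab_t0 /nabla.
have -> : Lder X (fun y => rho y *m A y) x = LD X (fun y => rho y *m A y) x by rewrite LD.unlock.
rewrite (LderM _ _ (rep_smooth rho) As) (Lder_rep rho) mulmxDr !mulmxA -repM mulVg rep1 !mul1mx.
by rewrite addrC.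
Qed.

Lemma hW_nondeg (u u' : 'cV[R]_w) : (forall s : 'cV[R]_w, s^T *m hW S *m u = s^T *m hW S *m u') -> u = u'.
Proof.
move=> h; have [_ hpos _ _] := geomMetric geo; apply/eqP; rewrite -subr_eq0; apply/negPn/negP => /hpos.
by rewrite mulmxBr h subrr mxE ltxx.
Qed.

(** Uniqueness follows by testing on constant sections, since [h] is definite; existence is the
    product rule together with the invariance of [h]. *)
Lemma nabla_theta_nab X A x : smooth A -> nabla_theta (rW S) (hW S) X A x = nab sgth t0 X A x.
Proof.
move=> As; rewrite nab_t0.
have [_ _ _ hinv] := geomMetric geo.
have P (s : G -> 'cV[R]_w) : smooth s -> (s x)^T *m hW S *m (LD X A x + sgth X *m A x) =
        Lder X (fun y => (s y)^T *m hW S *m A y) x - (nabla (rW S) X s x)^T *m hW S *m A x.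
  move=> ss; rewrite (nabla_nab _ _ _ ss) nab_t0.
  have -> : Lder X (fun y => (s y)^T *m hW S *m A y) x = LD X (fun y => (s y)^T *m hW S *m A y) x by rewrite LD.unlock.
  have st : smooth (fun y => (s y)^T).
    apply: smooth_mx => i j; apply: smooth_ext (smooth_entry j i ss) => y.
    by rewrite !mxE.
  have LT : LD X (fun y => (s y)^T) x = (LD X s x)^T.
    by apply/matrixP => i j; rewrite -(Lder_entry _ _ _ _ st) mxE -(Lder_entry _ _ _ _ ss) (Lder_ext (g := fun y => (s y j i)%:M)) // => y; rewrite mxE.
  have sth : smooth (fun y => (s y)^T *m hW S) by apply: smoothM => //; exact: smooth_cst.
  rewrite (LderM _ _ sth As) (LderM _ _ st (@smooth_cst _ G _ _ (hW S))) Lder_cst mulmx0 addr0 LT.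
  have -> : (LD X s x + sg X *m s x)^T = (LD X s x)^T + (s x)^T *m (sg X)^T.
    by rewrite linearD /= trmx_mul.
  rewrite !mulmxDl mulmxDr -!mulmxA [(sg X)^T *m _]mulmxA.
  rewrite hinv mulNmx mulmxN -!mulmxA opprD opprK addrA; congr (_ + _).
  by rewrite addrAC subrr add0r.
rewrite /nabla_theta; set Q := [set _ | _].
have ex : exists u, Q u by exists (LD X A x + sgth X *m A x) => s; exact: P.
apply: hW_nondeg => s; have sc : smooth (fun _ : G => s) by exact: smooth_cst.
by rewrite (getPex ex _ sc) (P _ sc).
Qed.

Lemma conn_hom_nab (nb : conn G w 1) sig X A x : (forall X A, smooth A -> nb X A x = nab sig t0 X A x) ->
  smooth A -> conn_hom nb (nabla (rV S)) X A x = nab sig tv X A x.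
Proof.
move=> h As; have cs j : smooth (fun y => col j (A y)).
  apply: smooth_mx => i k; apply: smooth_ext (smooth_entry i j As) => y.
  by rewrite !mxE.
apply/matrixP => i j; rewrite /conn_hom mxE (h _ _ (cs j)) (nabla_nab _ _ _ (@smooth_cst _ G _ _ _)).
have e : A x *m (tv X *m delta_mx j (0 : 'I_1)) = col j (A x *m tv X) by rewrite mulmxA -colE.
have e2 : sig X *m col j (A x) = col j (sig X *m A x) by rewrite !colE mulmxA.
rewrite !nab_t0 Lder_cst add0r e e2 /nab /lact; move: (sig X *m A x) (A x *m tv X) => M N.
rewrite !mxE [RHS]addrA; congr (_ + _ - _).
rewrite -(Lder_entry _ _ _ _ (cs j)) -(Lder_entry _ _ _ _ As).
by rewrite (Lder_ext (g := fun y => (A y i j)%:M)) // => y; rewrite mxE.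
Qed.

(** * Bidegree and adapted argument lists *)

Lemma multi_zero (A : lmodType R) (D : seq g -> A) : slot_linear D ->
  (forall r, all (fun X => (X \in pp) || (X \in kk)) r -> D r = 0) -> forall r, D r = 0.
Proof.
move=> Dl Dg r; suff h pre : all (fun X => (X \in pp) || (X \in kk)) pre -> D (pre ++ r) = 0 by exact: (h [::]).
elim: r pre => [|X r IH] pre prek; first by rewrite cats0 Dg.
have : X \in (kk + pp)%VS by rewrite kp_full memvf.
move=> /memv_addP [X1 X1k [X2 X2p ->]]; rewrite slotD // -!cat_rcons !IH ?addr0 //.
  by rewrite all_rcons prek X2p.
by rewrite all_rcons prek X1k orbT.
Qed.

Lemma count_good r : all (fun X => (X \in pp) || (X \in kk)) r ->
  (size r <= count (fun X => X \in pp) r + count (fun X => X \in kk) r)%N.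
Proof.
elim: r => //= X r IH /andP [/orP [] h /IH l]; rewrite h /= ?addSn ?addnS; lia.
Qed.

Lemma split_good r p q : all (fun X => (X \in pp) || (X \in kk)) r -> size r = (p + q)%N ->
  (count (fun X => X \in pp) r <= p)%N -> (count (fun X => X \in kk) r <= q)%N ->
  exists s t, [/\ perm_eq (s ++ t) r, allp s, allk t, size s = p & size t = q].
Proof.
move=> ra sr cp ck; have cg := count_good ra.
exists [seq X <- r | X \in pp], [seq X <- r | X \notin pp]; split.
- by rewrite perm_filterC.
- exact: filter_all.
- rewrite /allk all_filter; apply/allP => X Xr; apply/implyP => Xp.
  by have := allP ra X Xr; rewrite (negPf Xp).
- have e : size [seq X <- r | X \in pp] = count (fun X => X \in pp) r := size_filter _ _.
  by rewrite e; move: cp ck cg; rewrite sr; lia.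
have e : size [seq X <- r | X \in pp] = count (fun X => X \in pp) r := size_filter _ _.
have e2 : size [seq X <- r | X \notin pp] = count (predC (fun X => X \in pp)) r := size_filter _ _.
have := count_predC (fun X => X \in pp) r; rewrite e2; move: cp ck cg; rewrite sr; lia.
Qed.

Section Ext.
Variables (a b : nat).
Implicit Types u : seq g -> 'M[R]_(a, b).
(** Splitting each argument along [g = k + p] leaves lists with at most [p] vectors of [pp] and at
    most [q] of [kk]. Vectors in both subspaces are counted twice, so such a list still sorts into
    exactly [p] of the first kind followed by [q] of the second. *)
Lemma vanish_zero p q u : altform (p + q) mm u ->
  (forall s, (p < count (fun x => x \in pp) s)%N || (q < count (fun x => x \in kk) s)%N -> u s = 0) ->
  (forall s t, allp s -> allk t -> size s = p -> size t = q ->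
     u (s ++ t) = 0) -> forall r, u r = 0.
Proof.
move=> ua uv uz; have [us ul _ _] := ua; apply: multi_zero => // r ra.
have [sr|/eqP sr] := eqVneq (size r) (p + q)%N; last by apply: us; apply/eqP.
have [cp|cp] := leqP (count (fun x => x \in pp) r) p; last by apply: uv; rewrite cp.
have [ck|ck] := leqP (count (fun x => x \in kk) r) q; last by apply: uv; rewrite ck orbT.
have [s [t [st sp tk ss tt]]] := split_good ra sr cp ck.
by apply: (alt_perm_eq ua st); exact: uz.
Qed.

Lemma altform_sub2 p (hh : {vspace g}) u u' : altform p hh u -> altform p hh u' -> altform p hh (fun s => u s - u' s).
Proof.
move=> ua ua'; apply: altform_eq (altform_linear (-1) ua' ua) => s.
by rewrite scaleN1r addrC.
Qed.

Lemma bideg_ext p q u u' : bideg S p q u -> bideg S p q u' ->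
  (forall s t, allp s -> allk t -> size s = p -> size t = q ->
     u (s ++ t) = u' (s ++ t)) -> u = u'.
Proof.
move=> [ua uv] [ua' uv'] h; apply/funext => r; apply/eqP; rewrite -subr_eq0; apply/eqP.
apply: (vanish_zero (p := p) (q := q) (u := fun s => u s - u' s)) => [|s sv|s t sp tk ss tt].
- exact: altform_sub2.
- by rewrite uv // uv' // subrr.
by rewrite h // subrr.
Qed.

Lemma bideg0 p q : bideg S p q (fun _ => 0 : 'M[R]_(a, b)).
Proof. by split=> //; exact: altform0. Qed.

Lemma bideg_linear p q c u u' : bideg S p q u -> bideg S p q u' -> bideg S p q (fun s => c *: u s + u' s).
Proof.
move=> [ua uv] [ua' uv']; split; first exact: altform_linear.
by move=> s sv; rewrite uv // uv' // scaler0 addr0.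
Qed.

Lemma bidegZ p q c u : bideg S p q u -> bideg S p q (fun s => c *: u s).
Proof.
by move=> [ua uv]; split=> [|s sv]; [exact: altformZ | rewrite uv // scaler0].
Qed.

Lemma bideg_sum p q I (r : seq I) (F : I -> seq g -> 'M[R]_(a, b)) : (forall i, bideg S p q (F i)) ->
  bideg S p q (fun s => \sum_(i <- r) F i s).
Proof.
move=> Fb; split; first by apply: altform_sum => i; case: (Fb i).
by move=> s sv; apply: big1 => i _; case: (Fb i) => _; apply.
Qed.

Lemma count_all (hh : {vspace g}) t : all (fun X => X \in hh) t -> count (fun X => X \in hh) t = size t.
Proof. by rewrite all_count => /eqP. Qed.

Lemma bideg_left p q u t : bideg S p q u -> allk t -> size t = q ->
  altform p kk (fun s => u (s ++ t)).
Proof.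
move=> [ua uv] tk tt; have [u1 u2 u3 _] := altform_ios_r t ua; rewrite tt addnK in u1 *.
split=> // s; rewrite has_count => h; apply: uv; apply/orP; right.
by rewrite count_cat (count_all tk) tt; lia.
Qed.

Lemma bideg_right p q u s : bideg S p q u -> allp s -> size s = p ->
  altform q pp (fun t => u (s ++ t)).
Proof.
move=> [ua uv] sp ss; have [u1 u2 u3 _] := altform_ios s ua; rewrite ss addKn in u1 *.
split=> // t; rewrite has_count => h; apply: uv; apply/orP; left.
by rewrite count_cat (count_all sp) ss; lia.
Qed.
End Ext.

Lemma wedge_bideg n p q a b c (al : seq g -> 'M[R]_(a, b)) (be : seq g -> 'M[R]_(b, c)) :
  n = p -> altform p kk al -> altform q pp be -> bideg S p q (wedge n mulmx al be).
Proof.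
move=> -> ala bea; split.
  apply: wedge_alt; [exact: mxL | exact: mxR | |].
    exact: altform_sub (capvSl _ _) ala.
  exact: altform_sub (capvSr _ _) bea.
move=> s /orP [sp|sk]; first exact: (wedge_vanishr (mxR (p := c)) _ bea sp).
have [ss|ss] := eqVneq (size s) (p + q)%N; last by apply: (wedge_size (mxL (p := c)) (mxR (p := c)) ala bea).
apply: (wedge_vanishl (mxL (p := c)) _ ala).
have := count_predC (fun x => x \in kk) s; rewrite ss => h.
have e : count (predC (fun x => x \in kk)) s = count (fun x => x \notin kk) s by [].
by rewrite e in h; lia.
Qed.

Lemma alt_map_mod (A : lmodType R) p (hh : {vspace g}) (u : seq g -> A) (phi : g -> g) pre s post :
  altform p hh u -> (forall X, X \in s -> X - phi X \in hh) ->
  u (pre ++ map phi s ++ post) = u (pre ++ s ++ post).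
Proof.
move=> ua; elim: s pre => //= X s IH pre h; have [_ ul _ um] := ua.
rewrite -!cat_rcons IH => [|Y Ys]; last by apply: h; rewrite in_cons Ys orbT.
rewrite !cat_rcons -[in RHS](subrK (phi X) X) (slotD _ _ _ _ ul) [X in _ = X + _]um ?add0r //.
by rewrite has_cat /= h ?mem_head ?orbT.
Qed.

Section Projection.
Variables (hh : {vspace g}) (n : nat) (E F : 'I_n -> g).
Hypothesis EF : dual_frame hh E F.
Definition fproj X : g := \sum_i B (F i) X *: E i.
Lemma fproj_linear a X Y : fproj (a *: X + Y) = a *: fproj X + fproj Y.
Proof.
rewrite /fproj scaler_sumr -big_split; apply: eq_bigr => i _ /=.
by rewrite (KFDr Tcartan) (KFZr Tcartan) scalerDl scalerA.
Qed.
Lemma fproj_mod X : X - fproj X \in hh. Proof. by case: EF. Qed.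
Lemma fproj_hh X : X \in hh -> fproj X = 0.
Proof. by move=> Xh; apply: big1 => i _; rewrite (frame_Fh EF) ?scale0r. Qed.
Lemma fproj_E i : fproj (E i) = E i.
Proof.
rewrite /fproj (bigD1 i) //= (frame_FE EF) eqxx scale1r big1 ?addr0 // => j ji.
by rewrite (frame_FE EF) (negPf ji) scale0r.
Qed.
Lemma fproj_mkl p (x : 'I_p -> 'I_n) : map fproj (mkl (fun k => E (x k))) = mkl (fun k => E (x k)).
Proof. by rewrite /mkl -map_comp; apply: eq_map => k; exact: fproj_E. Qed.
Lemma fproj_in (U : {vspace g}) X : (forall i, E i \in U) -> fproj X \in U.
Proof. by move=> EU; apply: memv_suml => i _; exact: rpredZ. Qed.
End Projection.

Lemma altform_fproj (A : lmodType R) hh n (E F : 'I_n -> g) p m (u : seq g -> A) post : dual_frame hh E F ->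
  altform (p + size post) m u -> altform p hh (fun s => u (map (fproj E F) s ++ post)).
Proof.
move=> EF [us ul un um]; split.
- by move=> s ss; apply: us; rewrite size_cat size_map eqn_add2r.
- by move=> s1 s2 a x y; rewrite !map_cat /= fproj_linear -!catA /= ul.
- move=> s su; apply: un; rewrite cat_uniq negb_and; apply/orP; left.
  by apply: contra su; exact: map_uniq.
move=> s /hasP [X Xs Xh]; have /path.splitPr[s1 s2] := Xs.
by rewrite map_cat /= (fproj_hh EF Xh) -catA /= (slot0 _ _ ul).
Qed.

(** The component of bidegree (p, q), read off the values of [u] on finitely many lists [lst i] that
    do not depend on [u]. The lists come from a frame modulo [kk] inside [pp] and one modulo [pp]
    inside [kk]. This serves both for decompositions into products and for smoothness of
    components. *)
Lemma comp_exists p q : exists (T : finType) (al : T -> seq g -> 'cV[R]_w) (lst : T -> seq g)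
    (be : T -> 'M[R]_(w, v) -> seq g -> 'rV[R]_v),
  [/\ (forall i, altform p kk (al i)) /\ forall i, exists s t, [/\ lst i = s ++ t,
        allp s, allk t, size s = p & size t = q],
      forall i M, altform q pp (be i M),
      forall i (F : G -> 'M[R]_(w, v)) s, smooth F -> smooth (fun x => be i (F x) s) &
      forall u, altform (p + q) mm u -> forall s t, allp s ->
        allk t -> size s = p -> size t = q ->
        \sum_i wedge p mulmx (al i) (be i (u (lst i))) (s ++ t) = u (s ++ t)].
Proof.
have [A [A' [AA Ap]]] := dual_frame_exists Tcartan kp_full.
have kp : (pp + kk)%VS = fullv by rewrite addvC kp_full.
have [C [C' [CC Ck]]] := dual_frame_exists Tcartan kp.
move: (ldim G - \dim kk)%N A A' AA Ap => nA A A' AA Ap.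
move: (ldim G - \dim pp)%N C C' CC Ck => nC C C' CC Ck.
pose mA I := mkl (fun k => A ((I : {ffun 'I_p -> 'I_nA}) k)).
pose mA' I := mkl (fun k => A' ((I : {ffun 'I_p -> 'I_nA}) k)).
pose mC I := mkl (fun k => C ((I : {ffun 'I_q -> 'I_nC}) k)).
pose mC' I := mkl (fun k => C' ((I : {ffun 'I_q -> 'I_nC}) k)).
exists ({ffun 'I_p -> 'I_nA} * {ffun 'I_q -> 'I_nC} * 'I_w)%type.
exists (fun i => decomp (mA' i.1.1) (delta_mx i.2 0)), (fun i => mA i.1.1 ++ mC i.1.2).
exists (fun i M => decomp (mC' i.1.2) ((p`!%:R)^-1 *: ((q`!%:R)^-1 *: row i.2 M))).
have aA I (x : 'cV[R]_w) : altform p kk (decomp (mA' I) x).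
  rewrite -[p](size_mkl (fun k => A' (I k))); apply: (decomp_alt Tcartan) => z X /mapP [k _ ->].
  exact: (frame_Fh AA).
have aC I (x : 'rV[R]_v) : altform q pp (decomp (mC' I) x).
  rewrite -[q](size_mkl (fun k => C' (I k))); apply: (decomp_alt Tcartan) => z X /mapP [k _ ->].
  exact: (frame_Fh CC).
split=> [|i M|i F s Fs|u ua s t sp tk ss tt] //.
  split=> [i|i] //; exists (mA i.1.1), (mC i.1.2); rewrite !size_mkl; split=> //.
    by apply/allP => X /mapP [k _ ->].
  by apply/allP => X /mapP [k _ ->].
  have rs : smooth (fun x => row i.2 (F x)).
    apply: smooth_mx => j k; apply: smooth_ext (smooth_entry i.2 k Fs) => y.
    by rewrite !mxE.
  rewrite /decomp; case: eqP => _; last exact: smooth_cst.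
  by apply: smoothZl; apply: smoothZl; apply: smoothZl.
(* Projecting to the frames changes the arguments by elements of [kk :&: pp] only, which [u] does
   not see. *)
have EA : u (s ++ t) = u (map (fproj A A') s ++ map (fproj C C') t).
  rewrite -[X in u (X ++ _)]cat0s -catA -(alt_map_mod (phi := fproj A A') [::] t ua); last first.
    move=> X Xs; rewrite memv_cap (fproj_mod AA) /=; apply: rpredB; first exact: (allP sp).
    exact: fproj_in.
  rewrite cat0s -[X in u (_ ++ X)]cats0 -(alt_map_mod (phi := fproj C C') _ [::] ua) ?cats0 //.
  move=> X Xt; rewrite memv_cap (fproj_mod CC) andbT; apply: rpredB; first exact: (allP tk).
  exact: fproj_in.
have st' : size (map (fproj C C') t) = q by rewrite size_map.
have ua1 : altform (p + size (map (fproj C C') t)) mm u by rewrite st'.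
rewrite EA (decomp_expand AA _ (altform_fproj AA ua1)).
have EC I : u (map (fproj A A') (mA I) ++ map (fproj C C') t) =
  \sum_(J : {ffun 'I_q -> 'I_nC}) decomp (mC' J) ((q`!%:R)^-1 *: u (mA I ++ mC J)) t.
  rewrite (fproj_mkl AA) -/(mA I) (alt_catC _ _ ua) size_map.
  have ua2 : altform (q + size (mA I)) mm u by rewrite size_mkl addnC.
  rewrite (decomp_expand CC _ (altform_fproj CC ua2)) scaler_sumr.
  apply: eq_bigr => J _; rewrite (fproj_mkl CC) -/(mC J) (alt_catC (mC J) (mA I) ua) !size_mkl tt.
  rewrite /decomp; case: eqP => _; last by rewrite scaler0.
  rewrite !scalerA [(q * p)%N]mulnC; congr (_ *: _); set d := \det _; set c := _^-1.
  have ee : (-1) ^+ (p * q) * (-1) ^+ (p * q) = 1 :> R by rewrite signr_sq.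
  by move: ee; set e := (-1) ^+ _ => ee; transitivity (e * e * (d * c)); [ring | rewrite ee mul1r].
rewrite (eq_bigr (fun i : {ffun 'I_p -> 'I_nA} * {ffun 'I_q -> 'I_nC} * 'I_w =>
  decomp (mA' i.1.1) (delta_mx i.2 (0 : 'I_1)) s *m decomp (mC' i.1.2) ((p`!%:R)^-1 *: ((q`!%:R)^-1 *: row i.2 (u (mA i.1.1 ++ mC i.1.2)))) t)); last first.
  move=> i _; apply: wedge_catE (aA _ _) (aC _ _) sp ss; [exact: mxL | exact: mxR].
rewrite -(pair_bigA _ (fun IJ a => decomp (mA' IJ.1) (delta_mx a (0 : 'I_1)) s *m decomp (mC' IJ.2) ((p`!%:R)^-1 *: ((q`!%:R)^-1 *: row a (u (mA IJ.1 ++ mC IJ.2)))) t)) /=.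
rewrite -(pair_bigA _ (fun I J => \sum_a decomp (mA' I) (delta_mx a (0 : 'I_1)) s *m decomp (mC' J) ((p`!%:R)^-1 *: ((q`!%:R)^-1 *: row a (u (mA I ++ mC J)))) t)) /=.
apply: eq_bigr => I _; rewrite EC scaler_sumr /decomp.
case: eqP => _; last by apply: big1 => J _; apply: big1 => a _; rewrite mul0mx.
rewrite scaler_sumr; apply: eq_bigr => J _.
case: eqP => _; last by rewrite !scaler0; apply: big1 => a _; rewrite mulmx0.
rewrite !scalerA; set c := \det _; set c' := \det _; set M := u _.
rewrite (eq_bigr (fun a => (c * (c' * ((p`!%:R)^-1 * (q`!%:R)^-1))) *: (delta_mx a (0 : 'I_1) *m row a M))); last first.
  by move=> a _; rewrite -scalemxAl -!scalemxAr !scalerA !mulrA.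
rewrite -scaler_sumr.
have -> : \sum_a delta_mx a (0 : 'I_1) *m row a M = M.
  apply/matrixP => i j; rewrite summxE (bigD1 i) //= mxE big_ord1 !mxE eqxx mul1r big1 ?addr0 // => a ai.
  by rewrite mxE big_ord1 mxE eq_sym (negPf ai) mul0r.
by congr (_ *: _); ring.
Qed.

Lemma ext_decomp p q u : bideg S p q u -> exists (n : nat) (al : 'I_n -> seq g -> 'cV[R]_w)
    (be : 'I_n -> seq g -> 'rV[R]_v), (forall i, altform p kk (al i) /\ altform q pp (be i)) /\
    u = (fun s => \sum_i wedge p mulmx (al i) (be i) s).
Proof.
move=> ub; have [T [al [lst [be [[ala _] bea _ E]]]]] := comp_exists p q.
exists #|T|, (fun i => al (enum_val i)), (fun i => be (enum_val i) (u (lst (enum_val i)))).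
split=> //; apply: (bideg_ext ub).
  by apply: bideg_sum => i; exact: wedge_bideg.
move=> s t sp tk ss tt; rewrite -(E u _ s t sp tk ss tt); last by case: ub.
by rewrite [LHS](reindex_onto enum_val enum_rank) /=; [apply: eq_bigl => i; rewrite enum_valK eqxx | move=> i _; exact: enum_rankK].
Qed.

(** * The Hodge star of G/K and its lift *)

Definition delK (s : seq g) : R^o := volK S s 0 0.
Local Notation HK := (Hs E delK).

Lemma volK_alt : altform nK kk (volK S).
Proof.
rewrite -size_frame; apply: (decomp_alt Tcartan) => z X zf Xk.
exact: (frame_kk zf Xk).
Qed.

Lemma delK_alt : altform nK kk delK.
Proof. by apply: (altform_lin (L := fun M : 'M[R]_1 => M 0 0 : R^o)) volK_alt => a x y; rewrite !mxE. Qed.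

Lemma delK1 : delK (mkl E) = 1.
Proof.
rewrite /delK /volK -mkl_frame decomp_mkl !mxE eqxx mulr1 (_ : (\matrix_(i, j) _) = 1%:M) ?det1 //.
by apply/matrixP => i j; rewrite !mxE frame_orth.
Qed.

Lemma delK_Ad x s : K S x -> delK (map (AD x) s) = delK s.
Proof.
by move=> Kx; case: (geomFrame geo) => _ _ _ h; rewrite /delK; have := h x s Kx; rewrite AD.unlock => ->.
Qed.

Definition mulh (x y : 'cV[R]_w) : 'M[R]_1 := x^T *m hW S *m y.
Lemma mulhL a x y z : mulh (a *: x + y) z = a *: mulh x z + mulh y z.
Proof. by rewrite /mulh linearP /= !mulmxDl -!scalemxAl. Qed.
Lemma mulhR a x y z : mulh z (a *: x + y) = a *: mulh z x + mulh z y.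
Proof. by rewrite /mulh mulmxDr -scalemxAr. Qed.

(** On the frame, [wedge_frame] contracts [HK b] once more with the volume form, which returns [b]
    by [HsK]; the remaining sum is the inner product. *)
Lemma HK_wedge p a b : (p <= nK)%N -> altform p kk a -> altform p kk b ->
  wedge p mulh a (HK p b) = (fun s => innerh S p a b *: volK S s).
Proof.
move=> pn aa ba; have pq : (p + (nK - p) = nK)%N by rewrite subnKC.
have ha := Hs_alt E delK_alt p b.
have wa : altform nK kk (wedge p mulh a (HK p b)).
  by rewrite -{1}pq; apply: wedge_alt => //; [exact: mulhL | exact: mulhR].
apply/funext; apply: (top_form_eq EE wa); first exact: altformZ volK_alt.
rewrite (wedge_frame delK_alt delK1 mulh a _ pq).
have -> : volK S (mkl E) = 1%:M.
  by apply/matrixP => i j; rewrite !ord1 -[LHS]/(delK (mkl E)) delK1 mxE eqxx.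
have Hin s : size s = p -> fsum E (nK - p) (fun t => delK (s ++ t) *: mulh (a s) (HK p b t)) =
  ((nK - p)`!)%:R *: mulh (a s) (b s).
  move=> ss; have := HsK EE delK_alt delK1 s (etrans (subnK pn) erefl : (nK - p + p)%N = nK) ba.
  move=> h; have {}h : fsum E (nK - p) (fun t => delK (s ++ t) *: HK p b t) = ((nK - p)`!)%:R *: b s.
    transitivity (((nK - p)`!)%:R *: ((-1) ^+ ((nK - p) * p) *: HK (nK - p) (HK p b) s)); last first.
      by rewrite h !scalerA -mulrA signr_sq mulr1.
    move: (HK p b) => c; have f0 : ((nK - p)`!)%:R != 0 :> R by rewrite pnatr_eq0 -lt0n fact_gt0.
    rewrite /Hs !scalerA mulrAC mulfV // mul1r -fsumZ; apply: fsum_ext => t st.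
    by rewrite (alt_catC _ _ delK_alt) ss st [(p * _)%N]mulnC scalerA.
  transitivity (fsum E (nK - p) (fun t => mulh (a s) (delK (s ++ t) *: HK p b t))).
    by apply: fsum_ext => t _; apply: esym; exact: (bilZr mulhR).
  rewrite -(fsum_lin _ _ _ (L := mulh (a s))); first by rewrite h (bilZr mulhR).
    exact: bil0r mulhR _.
  by move=> x y; have := mulhR 1 x y (a s); rewrite !scale1r.
rewrite (fsum_ext _ Hin) fsumZ scalerA invfM -mulrA mulVf ?mulr1; last first.
  by rewrite pnatr_eq0 -lt0n fact_gt0.
rewrite /innerh scalemx1; apply/matrixP => i j; rewrite !ord1 !mxE eqxx mulr1n; congr (_ * _).
rewrite /fsum summxE; apply: eq_bigr => I _; rewrite /mulh /mkl /fE //.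
Qed.

(** Wedging with the forms [delK (s ++ t) *: u] in [s] recovers the value of a candidate at [t] by
    [wedge_top_l], and [h] is nondegenerate; so the candidate is unique. *)
Lemma hodgeE p b : altform p kk b -> hodge S p b = HK p b.
Proof.
move=> ba; rewrite /hodge; case: leqP => pn; last first.
  by apply/funext => t; rewrite (Hs_over E delK_alt).
set Q := [set _ | _]; have QH : Q (HK p b).
  by split=> [|a aa]; [exact: (Hs_alt E delK_alt) | exact: HK_wedge].
have [ca cw] := getPex (ex_intro Q _ QH); have [ha hw] := QH.
move: (get Q) ca cw => c ca cw; apply/funext => t.
have [st|st] := eqVneq (size t) (nK - p)%N; last first.
  by have [-> // _ _ _] := ca; have [-> // _ _ _] := ha.
apply: hW_nondeg => u.
have aa : altform p kk (fun s => delK (s ++ t) *: u).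
  have := altform_ios_r t delK_alt; rewrite st subKn // => h.
  by apply: (altform_lin (L := fun a : R^o => a *: u)) h => a x y; rewrite scalerDl scalerA.
have top c' : altform (nK - p) kk c' -> wedge p mulh (fun s => delK (s ++ t) *: u) c' (mkl E) = mulh u (c' t).
  rewrite -st => ca'; have := wedge_top_l EE mulhL mulhR delK_alt u (mkl E) ca'.
  by rewrite delK1 scale1r; apply; rewrite st subnKC.
by rewrite -[LHS]/(mulh u (c t)) -[RHS]/(mulh u (HK p b t)) -!top // (cw _ aa) (hw _ aa).
Qed.

Lemma HKK (A : lmodType R) p (c : seq g -> A) t : (p <= nK)%N -> altform p kk c ->
  (-1) ^+ (p * (nK - p)) *: HK (nK - p) (HK p c) t = c t.
Proof.
move=> pn ca; rewrite (HsK EE delK_alt delK1 t (subnK pn) ca) scalerA [((nK - p) * _)%N]mulnC.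
by rewrite signr_sq scale1r.
Qed.

(** By [HKK] the star is its own inverse up to sign, which leaves one solution to choose. *)
Lemma hodgeVE p c : (p <= nK)%N -> altform (nK - p) kk c ->
  hodgeV S p c = (fun s => (-1) ^+ (p * (nK - p)) *: HK (nK - p) c s).
Proof.
move=> pn ca; set Q := [set b | altform p kk b /\ hodge S p b = c].
have ha : altform p kk (fun s => (-1) ^+ (p * (nK - p)) *: HK (nK - p) c s).
  by apply: altformZ; have := Hs_alt E delK_alt (nK - p) c; rewrite subKn.
have QH : Q (fun s => (-1) ^+ (p * (nK - p)) *: HK (nK - p) c s).
  split=> //; rewrite hodgeE //; apply/funext => t; rewrite HsZ.
  by rewrite -[RHS](HKK t (leq_subr p nK) ca) subKn // mulnC.
have [ba bc] := getPex (ex_intro Q _ QH); rewrite -/(hodgeV S p c) in ba bc *.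
move: (hodgeV S p c) ba bc => b ba <-; apply/funext => t.
by rewrite -[LHS](HKK t pn ba) hodgeE.
Qed.

Lemma hodgeV0 p : hodgeV S p (fun=> 0) = (fun=> 0).
Proof.
have [pn|pn] := leqP p nK.
  by rewrite hodgeVE //; [apply/funext => t; rewrite Hs0 scaler0 | exact: altform0].
set Q := [set b | altform p kk b /\ hodge S p b = (fun=> 0)].
have QH : Q (fun=> 0) by split; [exact: altform0 | rewrite /hodge leqNgt pn].
have [ba _] := getPex (ex_intro Q _ QH); apply/funext => t.
exact: (altform_over EE t ba pn).
Qed.

Local Notation ext p al be := (fun s => \sum_i wedge p mulmx (al i) (be i) s).

Lemma ext_star p q m (al : 'I_m -> seq g -> 'cV[R]_w) (be : 'I_m -> seq g -> 'rV[R]_v) :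
  (forall i, altform p kk (al i)) -> (forall i, altform q pp (be i)) ->
  bideg S (nK - p) q (ext (nK - p)%N (fun i => HK p (al i)) be) /\
  forall s t, allk t -> size t = q ->
    ext (nK - p)%N (fun i => HK p (al i)) be (s ++ t) = HK p (fun s => ext p al be (s ++ t)) s.
Proof.
move=> ala bea; have ha i : altform (nK - p) kk (HK p (al i)) by exact: (Hs_alt E delK_alt).
have cb : bideg S (nK - p) q (ext (nK - p)%N (fun i => HK p (al i)) be).
  by apply: bideg_sum => i; exact: wedge_bideg.
split=> // s t tk tt; have [ss|ss] := eqVneq (size s) (nK - p)%N; last first.
  have [[c0 _ _ _] _] := cb; rewrite c0 ?size_cat ?tt ?eqn_add2r //.
  by have [-> // _ _ _] := Hs_alt E delK_alt p (fun s => ext p al be (s ++ t)).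
transitivity (HK p (fun s => \sum_i al i s *m be i t) s).
  rewrite Hs_sum; apply: eq_bigr => i _.
  rewrite (wedge_catl (@mxL _ _ _ _) (@mxR _ _ _ _) (ha i) (bea i) tk ss).
  rewrite (Hs_lin E delK p (al i) (L := fun M => M *m be i t)) ?mul0mx // => [x y|a x].
    by rewrite mulmxDl.
  by rewrite scalemxAl.
apply: Hs_ext => s' ss'; apply: eq_bigr => i _.
by rewrite (wedge_catl (@mxL _ _ _ _) (@mxR _ _ _ _) (ala i) (bea i) tk ss').
Qed.

Lemma starKx_spec p q (u : seq g -> 'M[R]_(w, v)) : bideg S p q u ->
  bideg S (nK - p) q (starKx S p q u) /\
  forall s t, allk t -> size t = q ->
    starKx S p q u (s ++ t) = HK p (fun s => u (s ++ t)) s.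
Proof.
move=> ub; rewrite /starKx /ext_op; set Q := [set c | _].
suff h c : Q c -> bideg S (nK - p) q c /\ forall s t, allk t -> size t = q ->
    c (s ++ t) = HK p (fun s => u (s ++ t)) s.
  apply: h; apply: getPex; have [n [al [be [ab uE]]]] := ext_decomp ub.
  by exists (ext (nK - p)%N (fun i => hodge S p (al i)) be), n, al, be.
move=> [n [al [be [ab uE cE]]]].
have -> : c = ext (nK - p)%N (fun i => HK p (al i)) be.
  by rewrite cE; apply/funext => s; apply: eq_bigr => i _; rewrite hodgeE //; case: (ab i).
have [ala bea] := all_and2 ab.
have [eb eE] := ext_star ala bea.
by split=> // s t tk tt; rewrite uE; exact: eE.
Qed.

Lemma starKx_K p q (u : seq g -> 'M[R]_(w, v)) : (p <= nK)%N -> bideg S p q u ->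
  starKx S (nK - p) q (starKx S p q u) = (fun s => (-1) ^+ (p * (nK - p)) *: u s).
Proof.
move=> pn ub; have [sb sE] := starKx_spec ub; have [sb2 sE2] := starKx_spec sb.
rewrite subKn // in sb2.
apply: (bideg_ext sb2 (bidegZ _ ub)) => s t sp tk ss tt.
rewrite sE2 // (Hs_ext _ _ _ (u' := HK p (fun s => u (s ++ t)))); last by move=> s' _; exact: sE.
rewrite -(HKK s pn (bideg_left ub tk tt)) scalerA signr_sq scale1r //.
Qed.

Lemma starKVE p q (f : gform G w v) x : (p <= nK)%N -> bideg S (nK - p) q (f x) ->
  starKV S p q f x = (fun s => (-1) ^+ (p * (nK - p)) *: starKx S (nK - p) q (f x) s).
Proof.
move=> pn fb; set Q := [set u | bideg S p q u /\ starKx S p q u = f x].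
have [sb sE] := starKx_spec fb; rewrite subKn // in sb.
have ub := bidegZ ((-1) ^+ (p * (nK - p))) sb.
have QH : Q (fun s => (-1) ^+ (p * (nK - p)) *: starKx S (nK - p) q (f x) s).
  split=> //; have [sb2 sE2] := starKx_spec ub; apply: (bideg_ext sb2 fb) => s t sp tk ss tt.
  rewrite sE2 // HsZ (Hs_ext _ _ _ (u' := HK (nK - p) (fun s => f x (s ++ t)))); last by move=> s' _; exact: sE.
  have := HKK s (leq_subr p nK) (bideg_left fb tk tt); rewrite subKn // mulnC; exact.
have [ba bc] := getPex (ex_intro Q _ QH); rewrite -/(starKV S p q f x) in ba bc *.
move: (starKV S p q f x) ba bc => b ba <-.
rewrite starKx_K //; apply/funext => s.
by rewrite scalerA signr_sq scale1r.
Qed.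

Lemma bideg_over p q (u : seq g -> 'M[R]_(w, v)) : (nK < p)%N -> bideg S p q u -> u = (fun=> 0).
Proof.
move=> pn ub; apply: (bideg_ext ub); first exact: bideg0.
by move=> s t sp tk ss tt; exact: (altform_over EE s (bideg_left ub tk tt) pn).
Qed.

Lemma starKx0 p q : starKx S p q (fun=> 0) = (fun=> 0).
Proof.
have [sb sE] := starKx_spec (bideg0 w v p q).
apply: (bideg_ext sb); first exact: bideg0.
by move=> s t sp tk ss tt; rewrite sE // Hs0.
Qed.

Lemma starKV0 p q (f : gform G w v) x : f x = (fun=> 0) -> starKV S p q f x = (fun=> 0).
Proof.
move=> f0; have [pn|pn] := leqP p nK.
  rewrite starKVE //; last by rewrite f0; exact: bideg0.
  by rewrite f0 starKx0; apply/funext => s; rewrite scaler0.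
set Q := [set u | bideg S p q u /\ starKx S p q u = f x].
have QH : Q (fun=> 0) by split; [exact: bideg0 | rewrite starKx0 f0].
by have [ub _] := getPex (ex_intro Q _ QH); exact: (bideg_over pn ub).
Qed.

(** * The lift of the codifferential *)

Section Codifferential.
Variables (n : nat) (C C' : 'I_n -> g).
Hypothesis CC : dual_frame pp C C'.
Local Notation kosV := (kos C C' (dact (rV S))).

Lemma kos_mull a b c (A : 'M[R]_(a, b)) (u : seq g -> 'M[R]_(b, c)) (r' : rep G c) s :
  kos C C' (dact r') (fun t => A *m u t) s = A *m kos C C' (dact r') u s.
Proof.
rewrite /kos mulmx_sumr; apply: eq_bigr => i _; rewrite /kos_pair mulmxDr mulmxN; congr (_ + _).
  by rewrite /dact !opprK mulmxN opprK mulmxA.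
rewrite -scalemxAr; congr (_ *: _); rewrite /adact mulmx_sumr; apply: eq_bigr => j _.
by rewrite scalemxAr.
Qed.

Lemma ext_kos p q m (al : 'I_m -> seq g -> 'cV[R]_w) (be : 'I_m -> seq g -> 'rV[R]_v) :
  (forall i, altform p kk (al i)) -> (forall i, altform q pp (be i)) ->
  bideg S p q.-1 (ext p al (fun i => kosV (be i))) /\
  forall s t, allp s -> size s = p ->
    ext p al (fun i => kosV (be i)) (s ++ t) = kosV (fun t => ext p al be (s ++ t)) t.
Proof.
move=> ala bea; have ka i : altform q.-1 pp (kosV (be i)).
  exact: (kos_alt Tcartan (geomPar geo) (geomNil geo) CC (dact_r (rV S))).
split=> [|s t sp ss]; first by apply: bideg_sum => i; exact: wedge_bideg.
rewrite (kos_eq C C' _ t (u' := fun t => \sum_i al i s *m be i t)); last first.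
  move=> t'; apply: eq_bigr => i _.
  by apply: wedge_catE (ala i) (bea i) sp ss; [exact: mxL | exact: mxR].
rewrite (kos_sum C C' (dact_r (rV S))); apply: eq_bigr => i _; rewrite kos_mull.
by apply: wedge_catE (ala i) (ka i) sp ss; [exact: mxL | exact: mxR].
Qed.

(** Counterpart of [starKx_spec]: the arguments in [pp] are frozen in front, and [kos] acts behind
    them. *)
Lemma codiffP_spec p q (f : gform G w v) x : bideg S p q (f x) ->
  bideg S p q.-1 (codiffP S p q f x) /\
  forall s t, allp s -> size s = p ->
    codiffP S p q f x (s ++ t) = (-1) ^+ p *: kosV (fun t => f x (s ++ t)) t.
Proof.
move=> ub; rewrite /codiffP /ext_op; set u := f x in ub *; set Q := [set c | _].
suff h c : Q c -> bideg S p q.-1 c /\ forall s t, allp s -> size s = p ->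
    c (s ++ t) = (-1) ^+ p *: kosV (fun t => u (s ++ t)) t.
  apply: h; apply: getPex; have [m [al [be [ab uE]]]] := ext_decomp ub.
  by eexists; exists m, al, be; split; [exact: ab | exact: uE | reflexivity].
move=> [m [al [be [ab uE cE]]]].
have [ala bea] := all_and2 ab.
have -> : c = (fun s => (-1) ^+ p *: ext p al (fun i => kosV (be i)) s).
  rewrite cE; apply/funext => s; rewrite scaler_sumr; apply: eq_bigr => i _; rewrite (wedgeZl (@mxL _ _ _ _)).
  by rewrite (kostantE Tcartan (geomPar geo) (geomNil geo) CC (dact_l (rV S)) (dact_r (rV S)) (bea i)).
have [eb eE] := ext_kos ala bea; split; first exact: bidegZ.
by move=> s t sp ss; rewrite uE; exact: (congr1 _ (eE _ _ sp ss)).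
Qed.
End Codifferential.

(** * Forms of bidegree (p, q) on G/M *)

Lemma OmegaM_P p q (f : gform G w v) : OM p q f <->
  [/\ forall x, bideg S p q (f x), forall s, smooth (fun x => f x s) &
    forall x h s, K S h -> P S h -> f (x * h)%g s = rW S h^-1%g *m f x (map (AD h) s) *m rV S h].
Proof.
split=> [[[fa fs fh] fb]|[fb fs fh]].
  by split=> // x h s Kh Ph; rewrite fh // invgK AD.unlock.
split=> //; split=> // [x|x h s [Kh Ph]]; first by case: (fb x).
by rewrite fh // invgK AD.unlock.
Qed.

Lemma OmegaM_sform p q f : OM p q f -> sform (p + q) f.
Proof.
by move=> [[fa fs _] _]; split=> // x; exact: altform_0v (fa x).
Qed.

Lemma count_map (hh : {vspace g}) (phi : g -> g) s : (forall X, X \in hh -> phi X \in hh) ->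
  (count (fun X => X \in hh) s <= count (fun X => X \in hh) (map phi s))%N.
Proof.
move=> h; elim: s => //= X s IH; apply: leq_add => //.
by case: (boolP (X \in hh)) => [/h -> |_].
Qed.

Lemma bideg_map p q (u : seq g -> 'M[R]_(w, v)) h (A : 'M[R]_w) (A' : 'M[R]_v) : K S h -> P S h ->
  bideg S p q u -> bideg S p q (fun s => A *m u (map (AD h) s) *m A').
Proof.
move=> Kh Ph [[us ul un um] uv]; split.
  split.
  - by move=> s ss; rewrite us ?mulmx0 ?mul0mx // size_map.
  - move=> s1 s2 a x y; rewrite !map_cat /= AdD AdZ ul mulmxDr mulmxDl -scalemxAr.
    by rewrite -scalemxAl.
  - by move=> s su; rewrite un ?mulmx0 ?mul0mx // map_inj_uniq //; exact: can_inj (AdK h).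
  move=> s /hasP [X Xs]; rewrite memv_cap => /andP [Xk Xp].
  rewrite um ?mulmx0 ?mul0mx //; apply/hasP; exists (AD h X); first exact: map_f.
  by rewrite memv_cap Ad_kk // Ad_pp.
move=> s sv; rewrite uv ?mulmx0 ?mul0mx //.
have h1 := count_map s (fun X Xk => Ad_kk Kh (X := X) Xk).
have h2 := count_map s (fun X Xp => Ad_pp Ph (X := X) Xp).
by case/orP: sv => c; apply/orP; [left|right]; lia.
Qed.

(** [comp_exists] expresses every value through finitely many values on adapted lists, so smoothness
    is checked on those; equivariance follows from [bideg_ext]. *)
Lemma OmegaM_intro p q (F : gform G w v) : (forall x, bideg S p q (F x)) ->
  (forall s t, allp s -> allk t -> size s = p -> size t = q -> smooth (fun x => F x (s ++ t))) ->
  (forall x h s t, K S h -> P S h -> allp s -> allk t -> size s = p -> size t = q ->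
     F (x * h)%g (s ++ t) = rW S h^-1%g *m F x (map (AD h) s ++ map (AD h) t) *m rV S h) -> OM p q F.
Proof.
move=> Fb Fs Fh; apply/OmegaM_P; split=> // [r|x h s Kh Ph].
  have [T [al [lst [be [[ala lstP] bea bes E]]]]] := comp_exists p q.
  have -> : (fun x => F x r) = fun x => \sum_i wedge p mulmx (al i) (be i (F x (lst i))) r.
    apply/funext => x; suff {1}-> : F x = (fun r => \sum_i wedge p mulmx (al i) (be i (F x (lst i))) r) by [].
  apply: (bideg_ext (Fb x)).
      by apply: bideg_sum => i; exact: wedge_bideg.
    by move=> s t sp tk ss tt; rewrite E //; case: (Fb x).
  apply: smooth_sum => i; apply: smooth_wedge => s; first exact: smooth_cst.
  by apply: bes; have [s' [t' [-> a b c d]]] := lstP i; exact: Fs.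
suff -> : F (x * h)%g = (fun s => rW S h^-1%g *m F x (map (AD h) s) *m rV S h) by [].
apply: (bideg_ext (Fb _) (bideg_map _ _ Kh Ph (Fb x))) => s' t sp tk ss tt.
by rewrite Fh // map_cat.
Qed.

Lemma OmegaM0 p q : OM p q (fun _ _ => 0).
Proof.
apply: OmegaM_intro => [x|s t _ _ _ _|x h s t _ _ _ _ _ _].
- exact: bideg0.
- exact: smooth_cst.
- by rewrite mulmx0 mul0mx.
Qed.

Lemma OmegaM_linear p q c f f' : OM p q f -> OM p q f' -> OM p q (fun x s => c *: f x s + f' x s).
Proof.
move=> /OmegaM_P [fb fs fh] /OmegaM_P [fb' fs' fh']; apply/OmegaM_P; split.
- by move=> x; exact: bideg_linear.
- by move=> s; apply: smoothD => //; exact: smoothZl.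
by move=> x h s Kh Ph; rewrite fh // fh' // mulmxDr mulmxDl -scalemxAr -scalemxAl.
Qed.

Lemma OmegaMZ p q c f : OM p q f -> OM p q (fun x s => c *: f x s).
Proof.
move=> fO; have := OmegaM_linear c fO (OmegaM0 p q).
by rewrite (_ : (fun x s => c *: f x s + 0) = fun x s => c *: f x s) //; apply: funext2 => x s; rewrite addr0.
Qed.

Lemma OmegaM_ext p q f f' : OM p q f -> OM p q f' ->
  (forall x s t, allp s -> allk t -> size s = p -> size t = q -> f x (s ++ t) = f' x (s ++ t)) -> f = f'.
Proof.
move=> [_ fb] [_ fb'] h; apply/funext => x; apply: (bideg_ext (fb x) (fb' x)) => s t sp tk ss tt.
exact: h.
Qed.

Lemma vanish_p p q f x r : OM p q f -> (p < count (fun X => X \in pp) r)%N -> f x r = 0.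
Proof. by move=> [_ fb] c; have [_ h] := fb x; apply: h; rewrite c. Qed.
Lemma vanish_k p q f x r : OM p q f -> (q < count (fun X => X \in kk) r)%N -> f x r = 0.
Proof. by move=> [_ fb] c; have [_ h] := fb x; apply: h; rewrite c orbT. Qed.

Lemma count_catp s t : allp s -> (size s <= count (fun X => X \in pp) (s ++ t))%N.
Proof. by move=> sp; rewrite count_cat (count_all sp) leq_addr. Qed.
Lemma count_catk s t : allk t -> (size t <= count (fun X => X \in kk) (s ++ t))%N.
Proof. by move=> tk; rewrite count_cat (count_all tk) leq_addl. Qed.

Lemma count_del (a : pred g) i s : (i < size s)%N -> count a s = (a (s`_i)%R + count a (del i s))%N.
Proof.
move=> il; rewrite -{1}(cat_take_drop i s) (drop_nth 0 il) /del !count_cat /= addnCA.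
by rewrite !addnA.
Qed.

(** [AD h] preserves [k] and, by invariance of the Killing form, its orthogonal. On the latter
    [theta] is -1, because [Z + theta Z] is a fixed vector orthogonal to [k], where the form is
    definite. *)
Lemma Ad_theta h X : K S h -> theta (AD h X) = AD h (theta X).
Proof.
move=> Kh; have [H1 HM HV] := Kgrp.
have perp Z : (forall Y, Y \in kk -> KF Z Y = 0) -> theta Z = - Z.
  move=> Zp; have ZW : Z + theta Z \in kk.
    by apply/(geomFix geo); rewrite linearD /= addrC; case: Tcartan => -> _ _.
  have W0 : Z + theta Z = 0.
    apply: (KF_def Tcartan kk_fix ZW); rewrite (KFDl Tcartan) Zp // add0r.
    by rewrite -(kk_fix ZW) (KF_theta Tcartan) Zp.
  by apply/eqP; rewrite -addr_eq0 addrC W0.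
have kkc Y : Y \in kk -> theta (AD h Y) = AD h (theta Y).
  by move=> Yk; rewrite (kk_fix Yk) kk_fix // Ad_kk.
pose X1 := 2^-1 *: (X + theta X); pose X2 := 2^-1 *: (X - theta X).
have XE : X = X1 + X2.
  have two : 2^-1 + 2^-1 = 1 :> R by field.
  by rewrite /X1 /X2 -scalerDr addrACA subrr addr0 scalerDr -scalerDl two scale1r.
have t2 : theta (theta X) = X by case: Tcartan.
have X1k : X1 \in kk.
  by apply/(geomFix geo); rewrite /X1 linearZ /= linearD /= t2 addrC.
have X2t : theta X2 = - X2 by rewrite /X2 linearZ /= linearB /= t2 -scalerN opprB.
have X2p Y : Y \in kk -> KF X2 Y = 0.
  move=> Yk; have := KF_theta Tcartan X2 Y; rewrite X2t (kk_fix Yk) (KFNl Tcartan) => e.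
  have : KF X2 Y + KF X2 Y = 0 by rewrite -{1}e addNr.
  by rewrite -mulr2n => /eqP; rewrite mulrn_eq0 => /eqP.
have X2pA Y : Y \in kk -> KF (AD h X2) Y = 0.
  by move=> Yk; rewrite -(AdVK h Y) (KF_Ad Tcartan) X2p // Ad_kk //; exact: HV.
have l1 : theta (AD h (X1 + X2)) = theta (AD h X1) + theta (AD h X2) by rewrite AdD linearD.
have l2 : AD h (theta (X1 + X2)) = AD h (theta X1) + AD h (theta X2) by rewrite linearD AdD.
rewrite XE l1 l2 (kkc _ X1k) (perp _ X2pA) X2t; congr (_ + _).
by rewrite -scaleN1r -AdZ scaleN1r.
Qed.

(** * Splitting of the covariant derivative *)

Section Conn.
Variables (sig : g -> 'M[R]_w) (nb : conn G w v).
(** Common ground of the tractor connection and its twist by [theta]: flat, equivariant under K, and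
    given by the differential of the representation along [kk]. *)
Definition good_conn := [/\ forall c X Y, sig (c *: X + Y) = c *: sig X + sig Y,
  forall X Y, sig (LB X Y) = sig X *m sig Y - sig Y *m sig X,
  forall h X, K S h -> sig X *m rW S h^-1%g = rW S h^-1%g *m sig (AD h X),
  forall X, X \in kk -> sig X = sg X &
  forall X A x, smooth A -> nb X A x = nab sig tv X A x].
End Conn.

Section Connection.
Variables (sig : g -> 'M[R]_w) (nb : conn G w v).
Hypothesis good : good_conn sig nb.
Local Notation th := (drep_lie Tcartan (rV S)).
Local Notation D := (dl sig tv).
Let sigl : forall c X Y, sig (c *: X + Y) = c *: sig X + sig Y. Proof. by case: good. Qed.
Let sigh : forall X Y, sig (LB X Y) = sig X *m sig Y - sig Y *m sig X. Proof. by case: good. Qed.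
Let sigAd : forall h X, K S h -> sig X *m rW S h^-1%g = rW S h^-1%g *m sig (AD h X). Proof. by case: good. Qed.
Let sigkk : forall X, X \in kk -> sig X = sg X. Proof. by case: good. Qed.
Let nbE : forall X A x, smooth A -> nb X A x = nab sig tv X A x. Proof. by case: good. Qed.

Lemma tauAd h X : rV S h *m tv X = tv (AD h X) *m rV S h. Proof. exact: drep_Ad. Qed.

Lemma LL_mm p q f X x s : OM p q f -> X \in mm -> LL sig tv X f x s = 0.
Proof.
move=> fO Xm; have fs := OmegaM_sform fO; have /OmegaM_P [_ _ fh] := fO.
have := inf_equivariant Tcartan x s mm_alg KPgrp Xm fs (r := rW S) (r' := rV S).
move=> <- => [|y h t [Kh Ph]]; last exact: fh.
rewrite /LL /nab /lact sigkk //.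
by move: Xm; rewrite memv_cap => /andP [].
Qed.

Lemma D_alt p q f x : OM p q f -> altform (p + q).+1 mm (D f x).
Proof.
move=> fO; apply: (dl_hor Tcartan sigl tl (OmegaM_sform fO)) => [y|X s Xm]; first by case: fO => [[]].
exact: LL_mm fO Xm.
Qed.

(** [pp] and [kk] are subalgebras: a bracket of two of their vectors is again one, so each term of
    [dl] loses at most one vector of either kind. *)
Lemma D_vanish p q f x r : OM p q f ->
  (p.+1 < count (fun X => X \in pp) r)%N || (q.+1 < count (fun X => X \in kk) r)%N -> D f x r = 0.
Proof.
move=> fO cr.
have key (hh : {vspace g}) n : (n.+1 < count (fun X => X \in hh) r)%N ->
  (forall X Y, X \in hh -> Y \in hh -> LB X Y \in hh) ->
  (forall y s, (n < count (fun X => X \in hh) s)%N -> f y s = 0) -> D f x r = 0.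
  move=> cn hl fz; rewrite /dl [X in X + _]big1 ?add0r => [|i _].
    apply: big1 => j _; apply: big1 => i _; rewrite fz ?scaler0 //=.
    have il : (i < size r)%N := ltn_trans (ltn_ord i) (ltn_ord j).
    have e1 := count_del (fun X => X \in hh) (ltn_ord j).
    have e2 := @count_del (fun X => X \in hh) i (del j r).
    rewrite size_del // in e2; have il' : (i < (size r).-1)%N.
      apply: leq_trans (ltn_ord i) _; rewrite -ltnS prednK //; exact: leq_ltn_trans (ltn_ord j).
    have {}e2 := e2 il'.
    have e3 : (del j r)`_i = r`_i by rewrite nth_del /bump leqNgt ltn_ord.
    rewrite e3 in e2.
    have hb : (((r`_i)%R \in hh) + ((r`_j)%R \in hh) <= (LB (r`_i)%R (r`_j)%R \in hh).+1)%N.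
      case: (boolP ((r`_i)%R \in hh)) => hi; case: (boolP ((r`_j)%R \in hh)) => hj //.
      by rewrite (hl _ _ hi hj).
    have arith (a b c y : nat) : (a + b <= c.+1 -> n.+1 < b + (a + y) -> n < c + y)%N by lia.
    by apply: arith hb _; rewrite -e2 -e1.
  have z y : f y (del i r) = (fun=> 0) y.
    apply: fz; move: cn; rewrite (count_del (fun X => X \in hh) (ltn_ord i)).
    by case: (_ \in hh); [rewrite ltnS | move/ltnW].
  by rewrite (nab_ext _ _ _ _ z) nab0 scaler0.
case/orP: cr => cr.
  exact: (key pp p cr (fun X Y => pplie (X:=X) (Y:=Y)) (fun y s => vanish_p y fO (r:=s))).
exact: (key kk q cr (fun X Y => kk_lie (X:=X) (Y:=Y)) (fun y s => vanish_k y fO (r:=s))).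
Qed.

Lemma D_smooth p q f s : OM p q f -> smooth (fun x => D f x s).
Proof. by move=> fO; apply: smooth_dl => t; case: fO => [[]]. Qed.

Lemma D_equiv p q f x h s : OM p q f -> K S h -> P S h ->
  D f (x * h)%g s = rW S h^-1%g *m D f x (map (AD h) s) *m rV S h.
Proof.
move=> fO Kh Ph; have /OmegaM_P [_ _ fh] := fO.
apply: (dl_equiv Tcartan (OmegaM_sform fO)) => [y t|X|X]; first exact: fh.
- exact: sigAd.
- exact: tauAd.
Qed.

Lemma dcov_D p q f x s : OM p q f -> dcov nb f x s = D f x s.
Proof. by move=> fO; apply: dcovE => [X A As|t]; [exact: nbE | case: fO => [[]]]. Qed.

(** [comp_exists] cuts out the component [u] of bidegree (p + 1, q); the difference [D f - u] then
    vanishes as soon as [p + 1] vectors of [pp] are inserted. *)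
Lemma comp_D p q f : OM p q f -> exists2 u, OM p.+1 q u & OM p q.+1 (fun x s => D f x s - u x s).
Proof.
move=> fO; have [T [al [lst [be [[ala lstP] bea bes E]]]]] := comp_exists p.+1 q.
pose u x r : 'M[R]_(w, v) := \sum_i wedge p.+1 mulmx (al i) (be i (D f x (lst i))) r.
have ub x : bideg S p.+1 q (u x) by apply: bideg_sum => i; exact: wedge_bideg.
have uE x s t : allp s -> allk t -> size s = p.+1 -> size t = q -> u x (s ++ t) = D f x (s ++ t).
  by move=> sp tk ss tt; apply: E => //; rewrite addSn; exact: D_alt.
have uO : OM p.+1 q u.
  apply: OmegaM_intro => // [s t sp tk ss tt|x h s t Kh Ph sp tk ss tt].
    by rewrite (_ : (fun x => _) = fun x => D f x (s ++ t)); [exact: D_smooth fO | apply/funext => x; rewrite uE].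
  rewrite !uE ?size_map //; first by rewrite (D_equiv _ _ fO) // map_cat.
    by rewrite /allp all_map; apply/allP => X Xs /=; apply: (Ad_pp Ph); exact: (allP sp).
  by rewrite /allk all_map; apply/allP => X Xs /=; apply: (Ad_kk Kh); exact: (allP tk).
exists u => //; apply/OmegaM_P; have /OmegaM_P [_ us uh] := uO.
split=> [x|s|x h s Kh Ph].
- have [ua uv] := ub x; have Da := D_alt x fO; rewrite -addnS in Da; rewrite addSnnS in ua.
  split; first exact: altform_sub2.
  move=> r cr; have [ck|ck] := ltnP q.+1 (count (fun X => X \in kk) r).
    by rewrite (D_vanish _ fO) ?ck ?orbT // uv ?subr0 // (ltnW ck) orbT.
  have cp : (p < count (fun X => X \in pp) r)%N by case/orP: cr => //; rewrite ltnNge ck.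
  pose r1 := take p.+1 [seq X <- r | X \in pp].
  pose r2 := drop p.+1 [seq X <- r | X \in pp] ++ [seq X <- r | X \notin pp].
  have pr : perm_eq (r1 ++ r2) r by rewrite catA cat_take_drop perm_filterC.
  have ra : altform (p + q.+1) mm (fun s => D f x s - u x s) by exact: altform_sub2.
  have r1p : allp r1.
    by apply/allP => X /mem_take; rewrite mem_filter => /andP [].
  have sr1 : size r1 = p.+1.
    rewrite size_takel // size_filter; exact: cp.
  apply: (alt_perm_eq ra pr).
  have [rs rl _ _] := ra.
  suff h : forall r2 : seq g, D f x (r1 ++ r2) - u x (r1 ++ r2) = 0 by exact: h.
  apply: multi_zero => [s1 s2 a X Y|t tg]; first by rewrite !catA rl.
  have [st|st] := eqVneq (size t) q; last by apply: rs; rewrite size_cat sr1 addSnnS eqn_add2l eqSS.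
  have [tk|ntk] := boolP (allk t); first by rewrite uE // subrr.
  have c2 : (p.+1 < count (fun X => X \in pp) (r1 ++ t))%N.
    rewrite count_cat (count_all r1p) sr1 -[X in (X < _)%N]addn0 ltn_add2l -has_count.
    have /allPn [X Xt Xk] := ntk; apply/hasP; exists X => //.
    by have := allP tg X Xt; rewrite (negPf Xk) orbF.
  by rewrite (D_vanish _ fO) ?c2 // uv ?subr0 // c2.
- have := smoothD (D_smooth s fO) (smoothZl (-1) (us s)).
  by apply: smooth_ext => x; rewrite scaleN1r.
by rewrite (D_equiv _ _ fO) // uh // mulmxBr mulmxBl.
Qed.

Lemma partK_spec p q f : OM p q f ->
  OM p.+1 q (partK S nb p q f) /\ OM p q.+1 (fun x s => D f x s - partK S nb p q f x s).
Proof.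
move=> fO; set Q := [set u | OM p.+1 q u /\ OM p q.+1 (fun x s => dcov nb f x s - u x s)].
have dE : (fun x s => dcov nb f x s) = D f by apply: funext2 => x s; exact: dcov_D fO.
have Qex : exists u, Q u.
  have [u uO duO] := comp_D fO; exists u; split=> //.
  by rewrite (_ : (fun x s => _) = fun x s => D f x s - u x s) //; apply: funext2 => x s; rewrite (dcov_D _ _ fO).
have [uO duO] := getPex Qex; split=> //.
by move: duO; rewrite (_ : (fun x s => _) = fun x s => D f x s - get Q x s) //; apply: funext2 => x s; rewrite (dcov_D _ _ fO).
Qed.

Lemma partPE p q f : OM p q f -> partP S nb p q f = (fun x s => D f x s - partK S nb p q f x s).
Proof.
move=> fO; set Q := [set u | OM p q.+1 u /\ OM p.+1 q (fun x s => dcov nb f x s - u x s)].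
have [kO kO2] := partK_spec fO.
have Qex : exists u, Q u.
  exists (fun x s => D f x s - partK S nb p q f x s); split=> //.
  rewrite (_ : (fun x s => _) = partK S nb p q f) //; apply: funext2 => x s.
  by rewrite (dcov_D _ _ fO) opprB addrC subrK.
have [uO duO] := getPex Qex; apply: (OmegaM_ext uO kO2) => x s t sp tk ss tt.
have z : dcov nb f x (s ++ t) - get Q x (s ++ t) = 0.
  by apply: (vanish_k _ duO); rewrite -tt; exact: count_catk.
have z2 : partK S nb p q f x (s ++ t) = 0.
  by apply: (vanish_k _ kO); rewrite -tt; exact: count_catk.
by rewrite z2 subr0 -(dcov_D _ _ fO); apply/esym/eqP; rewrite -subr_eq0 z.
Qed.

Lemma partP_spec p q f : OM p q f -> OM p q.+1 (partP S nb p q f).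
Proof. by move=> fO; rewrite partPE //; case: (partK_spec fO). Qed.

Lemma partKE p q f x s t : OM p q f -> allp s -> size s = p.+1 -> partK S nb p q f x (s ++ t) = D f x (s ++ t).
Proof.
move=> fO sp ss; have [_ kO] := partK_spec fO; apply/esym/eqP; rewrite -subr_eq0; apply/eqP.
by apply: (vanish_p _ kO); rewrite -ss; exact: count_catp.
Qed.

Lemma partP_val p q f x s t : OM p q f -> allk t -> size t = q.+1 -> partP S nb p q f x (s ++ t) = D f x (s ++ t).
Proof.
move=> fO tk tt; rewrite partPE // [X in _ - X](vanish_k _ (proj1 (partK_spec fO))) ?subr0 //.
by rewrite -tt; exact: count_catk.
Qed.

Lemma partK_linear p q c f f' : OM p q f -> OM p q f' ->
  partK S nb p q (fun x s => c *: f x s + f' x s) = (fun x s => c *: partK S nb p q f x s + partK S nb p q f' x s).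
Proof.
move=> fO fO'; have lO := OmegaM_linear c fO fO'.
apply: (OmegaM_ext (proj1 (partK_spec lO))).
  by apply: OmegaM_linear; [case: (partK_spec fO) | case: (partK_spec fO')].
move=> x s t sp tk ss tt; rewrite !partKE //.
by apply: dl_linear => r; [case: fO => [[]] | case: fO' => [[]]].
Qed.

Lemma partP_linear p q c f f' : OM p q f -> OM p q f' ->
  partP S nb p q (fun x s => c *: f x s + f' x s) = (fun x s => c *: partP S nb p q f x s + partP S nb p q f' x s).
Proof.
move=> fO fO'; have lO := OmegaM_linear c fO fO'.
apply: (OmegaM_ext (partP_spec lO)).
  by apply: OmegaM_linear; exact: partP_spec.
move=> x s t sp tk ss tt; rewrite !partP_val //.
by apply: dl_linear => r; [case: fO => [[]] | case: fO' => [[]]].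
Qed.

(** [D (D f) = 0] is evaluated on [p + 1] vectors of [pp] and [q + 1] of [kk]; there [D] of each of
    the two components of [D f] is one of the two mixed compositions. *)
Lemma partP_partK p q f : OM p q f ->
  partP S nb p.+1 q (partK S nb p q f) = (fun x s => - partK S nb p q.+1 (partP S nb p q f) x s).
Proof.
move=> fO; have [kO kO2] := partK_spec fO; have pO := partP_spec fO.
have [pkO _] := partK_spec pO.
have nO : OM p.+1 q.+1 (fun x s => - partK S nb p q.+1 (partP S nb p q f) x s).
  have := OmegaMZ (-1) pkO; rewrite (_ : (fun x s => _) = fun x s => - partK S nb p q.+1 (partP S nb p q f) x s) //.
  by apply: funext2 => x s; rewrite scaleN1r.
apply: (OmegaM_ext (partP_spec kO) nO) => x s t sp tk ss tt.
rewrite (partP_val _ _ kO) // (partKE _ _ pO) //; apply/eqP; rewrite -addr_eq0; apply/eqP.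
have sK r : smooth (fun y => partK S nb p q f y r) by case: kO => [[]].
have sP r : smooth (fun y => partP S nb p q f y r) by case: pO => [[]].
rewrite -dlD // -[RHS](dl_dl Tcartan sigl tl sigh th x (s ++ t) (OmegaM_sform fO)).
by apply: dl_eq => y r; rewrite partPE // addrC subrK.
Qed.
End Connection.

(** * The lifted operators act on forms on G/M *)

Lemma dual_frame_Ad (hh : {vspace g}) n (F F' : 'I_n -> g) h : (forall X, X \in hh -> AD h X \in hh) ->
  (forall X, X \in hh -> AD h^-1%g X \in hh) ->
  dual_frame hh F F' -> dual_frame hh (fun i => AD h (F i)) (fun i => AD h (F' i)).
Proof.
move=> hh1 hh2 [F1 F2 F3]; split=> [i X Xh|i j|X].
- by rewrite -(AdVK h X) (KF_Ad Tcartan); apply: F1; exact: hh2.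
- by rewrite (KF_Ad Tcartan).
have -> : X - \sum_i KF (AD h (F' i)) X *: AD h (F i) = AD h (AD h^-1%g X - \sum_i KF (F' i) (AD h^-1%g X) *: F i).
  have ADB Y Z : AD h (Y - Z) = AD h Y - AD h Z by rewrite AdD -scaleN1r AdZ scaleN1r.
  rewrite ADB AdVK; congr (_ - _).
  have AD0 : AD h 0 = 0 by have := AdZ h 0 0; rewrite !scale0r.
  rewrite (big_morph _ (AdD h) AD0); apply: eq_bigr => i _.
  by rewrite AdZ -{1}(AdVK h X) (KF_Ad Tcartan).
exact/hh1/F3.
Qed.

Lemma frameK_Ad h : K S h -> dual_frame kk (fun i => AD h (E i)) (fun i => AD h (E i)).
Proof.
move=> Kh; have [_ _ HV] := Kgrp; apply: dual_frame_Ad EE => X Xk.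
  exact: (Ad_kk Kh).
exact: (Ad_kk (HV _ Kh)).
Qed.

Lemma sg_good : good_conn sg (nablaE S).
Proof.
split=> [c X Y|X Y|h X _|//|X A x As].
- exact: drep_linear.
- exact: (drep_lie Tcartan (rW S) X Y).
- by rewrite drep_Ad AdK.
apply: (conn_hom_nab X) As => Y B Bs.
exact: nabla_nab.
Qed.

Lemma sgth_good : good_conn sgth (nablaEtheta S).
Proof.
split=> [c X Y|X Y|h X Kh|X Xk|X A x As].
- exact: sgth_linear.
- exact: sgth_lie.
- by rewrite /sgth drep_Ad Ad_theta ?AdK.
- by rewrite /sgth kk_fix.
apply: (conn_hom_nab X) As => Y B Bs.
exact: nabla_theta_nab.
Qed.

Lemma bideg_swap p q (u : seq g -> 'M[R]_(w, v)) s t : bideg S p q u -> size t = q ->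
  u (t ++ s) = (-1) ^+ (q * p) *: u (s ++ t).
Proof.
move=> [ua _] tq; have [sp|sp] := eqVneq (size s) p; first by rewrite (alt_catC _ _ ua) tq sp.
have [u0 _ _ _] := ua; rewrite !u0 ?scaler0 // size_cat tq; last by rewrite addnC eqn_add2r.
by rewrite eqn_add2r.
Qed.

Lemma OmegaM_b p q f x : OM p q f -> bideg S p q (f x). Proof. by case. Qed.
Lemma OmegaM_s p q f s : OM p q f -> smooth (fun x => f x s). Proof. by case=> [[]]. Qed.

Lemma starK_val p q f x s t : OM p q f -> allk t -> size t = q ->
  starK S p q f x (s ++ t) = HK p (fun s => f x (s ++ t)) s.
Proof. by move=> fO tk tt; have [_ h] := starKx_spec (OmegaM_b x fO); exact: h. Qed.

(** For [h] in K, [AD h] carries the orthonormal frame to another one and fixes the volume form,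
    which makes the star equivariant. *)
Lemma starK_O p q f : OM p q f -> OM (nK - p) q (starK S p q f).
Proof.
move=> fO; apply: OmegaM_intro => [x|s t sp tk ss tt|x h s t Kh Ph sp tk ss tt].
- by have [] := starKx_spec (OmegaM_b x fO).
- rewrite (_ : (fun x => _) = fun x => HK p (fun s => f x (s ++ t)) s).
    by apply: (smooth_Hs E delK p (f := fun x s => f x (s ++ t)) s) => r; exact: (OmegaM_s _ fO).
  by apply/funext => x; exact: starK_val.
have tk' : allk (map (AD h) t).
  by rewrite /allk all_map; apply/allP => X Xs /=; apply: (Ad_kk Kh); exact: (allP tk).
rewrite !(starK_val _ _ fO) ?size_map //.
have /OmegaM_P [_ _ fh] := fO.
pose L (M : 'M[R]_(w, v)) := rW S h^-1%g *m M *m rV S h.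
pose u s := f x (s ++ map (AD h) t).
transitivity (HK p (fun s => L (u (map (AD h) s))) s).
  by apply: Hs_ext => r _; rewrite fh // map_cat.
rewrite -(Hs_lin E delK p (fun s => u (map (AD h) s)) (L := L)); last 3 first.
- by rewrite /L mulmx0 mul0mx.
- by move=> A B; rewrite /L mulmxDr mulmxDl.
- by move=> a A; rewrite /L -scalemxAr -scalemxAl.
have ua : altform p kk u by apply: (bideg_left (OmegaM_b x fO)) => //; rewrite size_map.
have -> : HK p (fun s => u (map (AD h) s)) s = HK p u (map (AD h) s); last by [].
exact: (Hs_map Tcartan EE delK_alt s (frameK_Ad Kh) (fun r => delK_Ad r Kh) ua).
Qed.

Lemma starK_lin p q c f f' : OM p q f -> OM p q f' ->
  starK S p q (fun x s => c *: f x s + f' x s) = (fun x s => c *: starK S p q f x s + starK S p q f' x s).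
Proof.
move=> fO fO'; have lO := OmegaM_linear c fO fO'.
apply: (OmegaM_ext (starK_O lO)).
  by apply: OmegaM_linear; exact: starK_O.
by move=> x s t sp tk ss tt; rewrite !(starK_val _ _ lO, starK_val _ _ fO, starK_val _ _ fO') // Hs_linear.
Qed.

Section Kostant.
Variables (n : nat) (C C' : 'I_n -> g).
Hypothesis CC : dual_frame pp C C'.
Local Notation kosV := (kos C C' (dact (rV S))).

Lemma codiffP_val p q f x s t : OM p q f -> allp s -> size s = p ->
  codiffP S p q f x (s ++ t) = (-1) ^+ p *: kosV (fun t => f x (s ++ t)) t.
Proof. by move=> fO sp ss; have [_ h] := codiffP_spec CC (OmegaM_b x fO); exact: h. Qed.

Lemma kosV_pp q h (u : seq g -> 'M[R]_(w, v)) t : P S h -> altform q pp u ->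
  kosV (fun s => rW S h^-1%g *m u (map (AD h) s) *m rV S h) t = rW S h^-1%g *m kosV u (map (AD h) t) *m rV S h.
Proof.
move=> Ph ua; have [_ _ HV] := geomP geo.
apply: (kos_map Tcartan CC (dact_l (rV S)) (dact_r (rV S)) (phi := AD h)
  (L := fun M => rW S h^-1%g *m M *m rV S h)) ua.
- apply: dual_frame_Ad CC => X Xp; first exact: (Ad_pp Ph).
  exact: (Ad_pp (HV _ Ph)).
- by move=> X Y; rewrite (Ad_lie Tcartan).
- by move=> c A B; rewrite mulmxDr mulmxDl -scalemxAr -scalemxAl.
by move=> Z M; rewrite /dact -mulmxA drep_Ad !mulmxA mulmxN mulNmx !mulmxA.
Qed.

Lemma codiffP_O p q f : OM p q f -> OM p q.-1 (codiffP S p q f).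
Proof.
move=> fO; apply: OmegaM_intro => [x|s t sp tk ss tt|x h s t Kh Ph sp tk ss tt].
- by have [] := codiffP_spec CC (OmegaM_b x fO).
- rewrite (_ : (fun x => _) = fun x => (-1) ^+ p *: kosV (fun t => f x (s ++ t)) t).
    apply: smoothZl; apply: (smooth_kos C C' (f := fun x t => f x (s ++ t)) t) => [Z A As|r].
      exact: smooth_dact.
    exact: (OmegaM_s _ fO).
  by apply/funext => x; exact: codiffP_val.
have sp' : allp (map (AD h) s).
  by rewrite /allp all_map; apply/allP => X Xs /=; apply: (Ad_pp Ph); exact: (allP sp).
rewrite !(codiffP_val _ _ fO) ?size_map // -scalemxAr -scalemxAl; congr (_ *: _).
have /OmegaM_P [_ _ fh] := fO.
have fa : altform q pp (fun t => f x (map (AD h) s ++ t)).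
  by apply: (bideg_right (OmegaM_b x fO)) => //; rewrite size_map.
by rewrite -(kosV_pp _ Ph fa); apply: kos_eq => r; rewrite fh // map_cat.
Qed.

Lemma codiffP_lin p q c f f' : OM p q f -> OM p q f' ->
  codiffP S p q (fun x s => c *: f x s + f' x s) = (fun x s => c *: codiffP S p q f x s + codiffP S p q f' x s).
Proof.
move=> fO fO'; have lO := OmegaM_linear c fO fO'.
apply: (OmegaM_ext (codiffP_O lO)).
  by apply: OmegaM_linear; exact: codiffP_O.
move=> x s t sp tk ss tt; rewrite (codiffP_val _ _ lO) // (codiffP_val _ _ fO) // (codiffP_val _ _ fO') //.
rewrite (kos_linear C C' (dact_r (rV S))) scalerDr !scalerA; congr (_ *: _ + _).
by rewrite mulrC.
Qed.

Lemma starKx_wedge p q m (al : 'I_m -> seq g -> 'cV[R]_w) (be : 'I_m -> seq g -> 'rV[R]_v) :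
  (forall i, altform p kk (al i)) -> (forall i, altform q pp (be i)) ->
  starKx S p q (ext p al be) = ext (nK - p)%N (fun i => HK p (al i)) be.
Proof.
move=> ala bea; have ub : bideg S p q (ext p al be) by apply: bideg_sum => i; exact: wedge_bideg.
have [sb sE] := starKx_spec ub; have [eb eE] := ext_star ala bea.
by apply: (bideg_ext sb eb) => s t sp tk ss tt; rewrite sE //; exact/esym/eE.
Qed.

Lemma codiffP_wedge p q m (f : gform G w v) x (al : 'I_m -> seq g -> 'cV[R]_w) (be : 'I_m -> seq g -> 'rV[R]_v) :
  (forall i, altform p kk (al i)) -> (forall i, altform q pp (be i)) -> f x = ext p al be ->
  codiffP S p q f x = (fun s => (-1) ^+ p *: ext p al (fun i => kosV (be i)) s).
Proof.
move=> ala bea fE; have ub : bideg S p q (f x).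
  by rewrite fE; apply: bideg_sum => i; exact: wedge_bideg.
have [sb sE] := codiffP_spec CC ub; have [eb eE] := ext_kos CC ala bea.
by apply: (bideg_ext sb (bidegZ _ eb)) => s t sp tk ss tt; rewrite sE // fE; exact: (congr1 _ (esym (eE _ _ sp ss))).
Qed.

Lemma OmegaM_over p q f : (nK < p)%N -> OM p q f -> f = (fun _ _ => 0).
Proof. by move=> pn fO; apply/funext => x; exact: (bideg_over pn (OmegaM_b x fO)). Qed.

Lemma starK0 p q : starK S p q (fun _ _ => 0) = (fun _ _ => 0).
Proof. by apply/funext => x; rewrite /starK starKx0. Qed.

Lemma codiffP0 p q : codiffP S p q (fun _ _ => 0) = (fun _ _ => 0).
Proof.
have z := OmegaM0 p q; have := codiffP_lin (-1) z z.
rewrite (_ : (fun _ _ => _ + _) = (fun _ _ => 0)) => [->|].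
  by apply: funext2 => x s; rewrite scaleN1r addNr.
by apply: funext2 => x s; rewrite scaler0 addr0.
Qed.

(** The two operators act on different factors of a product; the sign of the lifted codifferential
    is [(-1)^p] before the star and [(-1)^(dimK - p)] after it. *)
Lemma star_codiff p q f : OM p q f ->
  starK S p q.-1 (codiffP S p q f) = (fun x s => (-1) ^+ nK *: codiffP S (nK - p) q (starK S p q f) x s).
Proof.
move=> fO; have [pn|pn] := leqP p nK; last first.
  rewrite (OmegaM_over pn fO) codiffP0 !starK0 codiffP0.
  by apply: funext2 => x s; rewrite scaler0.
apply/funext => x; have [m [al [be [ab fE]]]] := ext_decomp (OmegaM_b x fO).
have [ala bea] := all_and2 ab.
have ka i : altform q.-1 pp (kosV (be i)).
  exact: (kos_alt Tcartan (geomPar geo) (geomNil geo) CC (dact_r (rV S))).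
have ha i : altform (nK - p) kk (HK p (al i)) by exact: (Hs_alt E delK_alt).
have fS : starK S p q f x = (fun s => \sum_i wedge (nK - p) mulmx (HK p (al i)) (be i) s).
  by rewrite /starK fE starKx_wedge.
rewrite (codiffP_wedge ha bea fS) /starK (codiffP_wedge ala bea fE).
have -> : (fun s => (-1) ^+ p *: \sum_i wedge p mulmx (al i) (kosV (be i)) s) =
  (fun s => \sum_i wedge p mulmx (fun s => (-1) ^+ p *: al i s) (kosV (be i)) s).
  apply/funext => s; rewrite scaler_sumr; apply: eq_bigr => i _.
  by rewrite (wedgeZl (@mxL _ _ _ _)).
rewrite starKx_wedge // => [|i]; last exact: altformZ.
apply/funext => s; rewrite scalerA -exprD scaler_sumr; apply: eq_bigr => i _.
have -> : HK p (fun s => (-1) ^+ p *: al i s) = (fun s => (-1) ^+ p *: HK p (al i) s).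
  by apply/funext => t; rewrite HsZ.
rewrite (wedgeZl (@mxL _ _ _ _)) -signr_odd -[in RHS]signr_odd; congr (_ ^+ nat_of_bool _ *: _).
by rewrite oddD oddB // addbA addbb addFb.
Qed.
End Kostant.

(** * Commutation relations *)

Section Moreover.
Local Notation "c ** f" := (fun x s => c *: f x s) (at level 40).
Local Notation gform := (gform G w v).
Local Opaque partK partP starKx starKV codiffP OmegaM.

Lemma gZZ a b (f : gform) : a ** (b ** f) = (a * b) ** f.
Proof. by apply: funext2 => x s; rewrite scalerA. Qed.
Lemma gZ1 (f : gform) : 1 ** f = f.
Proof. by apply: funext2 => x s; rewrite scale1r. Qed.
Lemma gZ0 a : a ** (fun _ _ => 0 : 'M[R]_(w, v)) = (fun _ _ => 0) :> gform.
Proof. by apply: funext2 => x s; rewrite scaler0. Qed.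
Lemma gN (f : gform) : (fun x s => - f x s) = (-1) ** f.
Proof. by apply: funext2 => x s; rewrite scaleN1r. Qed.

Lemma lin0 p q (O : gform -> gform) : (forall c f f', OM p q f -> OM p q f' ->
  O (fun x s => c *: f x s + f' x s) = (fun x s => c *: O f x s + O f' x s)) -> O (fun _ _ => 0) = (fun _ _ => 0).
Proof.
move=> l; have z := OmegaM0 p q; have := l (-1) _ _ z z.
rewrite (_ : (fun _ _ => _ + _) = (fun _ _ => 0)) => [->|]; last by apply: funext2 => x s; rewrite scaler0 addr0.
by apply: funext2 => x s; rewrite scaleN1r addNr.
Qed.

Lemma linZ p q (O : gform -> gform) : (forall c f f', OM p q f -> OM p q f' ->
  O (fun x s => c *: f x s + f' x s) = (fun x s => c *: O f x s + O f' x s)) ->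
  forall c f, OM p q f -> O (c ** f) = c ** O f.
Proof.
move=> l c f fO; have := l c f _ fO (OmegaM0 p q).
rewrite (_ : (fun x s => _ + _) = c ** f) => [->|]; last by apply: funext2 => x s; rewrite addr0.
by apply: funext2 => x s; rewrite (lin0 l) addr0.
Qed.

Lemma starKZ p q c f : OM p q f -> starK S p q (c ** f) = c ** starK S p q f.
Proof. by move=> fO; apply: (linZ (p := p) (q := q)) => // a h h'; exact: starK_lin. Qed.

Section OneConnection.
Variables (sig : g -> 'M[R]_w) (nb : conn G w v).
Hypothesis good : good_conn sig nb.
Local Notation D := (dl sig tv).
Local Notation dk := (partK S nb).
Local Notation dp := (partP S nb).

Lemma dk_O p q f : OM p q f -> OM p.+1 q (dk p q f).
Proof. by move=> fO; case: (partK_spec good fO). Qed.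
Lemma dkZ p q c f : OM p q f -> dk p q (c ** f) = c ** dk p q f.
Proof. by move=> fO; apply: (linZ (p := p) (q := q)) => // a h h'; exact: (partK_linear good). Qed.
Lemma dk0 p q : dk p q (fun _ _ => 0) = (fun _ _ => 0).
Proof. by apply: (lin0 (p := p) (q := q)) => a h h'; exact: (partK_linear good). Qed.
Lemma dp0 p q : dp p q (fun _ _ => 0) = (fun _ _ => 0).
Proof. by apply: (lin0 (p := p) (q := q)) => a h h'; exact: (partP_linear good). Qed.

(** [dl_comm] with [U = kk] needs the arguments in [kk] in front. With [N = dimK S], the reorderings
    contribute [q p], [q (N - p)], [(q + 1) p] and [(q + 1) (N - p)], whose sum has the parity of
    [N]. *)
Lemma star_dp p q f : OM p q f ->
  starK S p q.+1 (dp p q f) = (fun x s => (-1) ^+ nK *: dp (nK - p) q (starK S p q f) x s).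
Proof.
move=> fO; have [pn|pn] := leqP p nK; last first.
  by rewrite (OmegaM_over pn fO) dp0 !starK0 dp0 gZ0.
have pO := partP_spec good fO; have sO := starK_O fO.
(* The signs for moving [q] arguments in [kk] to the front, in [f] and in its star. *)
pose c0 : R := (-1) ^+ (q * p) * (-1) ^+ (q * (nK - p)).
have cO : OM (nK - p) q (c0 ** starK S p q f) by exact: (OmegaMZ c0 sO).
have sq (n : nat) : (-1) ^+ n * (-1) ^+ n = 1 :> R.
  by rewrite signr_sq.
apply: (OmegaM_ext (starK_O pO)); first exact: (OmegaMZ _ (partP_spec good sO)).
move=> x s t sp tk ss tt; rewrite (starK_val _ _ pO) // (partP_val good _ _ sO) //.
transitivity (HK p (fun s => D f x (s ++ t)) s).
  by apply: Hs_ext => r _; exact: (partP_val good).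
have Da := D_alt good x fO.
have DE r : D f x (t ++ r) = (-1) ^+ (q.+1 * p) *: D f x (r ++ t).
  have [sr|sr] := eqVneq (size r) p; first by rewrite (alt_catC _ _ Da) tt sr.
  have [u0 _ _ _] := Da; rewrite !u0 ?scaler0 // size_cat tt ?addnS ?addSn eqSS; last by rewrite addnC eqn_add2r.
  by rewrite eqn_add2r.
have Dsa := D_alt good x sO.
have key : D (c0 ** starK S p q f) x (t ++ s) = HK p (fun s => D f x (t ++ s)) s.
  apply: (dl_comm (U := kk) (hh := kk) (q := p) (T := HK p) _ _ _ (OmegaM_sform fO) (OmegaM_sform cO) (k := q)) => //.
  - exact: kk_lie.
  - by move=> *; exact: Hs_linear.
  - move=> X h Xk ha hs y r; apply: (LL_Hs Tcartan sig tv y r EE delK_alt delK1) => // Y Yk.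
    exact: kk_lie.
  - move=> y t' s' tk' tt'.
    rewrite (bideg_swap _ (OmegaM_b y sO)) // (starK_val _ _ fO) // scalerA -mulrA sq mulr1 -HsZ.
    by apply: Hs_ext => r _; rewrite [RHS](bideg_swap _ (OmegaM_b y fO) tt').
  - move=> y t' tk' tt'; apply: altform_eq (altformZ ((-1) ^+ (q * p)) (bideg_left (OmegaM_b y fO) tk' tt')) => r.
    by rewrite [RHS](bideg_swap _ (OmegaM_b y fO) tt').
  move=> y t' s' tk' tt'.
  have cq : (q < count (fun X => X \in kk) (t' ++ s'))%N.
    by rewrite count_cat (count_all tk') tt' ltnS leq_addr.
  by split; [exact: (vanish_k y fO) | rewrite (vanish_k y sO) ?scaler0].
have e1 : HK p (fun s => D f x (t ++ s)) s = (-1) ^+ (q.+1 * p) *: HK p (fun s => D f x (s ++ t)) s.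
  by rewrite -HsZ; apply: Hs_ext => r _.
have e2 : D (c0 ** starK S p q f) x (t ++ s) = (c0 * (-1) ^+ (q.+1 * (nK - p))) *: D (starK S p q f) x (s ++ t).
  rewrite dlZ => [|r]; last exact: (OmegaM_s _ sO).
  by rewrite (alt_catC _ _ Dsa) ss tt scalerA.
move: key; rewrite e1 e2 => /(congr1 (fun M => (-1) ^+ (q.+1 * p) *: M)).
rewrite scalerA [X in _ = X]scalerA sq scale1r => <-; congr (_ *: _).
rewrite /c0 -!exprD -signr_odd -[in RHS]signr_odd; congr (_ ^+ nat_of_bool _).
rewrite -[in RHS](subnK pn) !mulSn !oddD.
by case: (odd p); case: (odd (nK - p)); case: (odd (q * p)); case: (odd (q * (nK - p))).
Qed.

Section Kostant.
Variables (n : nat) (C C' : 'I_n -> g).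
Hypothesis CC : dual_frame pp C C'.
Local Notation kosV := (kos C C' (dact (rV S))).

(** [dl_comm] with [U = pp]: on [p + 1] vectors of [pp] the operators [kos] and [D] commute, and the
    minus sign is the passage from [(-1)^p] to [(-1)^(p + 1)] in the lift of the codifferential. *)
Lemma codiff_dk p q f : OM p q f ->
  codiffP S p.+1 q (dk p q f) = (fun x s => - dk p q.-1 (codiffP S p q f) x s).
Proof.
move=> fO; have kO := dk_O fO; have cO := codiffP_O CC fO.
rewrite gN; apply: (OmegaM_ext (codiffP_O CC kO)).
  exact: (OmegaMZ _ (dk_O cO)).
move=> x s t sp tk ss tt; rewrite (codiffP_val CC _ _ kO) // (partKE good _ _ cO) //.
have pcO : OM p q.-1 ((-1) ^+ p ** codiffP S p q f) by exact: (OmegaMZ _ cO).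
have sq (m : nat) : (-1) ^+ m * (-1) ^+ m = 1 :> R.
  by rewrite signr_sq.
have key : D ((-1) ^+ p ** codiffP S p q f) x (s ++ t) = kosV (fun t => D f x (s ++ t)) t.
  apply: (dl_comm (U := pp) (hh := pp) (q := q) (T := kosV) _ _ _ (OmegaM_sform fO) (OmegaM_sform pcO) (k := p)) => //.
  - exact: pplie.
  - by move=> *; exact: (kos_linear C C' (dact_r (rV S))).
  - move=> X h Xp ha hs y r; exact: (LL_kos Tcartan sig (rV S) CC (geomPar geo)).
  - by move=> y t' s' tp' tt'; rewrite (codiffP_val CC _ _ fO) // scalerA sq scale1r.
  - by move=> y t' tp' tt'; exact: (bideg_right (OmegaM_b y fO)).
  move=> y t' s' tp' tt'.
  have cq : (p < count (fun X => X \in pp) (t' ++ s'))%N.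
    by rewrite count_cat (count_all tp') tt' ltnS leq_addr.
  by split; [exact: (vanish_p y fO) | rewrite (vanish_p y cO) ?scaler0].
transitivity ((-1) ^+ p.+1 *: kosV (fun t => D f x (s ++ t)) t).
  by congr (_ *: _); apply: kos_eq => r; rewrite (partKE good _ _ fO).
rewrite -key dlZ => [|r]; last exact: (OmegaM_s _ cO).
by rewrite scalerA exprS -mulrA sq mulr1.
Qed.
End Kostant.
End OneConnection.

(** On [q + 1] arguments in [kk] only derivatives along [kk] survive, and there the two connections
    agree. *)
Lemma dP_theta p q f : OM p q f -> dP S p q f = partP S (nablaEtheta S) p q f.
Proof.
move=> fO; have [s1 g1] := (sg_good, sgth_good).
apply: (OmegaM_ext (partP_spec s1 fO) (partP_spec g1 fO)) => x s t sp tk ss tt.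
rewrite (partP_val s1 x s fO tk tt) (partP_val g1 x s fO tk tt) /dl; apply: (congr1 (fun z => z + _)); apply: eq_bigr => i _; apply: (congr1 (fun z => _ *: z)).
have [il|il] := ltnP i (size s).
  have z y : f y (del i (s ++ t)) = (fun=> 0) y.
    apply: (vanish_k y fO); rewrite (_ : del i (s ++ t) = del i s ++ t).
      by rewrite count_cat (count_all tk) tt ltn_addl.
    by rewrite /del take_cat il drop_cat; case: ltnP => // h; rewrite -catA ?(drop_oversize h) //
      (_ : (i.+1 - size s = 0)%N) ?drop0 //; apply/eqP; rewrite subn_eq0.
  by rewrite !(nab_ext _ _ _ _ z) !nab0.
have tki : ((s ++ t)`_i)%R \in kk.
  rewrite nth_cat ltnNge il /=; apply: (allP tk); apply: mem_nth.
  by rewrite -(ltn_add2l (size s)) subnKC // -size_cat.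
by rewrite /nab /lact /sgth (kk_fix tki).
Qed.

Local Notation dK := (dK S).
Local Notation dKth := (dKtheta S).

Lemma deltaK_z p q : deltaK S p q (fun _ _ => 0) = (fun _ _ => 0).
Proof.
case: p => [//|p]; rewrite /deltaK starK0 /dKtheta (dk0 sgth_good).
by apply: funext2 => x s; rewrite starKV0 // scaler0.
Qed.

Lemma deltaK_low q f : deltaK S 0 q f = (fun _ _ => 0). Proof. by []. Qed.

Lemma deltaKE p q f : (p < nK)%N -> OM p.+1 q f ->
  deltaK S p.+1 q f = ((-1) ^+ p.+1 * (-1) ^+ (p * (nK - p))) ** starK S (nK - p) q (dKth (nK - p.+1) q (starK S p.+1 q f)).
Proof.
move=> pn fO; have sO := starK_O fO; have kO := dk_O sgth_good sO.
have e : (nK - p = (nK - p.+1).+1)%N by rewrite subnSK.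
apply: funext2 => x s; rewrite /deltaK (starKVE (ltnW pn)); last by rewrite e; exact: (OmegaM_b x kO).
by rewrite scalerA.
Qed.

Local Opaque deltaK.

Lemma star_dKth_O p q f : (p < nK)%N -> OM p.+1 q f ->
  OM (nK - p)%N q (dKth (nK - p.+1)%N q (starK S p.+1 q f)) /\
  OM p q (starK S (nK - p)%N q (dKth (nK - p.+1)%N q (starK S p.+1 q f))).
Proof.
move=> pn fO; have sO := starK_O fO; have kO := dk_O sgth_good sO.
have e : (nK - p = (nK - p.+1).+1)%N by rewrite subnSK.
rewrite -e in kO; split; first exact: kO.
by have := starK_O kO; rewrite subKn // ltnW.
Qed.

Lemma deltaK_O p q f : OM p q f -> OM p.-1 q (deltaK S p q f).
Proof.
case: p => [|p] fO; first by rewrite deltaK_low; exact: (OmegaM0 0 q).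
have [pn|pn] := ltnP p nK; last first.
  by rewrite (OmegaM_over (p := p.+1) pn fO) deltaK_z; exact: OmegaM0.
by rewrite (deltaKE pn fO); apply: OmegaMZ; case: (star_dKth_O pn fO).
Qed.

Lemma deltaKZ p q c f : OM p q f -> deltaK S p q (c ** f) = c ** deltaK S p q f.
Proof.
case: p => [|p] fO; first by rewrite !deltaK_low gZ0.
have [pn|pn] := ltnP p nK; last first.
  by rewrite (OmegaM_over (p := p.+1) pn fO) gZ0 deltaK_z gZ0.
have sO := starK_O fO; have [kO _] := star_dKth_O pn fO.
rewrite (deltaKE pn fO) (deltaKE pn (OmegaMZ c fO)) (starKZ _ fO) /dKtheta (dkZ sgth_good _ sO).
by rewrite (starKZ _ kO) !gZZ mulrC.
Qed.

(** What [dP] and the lifted codifferential have in common, [rq] being the effect on the degree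
    along G/P; the relations with [deltaK] and [LaplaceK] follow from these properties. *)
Definition P_operator (rq : nat -> nat) (O : nat -> nat -> gform -> gform) : Prop :=
  [/\ forall p q f, OM p q f -> OM p (rq q) (O p q f),
    forall p q c f f', OM p q f -> OM p q f' ->
      O p q (fun x s => c *: f x s + f' x s) = (fun x s => c *: O p q f x s + O p q f' x s),
    forall p q f, OM p q f -> starK S p (rq q) (O p q f) = (-1) ^+ nK ** O (nK - p)%N q (starK S p q f),
    forall p q f, OM p q f -> O p.+1 q (dK p q f) = (fun x s => - dK p (rq q) (O p q f) x s) &
    forall p q f, OM p q f -> O p.+1 q (dKth p q f) = (fun x s => - dKth p (rq q) (O p q f) x s)].

Section Generic.
Variables (rq : nat -> nat) (O : nat -> nat -> gform -> gform).
Hypothesis Oop : P_operator rq O.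

Let OZ p q c f : OM p q f -> O p q (c ** f) = c ** O p q f.
Proof. by case: Oop => _ l _ _ _ fO; apply: (linZ (p := p) (q := q)) => // a h h'; exact: l. Qed.
Let O0 p q : O p q (fun _ _ => 0) = (fun _ _ => 0).
Proof. by case: Oop => _ l _ _ _; apply: (lin0 (p := p) (q := q)) => a h h'; exact: l. Qed.
Let sq : (-1) ^+ nK * (-1) ^+ nK = 1 :> R.
Proof. by rewrite signr_sq. Qed.

Lemma Ostar' p q f : OM p q f -> O (nK - p) q (starK S p q f) = (-1) ^+ nK ** starK S p (rq q) (O p q f).
Proof. by case: Oop => _ _ h _ _ fO; rewrite h // gZZ sq gZ1. Qed.

(** Up to a constant [deltaK] is star, [dKtheta], star: the two factors [(-1)^dimK] from the stars
    cancel, and [dKtheta] contributes the minus sign. *)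
Lemma O_deltaK p q f : OM p q f -> O p.-1 q (deltaK S p q f) = (fun x s => - deltaK S p (rq q) (O p q f) x s).
Proof.
have [OO _ _ _ OdKth] := Oop; case: p => [|p] fO; first by rewrite !deltaK_low O0; apply: funext2 => x s /=; rewrite oppr0.
have oO := OO _ _ _ fO.
have [pn|pn] := ltnP p nK; last first.
  rewrite (OmegaM_over (p := p.+1) pn fO) O0 !deltaK_z /= O0.
  by apply: funext2 => x s; rewrite oppr0.
have e : (nK - p = (nK - p.+1).+1)%N by rewrite subnSK.
have sO := starK_O fO; have soO := starK_O oO.
have [kO skO] := star_dKth_O pn fO; have [koO _] := star_dKth_O pn oO.
rewrite [p.+1.-1]/= (deltaKE pn fO) (deltaKE pn oO) gN gZZ (OZ _ skO).
have := Ostar' kO; rewrite (subKn (ltnW pn)) => ->.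
have OdE := OdKth _ _ _ sO; rewrite -e in OdE; rewrite OdE (Ostar' fO) gN /dKtheta (dkZ sgth_good _ soO) !gZZ (starKZ _ koO) !gZZ.
rewrite /dKtheta; apply: (congr1 (fun c : R => c ** _)); by rewrite mulN1r mulrN mulN1r -!mulrA sq mulr1.
Qed.

(** [O] anticommutes with both factors of each summand, so the signs cancel in pairs. *)
Lemma O_LaplaceK p q f : OM p q f -> O p q (LaplaceK S p q f) = LaplaceK S p (rq q) (O p q f).
Proof.
have [OO Olin _ OdK _] := Oop; move=> fO; have oO := OO _ _ _ fO; have kO := dk_O sg_good fO.
have dkO := deltaK_O kO.
have second : O p q (deltaK S p.+1 q (dK p q f)) = deltaK S p.+1 (rq q) (dK p (rq q) (O p q f)).
  have := O_deltaK kO; rewrite [p.+1.-1]/= => ->; have koO := dk_O sg_good oO.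
  by rewrite (OdK _ _ _ fO) !gN (deltaKZ _ koO) gZZ mulrNN mulr1 gZ1.
case: p fO oO kO dkO second => [|p] fO oO kO dkO second.
  (* For [p = 0] the index [p.-1] is not [p - 1], but the first summand vanishes since [deltaK] is 0
     there. *)
  have L0 m h : LaplaceK S 0 m h = deltaK S 1 m (dK 0 m h).
    by apply: funext2 => x s; rewrite /LaplaceK deltaK_low /Defs.dK (dk0 sg_good) add0r.
  by rewrite !L0 second.
have dO := deltaK_O fO; have kdO := dk_O sg_good dO.
have odO := deltaK_O oO.
have first_ : O p.+1 q (dK p q (deltaK S p.+1 q f)) = dK p (rq q) (deltaK S p.+1 (rq q) (O p.+1 q f)).
  by rewrite (OdK _ _ _ dO) (O_deltaK fO) !gN /Defs.dK (dkZ sg_good _ odO) gZZ mulrNN mulr1 gZ1.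
have -> : LaplaceK S p.+1 q f = fun x s => 1 *: dK p q (deltaK S p.+1 q f) x s + deltaK S p.+2 q (dK p.+1 q f) x s.
  by apply: funext2 => x s; rewrite scale1r.
by rewrite (Olin _ _ _ _ _ kdO dkO) first_ second; apply: funext2 => x s; rewrite scale1r.
Qed.
End Generic.

Lemma codiff_frame : exists (n : nat) (C C' : 'I_n -> g), n = dimP S /\ dual_frame pp C C'.
Proof.
have [|C [C' [CC _]]] := dual_frame_exists (theta := theta) Tcartan (hh := pp) (U := kk).
  by rewrite addvC kp_full.
by exists (ldim G - \dim pp)%N, C, C'.
Qed.

Lemma dP_operator : P_operator succn (dP S).
Proof.
have [s1 g1] := (sg_good, sgth_good); split.
- exact: (partP_spec s1).
- exact: (partP_linear s1).
- exact: (star_dp s1).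
- exact: (partP_partK s1).
by move=> p q f fO; rewrite (dP_theta (dk_O g1 fO)) (dP_theta fO); exact: (partP_partK g1 fO).
Qed.

Lemma codiffP_operator : P_operator predn (codiffP S).
Proof.
have [n [C [C' [_ CC]]]] := codiff_frame; split.
- exact: (codiffP_O CC).
- exact: (codiffP_lin CC).
- exact: (star_codiff CC).
- exact: (codiff_dk sg_good CC).
exact: (codiff_dk sgth_good CC).
Qed.
End Moreover.

(** * Operators on G/K and G/P, and products with kernels *)

Lemma star_val l (f : gform G w 1) x : OmegaK S l f -> star S l f x = HK l (f x).
Proof. by move=> [fa _ _]; rewrite /star hodgeE. Qed.

Lemma OmegaK_star l (f : gform G w 1) : OmegaK S l f -> OmegaK S (nK - l) (star S l f).
Proof.
move=> fO; have /OmegaC_P [fa fs fh] := fO; apply/OmegaC_P; split=> [x|s|x h s Kh].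
- by rewrite star_val //; exact: (Hs_alt E delK_alt).
- rewrite (_ : (fun x => _) = fun x => HK l (f x) s); first exact: smooth_Hs.
  by apply/funext => x; rewrite star_val.
rewrite !star_val //.
rewrite (Hs_ext E _ s (u' := fun s => rW S h^-1%g *m f x (map (AD h) s))); last by move=> t _; rewrite fh.
rewrite -(Hs_lin E delK l (fun s => f x (map (AD h) s)) (L := fun M => rW S h^-1%g *m M)); last 3 first.
- by rewrite mulmx0.
- by move=> A B; rewrite mulmxDr.
- by move=> a A; rewrite -scalemxAr.
congr (_ *m _).
exact: (Hs_map Tcartan EE delK_alt s (frameK_Ad Kh) (fun r => delK_Ad r Kh) (fa x)).
Qed.

Definition cact (Z : g) (u : 'cV[R]_v) := drep (rV S) Z *m u.
Lemma cact_l c X Y u : cact (c *: X + Y) u = c *: cact X u + cact Y u.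
Proof. by rewrite /cact drep_linear mulmxDl -scalemxAl. Qed.
Lemma cact_r X c x y : cact X (c *: x + y) = c *: cact X x + cact X y.
Proof. by rewrite /cact mulmxDr -scalemxAr. Qed.

Section Kostant.
Variables (n : nat) (C C' : 'I_n -> g).
Hypothesis CC : dual_frame pp C C'.

Lemma codiff_val k (f : gform G v 1) x : OmegaP S k f -> codiff S k f x = kos C C' cact (f x).
Proof.
by move=> [fa _ _]; exact: (kostantE Tcartan (geomPar geo) (geomNil geo) CC cact_l cact_r).
Qed.

Lemma OmegaP_codiff k (f : gform G v 1) : OmegaP S k f -> OmegaP S k.-1 (codiff S k f).
Proof.
move=> fO; have /OmegaC_P [fa fs fh] := fO; have [_ _ HV] := geomP geo.
apply/OmegaC_P; split=> [x|s|x h s Ph].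
- by rewrite codiff_val //; exact: (kos_alt Tcartan (geomPar geo) (geomNil geo) CC cact_r).
- rewrite (_ : (fun x => _) = fun x => kos C C' cact (f x) s).
    apply: smooth_kos => // Z A As; apply: smoothM => //; exact: smooth_cst.
  by apply/funext => x; rewrite codiff_val.
rewrite !codiff_val // (kos_eq _ _ _ _ (u' := fun s => rV S h^-1%g *m f x (map (AD h) s))); last first.
  by move=> t; rewrite fh.
apply: (kos_map Tcartan CC cact_l cact_r (phi := AD h) (L := fun M => rV S h^-1%g *m M)) (fa x).
- apply: dual_frame_Ad CC => X Xp; first exact: (Ad_pp Ph).
  exact: (Ad_pp (HV _ Ph)).
- by move=> X Y; rewrite (Ad_lie Tcartan).
- by move=> c A B; rewrite mulmxDr -scalemxAr.
by move=> Z M; rewrite /cact !mulmxA drep_Ad AdK.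
Qed.
End Kostant.

Lemma OmegaP_dV k (f : gform G v 1) : OmegaP S k f -> OmegaP S k.+1 (dV S f).
Proof.
apply: (OmegaC_d Tcartan (geomP geo) (geomPlie geo) (sig := drep (rV S))) => //.
- exact: drep_linear.
- by move=> h X _; rewrite drep_Ad AdK.
exact: nabla_nab.
Qed.

Lemma dV_translate k z (f : gform G v 1) : OmegaP S k f -> dV S (translate z f) = translate z (dV S f).
Proof. exact: (dcov_translate (sig := drep (rV S)) (nabla_nab (rV S))). Qed.

Lemma dV_dl k (f : gform G v 1) x s : OmegaP S k f -> dV S f x s = dl (drep (rV S)) (drep (triv_rep G)) f x s.
Proof. by move=> [_ fs _]; apply: dcov_dl => // X A y; exact: nabla_nab. Qed.

Section Values.
Variables (a b c : nat).

(** [x] kills vectors of [pp] and takes only [k] arguments, so [u] receives all the vectors of [pp]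
    and all but at most [k] of those in [kk]. *)
Lemma wedge_bideg_col p q k (u : seq g -> 'M[R]_(a, b)) (x : seq g -> 'M[R]_(b, c)) :
  bideg S p q u -> altform k pp x -> bideg S p (q + k) (wedge (p + q) mulmx u x).
Proof.
move=> [ua uv] xa.
have wa : altform (p + (q + k)) mm (wedge (p + q) mulmx u x).
  rewrite addnA; apply: wedge_alt ua _; [exact: mxL | exact: mxR |].
  exact: altform_sub (capvSr _ _) xa.
split=> // s sv; have [ss|ss] := eqVneq (size s) (p + (q + k))%N; last by case: wa => h _ _ _; exact: h.
rewrite wedgeE big1 ?scaler0 // => sg _; set L := plist sg.
have cL (P : pred g) : count P s = (count P (take (p + q) L) + count P (drop (p + q) L))%N.
  by rewrite -count_cat cat_take_drop plist_count.
have [dp|dp] := boolP (has (fun X => X \in pp) (drop (p + q) L)).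
  by case: xa => _ _ _ ->; rewrite // mulmx0 scaler0.
have c0 : count (fun X => X \in pp) (drop (p + q) L) = 0%N.
  by apply/eqP; rewrite -leqn0 leqNgt -has_count.
have ck : (count (fun X => X \in kk) (drop (p + q) L) <= k)%N.
  apply: leq_trans (count_size _ _) _; rewrite size_drop (perm_size (plist_perm sg)) ss addnA addKn //.
rewrite uv ?mul0mx ?scaler0 //.
have e1 := cL (fun X => X \in pp); rewrite c0 addn0 in e1; rewrite -e1.
have e2 := cL (fun X => X \in kk).
case/orP: sv => [->//|h]; apply/orP; right.
by rewrite -(ltn_add2r k) (leq_trans h) // e2 leq_add2l.
Qed.

Lemma bideg_overP n (C C' : 'I_n -> g) p q (u : seq g -> 'M[R]_(a, b)) : dual_frame pp C C' ->
  (n < q)%N -> bideg S p q u -> u = (fun=> 0).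
Proof.
move=> CC nq ub; apply: (bideg_ext ub); first exact: bideg0.
by move=> s t sp tk ss tt; exact: (altform_over CC t (bideg_right ub sp ss) nq).
Qed.

Lemma kkform_ext p (u u' : seq g -> 'M[R]_(a, b)) : altform p kk u -> altform p kk u' ->
  (forall s, allp s -> size s = p -> u s = u' s) -> forall s, u s = u' s.
Proof.
move=> ua ua' h; have da := altform_sub2 ua ua'; have [d0 dl _ dm] := da.
suff z s : u s - u' s = 0 by move=> s; apply/eqP; rewrite -subr_eq0 z.
move: s; apply: (multi_zero (D := fun s => u s - u' s)) => [|r rg]; first exact: dl.
have [sr|sr] := eqVneq (size r) p; last exact: d0.
have [hk|hk] := boolP (has (fun X => X \in kk) r); first exact: dm.
rewrite h ?subrr //; apply/allP => X Xr; have := allP rg X Xr.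
by rewrite (negPf (hasPn hk X Xr)) orbF.
Qed.
End Values.

Lemma wedge_mull a b c d q (A : 'M[R]_(a, b)) (u : seq g -> 'M[R]_(b, c)) (x : seq g -> 'M[R]_(c, d)) t :
  wedge q mulmx (fun s => A *m u s) x t = A *m wedge q mulmx u x t.
Proof.
rewrite !wedgeE -scalemxAr; congr (_ *: _); rewrite mulmx_sumr; apply: eq_bigr => sg _.
by rewrite -scalemxAr mulmxA.
Qed.

(** With [q + k] arguments in [kk] at the end, [al] takes exactly the others, and the rest is a
    product of forms along the fibre. *)
Lemma fib_wedge m p q k (al : 'I_m -> seq g -> 'cV[R]_w) (be : 'I_m -> seq g -> 'rV[R]_v)
    (x : seq g -> 'cV[R]_v) s t : (forall i, altform p kk (al i)) -> (forall i, altform q pp (be i)) ->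
  altform k pp x -> allk t -> size t = (q + k)%N ->
  wedge (p + q) mulmx (fun s => \sum_i wedge p mulmx (al i) (be i) s) x (s ++ t) =
  \sum_i al i s *m wedge q mulmx (be i) x t.
Proof.
move=> ala bea xa tk tt; have ub : bideg S p q (fun s => \sum_i wedge p mulmx (al i) (be i) s).
  by apply: bideg_sum => i; exact: wedge_bideg.
have wb := wedge_bideg_col ub xa.
move: s; apply: (kkform_ext (bideg_left wb tk tt)).
  apply: altform_sum => i.
  apply: (altform_lin (L := fun M => M *m wedge q mulmx (be i) x t)) (ala i) => c A B.
  by rewrite mulmxDl scalemxAl.
move=> s sp ss; have [ua _] := ub.
rewrite (wedge_catr (@mxL _ _ _ _) (@mxR _ _ _ _) _ ua xa sp) ?ss ?leq_addr // addKn.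
transitivity (wedge q mulmx (fun t => \sum_i al i s *m be i t) x t).
  apply: wedge_eq => // r; apply: eq_bigr => i _.
  by apply: wedge_catE (ala i) (bea i) sp ss; [exact: mxL | exact: mxR].
by rewrite (wedge_suml (@mxL _ _ _ _)); apply: eq_bigr => i _; rewrite wedge_mull.
Qed.

(** * Compositions of Poisson transforms *)

Lemma haar_fin : (haar S (K S) < +oo)%E. Proof. by case: (geomHaar geo). Qed.
Lemma haar_inv (x : G) (A : set (g_sigma_algebraType (@open G))) : K S x -> measurable A -> A `<=` K S ->
  haar S [set (y * x)%g | y in (A : set G)] = haar S A.
Proof. by move=> Kx mA AK; case: (geomHaar geo) => _ _ h; case: (h x A Kx mA AK). Qed.
Local Notation FI_dlK := (FI_dl Tcartan Kgrp Kcpt (geomKlie geo) (geomPlie geo) kp_full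
  haar_fin haar_inv kk_fix kk_lie (capvSl _ _) fibre_kk fibre_span).

Lemma fibre_intE (psi : gform G w 1) : fibre_int S psi = fint psi.
Proof.
by apply: funext2 => x s; rewrite /fibre_int /FI /MI /II AD.unlock.
Qed.

Lemma sform_suffix a b p (f : gform G a b) t : sform p f -> sform (p - size t) (fun y s => f y (s ++ t)).
Proof.
by move=> [fa fs]; split=> [x|s]; [exact: altform_ios_r | exact: fs].
Qed.

Lemma fint_ext (f f' : gform G w 1) x s :
  (forall y r, size r = size s -> f y (r ++ fibre S) = f' y (r ++ fibre S)) -> fint f x s = fint f' x s.
Proof. by move=> h; apply: MI_ext => k _; rewrite h // size_map. Qed.

Lemma fint_smooth p (f : gform G w 1) x s : sform p f ->
  smooth (fun k => rW S k *m f (x * k)%g (map (AD k^-1%g) s ++ fibre S)).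
Proof. by move=> ff; exact: (total_smooth Tcartan (rW S) x s (sform_suffix (fibre S) ff)). Qed.

Lemma fint_linear p p' c (f f' : gform G w 1) x s : sform p f -> sform p' f' ->
  fint (fun x s => c *: f x s + f' x s) x s = c *: fint f x s + fint f' x s.
Proof.
move=> ff ff'; rewrite /FI -(MI_linear Kcpt haar_fin c (fint_smooth x s ff) (fint_smooth x s ff')).
by apply: MI_ext => k _; rewrite mulmxDr scalemxAr.
Qed.

Lemma fint0 (f : gform G w 1) x s : (forall y r, size r = size s -> f y (r ++ fibre S) = 0) -> fint f x s = 0.
Proof.
move=> h; rewrite -[RHS](MI0 Kcpt haar_fin w 1); apply: MI_ext => k _.
by rewrite h ?size_map // mulmx0.
Qed.

Lemma fibre_all : allk (fibre S). Proof. by apply/allP => X; exact: fibre_kk. Qed.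

Section Kernel.
Variables (k l q : nat) (phi : gform G w v) (al : gform G v 1).
Hypothesis qk : (q + k)%N = nP.
Hypothesis phiO : OM l q phi.
Hypothesis alO : OmegaP S k al.
Local Notation W := (fun x => wedge (l + q) mulmx (phi x) (al x)).

Lemma kernel_bideg x : bideg S l nP (W x).
Proof. by rewrite -qk; apply: wedge_bideg_col (OmegaM_b x phiO) _; case: alO. Qed.

Lemma kernel_sform : sform (l + q + k) W.
Proof. exact: sform_wedge (OmegaM_sform phiO) (OmegaC_sform alO). Qed.

Lemma kernel_fibre_alt x : altform l kk (fun s => W x (s ++ fibre S)).
Proof. exact: (bideg_left (kernel_bideg x) fibre_all size_fibre). Qed.
End Kernel.

Lemma kernel_LL sig nb k l q (phi : gform G w v) (al : gform G v 1) X x s :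
  good_conn sig nb -> OM l q phi -> OmegaP S k al -> X \in mm ->
  LL sig t0 X (fun x => wedge (l + q) mulmx (phi x) (al x)) x s = 0.
Proof.
move=> good phiO alO Xm.
rewrite (LL_wedge Tcartan _ tv _ _ _ _ (OmegaM_sform phiO) (OmegaC_sform alO)).
rewrite (wedge_eq _ _ (u' := fun=> 0) (v' := al x)) ?(wedge0l (@mxL _ _ _ _)) ?add0r //; last first.
  by move=> t; exact: (LL_mm good x t phiO Xm).
rewrite (wedge_eq _ _ (u' := phi x) (v' := fun=> 0)) ?(wedge0r (@mxR _ _ _ _)) // => t.
apply: (OmegaC_LL Tcartan (geomP geo) (geomPlie geo) _ x t alO) => //.
by move: Xm; rewrite memv_cap => /andP [].
Qed.

Lemma PT_lin k l c Phi1 Phi2 phi1 phi2 : PoissonTransform S k l Phi1 phi1 -> PoissonTransform S k l Phi2 phi2 ->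
  PoissonTransform S k l (fun al x s => c *: Phi1 al x s + Phi2 al x s) (fun x s => c *: phi1 x s + phi2 x s).
Proof.
move=> [fO1 c1 t1 i1] [fO2 c2 t2 i2]; split.
- exact: OmegaM_linear.
- by move=> al alO; apply: OmegaC_linear; [exact: c1 | exact: c2].
- by move=> z al alO; rewrite t1 // t2.
move=> al alO; apply: funext2 => x s; rewrite i1 // i2 // !fibre_intE.
rewrite -(fint_linear c x s (kernel_sform fO1 alO) (kernel_sform fO2 alO)).
by apply: fint_ext => y r _; rewrite (wedge_linearl (@mxL _ _ _ _)).
Qed.

Lemma PT_ext k l Phi Phi' phi phi' : (forall al, OmegaP S k al -> Phi al = Phi' al) -> phi = phi' ->
  PoissonTransform S k l Phi phi -> PoissonTransform S k l Phi' phi'.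
Proof.
move=> e <- [fO1 c1 t1 i1]; split=> // [al alO|z al alO|al alO].
- by rewrite -e //; exact: c1.
- rewrite -!e //; first exact: t1.
  exact: OmegaC_translate.
by rewrite -e //; exact: i1.
Qed.

Lemma PT0 k l : PoissonTransform S k l (fun _ _ _ => 0) (fun _ _ => 0).
Proof.
split=> [|al alO|//|al alO]; first exact: OmegaM0.
- exact: OmegaC0.
apply: funext2 => x s; rewrite fibre_intE fint0 // => y r _.
by rewrite (wedge0l (@mxL _ _ _ _)).
Qed.

Lemma PT_scale k l c Phi phi : PoissonTransform S k l Phi phi ->
  PoissonTransform S k l (fun al x s => c *: Phi al x s) (fun x s => c *: phi x s).
Proof.
move=> h; apply: PT_ext (PT_lin c h (PT0 k l)) => [al _|]; apply: funext2 => x s.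
  by rewrite addr0.
by rewrite addr0.
Qed.

Lemma HK_MI l (u : G -> seq g -> 'cV[R]_w) t : (forall s, smooth (fun k => u k s)) ->
  HK l (fun s => MI (K S) (haar S) (fun k => u k s)) t = MI (K S) (haar S) (fun k => HK l (u k) t).
Proof.
move=> us; rewrite /Hs (MIZ Kcpt haar_fin); last by apply: smooth_sum => I; exact: smoothZl.
rewrite /fsum (MI_sum Kcpt haar_fin); last by move=> I; exact: smoothZl.
by congr (_ *: _); apply: eq_bigr => I _; rewrite (MIZ Kcpt haar_fin).
Qed.

(** By [fib_wedge] the part along the fibre is a constant factor on the right, through which the
    star passes. *)
Lemma star_kernel l q k (u : gform G w v) x (z : seq g -> 'cV[R]_v) s : OM l q u -> altform k pp z -> (q + k)%N = nP ->
  HK l (fun s => wedge (l + q) mulmx (u x) z (s ++ fibre S)) s =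
  wedge (nK - l + q) mulmx (starK S l q u x) z (s ++ fibre S).
Proof.
move=> uO za qk; have [m [al [be [ab uE]]]] := ext_decomp (OmegaM_b x uO).
have [ala bea] := all_and2 ab.
have ha i : altform (nK - l) kk (HK l (al i)) by exact: (Hs_alt E delK_alt).
have st : size (fibre S) = (q + k)%N by rewrite qk size_fibre.
rewrite /starK uE starKx_wedge // (fib_wedge _ ha bea za fibre_all st).
rewrite (Hs_ext E _ s (u' := fun s => \sum_i al i s *m wedge q mulmx (be i) z (fibre S))); last first.
  by move=> r _; rewrite (fib_wedge _ ala bea za fibre_all st).
rewrite Hs_sum; apply: eq_bigr => i _.
rewrite (Hs_lin E delK l (al i) (L := fun M => M *m wedge q mulmx (be i) z (fibre S))) ?mul0mx // => [A B|c A].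
  by rewrite mulmxDl.
by rewrite scalemxAl.
Qed.

(** The star of an integral is the integral of stars by linearity; at [x h] the arguments are moved
    by [AD h^-1], which preserves the frame up to a change of orthonormal frame and fixes the volume
    form. *)
Lemma PT_star k l Phi phi : (k <= nP)%N -> PoissonTransform S k l Phi phi ->
  PoissonTransform S k (nK - l) (fun al => star S l (Phi al)) (starK S l (nP - k) phi).
Proof.
move=> kn [phiO c1 t1 i1]; have qk := subnK kn; set q := (nP - k)%N in phiO i1 qk *.
split=> [|al alO|z al alO|al alO].
- exact: starK_O.
- by apply: OmegaK_star; exact: c1.
- by rewrite t1.
apply: funext2 => x s; rewrite (star_val _ (c1 _ alO)) i1 // !fibre_intE.
pose u y r := wedge (l + q) mulmx (phi y) (al y) (r ++ fibre S).
have us : sform (l + q + k - size (fibre S)) u := sform_suffix (fibre S) (kernel_sform phiO alO).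
rewrite [LHS](HK_MI _ s (u := fun h r => rW S h *m u (x * h)%g (map (AD h^-1%g) r))); last first.
  by move=> r; exact: (total_smooth Tcartan (rW S) x r us).
apply: MI_ext => h Kh; have [_ _ HV] := Kgrp.
rewrite -(Hs_lin E delK l (fun r => u (x * h)%g (map (AD h^-1%g) r)) (L := fun M => rW S h *m M)); last 3 first.
- by rewrite mulmx0.
- by move=> A B; rewrite mulmxDr.
- by move=> a A; rewrite -scalemxAr.
congr (_ *m _).
rewrite (Hs_map Tcartan EE delK_alt s (frameK_Ad (HV _ Kh)) (fun r => delK_Ad r (HV _ Kh))
  (kernel_fibre_alt qk phiO alO (x * h)%g)).
by apply: star_kernel => //; case: alO.
Qed.

Section Connection.
Variables (sig : g -> 'M[R]_w) (nb : conn G w v) (nb1 : conn G w 1).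
Hypothesis good : good_conn sig nb.
Hypothesis nb1E : forall X A x, smooth A -> nb1 X A x = nab sig t0 X A x.
Let sigl : forall c X Y, sig (c *: X + Y) = c *: sig X + sig Y. Proof. by case: good. Qed.
Let sigAd : forall h X, K S h -> sig X *m rW S h^-1%g = rW S h^-1%g *m sig (AD h X). Proof. by case: good. Qed.
Let sigkk : forall X, X \in kk -> sig X = sg X. Proof. by case: good. Qed.
Let nbE : forall X A x, smooth A -> nb X A x = nab sig tv X A x. Proof. by case: good. Qed.

Let sigA h X : K S h -> rW S h *m sig X = sig (AD h X) *m rW S h.
Proof.
move=> Kh; have [_ _ HV] := Kgrp.
by have := sigAd (AD h X) (HV _ Kh); rewrite invgK AdK => ->.
Qed.

Lemma OmegaK_d l (f : gform G w 1) : OmegaK S l f -> OmegaK S l.+1 (dcov nb1 f).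
Proof. exact: (OmegaC_d Tcartan Kgrp (geomKlie geo) sigl sigAd sigkk nb1E). Qed.

Lemma dl_kernel k l q (phi : gform G w v) (al : gform G v 1) y r : OM l q phi -> OmegaP S k al ->
  dl sig t0 (fun x => wedge (l + q) mulmx (phi x) (al x)) y r =
  wedge (l.+1 + q) mulmx (partK S nb l q phi y) (al y) r +
  wedge (l + q.+1) mulmx (fun s => dl sig tv phi y s - partK S nb l q phi y s) (al y) r +
  (-1) ^+ (l + q) *: wedge (l + q) mulmx (phi y) (dV S al y) r.
Proof.
move=> phiO alO.
rewrite (dl_wedge Tcartan sigl (drep_linear (rV S)) (drep_linear (triv_rep G)) y r (OmegaM_sform phiO) (OmegaC_sform alO)).
rewrite addnS -addSn -(wedgeDl (@mxL _ _ _ _)); congr (_ + _ *: _).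
  by apply: wedge_eq => // t; rewrite addrC subrK.
by apply: wedge_eq => // t; rewrite (dV_dl _ _ alO).
Qed.

Lemma PT_d k l Phi phi : (k <= nP)%N -> PoissonTransform S k l Phi phi ->
  PoissonTransform S k l.+1 (fun al => dcov nb1 (Phi al)) (partK S nb l (nP - k) phi).
Proof.
move=> kn [phiO c1 t1 i1]; have qk := subnK kn; set q := (nP - k)%N in phiO i1 qk *.
have [kO kO2] := partK_spec good phiO.
split=> [//|al alO|z al alO|al alO].
- exact: OmegaK_d (c1 _ alO).
- by rewrite t1 //; exact: (dcov_translate nb1E _ (c1 _ alO)).
have PO := c1 _ alO; have [Pa Ps _] := PO.
apply: funext2 => x s; have [ss|ss] := eqVneq (size s) l.+1; last first.
  have [DPa _ _] := OmegaK_d PO; have [h _ _ _] := DPa x; rewrite h // fibre_intE fint0 // => y r rs.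
  have [ka _ _ _] := kernel_fibre_alt qk kO alO y; apply: ka; by rewrite rs.
rewrite (dcov_dl nb1E) // fibre_intE.
have lE : (l + q + k = l + size (fibre S))%N by rewrite -addnA qk size_fibre.
have Wf := kernel_sform phiO alO; rewrite lE in Wf.
have Wm y : altform (l + size (fibre S)) mm (wedge (l + q) mulmx (phi y) (al y)).
  by rewrite size_fibre; case: (kernel_bideg qk phiO alO y).
have FE y t : Phi al y t = fint (fun x => wedge (l + q) mulmx (phi x) (al x)) y t by rewrite (i1 al alO) fibre_intE.
rewrite (dl_eq _ _ _ _ FE).
rewrite -(FI_dlK sigl sigkk sigA x Wf Wm _ _ ss); last first.
- by move=> t; apply: smooth_ext (Ps t) => y; rewrite FE.
- by move=> X y t Xm; exact: (kernel_LL y t good phiO alO Xm).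
apply: fint_ext => y r rs; rewrite (dl_kernel _ _ phiO alO).
have [n [C [C' [nE CC]]]] := codiff_frame.
(* The two remaining terms of the Leibniz rule have degree [nP + 1] along G/P. *)
have z1 := bideg_overP (q := q.+1 + k) CC _ (wedge_bideg_col (OmegaM_b y kO2) (let: And3 a _ _ := alO in a y)).
have z2 := bideg_overP (q := q + k.+1) CC _ (wedge_bideg_col (OmegaM_b y phiO) (let: And3 a _ _ := OmegaP_dV alO in a y)).
by rewrite z1 ?z2 ?scaler0 ?addr0 // nE ?addnS ?addSn qk.
Qed.
End Connection.

(** Here [phi ^ al] has degree [nP - 1] along the fibre, so its fibre integral vanishes and so does
    that of its derivative; the Leibniz rule then equates the two remaining integrals up to the
    factor [- (-1)^(l + q)]. *)
Lemma PT_dV k l Phi phi : (k.+1 <= nP)%N -> PT k.+1 l Phi phi ->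
  PT k l (fun al => Phi (dV S al)) (fun x s => (-1) ^+ (nP - k.+1 + l + 1) *: dP S l (nP - k.+1) phi x s).
Proof.
move=> kn [phiO c1 t1 i1]; have qk := subnK kn; set q := (nP - k.+1)%N in phiO i1 qk *.
have qE : (nP - k = q.+1)%N by rewrite /q subnSK.
have gd := sg_good; have [sigl _ _ sigkk _] := gd.
have [kO kO2] := partK_spec gd phiO.
have pO := partP_spec gd phiO.
have pE := partPE gd phiO.
split=> [|al alO|z al alO|al alO].
- by rewrite qE; exact: OmegaMZ.
- by apply: c1; exact: OmegaP_dV.
- by rewrite (dV_translate _ alO) t1 //; exact: OmegaP_dV.
have dO := OmegaP_dV alO; rewrite (i1 _ dO) qE.
apply: funext2 => x s; rewrite !fibre_intE.
have pf y r : wedge (l + q.+1) mulmx (fun s => (-1) ^+ (q + l + 1) *: dP S l q phi y s) (al y) r =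
   (-1) ^+ (q + l + 1) *: wedge (l + q.+1) mulmx (dP S l q phi y) (al y) r.
  by rewrite (wedgeZl (@mxL _ _ _ _)).
have qk' : (q.+1 + k)%N = nP by rewrite addSnnS.
have [ss|ss] := eqVneq (size s) l; last first.
  rewrite !fint0 // => y r rs.
    rewrite pf; have [h _ _ _] := kernel_fibre_alt qk' pO alO y.
    by rewrite h ?scaler0 // rs.
  by have [h _ _ _] := kernel_fibre_alt qk phiO dO y; apply: h; rewrite rs.
pose W y := wedge (l + q) mulmx (phi y) (al y).
have Wf : sform (l + q + k) W := kernel_sform phiO alO.
have Wb y : bideg S l (q + k) (W y).
  by apply: (wedge_bideg_col (OmegaM_b y phiO)); case: alO.
have Wm y : altform (l + q + k) mm (W y) by rewrite -addnA; case: (Wb y).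
have WL X y t : X \in mm -> LL sg t0 X W y t = 0.
  by move=> Xm; exact: (kernel_LL y t gd phiO alO Xm).
have sf := size_fibre.
have W0 y r : W y (r ++ fibre S) = 0.
  have [_ h] := Wb y; apply: h; apply/orP; right.
  by rewrite count_cat (count_all fibre_all) sf -qk addnS ltn_addl // ltnS.
have dW0 : fint (dl sg t0 W) x s = 0.
  (* [FI_dl] needs at least one base argument; for [l = 0] it is replaced by [FI_dl_nil]. *)
  case: l s ss W Wf Wm WL W0 {c1 t1 i1 kO kO2 pE pO phiO pf Wb} => [|l'] s ss W Wf Wm WL W0.
    case: s ss => // _.
    apply: (FI_dl_nil Tcartan Kgrp Kcpt (geomKlie geo) haar_fin haar_inv kk_fix
      kk_lie (capvSl _ _) fibre_kk fibre_span sigl sigkk x Wf Wm) => [X y t Xm|].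
      exact: WL.
    by rewrite sf -qk addnS.
  have lE : (l'.+1 + q + k = l' + size (fibre S))%N by rewrite sf -qk addnS -addnA addSnnS addnS.
  rewrite lE in Wf Wm.
  have F0 y t : fint W y t = (fun _ _ => 0) y t by apply: fint0 => y' r _; exact: W0.
  rewrite (FI_dlK sigl sigkk
    _ x Wf Wm _ _ ss).
  - by rewrite (dl_eq _ _ _ _ F0) dl0.
  - by move=> h X _; exact: drep_Ad.
  - by move=> X y t Xm; exact: WL.
  by move=> t; apply: smooth_ext (@smooth_cst _ G _ _ 0) => y; rewrite F0.
have Pf := kernel_sform pO alO; have Df := kernel_sform phiO dO.
have e : fint (dl sg t0 W) x s = fint (fun x s => (-1) ^+ (l + q) *: wedge (l + q) mulmx (phi x) (dV S al x) s +
    wedge (l + q.+1) mulmx (dP S l q phi x) (al x) s) x s.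
  apply: fint_ext => y r _; rewrite (dl_kernel gd y _ phiO alO).
  have kz : wedge (l.+1 + q) mulmx (partK S (nablaE S) l q phi y) (al y) (r ++ fibre S) = 0.
    have [_ h] := wedge_bideg_col (OmegaM_b y kO) (let: And3 a _ _ := alO in a y).
    apply: h; apply/orP; right.
    by rewrite count_cat (count_all fibre_all) sf -qk addnS ltn_addl // ltnS.
  rewrite kz add0r addrC; congr (_ + _); apply: wedge_eq => // t.
  by rewrite /dP pE.
have e2 : (-1) ^+ (l + q) *: fint (fun x => wedge (l + q) mulmx (phi x) (dV S al x)) x s +
   fint (fun x => wedge (l + q.+1) mulmx (dP S l q phi x) (al x)) x s = 0.
  by rewrite -(fint_linear _ x s Df Pf) -e.
have e3 : fint (fun x => wedge (l + q.+1) mulmx (fun s => (-1) ^+ (q + l + 1) *: dP S l q phi x s) (al x)) x s =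
   (-1) ^+ (q + l + 1) *: fint (fun x => wedge (l + q.+1) mulmx (dP S l q phi x) (al x)) x s.
  have := fint_linear ((-1) ^+ (q + l + 1)) x s Pf (sform0 G w 1 0).
  rewrite [X in _ = _ + X]fint0 // addr0 => <-.
  by apply: fint_ext => y r _; rewrite pf addr0.
rewrite e3; move/eqP: e2; rewrite addrC addr_eq0 => /eqP ->.
rewrite scalerN scalerA -exprD -scaleNr -[LHS]scale1r; congr (_ *: _).
by rewrite addn1 addSn exprS mulN1r opprK [(l + q)%N]addnC addnn -mul2n exprM sqrrN !expr1n.
Qed.

(** With the base arguments frozen, [kos_wedge] moves the codifferential from [al] to the kernel at
    the cost of [(-1)^q]; the factor [(-1)^l] undoes the sign in the lift [codiffP]. *)
Lemma PT_codiff k l Phi phi : (k <= nP)%N -> PT k l Phi phi ->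
  PT k.+1 l (fun al => Phi (codiff S k.+1 al)) (fun x s => (-1) ^+ (nP - k + l) *: codiffP S l (nP - k) phi x s).
Proof.
move=> kn [phiO c1 t1 i1]; have qk := subnK kn; set q := (nP - k)%N in phiO i1 qk *.
have qE : (nP - k.+1 = q.-1)%N by rewrite subnS.
have [n [C [C' [nE CC]]]] := codiff_frame.
have cO := codiffP_O CC phiO.
split=> [|al alO|z al alO|al alO].
- by rewrite qE; exact: OmegaMZ.
- by apply: c1; exact: (OmegaP_codiff CC alO).
- exact: (t1 z _ (OmegaP_codiff CC alO)).
have dO : OmegaP S k (codiff S k.+1 al) := OmegaP_codiff CC alO.
rewrite (i1 _ dO) qE; apply: funext2 => x s; rewrite !fibre_intE.
apply: fint_ext => y r _; have aa : altform k.+1 pp (al y) by case: alO.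
rewrite (wedgeZl (@mxL _ _ _ _)).
(* [q.-1] lowers the degree only for [q > 0]; for [q = 0] the degree of [al] exceeds [nP], and both
   sides are 0. *)
have [q0|q0] := posnP q.
  have al0 : al y = fun=> 0.
    by apply/funext => t; apply: (altform_over CC t aa); rewrite nE -qk q0.
  have c0 : codiff S k.+1 al y = fun=> 0.
    rewrite (codiff_val CC y alO) al0; apply/funext => t; exact: (kos0 _ _ cact_r).
  by rewrite c0 al0 !(wedge0r (@mxR _ _ _ _)) scaler0.
have b1 := kernel_bideg qk phiO dO y.
have b2 : bideg S l nP (wedge (l + q.-1) mulmx (codiffP S l q phi y) (al y)).
  have h := wedge_bideg_col (OmegaM_b y cO) aa; rewrite addnS -addSn prednK // qk in h.
  exact: h.
suff e : wedge (l + q) mulmx (phi y) (codiff S k.+1 al y) =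
  (fun z => (-1) ^+ (q + l) *: wedge (l + q.-1) mulmx (codiffP S l q phi y) (al y) z) by rewrite e.
apply: (bideg_ext b1 (bidegZ ((-1) ^+ (q + l)) b2)) => s' t sp tk ss tt.
have [pa _] := OmegaM_b y phiO; have [ca _] := OmegaM_b y cO.
have [da _ _] := dO.
rewrite (wedge_catr (@mxL _ _ _ _) (@mxR _ _ _ _) _ pa (da y) sp) ?ss ?leq_addr // addKn.
rewrite (wedge_catr (@mxL _ _ _ _) (@mxR _ _ _ _) _ ca aa sp) ?ss ?leq_addr // addKn.
have pb := bideg_right (OmegaM_b y phiO) sp ss.
rewrite (codiff_val CC y alO).
have am X (A : 'M[R]_(w, v)) B : A *m cact X B = - (dact (rV S) X A *m B) :> 'cV[R]_w.
  by rewrite /cact /dact mulNmx opprK mulmxA.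
rewrite (kos_wedge Tcartan (geomPar geo) (geomNil geo) CC (@mxL _ _ _ _) (@mxR _ _ _ _) (dact_r (rV S)) am t pb aa); last first.
  by rewrite nE.
rewrite exprD -scalerA; congr (_ *: _); rewrite -(wedgeZl (@mxL _ _ _ _)).
by apply: wedge_eq => // t'; rewrite (codiffP_val CC _ _ phiO) // scalerA signr_sq scale1r.
Qed.

Lemma dW_good X (A : G -> 'cV[R]_w) x : smooth A -> nabla (rW S) X A x = nab sg t0 X A x.
Proof. exact: nabla_nab. Qed.
Lemma dth_good X (A : G -> 'cV[R]_w) x : smooth A -> nabla_theta (rW S) (hW S) X A x = nab sgth t0 X A x.
Proof. exact: nabla_theta_nab. Qed.

Lemma PT_dW k l Phi phi : (k <= nP)%N -> PT k l Phi phi ->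
  PT k l.+1 (fun al => dW S (Phi al)) (dK S l (nP - k) phi).
Proof. exact: (PT_d sg_good dW_good). Qed.

Lemma PT_dtheta k l Phi phi : (k <= nP)%N -> PT k l Phi phi ->
  PT k l.+1 (fun al => dtheta S (Phi al)) (dKtheta S l (nP - k) phi).
Proof. exact: (PT_d sgth_good dth_good). Qed.

Lemma OmegaK_over l (f : gform G w 1) : (nK < l)%N -> OmegaK S l f -> f = (fun _ _ => 0).
Proof.
move=> ln [fa _ _]; apply: funext2 => x s; exact: (altform_over EE s (fa x) ln).
Qed.

Lemma dtheta0 : dtheta S (fun _ _ => 0) = (fun _ _ => 0).
Proof.
apply: funext2 => x s; rewrite /dtheta (dcov_dl dth_good) ?dl0 // => t.
exact: smooth_cst.
Qed.

Lemma dW_0 : dW S (fun _ _ => 0) = (fun _ _ => 0).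
Proof.
apply: funext2 => x s; rewrite /dW (dcov_dl dW_good) ?dl0 // => t.
exact: smooth_cst.
Qed.

Lemma deltaW_low f : deltaW S 0 f = (fun _ _ => 0). Proof. by []. Qed.

Lemma deltaWE l f : (l < nK)%N -> OmegaK S l.+1 f ->
  deltaW S l.+1 f = fun x s => ((-1) ^+ l.+1 * (-1) ^+ (l * (nK - l))) *: star S (nK - l) (dtheta S (star S l.+1 f)) x s.
Proof.
move=> ln fO; have e : (nK - l = (nK - l.+1).+1)%N by rewrite subnSK.
have dO : OmegaK S (nK - l) (dtheta S (star S l.+1 f)).
  by rewrite e; exact: (OmegaK_d sgth_good dth_good (OmegaK_star fO)).
have [da _ _] := dO.
apply: funext2 => x s; rewrite /deltaW (hodgeVE (ltnW ln)) // scalerA.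
by rewrite (star_val x dO).
Qed.

Lemma deltaW_over l f : (nK <= l)%N -> OmegaK S l.+1 f -> deltaW S l.+1 f = fun _ _ => 0.
Proof.
move=> ln fO; have -> := OmegaK_over (l := l.+1) ln fO.
have s0 : star S l.+1 (fun _ _ => 0) = (fun _ _ => 0).
  apply/funext => x; rewrite (star_val x (OmegaC0 _ _ _ _)); apply/funext => s; exact: Hs0.
by apply: funext2 => x s; rewrite /deltaW s0 dtheta0 hodgeV0 scaler0.
Qed.

(** [deltaW] and [deltaK] are the same composition of star, twisted derivative and star with the
    same constant; above the top degree both give 0. *)
Lemma PT_deltaW k l Phi phi : (k <= nP)%N -> PT k l Phi phi ->
  PT k l.-1 (fun al => deltaW S l (Phi al)) (deltaK S l (nP - k) phi).
Proof.
move=> kn; case: l => [|l] h; first exact: PT0.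
have [phiO c1 _ _] := h; have [ln|ln] := ltnP l nK; last first.
  apply: PT_ext (PT0 k l) => [al alO|]; first by rewrite (deltaW_over ln (c1 _ alO)).
  by rewrite (OmegaM_over (p := l.+1) ln phiO) deltaK_z.
have e : (nK - l = (nK - l.+1).+1)%N by rewrite subnSK.
have h1 := PT_star kn h; have h2 := PT_dtheta kn h1; rewrite -e in h2.
have h3 := PT_star kn h2; rewrite (subKn (ltnW ln)) in h3.
apply: PT_ext (PT_scale ((-1) ^+ l.+1 * (-1) ^+ (l * (nK - l))) h3) => [al alO|].
  by rewrite (deltaWE ln (c1 _ alO)).
by rewrite (deltaKE ln phiO).
Qed.

Lemma PT_LaplaceW k l Phi phi : (k <= nP)%N -> PT k l Phi phi ->
  PT k l (fun al => LaplaceW S l (Phi al)) (LaplaceK S l (nP - k) phi).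
Proof.
move=> kn h; have h2 : PT k l (fun al => deltaW S l.+1 (dW S (Phi al))) _ := PT_deltaW kn (PT_dW kn h).
case: l h h2 => [|l] h h2.
  apply: PT_ext h2 => [al alO|]; apply: funext2 => x s.
    by rewrite /LaplaceW deltaW_low dW_0 add0r.
  by rewrite /LaplaceK deltaK_low /dK (dk0 sg_good) add0r.
have h1 := PT_dW kn (PT_deltaW kn h).
apply: PT_ext (PT_lin 1 h1 h2) => [al alO|]; apply: funext2 => x s.
  by rewrite scale1r.
by rewrite scale1r.
Qed.
End Geometry.

Theorem theorem6 (R : realType) (G : lieGroup R) (v w : nat)
  (S : setting G v w) (theta : {linear lieAlg G -> lieAlg G})
  (Gsemisimple : semisimple G)
  (Gcenter : finite_set (lcenter G))
  (Kmaximal : maximal_compact (K S))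
  (Klie : lie_algebra_of (K S) (kk S))
  (Psubgroup : subgroup (P S))
  (Pclosed : closed (P S))
  (Plie : lie_algebra_of (P S) (pp S))
  (Pparabolic : parabolic (pp S))
  (Pnilradical : nilradical (pp S) (np S))
  (KPdecomposition : forall x : G, exists a b : G,
     [/\ K S a, P S b & x = (a * b)%g])
  (Tcartan : cartan_involution theta)
  (Tfixed : forall X : lieAlg G, X \in kk S <-> theta X = X)
  (hmetric : invariant_metric S theta)
  (Korientation : oriented_frameK S theta)
  (Porientation : oriented_fibreP S)
  (Khaar : haar_on_K S) :
  (forall (k l : nat) (Phi : gform G v 1 -> gform G w 1) (phi : gform G w v),
     (k <= dimP S)%N -> PoissonTransform S k l Phi phi ->
     let q := (dimP S - k)%N in
     [/\ forall k' : nat, k = k'.+1 ->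
           PoissonTransform S k' l (fun al => Phi (dV S al))
             (fun x s => (-1) ^+ (q + l + 1) *: dP S l q phi x s)
       & PoissonTransform S k.+1 l (fun al => Phi (codiff S k.+1 al))
           (fun x s => (-1) ^+ (q + l) *: codiffP S l q phi x s)]
     /\
     [/\ PoissonTransform S k l.+1 (fun al => dW S (Phi al)) (dK S l q phi),
         PoissonTransform S k (dimK S - l) (fun al => star S l (Phi al))
           (starK S l q phi),
         PoissonTransform S k l.-1 (fun al => deltaW S l (Phi al))
           (deltaK S l q phi)
       & PoissonTransform S k l (fun al => LaplaceW S l (Phi al))
           (LaplaceK S l q phi)])
  /\
  (forall (p q : nat) (f : gform G w v), OmegaM S p q f ->
     [/\ starK S p q.+1 (dP S p q f)
           = (fun x s => (-1) ^+ dimK S *: dP S (dimK S - p) q (starK S p q f) x s)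
       & starK S p q.-1 (codiffP S p q f)
           = (fun x s =>
                (-1) ^+ dimK S *: codiffP S (dimK S - p) q (starK S p q f) x s)]
     /\
     [/\ dP S p.+1 q (dK S p q f)
           = (fun x s => - dK S p q.+1 (dP S p q f) x s),
         dP S p.-1 q (deltaK S p q f)
           = (fun x s => - deltaK S p q.+1 (dP S p q f) x s)
       & dP S p q (LaplaceK S p q f) = LaplaceK S p q.+1 (dP S p q f)]
     /\
     [/\ codiffP S p.+1 q (dK S p q f)
           = (fun x s => - dK S p q.-1 (codiffP S p q f) x s),
         codiffP S p.-1 q (deltaK S p q f)
           = (fun x s => - deltaK S p q.-1 (codiffP S p q f) x s)
       & codiffP S p q (LaplaceK S p q f)
           = LaplaceK S p q.-1 (codiffP S p q f)]).
Proof.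
have geo : geometry S theta by split.
split=> [k l Phi phi kn h|p q f fO].
  split; split.
  - by move=> k' ke; subst k; exact: (PT_dV geo kn h).
  - exact: (PT_codiff geo kn h).
  - exact: (PT_dW geo kn h).
  - exact: (PT_star geo kn h).
  - exact: (PT_deltaW geo kn h).
  exact: (PT_LaplaceW geo kn h).
have [dop cop] := (dP_operator geo, codiffP_operator geo).
split; first by split; [case: dop => _ _ h _ _ | case: cop => _ _ h _ _]; exact: h.
split; split.
- by case: dop => _ _ _ h _; exact: h.
- exact: (O_deltaK geo dop fO).
- exact: (O_LaplaceK geo dop fO).
- by case: cop => _ _ _ h _; exact: h.
- exact: (O_deltaK geo cop fO).
exact: (O_LaplaceK geo cop fO).
Qed.
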